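(* Let $\Psi$ be an Orlicz function satisfying the $\Delta^2$-condition and let $\phi\colon\mathbb D\to\mathbb D$ be analytic. The following assertions about $C_\phi\colon H^\Psi\to H^\Psi$ are equivalent: 1) $C_\phi$ is order bounded into $M^\Psi(\mathbb T)$; 2) $C_\phi$ is compact; 3) $C_\phi$ is weakly compact; 4) $\Psi^{-1}\big(\frac{1}{1-|\phi^*|}\big)\in M^\Psi(\mathbb T)$, i.e. $\chi_B\big(\frac{1}{1-|\phi^*|}\big)\in L^1(\mathbb T)$ for every $B>0$; 5) for every $A>0$, $m(1-|\phi^*|<\lambda)=O\big(1/\chi_A(1/\lambda)\big)$ as $\lambda\to0$; 6) $\sup_{a\in\mathbb T}\|C_\phi(u_{a,r})\|_\Psi=o\Big(\dfrac{1}{\Psi^{-1}(1/(1-r))}\Big)$ as $r\to1$.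
   Context: An Orlicz function is a continuous, strictly convex, increasing $\Psi\colon[0,\infty)\to[0,\infty)$ with $\Psi(0)=0$ and $\Psi(x)/x\to\infty$ as $x\to\infty$. For a probability space $(\Omega,P)$, $L^\Psi(\Omega)$ is the space of measurable $f$ with $\int\Psi(|f|/C)\,dP<\infty$ for some $C>0$, with Luxemburg norm $\|f\|_\Psi=\inf\{C>0:\int\Psi(|f|/C)\,dP\le1\}$; $M^\Psi(\Omega)$ is the subspace of $f$ with $\int\Psi(|f|/C)\,dP<\infty$ for every $C>0$. $m$ is normalized Lebesgue measure on $\mathbb T=\partial\mathbb D$. The Hardy–Orlicz space $H^\Psi$ is the space of analytic $f$ on $\mathbb D$ with $\sup_{0\le r<1}\|f_r\|_\Psi<\infty$, $f_r(e^{it})=f(re^{it})$; such $f$ have radial boundary values $f^*\in L^\Psi(\mathbb T)$ and $\|f\|_{H^\Psi}=\|f^*\|_\Psi$. $C_\phi f=f\circ\phi$. $C_\phi$ is order bounded into $M^\Psi(\mathbb T)$ if there is $g\in M^\Psi(\mathbb T)$, $g\ge0$, with $|(C_\phi f)^*|\le g$ a.e. for every $f$ in the unit ball of $H^\Psi$. $\Psi$ satisfies $\Delta^2$ if there is $\alpha>1$ with $\Psi(x)^2\le\Psi(\alpha x)$ for all large $x$. $\chi_A(x)=\Psi(A\Psi^{-1}(x))$. For $|a|=1$, $0\le r<1$, $u_{a,r}(z)=\big(\frac{1-r}{1-\bar a rz}\big)^2$. *)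

(* Defs.v *)
From HB Require Import structures.
From mathcomp Require Import all_boot all_order all_algebra.
From mathcomp Require Import complex.
From mathcomp Require Import all_classical all_reals all_analysis.
From mathcomp Require Import measurable_realfun.

Set Implicit Arguments.
Unset Strict Implicit.
Unset Printing Implicit Defensive.

Import Order.TTheory GRing.Theory Num.Theory.
Import numFieldNormedType.Exports.

Local Open Scope classical_set_scope.
Local Open Scope ring_scope.

Section HardyOrlicz.
Variable R : realType.
Local Notation C := R[i].

Definition modc (z : C) : R := Normc.normc z.
Definition expi (t : R) : C := Complex (cos t) (sin t).
Definition cvgC (u : nat -> C) (l : C) : Prop :=
  (fun n => complex.Re (u n)) @ \oo --> complex.Re l /\
  (fun n => complex.Im (u n)) @ \oo --> complex.Im l.

Definition analytic_disc (f : C -> C) : Prop :=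
  exists a : nat -> C, forall z, modc z < 1 ->
    cvgC (fun n => \sum_(k < n) a k * z ^+ k) (f z).

Definition radial_limit (f : C -> C) (t : R) : C :=
  Complex (lim ((fun r : R => complex.Re (f ((r%:C)%C * expi t))) @ at_left 1))
          (lim ((fun r : R => complex.Im (f ((r%:C)%C * expi t))) @ at_left 1)).

Definition Tset : set R := `[0, 2 * pi].

Definition intT (h : R -> \bar R) : \bar R :=
  (((2 * pi)^-1)%:E * \int[lebesgue_measure]_(t in Tset) h t)%E.

Definition mT (A : set R) : \bar R :=
  (((2 * pi)^-1)%:E * lebesgue_measure (A `&` Tset))%E.

Definition orlicz (Psi : R -> R) : Prop :=
  [/\ {within `[0, +oo[, continuous Psi}, Psi 0 = 0,
      (forall x y, 0 <= x -> x < y -> Psi x < Psi y),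
      (forall x y l, 0 <= x -> 0 <= y -> x != y -> 0 < l < 1 ->
          Psi (l * x + (1 - l) * y) < l * Psi x + (1 - l) * Psi y) &
      Psi x / x @[x --> +oo] --> +oo].

Definition Delta2 (Psi : R -> R) : Prop :=
  exists alpha, 1 < alpha /\ exists x0, forall x, x0 <= x -> Psi x ^+ 2 <= Psi (alpha * x).

Definition PsiInv (Psi : R -> R) (y : R) : R := sup [set x | 0 <= x /\ Psi x <= y].

Definition chi (Psi : R -> R) (A x : R) : R := Psi (A * PsiInv Psi x).

(* Luxemburg norm of a real function on T *)
Definition lux (Psi : R -> R) (h : R -> R) : R :=
  inf [set c : R | 0 < c /\ (intT (fun t => (Psi (`|h t| / c))%:E) <= 1%:E)%E].

(* M^Psi(T) for real-valued functions *)
Definition MPsi (Psi : R -> R) (g : R -> R) : Prop :=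
  measurable_fun Tset g /\
  forall c : R, 0 < c -> (intT (fun t => (Psi (`|g t| / c))%:E) < +oo)%E.

(* Psi extended to \bar R with Psi(+-oo) = +oo, applied to |x|/c *)
Definition PsiE (Psi : R -> R) (x : \bar R) (c : R) : \bar R :=
  match x with EFin r => (Psi (`|r| / c))%:E | _ => +oo%E end.

(* M^Psi(T) for extended-real valued functions *)
Definition MPsiE (Psi : R -> R) (g : R -> \bar R) : Prop :=
  measurable_fun Tset g /\
  forall c : R, 0 < c -> (intT (fun t => PsiE Psi (g t) c) < +oo)%E.

Definition aeT (P : R -> Prop) : Prop :=
  (@lebesgue_measure R).-negligible [set t | Tset t /\ ~ P t].

(* Hardy-Orlicz space *)
Definition HPsi (Psi : R -> R) (f : C -> C) : Prop :=
  analytic_disc f /\ exists M : R, 0 < M /\ forall r : R, 0 <= r < 1 ->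
    (intT (fun t => (Psi (modc (f ((r%:C)%C * expi t)) / M))%:E) <= 1%:E)%E.

Definition normH (Psi : R -> R) (f : C -> C) : R :=
  lux Psi (fun t => modc (radial_limit f t)).

Definition distH (Psi : R -> R) (f g : C -> C) : R :=
  lux Psi (fun t => modc (radial_limit f t - radial_limit g t)).

Definition ballH (Psi : R -> R) : set (C -> C) :=
  [set f | HPsi Psi f /\ normH Psi f <= 1].

Definition Cphi (phi : C -> C) (f : C -> C) : C -> C := f \o phi.

Definition self_map_disc (phi : C -> C) : Prop :=
  analytic_disc phi /\ forall z, modc z < 1 -> modc (phi z) < 1.

(* compact operator: image of the unit ball is relatively compact
   (sequential form, the space being metric) *)
Definition compact_op (Psi : R -> R) (T : (C -> C) -> (C -> C)) : Prop :=
  forall fs : nat -> (C -> C), (forall n, ballH Psi (fs n)) ->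
  exists sg : nat -> nat, (forall n, (sg n < sg n.+1)%N) /\
  exists g, HPsi Psi g /\ (fun k => distH Psi (T (fs (sg k))) g) @ \oo --> 0.

(* bounded linear functionals on H^Psi *)
Definition bdd_functional (Psi : R -> R) (L : (C -> C) -> C) : Prop :=
  [/\ (forall f g, HPsi Psi f -> HPsi Psi g -> L (f \+ g) = L f + L g),
      (forall (c : C) f, HPsi Psi f -> L (fun z => c * f z) = c * L f) &
      exists K : R, forall f, HPsi Psi f -> modc (L f) <= K * normH Psi f].

(* open sets of the weak topology of H^Psi *)
Definition weak_open (Psi : R -> R) (O : set (C -> C)) : Prop :=
  O `<=` HPsi Psi /\
  forall f, O f -> exists (n : nat) (Ls : 'I_n -> (C -> C) -> C) (e : R),
    [/\ forall i, bdd_functional Psi (Ls i), 0 < e &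
        forall g, HPsi Psi g -> (forall i, modc (Ls i g - Ls i f) < e) -> O g].

(* closure in the weak topology of H^Psi *)
Definition weak_closure (Psi : R -> R) (S : set (C -> C)) : set (C -> C) :=
  [set g | HPsi Psi g /\
    forall (n : nat) (Ls : 'I_n -> (C -> C) -> C) (e : R),
      (forall i, bdd_functional Psi (Ls i)) -> 0 < e ->
      exists s, S s /\ forall i, modc (Ls i s - Ls i g) < e].

(* compactness in the weak topology (open-cover definition) *)
Definition weak_compact (Psi : R -> R) (K : set (C -> C)) : Prop :=
  forall (I : Type) (O : I -> set (C -> C)),
    (forall i, weak_open Psi (O i)) ->
    (forall f, K f -> exists i, O i f) ->
    exists (n : nat) (J : 'I_n -> I), forall f, K f -> exists j, O (J j) f.

Definition weakly_compact_op (Psi : R -> R) (T : (C -> C) -> (C -> C)) : Prop :=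
  weak_compact Psi (weak_closure Psi (T @` ballH Psi)).

(* C_phi order bounded into M^Psi(T) *)
Definition order_bounded_M (Psi : R -> R) (T : (C -> C) -> (C -> C)) : Prop :=
  exists g : R -> R, (forall t, 0 <= g t) /\ MPsi Psi g /\
    forall f, ballH Psi f -> aeT (fun t => modc (radial_limit (T f) t) <= g t).

Definition u_ar (a : C) (r : R) (z : C) : C :=
  ((((1 - r)%:C)%C) / (1 - (a^*)%C * ((r%:C)%C) * z)) ^+ 2.

End HardyOrlicz.

(* Main.v *)
Require Import Defs.
From HB Require Import structures.
From mathcomp Require Import all_boot all_order all_algebra.
From mathcomp Require Import complex.
From mathcomp Require Import all_classical all_reals all_analysis.
From mathcomp Require Import measurable_realfun.
From mathcomp Require Import ring lra.

Set Implicit Arguments.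
Unset Strict Implicit.
Unset Printing Implicit Defensive.

Import Order.TTheory GRing.Theory Num.Theory.
Import numFieldNormedType.Exports.
Local Open Scope classical_set_scope.
Local Open Scope ring_scope.

(** Write x(l) = Psi^{-1}(1/l). The functions x(1-r) u_{a,r} lie in the unit ball and
    |f(z)| <= 3 x(1-|z|) on it, so x(1-|phi*|) is the natural majorant of (C_phi f)*.
    If it belongs to M^Psi (assertion 4), the image of the ball is order bounded and, by a Montel
    extraction and dominated convergence, sequentially norm compact, hence weakly compact: a weak
    limit of the image agrees on the disc with an element of it.
    4 <-> 5 compares the integral with its dyadic level sets, Delta^2 making the sums converge;
    6 -> 5 covers the annulus 1-|z| < l by O(1/l) Carleson windows, on each of which one |u_{a,r}|
    is bounded below, the factor 1/l being absorbed by Delta^2.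
    2 -> 6: a norm limit of normalized test functions composed with phi vanishes on the disc.
    1 -> 6 and 3 -> 6: if normalized test functions have, along a subsequence, images with a common
    majorant in M^Psi, dominated convergence gives 6; the majorant also forces phi* <> a a.e.
    Order boundedness provides the majorant at once. Under weak compactness take a sparse sum S of
    the functions x(1-r) (1-r)/(1 - conj(a) r z), whose real parts dominate |x(1-r) u_{a,r}|;
    S lies in H^Psi, and (S o phi)* in M^Psi, for otherwise an ultralimit of pairings on the shells
    n < |(S o phi)*|/c <= m is a bounded functional that kills the images of the dilates of S but
    not their weak cluster point S o phi.
    The boundary theory needed (radial limits a.e., the Poisson formula for boundary values) is
    derived from f in H^2, since Psi dominates the square, and the Hardy-Littlewood maximal
    inequality. *)

(** The obstacle is the passage between the disc and the circle. That f o phi has boundary value f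
    at the boundary value w of phi is available where |w| < 1, or where f is Lipschitz up to the
    circle; hence 4 and 5 are read together with |w| < 1 a.e., and the test functions are Lipschitz.
    Analyticity is handled as uniform approximation by polynomials on smaller discs, a property
    stable under composition; Parseval on circles supplies Cauchy's estimates, so no contour
    integral enters. Limits of coefficients, points and functionals are taken along a free
    ultrafilter; a subsequence is extracted only where countably many conditions suffice. Delta^2
    acts twice: iterated, it gives Psi(x) >= x^3 for large x, whence H^Psi lies in H^2 and l
    Psi^{-1}(1/l)^2 tends to 0; used once, it merges a product of two values of Psi into one value
    at a dilated argument. Weak convergence alone gives no a.e. majorant, which is why 3 -> 6 needs
    a single function lying above a whole subsequence; the kernels summed have positive real part,
    so nothing cancels. *)

(** * Modulus, real and imaginary parts, and polar form of complex numbers *)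

Section ComplexModulus.
Variable R : realType.
Local Notation C := R[i].
Implicit Types (x y z w : C) (r s t : R).

Lemma modcM z w : modc (z * w) = modc z * modc w.
Proof. exact: Normc.normcM. Qed.

Lemma modcD z w : modc (z + w) <= modc z + modc w.
Proof. exact: (@le_normcD R z w). Qed.

Lemma modcN z : modc (- z) = modc z.
Proof. exact: (@normcN R z). Qed.

Lemma modcB z w : modc (z - w) <= modc z + modc w.
Proof. by rewrite -(modcN w) modcD. Qed.

Lemma modcBC z w : modc (z - w) = modc (w - z).
Proof. by rewrite -modcN opprB. Qed.

Lemma modc0 : modc (0 : C) = 0. Proof. exact: Normc.normc0. Qed.
Lemma modc1 : modc (1 : C) = 1. Proof. exact: Normc.normc1. Qed.

Lemma modc_ge0 z : 0 <= modc z.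
Proof. by case: z => a b; rewrite /modc /= sqrtr_ge0. Qed.

Lemma modc_eq0 z : (modc z == 0) = (z == 0).
Proof.
apply/eqP/eqP => [|->]; last exact: modc0.
exact: Normc.eq0_normc.
Qed.

Lemma modcV z : modc z^-1 = (modc z)^-1.
Proof. exact: Normc.normcV. Qed.

Lemma modcX z n : modc (z ^+ n) = modc z ^+ n.
Proof. by elim: n => [|n IH]; rewrite ?expr0 ?modc1// !exprS modcM IH. Qed.

Lemma modc_real r : modc (r%:C)%C = `|r|.
Proof. by rewrite /modc /= expr0n /= addr0 sqrtr_sqr. Qed.

Lemma modc_sqr z : modc z ^+ 2 = complex.Re z ^+ 2 + complex.Im z ^+ 2.
Proof. by case: z => a b; rewrite /modc /= sqr_sqrtr // addr_ge0 // sqr_ge0. Qed.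

Lemma normRe_le z : `|complex.Re z| <= modc z.
Proof.
rewrite -(@ler_pXn2r _ 2) ?nnegrE ?modc_ge0 //.
by rewrite modc_sqr real_normK ?num_real // lerDl sqr_ge0.
Qed.

Lemma normIm_le z : `|complex.Im z| <= modc z.
Proof.
rewrite -(@ler_pXn2r _ 2) ?nnegrE ?modc_ge0 //.
by rewrite modc_sqr real_normK ?num_real // lerDr sqr_ge0.
Qed.

Lemma Re_le_modc z : complex.Re z <= modc z.
Proof. exact: le_trans (ler_norm _) (normRe_le z). Qed.

Lemma modc_le_ReIm z : modc z <= `|complex.Re z| + `|complex.Im z|.
Proof.
rewrite -(@ler_pXn2r _ 2) ?nnegrE ?modc_ge0 ?addr_ge0 //.
rewrite modc_sqr sqrrD !real_normK ?num_real // addrAC lerDl.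
by rewrite mulrn_wge0 // mulr_ge0.
Qed.

Lemma modc_sum (I : Type) (s : seq I) (P : pred I) (F : I -> C) :
  modc (\sum_(i <- s | P i) F i) <= \sum_(i <- s | P i) modc (F i).
Proof.
elim/big_ind2: _ => [|a b c d ab cd|//]; first by rewrite modc0.
by apply: le_trans (modcD _ _) (lerD ab cd).
Qed.

Lemma modc_distr z w : modc z - modc w <= modc (z - w).
Proof. by rewrite lerBlDr; apply: le_trans (modcD _ _); rewrite subrK. Qed.

Lemma modc_dist z w : `|modc z - modc w| <= modc (z - w).
Proof.
by rewrite ler_norml modc_distr andbT lerNl opprB modcBC modc_distr.
Qed.

Lemma modc_conj z : modc (z^*)%C = modc z.
Proof. by case: z => a b; rewrite /modc /= sqrrN. Qed.

Lemma Re_add z w : complex.Re (z + w) = complex.Re z + complex.Re w.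
Proof. by case: z w => [? ?] [? ?]. Qed.
Lemma Im_add z w : complex.Im (z + w) = complex.Im z + complex.Im w.
Proof. by case: z w => [? ?] [? ?]. Qed.
Lemma Re_opp z : complex.Re (- z) = - complex.Re z.
Proof. by case: z. Qed.
Lemma Im_opp z : complex.Im (- z) = - complex.Im z.
Proof. by case: z. Qed.
Lemma Re_mul z w :
  complex.Re (z * w) = complex.Re z * complex.Re w - complex.Im z * complex.Im w.
Proof. by case: z w => [? ?] [? ?]. Qed.
Lemma Im_mul z w :
  complex.Im (z * w) = complex.Re z * complex.Im w + complex.Im z * complex.Re w.
Proof. by case: z w => [? ?] [? ?]. Qed.
Lemma Re_real_mul r z : complex.Re ((r%:C)%C * z) = r * complex.Re z.
Proof. by rewrite Re_mul /= mul0r subr0. Qed.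
Lemma Im_real_mul r z : complex.Im ((r%:C)%C * z) = r * complex.Im z.
Proof. by rewrite Im_mul /= mul0r addr0. Qed.
Lemma Re_sum (I : Type) (s : seq I) (P : pred I) (F : I -> C) :
  complex.Re (\sum_(i <- s | P i) F i) = \sum_(i <- s | P i) complex.Re (F i).
Proof. exact: (big_morph _ Re_add). Qed.

Lemma complexP z w : complex.Re z = complex.Re w -> complex.Im z = complex.Im w -> z = w.
Proof. by case: z w => [? ?] [? ?] /= -> ->. Qed.

Lemma expi0 : expi 0 = 1 :> C.
Proof. by rewrite /expi cos0 sin0. Qed.

Lemma expiD s t : expi (s + t) = expi s * expi t.
Proof. by apply: complexP; rewrite /expi ?Re_mul ?Im_mul /= ?cosD ?sinD // addrC (mulrC (sin s)). Qed.

Lemma expiX t n : expi t ^+ n = expi (n%:R * t).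
Proof.
elim: n => [|n IH]; first by rewrite expr0 mul0r expi0.
by rewrite exprS IH -expiD -natr1 mulrDl mul1r addrC.
Qed.

Lemma modc_expi t : modc (expi t) = 1.
Proof. by rewrite /modc /= cos2Dsin2 sqrtr1. Qed.

Lemma expi_conj t : ((expi t)^*)%C = expi (- t).
Proof. by rewrite /expi cosN sinN. Qed.

Lemma expi2pi : expi (2 * pi) = 1 :> C.
Proof. by rewrite /expi mulrC mulr_natr cos2pi sin2pi. Qed.

Lemma expi_addpi t : expi (t + 2 * pi) = expi t.
Proof. by rewrite expiD expi2pi mulr1. Qed.

Lemma expi_natpi n : expi (n%:R * (2 * pi)) = 1 :> C.
Proof. by rewrite -expiX expi2pi expr1n. Qed.

Lemma modc_polar r t : 0 <= r -> modc ((r%:C)%C * expi t) = r.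
Proof. by move=> r0; rewrite modcM modc_expi mulr1 modc_real ger0_norm. Qed.

Lemma realcM r s : ((r * s)%:C)%C = (r%:C)%C * (s%:C)%C.
Proof. exact: rmorphM. Qed.
Lemma realcD r s : ((r + s)%:C)%C = (r%:C)%C + (s%:C)%C.
Proof. exact: rmorphD. Qed.
Lemma realcB r s : ((r - s)%:C)%C = (r%:C)%C - (s%:C)%C.
Proof. exact: rmorphB. Qed.
Lemma realcX r n : ((r ^+ n)%:C)%C = (r%:C)%C ^+ n.
Proof. exact: rmorphXn. Qed.

Lemma polarX r t n : ((r%:C)%C * expi t) ^+ n = ((r ^+ n)%:C)%C * expi (n%:R * t).
Proof. by rewrite exprMn expiX realcX. Qed.

Lemma polar_ex z : exists t, [/\ 0 <= t, t < 2 * pi & z = ((modc z)%:C)%C * expi t].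
Proof.
have pg : 0 < (pi : R) := pi_gt0 R.
have [->|z0] := eqVneq z 0.
  by exists 0; rewrite modc0 mul0r; split => //; rewrite mulr_gt0.
have m0 : 0 < modc z by rewrite lt_neqAle modc_ge0 eq_sym modc_eq0 z0.
set c := complex.Re z / modc z; set s := complex.Im z / modc z.
have cs : c ^+ 2 + s ^+ 2 = 1.
  by rewrite !exprMn -mulrDl -modc_sqr -exprMn divff ?expr1n // gt_eqF.
have c1 : -1 <= c <= 1.
  have : c ^+ 2 <= 1 by rewrite -cs lerDl sqr_ge0.
  by move=> c2; apply/andP; split; nra.
set u := acos c.
have cu : cos u = c by rewrite acosK // in_itv.
have u0 : 0 <= u by exact: acos_ge0.
have upi : u <= pi by exact: acos_lepi.
have su : sin u = `|s|.
  rewrite sin_acos //; rewrite -sqrtr_sqr; congr Num.sqrt.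
  by rewrite -cs addrAC subrr add0r.
have fin v : cos v = c -> sin v = s -> z = ((modc z)%:C)%C * expi v.
  move=> cv sv; apply: complexP; rewrite ?Re_real_mul ?Im_real_mul /= ?cv ?sv /c /s.
  - by rewrite mulrC divfK // gt_eqF.
  - by rewrite mulrC divfK // gt_eqF.
have [s0|s0] := leP 0 s.
  exists u; split => //.
    lra.
  by apply: fin => //; rewrite su ger0_norm.
(* Lower half plane: [acos] only reaches [0, pi], so the angle is reflected. The value u = 0 is
   excluded because sin u = |s| > 0, which keeps the angle strictly below 2 pi. *)
exists (2 * pi - u); split.
- lra.
- rewrite ltrBlDr ltrDl lt_neqAle u0 andbT; apply/negP => /eqP u00.
  by move: su; rewrite -u00 sin0 => /esym/eqP; rewrite normr_eq0 => /eqP; apply/eqP; rewrite lt_eqF.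
apply: fin.
  by rewrite -cosN opprB -[u - _]addr0 -cu; have := f_equal (@complex.Re R) (expi_addpi (u - 2 * pi)); rewrite subrK addr0 /= => <-.
have := f_equal (@complex.Im R) (expi_addpi (- u)); rewrite /= addrC => ->.
by rewrite sinN su ltr0_norm // opprK.
Qed.

Lemma cvgCP (u : nat -> C) (l : C) :
  cvgC u l <-> (forall e, 0 < e -> exists N, forall n, (N <= n)%N -> modc (u n - l) < e).
Proof.
split=> [[cr ci] e e0|H].
  have e2 : 0 < e / 2 by rewrite divr_gt0.
  have /cvgrPdist_lt/(_ _ e2)[N _ HN] := cr.
  have /cvgrPdist_lt/(_ _ e2)[M _ HM] := ci.
  exists (maxn N M) => n; rewrite geq_max => /andP[nN nM].
  apply: le_lt_trans (modc_le_ReIm _) _; rewrite [e]splitr ltrD //.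
    by have := HN n nN; rewrite distrC Re_add Re_opp.
  by have := HM n nM; rewrite distrC Im_add Im_opp.
split; apply/cvgrPdist_lt => e /H[N HN]; exists N => // n /HN; apply: le_lt_trans.
  by rewrite distrC -Re_opp -Re_add normRe_le.
by rewrite distrC -Im_opp -Im_add normIm_le.
Qed.

Lemma modc_le_eps z w : (forall e, 0 < e -> modc (z - w) <= e) -> z = w.
Proof.
move=> H; apply/eqP; rewrite -subr_eq0 -modc_eq0 eq_le modc_ge0 andbT.
by apply/ler_addgt0Pl => e e0; rewrite addr0 H.
Qed.

End ComplexModulus.

(** * Orlicz functions, their inverses, and growth under Delta^2 *)

Section OrliczFunctions.
Variables (R : realType) (Psi : R -> R).
Hypothesis oPsi : orlicz Psi.
Implicit Types (x y l s : R).

Lemma orlicz0 : Psi 0 = 0. Proof. by case: oPsi. Qed.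

Lemma orlicz_lt x y : 0 <= x -> x < y -> Psi x < Psi y.
Proof. by case: oPsi => _ _ + _ _; exact. Qed.

Lemma orlicz_le x y : 0 <= x -> x <= y -> Psi x <= Psi y.
Proof. by move=> x0; rewrite le_eqVlt => /predU1P[->//|/(orlicz_lt x0)/ltW]. Qed.

Lemma orlicz_ge0 x : 0 <= x -> 0 <= Psi x.
Proof. by move=> x0; rewrite -orlicz0 orlicz_le. Qed.

Lemma orlicz_gt0 x : 0 < x -> 0 < Psi x.
Proof. by move=> x0; rewrite -orlicz0 orlicz_lt. Qed.

Lemma orlicz_leE x y : 0 <= x -> 0 <= y -> (Psi x <= Psi y) = (x <= y).
Proof.
move=> x0 y0; apply/idP/idP => [|/(orlicz_le x0)//].
by rewrite leNgt; apply: contraNle => /(orlicz_lt y0).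
Qed.

Lemma orlicz_convex x y l : 0 <= x -> 0 <= y -> 0 <= l <= 1 ->
  Psi (l * x + (1 - l) * y) <= l * Psi x + (1 - l) * Psi y.
Proof.
move=> x0 y0 /andP[l0 l1].
have [->|xy] := eqVneq x y; first by rewrite -!mulrDl addrC subrK !mul1r.
move: l0; rewrite le_eqVlt => /predU1P[<-|l0]; first by rewrite !mul0r !add0r subr0 !mul1r.
move: l1; rewrite le_eqVlt => /predU1P[->|l1]; first by rewrite subrr !mul0r !addr0 !mul1r.
case: oPsi => _ _ _ H _; apply/ltW/H => //; exact/andP.
Qed.

Lemma orlicz_scale x s : 0 <= x -> 0 <= s <= 1 -> Psi (s * x) <= s * Psi x.
Proof. by move=> x0 s01; have := @orlicz_convex x 0 s x0 (lexx _) s01; rewrite orlicz0 !mulr0 !addr0. Qed.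

(* The secant slope [Psi x / x] is nondecreasing. *)
Lemma orlicz_young x y : 0 < x -> 0 <= y -> y * Psi x <= x * Psi x + x * Psi y.
Proof.
move=> x0 y0; have [yx|xy] := leP y x.
  by rewrite -[leLHS]addr0 lerD // ?ler_wpM2r ?mulr_ge0 ?orlicz_ge0 // ltW.
have y1 : 0 < y by apply: lt_trans xy.
have := @orlicz_scale y (x / y) y0; rewrite divfK ?gt_eqF // => H.
have : y * Psi x <= x * Psi y.
  rewrite -ler_pdivlMl // mulrA [_^-1 * _]mulrC; apply: H.
  by rewrite divr_ge0 ?(ltW x0) //= ler_pdivrMr // mul1r ltW.
move=> /le_trans; apply; rewrite lerDr mulr_ge0 // ?orlicz_ge0 // ltW //.
Qed.

(** The mean of three numbers is at most the largest of them, and Psi of the largest is one of the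
    three summands. *)
Lemma orlicz_add3 x y z : 0 <= x -> 0 <= y -> 0 <= z ->
  Psi ((x + y + z) / 3) <= Psi x + Psi y + Psi z.
Proof.
move=> x0 y0 z0.
wlog xy : x y x0 y0 / x <= y.
  by move=> H; have [/H|/ltW/H] := leP x y; last rewrite [x + y]addrC [Psi x + _]addrC; exact.
have px := orlicz_ge0 x0; have py := orlicz_ge0 y0; have pz := orlicz_ge0 z0.
have [yz|/ltW zy] := leP y z.
  apply: (@le_trans _ _ (Psi z)); last lra.
  by apply: orlicz_le; lra.
apply: (@le_trans _ _ (Psi y)); last lra.
by apply: orlicz_le; lra.
Qed.

Lemma orlicz_superlinear K : exists X, 0 < X /\ forall x, X <= x -> K * x <= Psi x.
Proof.
case: oPsi => _ _ _ _ /cvgryPge/(_ K)[M [_ HM]].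
exists (Num.max 1 (M + 1)); split; first by rewrite lt_max ltr01.
move=> x; rewrite ge_max => /andP[x1 xM].
have x0 : 0 < x by apply: lt_le_trans x1.
by rewrite -ler_pdivlMr //; apply: HM; rewrite (lt_le_trans _ xM) // ltrDl.
Qed.

(** Continuity of Psi is given only within [0, +oo[; composing with the absolute value yields a
    function continuous on the whole line, as the measurability and limit arguments require. *)
Lemma orlicz_abs_continuous : continuous (fun x => Psi `|x|).
Proof.
case: oPsi => /subspace_continuousP cP _ _ _ _ x.
have /cP : `[0, +oo[%classic `|x| by rewrite /= in_itv /= normr_ge0.
move=> H V /H HV.
have {}HV : nbhs `|x| [set z | `[0, +oo[%classic z -> V (Psi z)] := HV.
have : nbhs x [set y | `[0, +oo[%classic `|y| -> V (Psi `|y|)].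
  exact: (@norm_continuous _ _ x _ HV).
by apply: filterS => y /=; apply; rewrite /= in_itv /= normr_ge0.
Qed.

Lemma orlicz_max_continuous : continuous (fun x => Psi (Num.max x 0)).
Proof.
have E x : Psi (Num.max x 0) = Psi `|Num.max x 0|.
  by rewrite ger0_norm // le_max lexx orbT.
rewrite (_ : (fun _ => _) = (fun x => Psi `|x|) \o (fun x : R => Num.max x 0)); last first.
  by apply/funext => x /=; rewrite -E.
move=> x; apply: continuous_comp; last exact: orlicz_abs_continuous.
by apply: continuous_max => //; exact: cst_continuous.
Qed.

Lemma orlicz_surj y : 0 <= y -> exists x, 0 <= x /\ Psi x = y.
Proof.
move=> y0; have [X [X0 HX]] := orlicz_superlinear 1.
(* Right endpoint for the intermediate value theorem: superlinearity with slope 1 gives Psi b >= b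
   >= y. *)
pose b := Num.max X y.
have b0 : 0 <= b by rewrite le_max ltW.
have [||c + Hc] := @IVT R (fun x => Psi (Num.max x 0)) 0 b y b0.
- by apply: continuous_subspaceT => x; exact: orlicz_max_continuous.
- rewrite maxxx orlicz0 (max_l b0) min_l ?orlicz_ge0 // y0 le_max /=.
  apply/orP; right; apply: le_trans (HX b _); last by rewrite le_max lexx.
  by rewrite mul1r le_max lexx orbT.
rewrite in_itv /= => /andP[c0 _]; exists c; split => //.
by rewrite -Hc max_l.
Qed.

Lemma PsiInvE x y : 0 <= x -> Psi x = y -> PsiInv Psi y = x.
Proof.
move=> x0 <-; rewrite /PsiInv.
have -> : [set u | 0 <= u /\ Psi u <= Psi x] = `[0, x]%classic.
  apply/seteqP; split => u /=; rewrite in_itv /=.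
    by move=> [u0]; rewrite orlicz_leE // => ->; rewrite u0.
  by move=> /andP[u0 ux]; rewrite orlicz_leE.
by rewrite sup_itv // bnd_simp.
Qed.

Lemma PsiInv_ge0 y : 0 <= y -> 0 <= PsiInv Psi y.
Proof. by move=> /orlicz_surj[x [x0 /(PsiInvE x0) ->]]. Qed.

Lemma PsiInvK y : 0 <= y -> Psi (PsiInv Psi y) = y.
Proof. by move=> /orlicz_surj[x [x0 xy]]; rewrite (PsiInvE x0 xy). Qed.

Lemma PsiInv_le x y : 0 <= x -> x <= y -> PsiInv Psi x <= PsiInv Psi y.
Proof.
move=> x0 xy; have y0 := le_trans x0 xy.
by rewrite -orlicz_leE ?PsiInv_ge0 // !PsiInvK.
Qed.

Lemma le_PsiInv x y : 0 <= x -> Psi x <= y -> x <= PsiInv Psi y.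
Proof.
move=> x0 xy; have y0 := le_trans (orlicz_ge0 x0) xy.
by rewrite -orlicz_leE ?PsiInv_ge0 // PsiInvK.
Qed.

Lemma PsiInv_gt0 y : 0 < y -> 0 < PsiInv Psi y.
Proof.
move=> y0; rewrite lt_neqAle PsiInv_ge0 ?ltW // andbT; apply/eqP => E.
by have := PsiInvK (ltW y0); rewrite -E orlicz0 => /eqP; rewrite lt_eqF.
Qed.

(** The slope is the supremum of the slopes of chords ending at x from the left; convexity puts it
    below the slope of every chord to the right. This supporting line drives Jensen's inequality for
    Poisson means. *)
Lemma orlicz_support x : 0 < x -> exists s, forall y, 0 <= y -> Psi x + s * (y - x) <= Psi y.
Proof.
move=> x0.
pose A := [set (Psi x - Psi u) / (x - u) | u in [set u | 0 <= u /\ u < x]].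
have slope u v : 0 <= u -> u < x -> x < v -> (Psi x - Psi u) / (x - u) <= (Psi v - Psi x) / (v - x).
  move=> u0 ux xv.
  have vu : 0 < v - u by lra.
  have xu0 : 0 < x - u by lra.
  have vx0 : 0 < v - x by lra.
  have v0 : 0 <= v by lra.
  have l01 : 0 <= (x - u) / (v - u) <= 1.
    rewrite divr_ge0 ?(ltW vu) ?(ltW xu0) //= ler_pdivrMr //; lra.
  have := orlicz_convex v0 u0 l01.
  have -> : (x - u) / (v - u) * v + (1 - (x - u) / (v - u)) * u = x by field; rewrite gt_eqF.
  have -> : (x - u) / (v - u) * Psi v + (1 - (x - u) / (v - u)) * Psi u =
    ((x - u) * Psi v + (v - x) * Psi u) / (v - u) by field; rewrite gt_eqF.
  rewrite (ler_pdivlMr _ _ vu) => H.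
  rewrite ler_pdivrMr // mulrAC ler_pdivlMr //.
  by move: H; lra.
have A0 : A !=set0 by exists ((Psi x - Psi 0) / (x - 0)), 0.
have ubA v : x < v -> ubound A ((Psi v - Psi x) / (v - x)).
  by move=> xv _ [u [u0 ux] <-]; exact: slope.
have hA : has_sup A by split=> //; exists ((Psi (x + 1) - Psi x) / (x + 1 - x)); apply: ubA; rewrite ltrDl.
exists (sup A) => y y0.
have [yx|xy|->] := ltgtP y x; last by rewrite subrr mulr0 addr0.
  have xy0 : 0 < x - y by lra.
  have : (Psi x - Psi y) / (x - y) <= sup A by apply: sup_upper_bound => //; exists y.
  by rewrite ler_pdivrMr //; lra.
have yx0 : 0 < y - x by lra.
have : sup A <= (Psi y - Psi x) / (y - x) by apply: ge_sup => //; exact: ubA.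
by rewrite ler_pdivlMr //; lra.
Qed.

Hypothesis dPsi : Delta2 Psi.

(** Two applications of Delta^2, starting from Psi x >= x, give x^4 <= Psi(a^2 x). Undoing the
    dilation costs the factor a^8, which one of the four powers of x absorbs once x >= a^8. *)
Lemma delta2_growth : exists X, 0 < X /\ forall x, X <= x -> x ^+ 3 <= Psi x.
Proof.
have [a [a1 [x0 H]]] := dPsi; have [X [X0 HX]] := orlicz_superlinear 1.
have a0 : 0 < a by apply: lt_trans a1.
pose Z := Num.max (Num.max x0 X) 1.
have HZ x : Z <= x -> [/\ 1 <= x, x0 <= x & X <= x].
  by rewrite !ge_max => /andP[/andP[-> ->] ->].
have H4 x : Z <= x -> x ^+ 4 <= Psi (a ^+ 2 * x).
  move=> Zx; have [x1 x00 xX] := HZ _ Zx.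
  have [y1 y00 yX] : [/\ 1 <= a * x, x0 <= a * x & X <= a * x].
    by apply/HZ/(le_trans Zx); rewrite ler_peMl ?ltW // (lt_le_trans _ x1).
  have h1 : x ^+ 2 <= Psi (a * x).
    apply: le_trans (H _ x00); rewrite lerXn2r ?nnegrE ?orlicz_ge0 //; try lra.
    by have := HX _ xX; rewrite mul1r.
  rewrite expr2 -mulrA; apply: le_trans (H _ y00).
  by rewrite (exprM _ 2 2) lerXn2r ?nnegrE ?orlicz_ge0 ?sqr_ge0 //; lra.
exists (Num.max (a ^+ 2 * Z) (a ^+ 8)); split.
  by rewrite lt_max exprn_gt0 ?orbT.
move=> x; rewrite ge_max => /andP[xZ xa].
have a20 : 0 < a ^+ 2 by rewrite exprn_gt0.
have := H4 (x / a ^+ 2); rewrite [a ^+ 2 * (x / _)]mulrC divfK ?gt_eqF // ler_pdivlMr // [Z * _]mulrC => /(_ xZ).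
apply: le_trans; rewrite expr_div_n -exprM ler_pdivlMr ?exprn_gt0 //= [x ^+ 4]exprSr.
by rewrite ler_wpM2l // exprn_ge0 // (le_trans _ xa) // exprn_ge0 // ltW.
Qed.

(** The additive constant covers small x; in this form the inequality integrates to the inclusion of
    H^Psi in H^2. *)
Lemma delta2_sqr_le : exists X, 0 < X /\ forall x, 0 <= x -> x ^+ 2 <= X + Psi x.
Proof.
have [X [X0 HX]] := delta2_growth; exists (Num.max X 1 ^+ 2); split.
  by rewrite exprn_gt0 // lt_max X0.
move=> x x0; have [xX|] := leP x (Num.max X 1).
  by rewrite -[leLHS]addr0 lerD ?orlicz_ge0 // lerXn2r ?nnegrE // le_max ler01 orbT.
rewrite gt_max => /andP[/ltW xX /ltW x1].
rewrite -[leLHS]add0r lerD ?sqr_ge0 //; apply: le_trans (HX _ xX).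
by rewrite [x ^+ 3]exprSr ler_peMr ?sqr_ge0.
Qed.

End OrliczFunctions.

(** * Integrals over one period and orthogonality of trigonometric monomials *)

Section PeriodIntegral.
Variable R : realType.
Local Notation C := R[i].
Local Notation mu := (@lebesgue_measure R).
Implicit Types (f g h : R -> R) (b c : R).

Lemma contD f g : continuous f -> continuous g -> continuous (fun x => f x + g x).
Proof. by move=> cf cg x; apply: (continuousD (cf x) (cg x)). Qed.

Lemma contM f g : continuous f -> continuous g -> continuous (fun x => f x * g x).
Proof. by move=> cf cg x; apply: (continuousM (cf x) (cg x)). Qed.

Lemma cont_cst c : continuous (fun _ : R => c).
Proof. by move=> x; exact: cst_continuous. Qed.

Lemma contN f : continuous f -> continuous (fun x => - f x).
Proof. by move=> cf x; apply: (continuousN (cf x)). Qed.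

Lemma contB f g : continuous f -> continuous g -> continuous (fun x => f x - g x).
Proof. by move=> cf cg; exact: contD cf (contN cg). Qed.

Lemma contX f n : continuous f -> continuous (fun x => f x ^+ n).
Proof.
move=> cf; elim: n => [|n IH]; first exact: cont_cst.
rewrite (_ : (fun _ => _) = (fun x => f x * f x ^+ n)); first exact: contM.
by apply/funext => x; rewrite exprS.
Qed.

Lemma cont_sum n (F : nat -> R -> R) : (forall k, continuous (F k)) ->
  continuous (fun x => \sum_(k < n) F k x).
Proof.
move=> cF; elim: n => [|n IH].
  rewrite (_ : (fun _ => _) = (fun=> 0)); first exact: cont_cst.
  by apply/funext => x; rewrite big_ord0.
rewrite (_ : (fun _ => _) = (fun x => \sum_(k < n) F k x + F n x)); first exact: contD.
by apply/funext => x; rewrite big_ord_recr.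
Qed.

Lemma cont_comp f g : continuous f -> continuous g -> continuous (fun x => f (g x)).
Proof. by move=> cf cg x; apply: (continuous_comp (cg x) (cf (g x))). Qed.

Lemma cont_abs f : continuous f -> continuous (fun x => `|f x|).
Proof. by move=> cf; apply: (@cont_comp (fun x => `|x|)) => // x; exact: norm_continuous. Qed.

Lemma cont_inv f : continuous f -> (forall x, f x != 0) -> continuous (fun x => (f x)^-1).
Proof. by move=> cf f0 x; apply: (continuousV (f0 x) (cf x)). Qed.

Lemma cont_id : continuous (fun x : R => x).
Proof. by move=> x; exact: cvg_id. Qed.

(** The base point is left free because the Poisson kernel centred at th is estimated over
    [th - pi, th + pi], while means are taken over [0, 2 pi]. *)
Definition per b h : R := \int[mu]_(t in `[b, b + 2 * pi]) h t.

Lemma twopi_gt0 : 0 < 2 * pi :> R.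
Proof. by rewrite mulr_gt0 // pi_gt0. Qed.

Lemma cont_itv_integrable a b h : continuous h -> mu.-integrable `[a, b] (EFin \o h).
Proof.
move=> ch; apply: continuous_compact_integrable; first exact: segment_compact.
exact: continuous_subspaceT.
Qed.

Lemma per_EFin b h : continuous h ->
  (\int[mu]_(t in `[b, (b + 2 * pi)%R]) (h t)%:E = (per b h)%:E)%E.
Proof.
move=> ch; rewrite /per /Rintegral fineK //.
by apply: integrable_fin_num => //; exact: cont_itv_integrable.
Qed.

Lemma perD b f g : continuous f -> continuous g ->
  per b (fun t => f t + g t) = per b f + per b g.
Proof. by move=> cf cg; rewrite /per RintegralD //; exact: cont_itv_integrable. Qed.

Lemma perZ b c f : continuous f -> per b (fun t => c * f t) = c * per b f.
Proof. by move=> cf; rewrite /per RintegralZl //; exact: cont_itv_integrable. Qed.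

Lemma perB b f g : continuous f -> continuous g ->
  per b (fun t => f t - g t) = per b f - per b g.
Proof. by move=> cf cg; rewrite /per RintegralB //; exact: cont_itv_integrable. Qed.

Lemma eq_per b f g : f =1 g -> per b f = per b g.
Proof. by move=> /funext ->. Qed.

Lemma per_cst b c : per b (fun=> c) = 2 * pi * c.
Proof.
rewrite /per Rintegral_cst //.
have E : mu `[b, (b + 2 * pi)%R]%classic = (2 * pi)%:E.
  by rewrite lebesgue_measure_itv /= lte_fin ltrDl twopi_gt0 -EFinD [b + _]addrC addrK.
by rewrite [RHS]mulrC; congr (c * _); exact: (f_equal fine E).
Qed.

Lemma per_sum b n (F : nat -> R -> R) : (forall k, continuous (F k)) ->
  per b (fun t => \sum_(k < n) F k t) = \sum_(k < n) per b (F k).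
Proof.
move=> cF; elim: n => [|n IH].
  rewrite big_ord0 -[RHS](mulr0 (2 * pi)) -(per_cst b).
  by apply: eq_per => x; rewrite big_ord0.
rewrite big_ord_recr /= -IH -perD //; last exact: cont_sum.
by apply: eq_per => x; rewrite big_ord_recr.
Qed.

Lemma per_le b f g : continuous f -> continuous g ->
  (forall t, f t <= g t) -> per b f <= per b g.
Proof. by move=> cf cg fg; apply: le_Rintegral => //; exact: cont_itv_integrable. Qed.

Lemma per_abs b f : continuous f -> `|per b f| <= per b (fun t => `|f t|).
Proof. by move=> cf; apply: le_normr_Rintegral => //; exact: cont_itv_integrable. Qed.

Lemma per_bound b f c : continuous f -> (forall t, `|f t| <= c) -> `|per b f| <= 2 * pi * c.
Proof.
move=> cf fc; apply: le_trans (per_abs b cf) _; rewrite -(per_cst b).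
by apply: per_le => //; [exact: cont_abs|exact: cont_cst].
Qed.

Lemma per_ge0 b f : (forall t, 0 <= f t) -> 0 <= per b f.
Proof. by move=> f0; apply: Rintegral_ge0. Qed.

Lemma conjcM (z w : C) : ((z * w)^*)%C = (z^*)%C * (w^*)%C.
Proof. by apply: complexP; case: z w => [? ?] [? ?] /=; ring. Qed.

Lemma conjcD (z w : C) : ((z + w)^*)%C = (z^*)%C + (w^*)%C.
Proof. by apply: complexP; case: z w => [? ?] [? ?] /=; ring. Qed.

Definition harm (c : C) (n : nat) (t : R) : R := complex.Re (c * expi (n%:R * t)).

Lemma harmE (c : C) n t :
  harm c n t = complex.Re c * cos (n%:R * t) - complex.Im c * sin (n%:R * t).
Proof. by rewrite /harm Re_mul. Qed.

Lemma cont_lin (n : R) : continuous (fun t => n * t).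
Proof. by apply: contM; [exact: cont_cst|exact: cont_id]. Qed.

Lemma cont_cosn (n : R) : continuous (fun t => cos (n * t)).
Proof. by apply: cont_comp; [move=> x; exact: continuous_cos|exact: cont_lin]. Qed.
Lemma cont_sinn (n : R) : continuous (fun t => sin (n * t)).
Proof. by apply: cont_comp; [move=> x; exact: continuous_sin|exact: cont_lin]. Qed.

Lemma cont_harm (c : C) n : continuous (harm c n).
Proof.
rewrite (_ : harm c n = fun t => complex.Re c * cos (n%:R * t) - complex.Im c * sin (n%:R * t)).
  by apply: contB; apply: contM; first [exact: cont_cst|exact: cont_cosn|exact: cont_sinn].
by apply/funext => t; rewrite harmE.
Qed.

Lemma per_harm b (c : C) n : (0 < n)%N -> per b (harm c n) = 0.
Proof.
move=> n0; have n0' : n%:R != 0 :> R by rewrite pnatr_eq0 -lt0n.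
pose F t := (complex.Re c * sin (n%:R * t) + complex.Im c * cos (n%:R * t)) / n%:R.
have dF t : is_derive t (1 : R) F (harm c n t).
  have dl : is_derive t (1 : R) (fun x : R => n%:R * x) (n%:R).
    have -> : (fun x : R => n%:R * x) = n%:R \*: (id : R -> R) by [].
    by apply: is_derive_eq; rewrite /GRing.scale /= mulr1.
  have ds : is_derive t (1 : R) (fun x : R => sin (n%:R * x)) (cos (n%:R * t) * n%:R).
    exact: (@is_derive1_comp _ sin (fun x => n%:R * x)).
  have dc : is_derive t (1 : R) (fun x : R => cos (n%:R * x)) (- sin (n%:R * t) * n%:R).
    exact: (@is_derive1_comp _ cos (fun x => n%:R * x)).
  have -> : F = (n%:R^-1 * complex.Re c) \*: (fun x : R => sin (n%:R * x))
     + (n%:R^-1 * complex.Im c) \*: (fun x : R => cos (n%:R * x)).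
    by apply/funext => x; rewrite /F /= mulrDl ![_ / _]mulrC !mulrA.
  apply: is_derive_eq; rewrite /GRing.scale /= harmE; field.
  exact: n0'.
have cF : continuous F.
  apply: contM; last exact: cont_cst.
  by apply: contD; apply: contM; first [exact: cont_cst|exact: cont_cosn|exact: cont_sinn].
rewrite /per /Rintegral (@continuous_FTC2 _ _ F).
- have E : expi (n%:R * (b + 2 * pi)) = expi (n%:R * b) :> C.
    by rewrite mulrDr expiD expi_natpi mulr1.
  have := f_equal (@complex.Re R) E; have := f_equal (@complex.Im R) E; rewrite /= /F => -> ->.
  by rewrite subrr.
- by rewrite ltrDl twopi_gt0.
- by apply: continuous_subspaceT; exact: cont_harm.
- split=> [x _||]; last 2 first.
  + by apply: cvg_at_right_filter; exact: cF.
  + by apply: cvg_at_left_filter; exact: cF.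
  + by have [] := dF x.
- by move=> x _; rewrite derive1E; have [_ ->] := dF x.
Qed.

Lemma per_harm0 b (c : C) : per b (harm c 0) = 2 * pi * complex.Re c.
Proof. by rewrite -(per_cst b); apply: eq_per => t; rewrite harmE mul0r cos0 sin0 mulr0 subr0 mulr1. Qed.

(** For k <= j the product of one monomial with the conjugate of the other is a single monomial of
    frequency j - k, whose integral vanishes unless j = k; conjugation exchanges the two indices. *)
Lemma per_cross b (c d : C) j k :
  per b (fun t => complex.Re (c * expi (j%:R * t) * (d * expi (k%:R * t))^*%C)) =
  if j == k then 2 * pi * complex.Re (c * d^*%C) else 0.
Proof.
wlog kj : c d j k / (k <= j)%N.
  move=> H; have [kj|jk] := leqP k j; first exact: H.
  rewrite [RHS](_ : _ = if k == j then 2 * pi * complex.Re (d * c^*%C) else 0); last first.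
    by rewrite [j == k]eq_sym; case: eqP => // _; congr (_ * _); case: c d => [? ?] [? ?] /=; ring.
  rewrite -H; last exact: ltnW.
  by apply: eq_per => t; case: (c * _) (d * _) => [? ?] [? ?] /=; ring.
transitivity (per b (harm (c * d^*%C) (j - k))).
  apply: eq_per => t; rewrite /harm; congr complex.Re.
  rewrite conjcM expi_conj mulrACA -expiD.
  by rewrite natrB // mulrBl.
case: eqP => [->|/eqP jk]; first by rewrite subnn per_harm0.
by rewrite per_harm // subn_gt0 ltn_neqAle eq_sym jk.
Qed.

Lemma cont_cross (c d : C) j k :
  continuous (fun t : R => complex.Re (c * expi (j%:R * t) * (d * expi (k%:R * t))^*%C)).
Proof.
have -> : (fun t : R => complex.Re (c * expi (j%:R * t) * (d * expi (k%:R * t))^*%C)) =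
  (fun t => harm c j t * harm d k t + harm (- 'i%C * c) j t * harm (- 'i%C * d) k t).
  apply/funext => t; rewrite /harm; case: c d => [? ?] [? ?] /=; ring.
by apply: contD; apply: contM; exact: cont_harm.
Qed.

(** Product to sum: Re z Re w is half of Re(z w) + Re(z conj w). The first term survives only at
    frequency 0, the second only for equal frequencies. *)
Lemma per_harmM b (c d : C) j k :
  per b (fun t => harm c j t * harm d k t) =
  pi * ((if (j + k == 0)%N then complex.Re (c * d) else 0) +
        (if j == k then complex.Re (c * d^*%C) else 0)).
Proof.
transitivity (per b (fun t => 2^-1 * (harm (c * d) (j + k) t +
   complex.Re (c * expi (j%:R * t) * (d * expi (k%:R * t))^*%C)))).
  apply: eq_per => t; rewrite /harm natrD mulrDl expiD mulrACA.
  by case: (c * _) (d * _) => [? ?] [? ?] /=; field.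
rewrite perZ ?perD; [|exact: cont_harm|exact: cont_cross|
  by apply: contD; [exact: cont_harm|exact: cont_cross]].
rewrite per_cross; case: (posnP (j + k)) => [->|jk]; first rewrite per_harm0; last rewrite per_harm //.
  by case: eqP => _; field.
by case: eqP => _; field.
Qed.

Lemma parseval_finite b n (c : nat -> C) :
  per b (fun t => modc (\sum_(k < n) c k * expi (k%:R * t)) ^+ 2) =
  2 * pi * \sum_(k < n) modc (c k) ^+ 2.
Proof.
transitivity (per b (fun t => \sum_(j < n) \sum_(k < n)
    complex.Re (c j * expi (j%:R * t) * (c k * expi (k%:R * t))^*%C))).
  apply: eq_per => t; set z : C := \sum_(k < n) c k * _.
  have -> : modc z ^+ 2 = complex.Re (z * z^*%C).
    by rewrite modc_sqr; case: z => ? ? /=; ring.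
  rewrite {1}/z mulr_suml Re_sum; apply: eq_bigr => j _.
  have -> : (z^*)%C = \sum_(k < n) (c k * expi (k%:R * t))^*%C by exact: (big_morph _ conjcD (conjc0 R)).
  by rewrite mulr_sumr Re_sum.
rewrite (per_sum b n (F := fun j t => \sum_(k < n)
    complex.Re (c j * expi (j%:R * t) * (c k * expi (k%:R * t))^*%C))); last first.
  by move=> j; apply: (cont_sum (F := fun k t => complex.Re (c j * expi (j%:R * t) * (c k * expi (k%:R * t))^*%C))) => k; exact: cont_cross.
rewrite mulr_sumr; apply: eq_bigr => j _.
rewrite (per_sum b n (F := fun k t => complex.Re (c j * expi (j%:R * t) * (c k * expi (k%:R * t))^*%C))); last first.
  by move=> k; exact: cont_cross.
rewrite (bigD1 j) //= per_cross eqxx big1 ?addr0.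
  by congr (_ * _); rewrite modc_sqr; case: (c j) => ? ? /=; ring.
by move=> k kj; rewrite per_cross eq_sym ifN.
Qed.

End PeriodIntegral.

(** * Limits along a free ultrafilter on the natural numbers *)

Section Ultralimits.
Variable R : realType.
Local Notation C := R[i].

(** One such ultrafilter assigns a limit to every bounded sequence at once, compatibly with sums, so
    infinitely many sequences need no diagonal extraction. *)
Lemma free_ultrafilter : exists U : set_system nat, UltraFilter U /\ \oo `<=` U.
Proof. exact: ultraFilterLemma. Qed.

Variable U : set_system nat.
Hypothesis uU : UltraFilter U.

(** Compactness of [-B, B] gives a cluster point of the image ultrafilter, and the dichotomy of
    ultrafilters turns a cluster point into a limit. *)
Lemma bounded_ulim_real (u : nat -> R) (B : R) : (forall n, `|u n| <= B) ->
  exists l, forall e, 0 < e -> U [set n | `|u n - l| < e].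
Proof.
move=> uB; have cK := @segment_compact R (- B) B.
have UA : U (u @^-1` `[- B, B]).
  by apply: filterS filterT => n _ /=; rewrite in_itv /= -ler_norml uB.
have [l [_ Hl]] := cK (u @ U) _ UA.
exists l => e e0; have [//|UC] := in_ultra_setVsetC [set n | `|u n - l| < e] uU.
have [x [/= ex lx]] := Hl [set x | ~ `|x - l| < e] _ UC (nbhsx_ballx l e e0).
by case: ex; move: lx; rewrite /ball /= distrC.
Qed.

Lemma bounded_ulim (u : nat -> C) (B : R) : (forall n, modc (u n) <= B) ->
  exists l, forall e, 0 < e -> U [set n | modc (u n - l) < e].
Proof.
move=> uB.
have [a Ha] := @bounded_ulim_real (fun n => complex.Re (u n)) B (fun n => le_trans (normRe_le _) (uB n)).
have [b Hb] := @bounded_ulim_real (fun n => complex.Im (u n)) B (fun n => le_trans (normIm_le _) (uB n)).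
exists (Complex a b) => e e0; have e2 : 0 < e / 2 by rewrite divr_gt0.
apply: filterS (filterI (Ha _ e2) (Hb _ e2)) => n /= [h1 h2].
apply: le_lt_trans (modc_le_ReIm _) _; rewrite [e]splitr.
by rewrite Re_add Im_add Re_opp Im_opp ltrD.
Qed.

Hypothesis freeU : \oo `<=` U.

Lemma ultra_ge N : U [set n | (N <= n)%N].
Proof. by apply: freeU; exists N. Qed.

Lemma ultra_ex (P : set nat) N : U P -> exists n, (N <= n)%N /\ P n.
Proof. move=> UP; have /filter_ex[n [Pn Nn]] : U (P `&` [set n | (N <= n)%N]).
  exact: filterI UP (ultra_ge N).
by exists n. Qed.

End Ultralimits.

(** * Analyticity as locally uniform approximation by polynomials *)

Section PolynomialApproximation.
Variable R : realType.
Local Notation C := R[i].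
Implicit Types (f g phi : C -> C) (p q : {poly C}) (z w : C) (r e t : R).

Lemma poly_bounded p : exists B, 0 <= B /\ forall z, modc z <= 1 -> modc p.[z] <= B.
Proof.
elim/poly_ind: p => [|p c [B [B0 HB]]].
  by exists 0; split=> // z _; rewrite horner0 modc0.
exists (B + modc c); split; first by rewrite addr_ge0 ?modc_ge0.
move=> z z1; rewrite hornerMXaddC; apply: le_trans (modcD _ _) _.
by rewrite lerD2r modcM -[B]mulr1 ler_pM ?modc_ge0 // HB.
Qed.

Lemma poly_lipschitz p : exists L, 0 <= L /\ forall z w, modc z <= 1 -> modc w <= 1 ->
  modc (p.[z] - p.[w]) <= L * modc (z - w).
Proof.
elim/poly_ind: p => [|p c [L [L0 HL]]].
  by exists 0; split=> // z w _ _; rewrite !horner0 subrr modc0 mul0r.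
have [B [B0 HB]] := poly_bounded p.
exists (B + L); split; first by rewrite addr_ge0.
move=> z w z1 w1; rewrite !hornerMXaddC.
have -> : p.[z] * z + c - (p.[w] * w + c) = p.[z] * (z - w) + (p.[z] - p.[w]) * w by ring.
apply: le_trans (modcD _ _) _; rewrite [leRHS]mulrDl !modcM lerD //.
  by rewrite ler_wpM2r ?modc_ge0 // HB.
by rewrite -[leRHS]mulr1 ler_pM ?modc_ge0 // HL.
Qed.

Lemma horner_polar p n r t : (size p <= n)%N ->
  p.[(r%:C)%C * expi t] = \sum_(k < n) (p`_k * ((r ^+ k)%:C)%C) * expi (k%:R * t).
Proof.
move=> pn; rewrite (horner_coef_wide _ pn); apply: eq_bigr => k _.
by rewrite polarX mulrA.
Qed.

Lemma sum_le_term (F : nat -> R) n k : (forall i, 0 <= F i) -> (k < n)%N ->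
  F k <= \sum_(i < n) F i.
Proof. by move=> F0 kn; rewrite (bigD1 (Ordinal kn)) //= lerDl sumr_ge0. Qed.

(** Cauchy's estimate read off from Parseval on the circle of radius r: a single squared coefficient
    is at most the mean of |p|^2. *)
Lemma cauchy_poly p r B n : 0 <= r -> (forall z, modc z <= r -> modc p.[z] <= B) ->
  modc p`_n * r ^+ n <= B.
Proof.
move=> r0 pB; have B0 : 0 <= B by apply: le_trans (modc_ge0 _) (pB 0 _); rewrite modc0.
have [sn|ns] := leqP (size p) n; first by rewrite nth_default // modc0 mul0r.
rewrite -(@ler_pXn2r _ 2) ?nnegrE ?mulr_ge0 ?modc_ge0 ?exprn_ge0 //.
pose c k := p`_k * ((r ^+ k)%:C)%C.
have E : (modc p`_n * r ^+ n) ^+ 2 = modc (c n) ^+ 2.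
  by rewrite modcM modc_real ger0_norm // exprn_ge0.
have h := @parseval_finite R 0 (size p) c.
have : modc (c n) ^+ 2 <= \sum_(k < size p) modc (c k) ^+ 2.
  by apply: (@sum_le_term (fun k => modc (c k) ^+ 2)) => // i; exact: sqr_ge0.
rewrite -E => /le_trans; apply; rewrite -(ler_pM2l (twopi_gt0 R)) -h.
rewrite -(per_cst 0); apply: per_le.
- rewrite (_ : (fun _ => _) = fun t => (\sum_(k < size p) harm (c k) k t) ^+ 2
     + (\sum_(k < size p) harm (- 'i%C * c k) k t) ^+ 2); last first.
    apply/funext => t; rewrite modc_sqr; congr (_ ^+ 2 + _ ^+ 2); first by rewrite Re_sum.
    have Im_Re (z : C) : complex.Im z = complex.Re (- 'i%C * z).
      by case: z => ? ? /=; ring.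
    by rewrite Im_Re mulr_sumr Re_sum; apply: eq_bigr => k _; rewrite mulrA.
  by apply: contD; apply: contX; [apply: (cont_sum (F := fun k => harm (c k) k))|
    apply: (cont_sum (F := fun k => harm (- 'i%C * c k) k))] => k; exact: cont_harm.
- exact: cont_cst.
- move=> t; rewrite -horner_polar // lerXn2r ?nnegrE ?modc_ge0 // pB //.
  by rewrite modc_polar.
Qed.

(* equivalent to analyticity, and convenient for composition *)
Definition approx f := forall r, 0 < r -> r < 1 -> forall e, 0 < e ->
  exists p, forall z, modc z <= r -> modc (f z - p.[z]) <= e.

Lemma geom_sum_le (q : R) n : 0 <= q -> q < 1 -> \sum_(k < n) q ^+ k <= (1 - q)^-1.
Proof.
move=> q0 q1; have q1' : 0 < 1 - q by rewrite subr_gt0.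
rewrite -[leRHS]mul1r ler_pdivlMr // mulrC -opprB mulNr -subrX1 opprB.
by rewrite gerBl exprn_ge0.
Qed.

(** At the point r, the k-th term is a difference of consecutive partial sums; beyond N both are
    within 1 of the limit, which explains the 2, and the finitely many earlier terms are added
    up. *)
Lemma coef_bounded (a : nat -> C) f r : 0 <= r -> r < 1 ->
  (forall z, modc z < 1 -> cvgC (fun n => \sum_(k < n) a k * z ^+ k) (f z)) ->
  exists M, 0 <= M /\ forall k, modc (a k) * r ^+ k <= M.
Proof.
move=> r0 r1 Ha; pose z := (r%:C)%C : C.
have mz : modc z = r by rewrite modc_real ger0_norm.
have /cvgCP/(_ 1 ltr01)[N HN] : cvgC (fun n => \sum_(k < n) a k * z ^+ k) (f z).
  by apply: Ha; rewrite mz.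
exists (\sum_(k < N) modc (a k) * r ^+ k + 2).
have s0 n : 0 <= \sum_(k < n) modc (a k) * r ^+ k.
  by apply: sumr_ge0 => k _; rewrite mulr_ge0 ?modc_ge0 ?exprn_ge0.
split; first by rewrite addr_ge0.
move=> k; have [kN|Nk] := ltnP k N.
  rewrite -[leLHS]addr0 lerD //.
  by apply: (@sum_le_term (fun k => modc (a k) * r ^+ k)) => // i; rewrite mulr_ge0 ?modc_ge0 ?exprn_ge0.
rewrite -[leLHS]add0r lerD //.
have h1 := HN _ (leqW Nk); have h2 := HN _ Nk.
have -> : modc (a k) * r ^+ k = modc (a k * z ^+ k) by rewrite modcM modcX mz.
have -> : a k * z ^+ k = (\sum_(i < k.+1) a i * z ^+ i - f z) - (\sum_(i < k) a i * z ^+ i - f z).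
  by rewrite big_ord_recr /=; ring.
by apply: le_trans (modcB _ _) _; rewrite -[2]/(1 + 1) lerD // ltW.
Qed.

Lemma psum_cauchy (a : nat -> C) r M z N n : 0 < r -> 0 <= M ->
  (forall k, modc (a k) * r ^+ k <= M) -> modc z < r ->
  modc (\sum_(k < N + n) a k * z ^+ k - \sum_(k < N) a k * z ^+ k)
    <= M * (modc z / r) ^+ N / (1 - modc z / r).
Proof.
move=> r0 M0 HM zr; set q := modc z / r.
have q0 : 0 <= q by rewrite divr_ge0 ?modc_ge0 // ltW.
have q1 : q < 1 by rewrite ltr_pdivrMr // mul1r.
rewrite big_split_ord /= addrAC subrr add0r.
apply: le_trans (modc_sum _ _ _) _.
apply: (@le_trans _ _ (\sum_(k < n) M * q ^+ N * q ^+ k)); last first.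
  by rewrite -mulr_sumr ler_wpM2l ?mulr_ge0 ?exprn_ge0 // geom_sum_le.
apply: ler_sum => k _; rewrite modcM modcX -mulrA -exprD /q expr_div_n mulrA.
rewrite ler_pdivlMr ?exprn_gt0 // -mulrA [_ * r ^+ _]mulrC mulrA.
by rewrite ler_wpM2r ?exprn_ge0 ?modc_ge0.
Qed.

Lemma expr_small (q M e : R) : 0 <= q -> q < 1 -> 0 < e -> exists N, M * q ^+ N < e.
Proof.
move=> q0 q1 e0; have : (fun n => M * q ^+ n) @ \oo --> M * 0.
  by apply: cvgMr => //; apply: cvg_expr; rewrite ger0_norm.
rewrite mulr0 => /cvgrPdist_lt/(_ _ e0)[N _ HN]; exists N.
have := HN N (leqnn N); rewrite sub0r normrN; exact/le_lt_trans/ler_norm.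
Qed.

Lemma psum_unif (a : nat -> C) f r : 0 <= r -> r < 1 ->
  (forall z, modc z < 1 -> cvgC (fun n => \sum_(k < n) a k * z ^+ k) (f z)) ->
  forall e, 0 < e -> exists N, forall n, (N <= n)%N -> forall z, modc z <= r ->
    modc (f z - \sum_(k < n) a k * z ^+ k) <= e.
Proof.
(* Coefficients are controlled at an intermediate radius s, so that tails on the disc of radius r
   are geometric with ratio r / s. *)
move=> r0 r1 Ha e e0; pose s := (r + 1) / 2.
have rs : r < s by rewrite /s; lra.
have s1 : s < 1 by rewrite /s; lra.
have s0 : 0 < s by apply: le_lt_trans rs.
have [M [M0 HM]] := coef_bounded (ltW s0) s1 Ha.
pose q := r / s.
have q0 : 0 <= q by rewrite divr_ge0 // ltW.
have q1 : q < 1 by rewrite ltr_pdivrMr // mul1r.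
have [N HN] := @expr_small q (M / (1 - q)) e q0 q1 e0.
exists N => n Nn z zr; have zs : modc z < s by apply: le_lt_trans rs.
have z1 : modc z < 1 by apply: lt_trans s1.
apply/ler_addgt0Pl => d d0.
have /cvgCP/(_ _ d0)[K HK] := Ha z z1.
have -> : f z - \sum_(k < n) a k * z ^+ k = (\sum_(k < n + K) a k * z ^+ k - \sum_(k < n) a k * z ^+ k)
   - (\sum_(k < n + K) a k * z ^+ k - f z) by ring.
apply: le_trans (modcB _ _) _; rewrite addrC lerD //.
  by apply/ltW/HK; rewrite leq_addl.
apply: le_trans (psum_cauchy n K s0 M0 HM zs) _; apply: le_trans (ltW HN).
have zq : modc z / s <= q by rewrite ler_wpM2r // invr_ge0 ltW.
have zq0 : 0 <= modc z / s by rewrite divr_ge0 ?modc_ge0 // ltW.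
have A : (modc z / s) ^+ n <= q ^+ N.
  apply: (@le_trans _ _ (q ^+ n)); first by rewrite lerXn2r ?nnegrE.
  by apply: ler_wiXn2l => //; rewrite ltW.
have B : (1 - modc z / s)^-1 <= (1 - q)^-1.
  by rewrite lef_pV2 ?posrE ?subr_gt0 // ?lerD2l ?lerN2 // (le_lt_trans zq).
rewrite -mulrA [leRHS]mulrAC -[leRHS]mulrA ler_wpM2l // ler_pM ?exprn_ge0 //.
by rewrite invr_ge0 subr_ge0 (le_trans zq) // ltW.
Qed.

Lemma analytic_approx f : analytic_disc f -> approx f.
Proof.
move=> [a Ha] r r0 r1 e e0; have [N HN] := psum_unif (ltW r0) r1 Ha e0.
exists (\poly_(k < N) a k) => z /(HN _ (leqnn N)).
by rewrite (horner_coef_wide _ (size_poly _ _)); under [X in _ -> modc (_ - X) <= _]eq_bigr do rewrite coef_poly ltn_ord.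
Qed.

(** The Taylor coefficients are ultralimits of the coefficients of polynomials approximating f on
    the disc of radius 1/2. Cauchy's estimate then compares them with the coefficients of any
    polynomial close to f on a larger disc. *)
Lemma approx_analytic f : approx f -> analytic_disc f.
Proof.
move=> Af; have [U [uU fU]] := free_ultrafilter.
have h1 : 0 < 2^-1 :> R by rewrite invr_gt0.
have h2 : 2^-1 < 1 :> R by rewrite invf_lt1 // ltr1n.
have /choice[P HP] : forall j : nat, exists p, forall z, modc z <= 2^-1 -> modc (f z - p.[z]) <= j.+1%:R^-1.
  by move=> j; apply: Af.
have dif p q r d d' k : 0 <= r -> (forall z, modc z <= r -> modc (f z - p.[z]) <= d) ->
   (forall z, modc z <= r -> modc (f z - q.[z]) <= d') -> modc (p`_k - q`_k) * r ^+ k <= d + d'.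
  move=> r0 Hp Hq; rewrite -coefB; apply: cauchy_poly => // z zr.
  have -> : (p - q).[z] = (f z - q.[z]) - (f z - p.[z]) by rewrite hornerD hornerN; ring.
  by apply: le_trans (modcB _ _) _; rewrite addrC lerD ?Hp ?Hq.
have /choice[a Ha] : forall k : nat, exists l, forall e, 0 < e -> U [set n | modc ((P n)`_k - l) < e].
  move=> k; apply: (bounded_ulim uU (B := modc (P 0%N)`_k + 2 / (2^-1) ^+ k)) => n.
  have -> : (P n)`_k = (P 0%N)`_k + ((P n)`_k - (P 0%N)`_k) by ring.
  apply: le_trans (modcD _ _) _; rewrite lerD2l ler_pdivlMr ?exprn_gt0 //.
  apply: le_trans (dif _ _ _ _ _ _ (ltW h1) (HP n) (HP 0%N)) _.
  by rewrite -[2]/(1 + 1) lerD // ?invf_le1 // ler1n.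
(* The polynomials defining [a] are close to f only on radius 1/2, so the first comparison is made
   at the smaller of r and 1/2. *)
have smalla p r d k : 0 < r -> r < 1 -> (forall z, modc z <= r -> modc (f z - p.[z]) <= d) ->
   modc (p`_k - a k) * Num.min r 2^-1 ^+ k <= d.
  move=> r0 r1 Hp; set m := Num.min r 2^-1.
  have m0 : 0 < m by rewrite lt_min r0.
  have m1 : m <= 1 by rewrite ge_min ltW.
  apply/ler_addgt0Pr => e e0; have e2 : 0 < e / 2 by rewrite divr_gt0.
  pose N := Num.truncn (e / 2)^-1.
  have [n [Nn /= Pn]] := ultra_ex uU fU N (Ha k _ e2).
  have ne : n.+1%:R^-1 <= e / 2.
    rewrite invf_ple ?posrE // ltW // (lt_le_trans (truncnS_gt _)) // ler_nat ltnS.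
    exact: Nn.
  have h3 := dif p (P n) m d _ k (ltW m0) _ _.
  have -> : p`_k - a k = (p`_k - (P n)`_k) + ((P n)`_k - a k) by ring.
  apply: (@le_trans _ _ (modc (p`_k - (P n)`_k) * m ^+ k + modc ((P n)`_k - a k) * m ^+ k)).
    by rewrite -mulrDl ler_wpM2r ?modcD // exprn_ge0 // ltW.
  rewrite [e]splitr addrA; apply: lerD; last first.
    apply: le_trans (ltW Pn); rewrite ler_piMr ?modc_ge0 // exprn_ile1 // ltW //.
  apply: le_trans (h3 _ _ _) _; last first.
  - by rewrite lerD2l; exact: ne.
  - by move=> z zm; apply: HP; apply: le_trans zm _; rewrite ge_min lexx orbT.
  - by move=> z zm; apply: Hp; apply: le_trans zm _; rewrite ge_min lexx.
(* Back to the full radius r: p is compared with an auxiliary q so close to f that the loss m^k in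
   [smalla] is already paid for, which forces the k-th coefficient of q within e/2 of [a k]. *)
have biga p r d k : 0 < r -> r < 1 -> (forall z, modc z <= r -> modc (f z - p.[z]) <= d) ->
   modc (p`_k - a k) * r ^+ k <= d.
  move=> r0 r1 Hp; set m := Num.min r 2^-1.
  have m0 : 0 < m by rewrite lt_min r0.
  apply/ler_addgt0Pr => e e0.
  pose d' := Num.min (e / 2) (e / 2 * m ^+ k).
  have d'0 : 0 < d' by rewrite lt_min divr_gt0 // mulr_gt0 ?divr_gt0 // exprn_gt0.
  have [q Hq] := Af r r0 r1 _ d'0.
  have h3 := dif p q r d d' k (ltW r0) Hp Hq.
  have h4 := smalla q r d' k r0 r1 Hq.
  have h5 : modc (q`_k - a k) * r ^+ k <= e / 2.
    apply: (@le_trans _ _ (modc (q`_k - a k))).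
      by rewrite ler_piMr ?modc_ge0 // exprn_ile1 // ltW.
    rewrite -(ler_pM2r (exprn_gt0 k m0)); apply: le_trans h4 _.
    by rewrite ge_min lexx orbT.
  have -> : p`_k - a k = (p`_k - q`_k) + (q`_k - a k) by ring.
  apply: (@le_trans _ _ (modc (p`_k - q`_k) * r ^+ k + modc (q`_k - a k) * r ^+ k)).
    by rewrite -mulrDl ler_wpM2r ?modcD // exprn_ge0 // ltW.
  have d'e : d' <= e / 2 by rewrite ge_min lexx.
  lra.
exists a => z z1; apply/cvgCP => e e0.
pose r := (modc z + 1) / 2.
have zr : modc z < r by rewrite /r; lra.
have r1 : r < 1 by rewrite /r; lra.
have r0 : 0 < r by apply: le_lt_trans (modc_ge0 z) zr.
pose q := modc z / r.
have q0 : 0 <= q by rewrite divr_ge0 ?modc_ge0 // ltW.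
have q1 : q < 1 by rewrite ltr_pdivrMr // mul1r.
have q1' : 0 < 1 - q by rewrite subr_gt0.
pose d := e / 2 / (1 + (1 - q)^-1).
have dd : 0 < 1 + (1 - q)^-1 by rewrite addr_gt0 ?invr_gt0.
have d0 : 0 < d by rewrite !divr_gt0.
have [p Hp] := Af r r0 r1 _ d0.
exists (size p) => n pn; rewrite modcBC.
have -> : f z - \sum_(k < n) a k * z ^+ k = (f z - p.[z]) + \sum_(k < n) (p`_k - a k) * z ^+ k.
  have -> : \sum_(k < n) (p`_k - a k) * z ^+ k = p.[z] - \sum_(k < n) a k * z ^+ k.
    by rewrite (horner_coef_wide _ pn) -sumrB; apply: eq_bigr => k _; ring.
  by ring.
apply: le_lt_trans (modcD _ _) _.
apply: (@le_lt_trans _ _ (d + d * (1 - q)^-1)); last first.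
  by rewrite -{1}[d]mulr1 -mulrDr /d divfK ?gt_eqF //; lra.
apply: lerD; first by apply/Hp/ltW.
apply: le_trans (modc_sum _ _ _) _.
apply: (@le_trans _ _ (\sum_(k < n) d * q ^+ k)); last first.
  by rewrite -mulr_sumr ler_wpM2l ?geom_sum_le // ltW.
apply: ler_sum => k _; rewrite modcM modcX /q expr_div_n mulrA ler_pdivlMr ?exprn_gt0 //.
by rewrite mulrAC ler_wpM2r ?exprn_ge0 ?modc_ge0 // biga.
Qed.

Lemma approx_ucont f r : approx f -> 0 < r -> r < 1 -> forall e, 0 < e ->
  exists d, 0 < d /\ forall z w, modc z <= r -> modc w <= r -> modc (z - w) < d ->
    modc (f z - f w) < e.
Proof.
move=> Af r0 r1 e e0; have e4 : 0 < e / 4 by rewrite divr_gt0.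
have [p Hp] := Af r r0 r1 _ e4; have [L [L0 HL]] := poly_lipschitz p.
exists (e / 4 / (1 + L)); split; first by rewrite divr_gt0 // ltr_wpDr.
move=> z w zr wr zw; have r1' := ltW r1.
have -> : f z - f w = (f z - p.[z]) + (p.[z] - p.[w]) - (f w - p.[w]) by ring.
apply: le_lt_trans (modcB _ _) _; have := modcD (f z - p.[z]) (p.[z] - p.[w]).
have := Hp _ zr; have := Hp _ wr.
have := HL z w (le_trans zr r1') (le_trans wr r1').
have : L * modc (z - w) <= e / 4.
  apply: (@le_trans _ _ ((1 + L) * modc (z - w))).
    by rewrite ler_wpM2r ?modc_ge0 // lerDr.
  by move: zw; rewrite ltr_pdivlMr ?ltr_wpDr // mulrC => /ltW.
lra.
Qed.

Lemma approx_cont f z : approx f -> modc z < 1 -> forall e, 0 < e ->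
  exists d, 0 < d /\ forall w, modc (w - z) < d -> modc w < 1 /\ modc (f w - f z) < e.
Proof.
move=> Af z1 e e0; pose r := (modc z + 1) / 2.
have zr : modc z < r by rewrite /r; lra.
have r1 : r < 1 by rewrite /r; lra.
have r0 : 0 < r by apply: le_lt_trans (modc_ge0 z) zr.
have [d [d0 Hd]] := approx_ucont Af r0 r1 e0.
exists (Num.min d (r - modc z)); split; first by rewrite lt_min d0 subr_gt0.
move=> w; rewrite lt_min => /andP[wd wr].
have wr' : modc w <= r.
  by apply: ltW; rewrite -(ltrD2r (- modc z)); apply: le_lt_trans wr; exact: modc_distr.
by split; [apply: le_lt_trans r1|apply: Hd => //; rewrite ltW].
Qed.

(** Compactness in ultralimit form: points at which |phi| approaches 1 would have an ultralimit l
    with |l| <= r, and continuity at l contradicts |phi l| < 1. *)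
Lemma self_map_sup phi r : approx phi -> (forall z, modc z < 1 -> modc (phi z) < 1) ->
  0 < r -> r < 1 -> exists s, [/\ 0 < s, s < 1 & forall z, modc z <= r -> modc (phi z) <= s].
Proof.
move=> Aphi sm r0 r1; apply: contrapT => H.
have /choice[z Hz] : forall n : nat, exists z, modc z <= r /\ 1 - n.+2%:R^-1 < modc (phi z).
  move=> n; apply: contrapT => Hn; apply: H; exists (1 - n.+2%:R^-1); split.
  - by rewrite subr_gt0 invf_lt1 // ltr1n.
  - by rewrite gtrBl invr_gt0.
  - by move=> z zr; rewrite leNgt; apply/negP => h; apply: Hn; exists z.
have [U [uU fU]] := free_ultrafilter.
have [l Hl] := bounded_ulim uU (fun n => (Hz n).1).
have l1 : modc l <= r.
  apply/ler_addgt0Pr => e e0; have [n [_ /= hn]] := ultra_ex uU fU 0%N (Hl _ e0).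
  have := modc_distr l (z n); rewrite modcBC; have := (Hz n).1; lra.
have pl := sm l (le_lt_trans l1 r1).
have e0 : 0 < (1 - modc (phi l)) / 2 by rewrite divr_gt0 // subr_gt0.
have [d [d0 Hd]] := approx_cont Aphi (le_lt_trans l1 r1) e0.
have [n [Nn /= hn]] := ultra_ex uU fU (Num.truncn ((1 - modc (phi l)) / 2)^-1) (Hl _ d0).
have [_ h1] := Hd _ hn.
have h2 : n.+2%:R^-1 <= (1 - modc (phi l)) / 2.
  rewrite invf_ple ?posrE // ltW // (lt_le_trans (truncnS_gt _)) // ler_nat ltnS.
  exact: leqW.
have h3 := (Hz n).2; have h4 := modc_distr (phi (z n)) (phi l).
have h5 := le_lt_trans h4 h1.
have h6 : 1 - (1 - modc (phi l)) / 2 < modc (phi (z n)) by apply: le_lt_trans h3; rewrite lerD2l lerN2.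
lra.
Qed.

Lemma approx_comp f phi : approx f -> approx phi ->
  (forall z, modc z < 1 -> modc (phi z) < 1) -> approx (f \o phi).
Proof.
move=> Af Aphi sm r r0 r1 e e0.
have [s [s0 s1 Hs]] := self_map_sup Aphi sm r0 r1.
have e2 : 0 < e / 2 by rewrite divr_gt0.
have [p Hp] := Af s s0 s1 _ e2.
have [L [L0 HL]] := poly_lipschitz p.
(* The bound 1 - s keeps the values of q in the closed unit disc, where p has Lipschitz constant
   L. *)
pose d := Num.min (1 - s) (e / 2 / (1 + L)).
have d0 : 0 < d by rewrite lt_min subr_gt0 s1 /= divr_gt0 // ltr_wpDr.
have [q Hq] := Aphi r r0 r1 _ d0.
exists (p \Po q) => z zr; rewrite horner_comp /=.
have -> : f (phi z) - p.[q.[z]] = (f (phi z) - p.[phi z]) + (p.[phi z] - p.[q.[z]]) by ring.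
apply: le_trans (modcD _ _) _; rewrite [e]splitr lerD // ?Hp ?Hs //.
have h1 := Hs z zr.
have h2 := Hq z zr; have h3 := modc_distr q.[z] (phi z).
have ds : d <= 1 - s by rewrite ge_min lexx.
apply: le_trans (HL _ _ _ _) _; [lra|rewrite modcBC in h3; lra|].
have : d <= e / 2 / (1 + L) by rewrite ge_min lexx orbT.
rewrite ler_pdivlMr ?ltr_wpDr // mulrC => /(le_trans _); apply.
by apply: ler_pM; rewrite ?modc_ge0 // lerDr.
Qed.

Lemma approxD f g : approx f -> approx g -> approx (f \+ g).
Proof.
move=> Af Ag r r0 r1 e e0; have e2 : 0 < e / 2 by rewrite divr_gt0.
have [p Hp] := Af r r0 r1 _ e2; have [q Hq] := Ag r r0 r1 _ e2.
exists (p + q) => z zr; rewrite hornerD /=.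
have -> : f z + g z - (p.[z] + q.[z]) = (f z - p.[z]) + (g z - q.[z]) by ring.
by apply: le_trans (modcD _ _) _; rewrite [e]splitr lerD ?Hp ?Hq.
Qed.

Lemma approxZ c f : approx f -> approx (fun z => c * f z).
Proof.
move=> Af r r0 r1 e e0; have c1 : 0 < 1 + modc c by rewrite ltr_wpDr ?modc_ge0.
have [p Hp] := Af r r0 r1 _ (divr_gt0 e0 c1).
exists (c *: p) => z zr; rewrite hornerZ -mulrBr modcM.
have := Hp z zr; rewrite ler_pdivlMr // mulrC; apply: le_trans.
by rewrite ler_wpM2r ?modc_ge0 // lerDr.
Qed.

Lemma approx_lim (F : nat -> C -> C) f : (forall n, approx (F n)) ->
  (forall r, 0 < r -> r < 1 -> forall e, 0 < e ->
     exists n, forall z, modc z <= r -> modc (f z - F n z) <= e) -> approx f.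
Proof.
move=> AF H r r0 r1 e e0; have e2 : 0 < e / 2 by rewrite divr_gt0.
have [n Hn] := H r r0 r1 _ e2; have [p Hp] := AF n r r0 r1 _ e2.
exists p => z zr.
have -> : f z - p.[z] = (f z - F n z) + (F n z - p.[z]) by ring.
by apply: le_trans (modcD _ _) _; rewrite [e]splitr lerD ?Hp ?Hn.
Qed.

Lemma approx_dilate f s : 0 <= s -> s < 1 -> approx f -> approx (fun z => f ((s%:C)%C * z)).
Proof.
move=> s0 s1 Af r r0 r1 e e0.
have [p Hp] := Af r r0 r1 _ e0; exists (p \Po ((s%:C)%C *: 'X)) => z zr.
rewrite horner_comp hornerZ hornerX; apply: Hp.
rewrite modcM modc_real ger0_norm //; apply: le_trans zr.
by rewrite ler_piMl ?modc_ge0 // ltW.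
Qed.

Lemma cont_expi t e : 0 < e -> \forall s \near t, modc (expi s - expi t) < e.
Proof.
move=> e0; have e2 : 0 < e / 2 by rewrite divr_gt0.
have /cvgrPdist_lt/(_ _ e2) := @continuous_cos R t.
have /cvgrPdist_lt/(_ _ e2) := @continuous_sin R t.
apply: filterS2 => s h1 h2; apply: le_lt_trans (modc_le_ReIm _) _.
by rewrite /= addrC [e]splitr [`|cos _ - _|]distrC [`|sin _ - _|]distrC ltrD.
Qed.

Lemma circle_near f r t e : approx f -> 0 <= r -> r < 1 -> 0 < e ->
  \forall s \near t, modc (f ((r%:C)%C * expi s) - f ((r%:C)%C * expi t)) < e.
Proof.
move=> Af r0 r1 e0.
have z1 : modc ((r%:C)%C * expi t) < 1 by rewrite modc_polar.
have [d [d0 Hd]] := approx_cont Af z1 e0.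
apply: filterS (cont_expi t d0) => s hs.
apply: (Hd _ _).2; rewrite -mulrBr modcM modc_real ger0_norm //.
by apply: le_lt_trans hs; rewrite ler_piMl ?modc_ge0 // ltW.
Qed.

Lemma cont_circle_Re f r : approx f -> 0 <= r -> r < 1 ->
  continuous (fun t => complex.Re (f ((r%:C)%C * expi t))).
Proof.
move=> Af r0 r1 t; apply/cvgrPdist_lt => e e0.
apply: filterS (circle_near t Af r0 r1 e0) => s; apply: le_lt_trans.
by rewrite distrC -Re_opp -Re_add normRe_le.
Qed.

Lemma cont_circle_Im f r : approx f -> 0 <= r -> r < 1 ->
  continuous (fun t => complex.Im (f ((r%:C)%C * expi t))).
Proof.
move=> Af r0 r1 t; apply/cvgrPdist_lt => e e0.
apply: filterS (circle_near t Af r0 r1 e0) => s; apply: le_lt_trans.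
by rewrite distrC -Im_opp -Im_add normIm_le.
Qed.

Lemma cont_circle_mod f r : approx f -> 0 <= r -> r < 1 ->
  continuous (fun t => modc (f ((r%:C)%C * expi t))).
Proof.
move=> Af r0 r1 t; apply/cvgrPdist_lt => e e0.
apply: filterS (circle_near t Af r0 r1 e0) => s; apply: le_lt_trans.
by rewrite distrC modc_dist.
Qed.

End PolynomialApproximation.

(** * Parseval's identity and the Poisson formula on circles inside the disc *)

Section PoissonParseval.
Variable R : realType.
Local Notation C := R[i].
Implicit Types (f g h : C -> C) (p q : {poly C}) (z w : C) (b r e t : R).

Lemma cont_trig_Re n (c : nat -> C) :
  continuous (fun t => complex.Re (\sum_(k < n) c k * expi (k%:R * t))).
Proof.
rewrite (_ : (fun _ => _) = fun t => \sum_(k < n) harm (c k) k t).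
  by apply: (cont_sum (F := fun k => harm (c k) k)) => k; exact: cont_harm.
by apply/funext => t; rewrite Re_sum.
Qed.

Lemma Im_ReNi z : complex.Im z = complex.Re (- 'i%C * z).
Proof. by case: z => ? ? /=; ring. Qed.

Lemma cont_trig_Im n (c : nat -> C) :
  continuous (fun t => complex.Im (\sum_(k < n) c k * expi (k%:R * t))).
Proof.
rewrite (_ : (fun _ => _) = fun t => complex.Re (\sum_(k < n) (- 'i%C * c k) * expi (k%:R * t))).
  exact: (@cont_trig_Re n (fun k => - 'i%C * c k)).
by apply/funext => t; rewrite Im_ReNi mulr_sumr; under eq_bigr do rewrite mulrA.
Qed.

Lemma cont_modsq (h : R -> C) : continuous (fun t => complex.Re (h t)) ->
  continuous (fun t => complex.Im (h t)) -> continuous (fun t => modc (h t) ^+ 2).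
Proof.
move=> c1 c2; rewrite (_ : (fun _ => _) = fun t => complex.Re (h t) ^+ 2 + complex.Im (h t) ^+ 2).
  by apply: contD; exact: contX.
by apply/funext => t; rewrite modc_sqr.
Qed.

(** Uniform closeness d <= 1 to the partial sums changes the square modulus by at most d (2B + 1), B
    being a bound for |h|, so the finite identity passes to the limit. *)
Lemma parseval_unif b (c : nat -> C) (h : R -> C) :
  continuous (fun t => complex.Re (h t)) -> continuous (fun t => complex.Im (h t)) ->
  (forall e, 0 < e -> exists N, forall n, (N <= n)%N -> forall t,
     modc (h t - \sum_(k < n) c k * expi (k%:R * t)) <= e) ->
  forall e, 0 < e -> exists N, forall n, (N <= n)%N ->
    `|per b (fun t => modc (h t) ^+ 2) - 2 * pi * \sum_(k < n) modc (c k) ^+ 2| <= e.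
Proof.
move=> c1 c2 H e e0; have p0 := twopi_gt0 R.
have [N0 H0] := H 1 ltr01.
pose B := 1 + \sum_(k < N0) modc (c k).
have hB t : modc (h t) <= B.
  have -> : h t = (h t - \sum_(k < N0) c k * expi (k%:R * t)) + \sum_(k < N0) c k * expi (k%:R * t) by ring.
  apply: le_trans (modcD _ _) _; rewrite lerD ?H0 //.
  apply: le_trans (modc_sum _ _ _) _; apply: ler_sum => k _.
  by rewrite modcM modc_expi mulr1.
have B0 : 0 < B by rewrite ltr_pwDl // sumr_ge0 // => k _; exact: modc_ge0.
pose d := Num.min 1 (e / (2 * pi * (2 * B + 1))).
have d0 : 0 < d by rewrite lt_min ltr01 /= divr_gt0 // mulr_gt0 // addr_gt0 // mulr_gt0.
have [N HN] := H d d0; exists N => n Nn.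
rewrite -(parseval_finite b) -perB; last 2 first.
- exact: cont_modsq.
- by apply: cont_modsq; [exact: cont_trig_Re|exact: cont_trig_Im].
have d1 : d <= 1 by rewrite ge_min lexx.
have de : d * (2 * pi * (2 * B + 1)) <= e.
  by rewrite -ler_pdivlMr ?ge_min ?lexx ?orbT // mulr_gt0 // addr_gt0 // mulr_gt0.
apply: le_trans (per_bound b (c := d * (2 * B + 1)) _ _) _; last by rewrite mulrCA.
  by apply: contB; apply: cont_modsq => //; [exact: cont_trig_Re|exact: cont_trig_Im].
move=> t; set S := \sum_(k < n) _; have hS := HN n Nn t; rewrite -/S in hS.
rewrite subr_sqr normrM ler_pM //.
  by apply: le_trans (modc_dist _ _) hS.
rewrite ger0_norm ?addr_ge0 ?modc_ge0 //.
have h1 := hB t; have := modc_distr S (h t); rewrite modcBC; lra.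
Qed.

Lemma modc1B_sqr w : modc (1 - w) ^+ 2 = 1 + modc w ^+ 2 - 2 * complex.Re w.
Proof. by rewrite !modc_sqr; case: w => ? ? /=; ring. Qed.

(* the Poisson kernel of z at e^{it} *)
Definition pk z t : R := (1 - modc z ^+ 2) / modc (1 - (z^*)%C * expi t) ^+ 2.

Lemma modc_conj_expi z t : modc ((z^*)%C * expi t) = modc z.
Proof. by rewrite modcM modc_conj modc_expi mulr1. Qed.

Lemma pk_den_ge z t : 1 - modc z <= modc (1 - (z^*)%C * expi t).
Proof. by have := modc_distr 1 ((z^*)%C * expi t); rewrite modc1 modc_conj_expi. Qed.

Lemma pk_den_gt0 z t : modc z < 1 -> 0 < modc (1 - (z^*)%C * expi t).
Proof. by move=> z1; apply: lt_le_trans (pk_den_ge z t); rewrite subr_gt0. Qed.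

Lemma pk_ge0 z t : modc z < 1 -> 0 <= pk z t.
Proof.
move=> z1; rewrite divr_ge0 ?sqr_ge0 // subr_ge0.
by rewrite exprn_ile1 ?modc_ge0 // ltW.
Qed.

Lemma pk_le z t : modc z < 1 -> pk z t <= 2 / (1 - modc z).
Proof.
move=> z1; have z0 := modc_ge0 z; have h := pk_den_ge z t.
have z1' : 0 < 1 - modc z by rewrite subr_gt0.
have h0 := pk_den_gt0 t z1.
rewrite ler_pdivrMr ?exprn_gt0 // mulrAC ler_pdivlMr //.
rewrite (_ : 1 - modc z ^+ 2 = (1 - modc z) * (1 + modc z)); last by ring.
have : (1 - modc z) ^+ 2 <= modc (1 - (z^*)%C * expi t) ^+ 2 by rewrite lerXn2r ?nnegrE // ltW.
have : 0 <= (1 - modc z) ^+ 2 by exact: sqr_ge0.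
nra.
Qed.

Lemma pk_cont z : modc z < 1 -> continuous (pk z).
Proof.
move=> z1; apply: contM; first exact: cont_cst.
apply: cont_inv; last by move=> t; rewrite gt_eqF // exprn_gt0 // pk_den_gt0.
rewrite (_ : (fun _ => _) = fun t => 1 + modc z ^+ 2 - 2 * harm (z^*)%C 1 t).
  by apply: contB; [exact: cont_cst|apply: contM; [exact: cont_cst|exact: cont_harm]].
by apply/funext => t; rewrite modc1B_sqr modc_conj_expi /harm mul1r.
Qed.

Lemma Re_div z w : complex.Re (z / w) = complex.Re (z * (w^*)%C) / modc w ^+ 2.
Proof.
have [->|w0] := eqVneq w 0; first by rewrite invr0 mulr0 modc0 expr0n /= invr0 mulr0.
have : modc w ^+ 2 != 0 by rewrite expf_neq0 // modc_eq0.
rewrite modc_sqr; case: z w {w0} => a1 b1 [a2 b2] /= h; field.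
exact: h.
Qed.

(** The kernel is the real part of (1 + w)/(1 - w) with w = conj(z) e^{it}; the expansion 1 + 2(w +
    w^2 + ...) has a geometric remainder. *)
Lemma pk_partial N z t : modc z < 1 ->
  `|pk z t - \sum_(j < N.+1) (if j == 0%N :> nat then 1 else 2) * harm ((z^*)%C ^+ j) j t|
     <= 2 * modc z ^+ N.+1 / (1 - modc z).
Proof.
move=> z1; pose w := (z^*)%C * expi t.
have mw : modc w = modc z by rewrite modc_conj_expi.
have w1 : 1 - w != 0 by rewrite -modc_eq0 gt_eqF // pk_den_gt0.
have Ew j : harm ((z^*)%C ^+ j) j t = complex.Re (w ^+ j) by rewrite /harm /w exprMn expiX.
have -> : \sum_(j < N.+1) (if j == 0%N :> nat then 1 else 2) * harm ((z^*)%C ^+ j) j t =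
   complex.Re (1 + 2%:R * \sum_(j < N) w ^+ j.+1).
  rewrite big_ord_recl /= Ew expr0 mul1r Re_add; congr (_ + _).
  rewrite mulr_sumr Re_sum; apply: eq_bigr => j _; rewrite Ew.
  by case: (w ^+ _) => ? ? /=; ring.
have -> : pk z t = complex.Re ((1 + w) / (1 - w)).
  rewrite Re_div /pk -/w; congr (_ / _); rewrite -mw modc_sqr.
  by case: (w) => ? ? /=; ring.
have E : (1 + w) / (1 - w) - (1 + 2%:R * \sum_(j < N) w ^+ j.+1) = 2%:R * w ^+ N.+1 / (1 - w).
  have -> : \sum_(j < N) w ^+ j.+1 = (w - w ^+ N.+1) / (1 - w).
    have -> : \sum_(j < N) w ^+ j.+1 = w * \sum_(j < N) w ^+ j.
      by rewrite mulr_sumr; apply: eq_bigr => j _; rewrite exprS.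
    apply: (mulIf w1); rewrite divfK // -mulrA [X in w * X]mulrC -opprB mulNr -subrX1 opprB.
    by rewrite mulrBr mulr1 exprS.
  by field.
rewrite -Re_opp -Re_add E; apply: le_trans (normRe_le _) _.
rewrite !modcM modcV modcX mw.
have -> : modc (2%:R : C) = 2.
  have -> : (2%:R : C) = ((2 : R)%:C)%C by rewrite -[2 : R]/(1 + 1) realcD.
  by rewrite modc_real ger0_norm.
rewrite ler_wpM2l ?mulr_ge0 ?exprn_ge0 ?modc_ge0 //.
by rewrite lef_pV2 ?posrE ?subr_gt0 ?pk_den_gt0 // pk_den_ge.
Qed.

(** The kernel is replaced by a partial sum of order N >= n, and orthogonality keeps only equal
    frequencies. The weights 1 and 2 of the kernel match the fact that both terms of [per_harmM]
    contribute exactly at frequency 0. *)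
Lemma poisson_finite b n (c : nat -> C) z : modc z < 1 ->
  per b (fun t => pk z t * complex.Re (\sum_(k < n) c k * expi (k%:R * t))) =
  2 * pi * complex.Re (\sum_(k < n) c k * z ^+ k).
Proof.
move=> z1; have p0 := twopi_gt0 R; have z1' : 0 < 1 - modc z by rewrite subr_gt0.
apply/eqP; rewrite -subr_eq0 -normr_eq0 eq_le normr_ge0 andbT.
apply/ler_addgt0Pr => e e0; rewrite add0r.
pose B := \sum_(k < n) modc (c k).
have B0 : 0 <= B by apply: sumr_ge0 => k _; exact: modc_ge0.
pose P t := complex.Re (\sum_(k < n) c k * expi (k%:R * t)).
have PB t : `|P t| <= B.
  apply: le_trans (normRe_le _) _; apply: le_trans (modc_sum _ _ _) _.
  by apply: ler_sum => k _; rewrite modcM modc_expi mulr1.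
have [N0 HN0] := @expr_small _ (modc z) (2 / (1 - modc z) * B * (2 * pi)) e (modc_ge0 z) z1 e0.
pose N := maxn N0 n.
pose Q t := \sum_(j < N.+1) (if j == 0%N :> nat then 1 else 2) * harm ((z^*)%C ^+ j) j t.
have cP : continuous P by exact: cont_trig_Re.
have cQ : continuous Q.
  apply: (cont_sum (F := fun j t => (if j == 0%N then 1 else 2) * harm ((z^*)%C ^+ j) j t)) => k.
  by apply: contM; [exact: cont_cst|exact: cont_harm].
have cpk := pk_cont z1.
have main : per b (fun t => Q t * P t) = 2 * pi * complex.Re (\sum_(k < n) c k * z ^+ k).
  transitivity (per b (fun t => \sum_(k < n) \sum_(j < N.+1)
      (if j == 0%N :> nat then 1 else 2) * (harm ((z^*)%C ^+ j) j t * harm (c k) k t))).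
    apply: eq_per => t; rewrite /P Re_sum mulr_sumr; apply: eq_bigr => k _.
    by rewrite mulr_suml; apply: eq_bigr => j _; rewrite mulrA.
  rewrite (per_sum b n (F := fun k t => \sum_(j < N.+1)
      (if j == 0%N :> nat then 1 else 2) * (harm ((z^*)%C ^+ j) j t * harm (c k) k t))); last first.
    move=> k; apply: (cont_sum (F := fun j t => (if j == 0%N then 1 else 2) * (harm ((z^*)%C ^+ j) j t * harm (c k) k t))) => j.
    by apply: contM; [exact: cont_cst|apply: contM; exact: cont_harm].
  rewrite Re_sum mulr_sumr; apply: eq_bigr => -[k kn] _ /=.
  rewrite (per_sum b N.+1 (F := fun j t => (if j == 0%N then 1 else 2) * (harm ((z^*)%C ^+ j) j t * harm (c k) k t))); last first.
    by move=> j; apply: contM; [exact: cont_cst|apply: contM; exact: cont_harm].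
  have kN : (k < N.+1)%N by rewrite ltnS (leq_trans (ltnW kn)) // leq_maxr.
  rewrite (bigD1 (Ordinal kN)) //= big1 ?addr0; last first.
    move=> [j jN] /= jk; rewrite perZ; last by apply: contM; exact: cont_harm.
    have {}jk : (j == k) = false by apply: contra_neqF jk => /eqP jk; apply: val_inj.
    have jk0 : (j + k == 0)%N = false.
      by apply: contraFF jk; rewrite addn_eq0 => /andP[/eqP -> /eqP ->].
    by rewrite per_harmM jk jk0 addr0 !mulr0.
  rewrite perZ; last by apply: contM; exact: cont_harm.
  rewrite per_harmM eqxx addn_eq0 andbb.
  have Ek : complex.Re ((z^*)%C ^+ k * (c k)^*%C) = complex.Re (c k * z ^+ k).
    have -> : (z^*)%C ^+ k = ((z ^+ k)^*)%C by rewrite rmorphXn.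
    by case: (z ^+ k) (c k) => ? ? [? ?] /=; ring.
  rewrite Ek; case: eqP => [->|_]; last by ring.
  by rewrite !expr0 [1 * c 0%N]mul1r [c 0%N * 1]mulr1; ring.
rewrite -main -perB; last 2 first; [exact: contM|exact: contM|].
apply: le_trans (per_bound b (c := 2 * modc z ^+ N.+1 / (1 - modc z) * B) _ _) _.
- by apply: contB; exact: contM.
- move=> t; rewrite -mulrBl normrM ler_pM ?PB //; exact: pk_partial.
apply: le_trans (ltW HN0).
have hN : modc z ^+ N.+1 <= modc z ^+ N0.
  by apply: ler_wiXn2l; rewrite ?modc_ge0 ?(ltW z1) // leqW // leq_maxl.
move: hN; set Y := modc z ^+ N.+1; set D := (1 - modc z)^-1 => hN.
rewrite [leLHS](_ : _ = 2 * D * B * (2 * pi) * Y); last by ring.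
by rewrite ler_wpM2l // !mulr_ge0 ?invr_ge0 ?(ltW z1') ?(ltW (pi_gt0 R)).
Qed.

Lemma per_pk b z : modc z < 1 -> per b (pk z) = 2 * pi.
Proof.
move=> z1; have := @poisson_finite b 1 (fun=> 1) z z1.
rewrite big_ord1 expr0 mulr1 /= mulr1 => <-; apply: eq_per => t.
by rewrite big_ord1 mul0r expi0 mulr1 /= mulr1.
Qed.

Lemma poisson_analytic b f r z : approx f -> 0 <= r -> r < 1 -> modc z < 1 ->
  per b (fun t => pk z t * complex.Re (f ((r%:C)%C * expi t))) =
  2 * pi * complex.Re (f ((r%:C)%C * z)).
Proof.
move=> Af r0 r1 z1; have p0 := twopi_gt0 R; have cpk := pk_cont z1.
have cf := cont_circle_Re Af r0 r1.
apply/eqP; rewrite -subr_eq0 -normr_eq0 eq_le normr_ge0 andbT.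
apply/ler_addgt0Pr => e e0; rewrite add0r.
(* [approx] is stated for positive radii, and r may be 0. *)
pose s := Num.max r 2^-1.
have s0 : 0 < s by rewrite lt_max invr_gt0 ltr0n orbT.
have s1 : s < 1 by rewrite gt_max r1 /= invf_lt1 // ltr1n.
have rs : r <= s by rewrite le_max lexx.
pose d := e / (2 * (2 * pi)).
have d0 : 0 < d by rewrite divr_gt0 // mulr_gt0.
have [p Hp] := Af s s0 s1 d d0.
pose c k := p`_k * ((r ^+ k)%:C)%C.
have h1 := @poisson_finite b (size p) c z z1.
have E1 t : \sum_(k < size p) c k * expi (k%:R * t) = p.[(r%:C)%C * expi t].
  by rewrite (@horner_polar _ _ (size p)).
have E2 : \sum_(k < size p) c k * z ^+ k = p.[(r%:C)%C * z].
  by rewrite horner_coef; apply: eq_bigr => k _; rewrite exprMn -realcX mulrA.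
rewrite E2 in h1.
have cp : continuous (fun t => complex.Re (\sum_(k < size p) c k * expi (k%:R * t))) by exact: cont_trig_Re.
have h2 : `|2 * pi * complex.Re (f ((r%:C)%C * z)) - 2 * pi * complex.Re p.[(r%:C)%C * z]| <= 2 * pi * d.
  rewrite -mulrBr normrM gtr0_norm // ler_wpM2l ?(ltW p0) // -Re_opp -Re_add.
  apply: le_trans (normRe_le _) (Hp _ _); rewrite modcM modc_real ger0_norm //.
  by rewrite (le_trans _ rs) // ler_piMr // ltW.
have h3 : `|per b (fun t => pk z t * complex.Re (f ((r%:C)%C * expi t))) - 2 * pi * complex.Re p.[(r%:C)%C * z]| <= 2 * pi * d.
  rewrite -h1 -perB; [|exact: contM|exact: contM].
  have cd : continuous (fun t => pk z t * complex.Re (f ((r%:C)%C * expi t)) -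
     pk z t * complex.Re (\sum_(k < size p) c k * expi (k%:R * t))) by apply: contB; exact: contM.
  apply: le_trans (per_abs b cd) _.
  rewrite -(per_pk b z1) [leRHS]mulrC -perZ //; apply: per_le.
  - exact: cont_abs.
  - by apply: contM => //; exact: cont_cst.
  - move=> t; rewrite -mulrBr normrM ger0_norm ?pk_ge0 // mulrC ler_wpM2r ?pk_ge0 //.
    rewrite E1 -Re_opp -Re_add; apply: le_trans (normRe_le _) (Hp _ _).
    by rewrite modc_polar.
have d2 : 2 * pi * d + 2 * pi * d = e.
  have : d * (2 * (2 * pi)) = e by rewrite /d divfK // gt_eqF // mulr_gt0.
  lra.
rewrite -d2; set X := per b _ in h3 *; set Y := 2 * pi * complex.Re (f _) in h2 *.
set Z := 2 * pi * complex.Re p.[_] in h2 h3 *.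
have -> : X - Y = (X - Z) - (Y - Z) by ring.
by apply: le_trans (ler_normB _ _) _; rewrite lerD.
Qed.

Lemma poisson_mod b f r z : approx f -> 0 <= r -> r < 1 -> modc z < 1 ->
  2 * pi * modc (f ((r%:C)%C * z)) <= per b (fun t => pk z t * modc (f ((r%:C)%C * expi t))).
Proof.
move=> Af r0 r1 z1; set v := f ((r%:C)%C * z).
have cpk := pk_cont z1; have cm := cont_circle_mod Af r0 r1.
have [v0|v0] := eqVneq v 0.
  rewrite v0 modc0 mulr0; apply: per_ge0 => t; rewrite mulr_ge0 ?pk_ge0 //; exact: modc_ge0.
have mv : 0 < modc v by rewrite lt_neqAle modc_ge0 eq_sym modc_eq0 v0.
(* The unimodular factor that makes u v equal to |v|: the formula for the real part of u f then
   gives the inequality for the modulus. *)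
pose u := (v^*)%C * (((modc v)^-1)%:C)%C.
have mu1 : modc u = 1 by rewrite modcM modc_conj modc_real ger0_norm ?invr_ge0 ?(ltW mv) // divff // gt_eqF.
have uv : complex.Re (u * v) = modc v.
  have -> : complex.Re (u * v) = (complex.Re v ^+ 2 + complex.Im v ^+ 2) / modc v.
    by rewrite /u; case: (v) => x y /=; ring.
  by rewrite -modc_sqr expr2 mulfK // gt_eqF.
have Auf := approxZ u Af.
rewrite -uv -(poisson_analytic b Auf r0 r1 z1); apply: per_le.
- by apply: contM => //; exact: cont_circle_Re Auf r0 r1.
- exact: contM.
- move=> t; rewrite ler_wpM2l ?pk_ge0 //; apply: le_trans (Re_le_modc _) _.
  by rewrite modcM mu1 mul1r.
Qed.

End PoissonParseval.

(** * Poisson integrals are dominated by the Hardy-Littlewood maximal function *)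

Section MaximalFunction.
Variable R : realType.
Local Notation C := R[i].
Local Notation mu := (@lebesgue_measure R).
Implicit Types (f g h : C -> C) (z w : C) (b r e t s : R).

(** Up to pi/4 the mean value theorem applies with cos at least cos(pi/4) >= 1/2. Beyond, sin x >=
    sin(pi/4) >= 1/2, while x/4 <= 1/2 because pi < 4. *)
Lemma sin_ge_lin x : 0 <= x -> x <= pi / 2 -> x / 4 <= sin x :> R.
Proof.
move=> x0 xp; have p0 := pi_gt0 R; have p2 := pihalf_lt2 R.
have itv y : 0 <= y -> y <= pi / 2 -> y \in `[- (pi / 2), pi / 2].
  by move=> y0 y1; rewrite in_itv /= y1 andbT; lra.
have mono y y' : 0 <= y -> y <= y' -> y' <= pi / 2 -> sin y <= sin y' :> R.
  move=> y0 yy y1; move: yy; rewrite le_eqVlt => /predU1P[->//|yy].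
  by apply: ltW; rewrite ltr_sin // itv //; lra.
pose m : R := sin (pi / 4).
have cosE y : cos y = sin (pi / 2 - y) :> R.
  by have := sinDpihalf (- y); rewrite cosN addrC => <-.
have m0 : 0 <= m by rewrite /m -(sin0 R); apply: mono; lra.
have mc : cos (pi / 4) = m :> R by rewrite cosE; congr sin; field.
have m1 : m ^+ 2 + m ^+ 2 = 1 by rewrite -{1}mc cos2Dsin2.
have m2 : 2^-1 <= m by nra.
have [xle|xge] := leP x (pi / 4); last first.
  by apply: (@le_trans _ _ m); [lra|apply: mono; lra].
have [|c + Hc] := @MVT_segment R sin cos 0 x x0.
  by apply: continuous_subspaceT => y; exact: continuous_sin.
rewrite in_itv /= => /andP[c0 cx].
move: Hc; rewrite sin0 !subr0 => ->.
have : m <= cos c by rewrite cosE; apply: mono; lra.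
nra.
Qed.

Lemma modc_1expi s : modc (1 - expi s : C) ^+ 2 = 2 - 2 * cos s.
Proof. by rewrite modc1B_sqr modc_expi expr1n /=. Qed.

Lemma modc_1expi_ge s : `|s| <= pi -> `|s| / 4 <= modc (1 - expi s : C).
Proof.
move=> sp; rewrite -(@ler_pXn2r _ 2) ?nnegrE ?modc_ge0 ?divr_ge0 // modc_1expi.
have h : `|s| / 2 / 4 <= sin (`|s| / 2) by apply: sin_ge_lin; [exact: divr_ge0|lra].
have -> : cos s = cos (`|s| / 2 *+ 2) :> R.
  rewrite -mulr_natr divfK //.
  by have [s0|s0] := leP 0 s; rewrite ?(ger0_norm s0) ?(ltr0_norm s0) ?cosN.
rewrite cos_mulr2n; have := cos2Dsin2 (`|s| / 2); have : 0 <= `|s| by [].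
nra.
Qed.

(** Moving from e^{is} to r e^{is} costs 1 - r, which is itself at most the modulus on the right;
    this halves the constant 1/4. *)
Lemma modc_1rexpi_ge r s : 0 <= r -> r <= 1 -> `|s| <= pi ->
  `|s| / 8 <= modc (1 - (r%:C)%C * expi s : C).
Proof.
move=> r0 r1 sp; have h := modc_1expi_ge sp.
have : modc (1 - expi s : C) <= modc (1 - (r%:C)%C * expi s) + (1 - r).
  have -> : 1 - expi s = (1 - (r%:C)%C * expi s) - ((1 - r)%:C)%C * expi s.
    by rewrite realcB mulrBl mul1r; ring.
  apply: le_trans (modcB _ _) _.
  by rewrite modc_polar // subr_ge0.
have : 1 - r <= modc (1 - (r%:C)%C * expi s : C).
  have := modc_distr 1 ((r%:C)%C * expi s); by rewrite modc1 modc_polar.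
lra.
Qed.

Lemma pk_polar r th t : modc (1 - ((r%:C)%C * expi th)^*%C * expi t : C) =
  modc (1 - (r%:C)%C * expi (t - th)).
Proof.
rewrite conjcM expi_conj expiD; congr (modc (1 - _)).
by rewrite [expi t * _]mulrC mulrA; congr (_ * _ * _); apply: complexP; rewrite //= oppr0.
Qed.

(** One term of the sum suffices, that of the least j with |t - th| < 2^j (1 - r). For j > 0,
    minimality bounds the denominator of the kernel below by (2^(j-1) (1 - r) / 8)^2, and 512 = 4 *
    2 * 64. *)
Lemma pk_dyadic r th t K : 0 <= r -> r < 1 -> `|t - th| <= pi -> `|t - th| < 2 ^+ K * (1 - r) ->
  pk ((r%:C)%C * expi th) t <=
    \sum_(k < K.+1) 512 / ((1 - r) * 4 ^+ k) * \1_(ball th (2 ^+ k * (1 - r))) t.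
Proof.
move=> r0 r1 tp tK; set d := 1 - r; have d0 : 0 < d by rewrite subr_gt0.
set s := t - th in tp tK.
have inb k : (`|s| < 2 ^+ k * d) -> \1_(ball th (2 ^+ k * d)) t = 1 :> R.
  by move=> h; rewrite indicE mem_set // /ball /= distrC.
have [j [jK js jmin]] : exists j, [/\ (j <= K)%N, `|s| < 2 ^+ j * d & forall i, (i < j)%N -> 2 ^+ i * d <= `|s|].
  have ex : exists j, `|s| < 2 ^+ j * d by exists K.
  exists (ex_minn ex); case: ex_minnP => j js jm; split => //; first exact: jm.
  by move=> i ij; rewrite leNgt; apply/negP => /jm; rewrite leqNgt ij.
have term0 (k : nat) : 0 <= 512 / (d * 4 ^+ k) * \1_(ball th (2 ^+ k * d)) t.
  rewrite mulr_ge0 ?divr_ge0 ?ler0n ?mulr_ge0 ?exprn_ge0 ?(ltW d0) ?ler0n //.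
apply: (@le_trans _ _ (512 / (d * 4 ^+ j) * \1_(ball th (2 ^+ j * d)) t)); last first.
  by apply: (@sum_le_term _ (fun k => 512 / (d * 4 ^+ k) * \1_(ball th (2 ^+ k * d)) t)).
rewrite inb // mulr1.
have mz : modc ((r%:C)%C * expi th : C) = r by rewrite modc_polar.
have z1 : modc ((r%:C)%C * expi th : C) < 1 by rewrite mz.
case: j jK js jmin => [|j] jK js jmin.
  rewrite expr0 mulr1; apply: le_trans (pk_le t z1) _; rewrite mz.
  by rewrite ler_wpM2r ?invr_ge0 ?(ltW d0) // ler_nat.
have sj := jmin j (ltnSn j).
rewrite /pk mz pk_polar -/s; set M := modc _.
have hM : `|s| / 8 <= M by apply: modc_1rexpi_ge => //; exact: ltW.
have p2 : 0 < 2 ^+ j :> R by rewrite exprn_gt0.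
have M0 : 0 < M by apply: lt_le_trans hM; rewrite divr_gt0 // (lt_le_trans _ sj) // mulr_gt0.
have -> : 1 - r ^+ 2 = d * (1 + r) by rewrite /d; ring.
rewrite ler_pdivrMr ?exprn_gt0 // mulrAC ler_pdivlMr ?mulr_gt0 ?exprn_gt0 //.
have hMj : 2 ^+ j * d / 8 <= M by apply: le_trans hM; rewrite ler_wpM2r // invr_ge0.
have h4 : 4 ^+ j.+1 = 4 * (2 ^+ j) ^+ 2 :> R by rewrite exprS -exprM mulnC exprM; congr (_ * _ ^+ _); ring.
rewrite h4.
have hsq : (2 ^+ j * d / 8) ^+ 2 <= M ^+ 2.
  by rewrite lerXn2r ?nnegrE ?(ltW M0) // divr_ge0 // mulr_ge0 // ltW.
have e1 : 0 <= d ^+ 2 * (2 ^+ j) ^+ 2 by rewrite mulr_ge0 // sqr_ge0.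
have e2 : d ^+ 2 * (2 ^+ j) ^+ 2 = 64 * (2 ^+ j * d / 8) ^+ 2 by field.
have e3 : d * (1 + r) * (d * (4 * (2 ^+ j) ^+ 2)) = 4 * (1 + r) * (d ^+ 2 * (2 ^+ j) ^+ 2) by ring.
rewrite e3 e2 in e1 *; nra.
Qed.

Local Open Scope ereal_scope.

Lemma ball_integral_HL (F : R -> R) x r : (0 < r)%R -> measurable_fun setT F ->
  \int[mu]_(y in ball x r) `|(F y)%:E| <= (r *+ 2)%:E * HL_maximal F x.
Proof.
move=> r0 mF; have r2 : (0 < r *+ 2)%R by rewrite pmulrn_lgt0.
have : iavg F (ball x r) <= HL_maximal F x.
  by apply: ereal_sup_ubound; exists r => //=; rewrite in_itv /= r0.
rewrite /iavg lebesgue_measure_ball ?(ltW r0) // inver gt_eqF //.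
by rewrite lee_pdivrMl.
Qed.

(** The k-th ball has length 2^(k+1) (1 - r), so the k-th dyadic term contributes 1024 / 2^k times
    the maximal function; these add up to at most 2048. *)
Lemma poisson_HL (F : R -> R) r th : (0 <= r)%R -> (r < 1)%R ->
  measurable_fun setT F -> (forall t, 0 <= F t)%R ->
  locally_integrable setT F ->
  \int[mu]_(t in `[(th - pi)%R, (th - pi + 2 * pi)%R]) (pk ((r%:C)%C * expi th)%R t * F t)%:E
    <= 2048%:E * HL_maximal F th.
Proof.
move=> r0 r1 mF F0 lF; set d := (1 - r)%R.
have d0 : (0 < d)%R by rewrite subr_gt0.
have HL0 : 0 <= HL_maximal F th by exact: HL_maximalT_ge0.
have z1 : (modc ((r%:C)%C * expi th : C) < 1)%R by rewrite modc_polar.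
have p0 := pi_gt0 R.
have [K HK] : exists K, (pi < 2 ^+ K * d)%R.
  have [||K HK] := @expr_small R 2^-1 (pi / d) 1 _ _ ltr01.
  - by rewrite invr_ge0.
  - by rewrite invf_lt1 // ltr1n.
  - exists K; move: HK; rewrite exprVn ltr_pdivrMr ?exprn_gt0 // mul1r ltr_pdivrMr //.
pose G k (t : R) := (512 / (d * 4 ^+ k) * (\1_(ball th (2 ^+ k * d)) t * F t))%:E.
have mG k : measurable_fun setT (G k).
  apply/measurable_EFinP; apply: measurable_funM => //; apply: measurable_funM => //.
  by apply: measurable_indic; exact: measurable_ball.
have mS : measurable_fun setT (fun t => \sum_(k < K.+1) G k t).
  rewrite (_ : (fun _ => _) = EFin \o (fun t => \sum_(k < K.+1) fine (G k t))%R); last first.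
    by apply/funext => t /=; rewrite -sumEFin.
  apply/measurable_EFinP; apply: measurable_sum => k.
  by apply/measurable_EFinP; exact: mG.
have c0 (k : nat) : (0 <= 512 / (d * 4 ^+ k))%R.
  by rewrite divr_ge0 ?ler0n ?mulr_ge0 ?exprn_ge0 ?(ltW d0) ?ler0n.
have G0 k t : 0 <= G k t.
  by rewrite lee_fin mulr_ge0 // mulr_ge0 // indicE.
apply: (@le_trans _ _ (\int[mu]_(t in setT) \sum_(k < K.+1) G k t)).
  apply: (@le_trans _ _ (\int[mu]_(t in `[(th - pi)%R, (th - pi + 2 * pi)%R]) \sum_(k < K.+1) G k t)).
    apply: ge0_le_integral => //.
    - by move=> t _; rewrite lee_fin mulr_ge0 // pk_ge0.
    - apply/measurable_EFinP/measurable_funM; last exact: measurable_funTS.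
      by apply: measurable_funTS; exact: continuous_measurable_fun (pk_cont z1).
    - exact: measurable_funTS.
    - move=> t; rewrite /= in_itv /= => /andP[t1 t2].
      have tp : (`|t - th| <= pi)%R by rewrite ler_norml; apply/andP; split; lra.
      rewrite sumEFin lee_fin; have := pk_dyadic r0 r1 tp (le_lt_trans tp HK).
      move=> /(ler_wpM2r (F0 t)) /le_trans; apply.
      by rewrite mulr_suml; apply: ler_sum => k _; rewrite mulrA.
  by apply: ge0_subset_integral => // t _; exact: sume_ge0.
rewrite ge0_integral_sum //; last by move=> n; exact: mG.
apply: (@le_trans _ _ (\sum_(k < K.+1) (1024 * 2^-1 ^+ k)%:E * HL_maximal F th)).
  apply: lee_sum => k _; rewrite /G.
  have E t : (512 / (d * 4 ^+ k) * (\1_(ball th (2 ^+ k * d)) t * F t))%:E =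
     (512 / (d * 4 ^+ k))%:E * ((fun t => `|(F t)%:E|) \_ (ball th (2 ^+ k * d))) t.
    rewrite EFinM patchE indicE; case: ifP => _; rewrite ?mul1r ?mul0r //=.
    by rewrite ger0_norm.
  under eq_integral do rewrite E.
  have mP : measurable_fun setT ((fun t => `|(F t)%:E|) \_ (ball th (2 ^+ k * d))).
    apply/(measurable_restrictT _ _).1; first exact: measurable_ball.
    by apply: measurableT_comp => //; apply/measurable_EFinP; exact: measurable_funTS.
  rewrite ge0_integralZl_EFin //; last first.
    by move=> t _; rewrite patchE; case: ifP.
  rewrite -integral_mkcond.
  have b0 : (0 < 2 ^+ k * d)%R by rewrite mulr_gt0 // exprn_gt0.
  apply: (@le_trans _ _ ((512 / (d * 4 ^+ k))%:E * (((2 ^+ k * d) *+ 2)%:E * HL_maximal F th))).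
    by apply: lee_wpmul2l; rewrite ?lee_fin //; exact: ball_integral_HL.
  rewrite muleA -EFinM le_eqVlt; apply/orP; left; apply/eqP; congr (_%:E * _).
  have -> : (4 ^+ k = 2 ^+ k * 2 ^+ k :> R)%R by rewrite -exprMn; congr (_ ^+ _)%R; ring.
  rewrite exprVn; field.
  by rewrite expf_neq0 //= gt_eqF.
have t0 k : (0 <= 1024 * 2^-1 ^+ k :> R)%R.
  by apply: mulr_ge0; [exact: ler0n|apply: exprn_ge0; rewrite invr_ge0; exact: ler0n].
rewrite -ge0_sume_distrl; last by move=> k _; rewrite lee_fin; exact: t0.
rewrite sumEFin -mulr_sumr; apply: lee_wpmul2r => //; rewrite lee_fin.
have := @geom_sum_le R 2^-1 K.+1 _ _; have -> : ((1 - 2^-1)^-1 = 2 :> R)%R by field.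
move=> h; have {}h : (\sum_(k < K.+1) 2^-1 ^+ k <= 2 :> R)%R.
  by apply: h; rewrite ?invr_ge0 // invf_lt1 // ltr1n.
lra.
Qed.

End MaximalFunction.

(** * Weak type estimate and radial limits almost everywhere for H^2 *)

Section RadialLimits.
Variable R : realType.
Local Notation C := R[i].
Local Notation mu := (@lebesgue_measure R).
Implicit Types (f g h : C -> C) (z w : C) (b r e t s : R).

Lemma TsetE : @Tset R = `[0, 0 + 2 * pi]%classic.
Proof. by rewrite add0r. Qed.

Lemma measurable_Tset : measurable (@Tset R).
Proof. exact: measurable_itv. Qed.

(** Integrate 2 eta h <= h^2 + eta^2. *)
Lemma per_le_sqr b (h : R -> R) eta : continuous h -> 0 < eta ->
  per b (fun t => h t ^+ 2) <= 2 * pi * eta ^+ 2 -> per b h <= 2 * pi * eta.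
Proof.
move=> ch eta0 H; have c2 := @contX _ h 2 ch.
have : per b (fun t => 2 * eta * h t) <= per b (fun t => h t ^+ 2 + eta ^+ 2).
  apply: per_le; [by apply: contM => //; exact: cont_cst|by apply: contD => //; exact: cont_cst|].
  by move=> t; have := sqr_ge0 (h t - eta); rewrite sqrrB; lra.
rewrite perZ // perD //; last exact: cont_cst.
rewrite per_cst => h1; have h2 := le_trans h1 (lerD H (lexx _)).
by rewrite -(ler_pM2l (mulr_gt0 (ltr0n R 2) eta0)); lra.
Qed.

Lemma weak_max_cst (p eta lam : R) : p != 0 -> lam != 0 ->
  3 / (2 * p * lam / 2048) * (4 * p * eta) = 12288 * eta / lam.
Proof. by move=> p0 l0; field; rewrite l0. Qed.

(** Weak type (1,1) for the radial maximal function of g on the disc of radius q: |g| is below its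
    Poisson integral, hence below the maximal function. The constant is 12288 = 3 * 2048 * 2, with 3
    from the maximal inequality and 2 from the two periods over which F is integrated. *)
Lemma weak_max_circle g q eta lam : approx g -> 0 <= q -> q < 1 -> 0 < eta -> 0 < lam ->
  (forall b, per b (fun t => modc (g ((q%:C)%C * expi t)) ^+ 2) <= 2 * pi * eta ^+ 2) ->
  exists V, [/\ measurable V, (mu V <= (12288 * eta / lam)%:E)%E &
   forall t r, @Tset R t -> 0 <= r -> r < 1 -> lam < modc (g (((q * r)%:C)%C * expi t)) -> V t].
Proof.
move=> Ag q0 q1 eta0 lam0 H; have p0 := pi_gt0 R; have pp := twopi_gt0 R.
pose h t := modc (g ((q%:C)%C * expi t)).
have ch : continuous h := cont_circle_mod Ag q0 q1.
have h0 t : 0 <= h t := modc_ge0 _.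
(* For t in [0, 2 pi] the window [t - pi, t + pi] lies in this interval; truncating the periodic h
   to two periods makes it integrable on the line. *)
pose F := h \_ `[- pi, 3 * pi].
have mh : measurable_fun setT h := continuous_measurable_fun ch.
have mF : measurable_fun setT F.
  by apply/(measurable_restrictT _ _).1; [exact: measurable_itv|exact: measurable_funTS].
have F0 t : 0 <= F t by rewrite /F patchE; case: ifP.
have EF : EFin \o F = (EFin \o h) \_ `[- pi, 3 * pi].
  by apply/funext => t; rewrite /F /= !patchE; case: ifP.
have iF : mu.-integrable setT (EFin \o F).
  by rewrite EF; apply/(integrable_mkcond _ _).1; [exact: measurable_itv|exact: cont_itv_integrable].
have lF : locally_integrable setT F by apply: open_integrable_locally => //; exact: openT.
have hper b : (\int[mu]_(t in `[b, (b + 2 * pi)%R]) (h t)%:E <= (2 * pi * eta)%:E)%E.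
  by rewrite per_EFin // lee_fin; apply: per_le_sqr.
have intF : (\int[mu]_(t in setT) `|(F t)%:E| <= (4 * pi * eta)%:E)%E.
  pose G b : R -> \bar R := (EFin \o h) \_ `[b, b + 2 * pi].
  have mG b : measurable_fun setT (G b).
    by apply/(measurable_restrictT _ _).1; [exact: measurable_itv|apply/measurable_EFinP; exact: measurable_funTS].
  have G0 b t : (0 <= G b t)%E by rewrite /G patchE; case: ifP => //= _; rewrite lee_fin.
  apply: (@le_trans _ _ (\int[mu]_(t in setT) (G (- pi)%R t + G pi t)%E)%E).
    apply: ge0_le_integral => //.
    - by apply: measurableT_comp => //; exact/measurable_EFinP.
    - exact: emeasurable_funD (mG _) (mG _).
    - move=> t _; rewrite gee0_abs ?lee_fin //.
      rewrite /F /G !patchE /= !mem_setE !in_itv /=.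
      case: ifPn => [/andP[t1 t2]|_]; last by rewrite adde_ge0 //; case: ifP => _ //; rewrite lee_fin.
      have [tp|tp] := leP t pi.
        have -> : t <= - pi + 2 * pi by lra.
        by rewrite t1 /= leeDl //; case: ifP => _ //; rewrite lee_fin.
      have -> : t <= pi + 2 * pi by lra.
      by rewrite (ltW tp) /= leeDr //; case: ifP => _ //; rewrite lee_fin.
  rewrite ge0_integralD //; [|exact: mG..].
  rewrite /G -!integral_mkcond.
  have -> : (4 * pi * eta)%:E = ((2 * pi * eta)%:E + (2 * pi * eta)%:E)%E by rewrite -EFinD; congr (_%:E); ring.
  by apply: leeD; exact: hper.
(* If |g| exceeds lam on the radius at t, then 2 pi lam is below 2048 times the maximal function at
   t. *)
pose c := 2 * pi * lam / 2048.
have c0 : 0 < c by rewrite divr_gt0 ?ltr0n // mulr_gt0.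
exists [set t | (c%:E < HL_maximal F t)%E]; split.
- rewrite -[X in measurable X]setTI; apply: emeasurable_fun_o_infty => //; exact: measurable_HL_maximal.
- apply: le_trans (maximal_inequality lF c0) _.
  apply: (@le_trans _ _ ((3 / c)%:E * (4 * pi * eta)%:E)%E).
    by apply: lee_wpmul2l => //; rewrite lee_fin divr_ge0 ?ler0n // ltW.
  by rewrite -EFinM lee_fin /c weak_max_cst // gt_eqF.
- move=> t r /=; rewrite /Tset /= in_itv /= => /andP[t0 t1] r0 r1 lt.
  have z1 : modc ((r%:C)%C * expi t : C) < 1 by rewrite modc_polar.
  have h1 := poisson_mod (t - pi) Ag q0 q1 z1.
  have h2 := poisson_HL t r0 r1 mF F0 lF.
  have cpk : continuous (fun u => pk ((r%:C)%C * expi t) u * h u) by apply: contM => //; exact: pk_cont.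
  have h3 : (\int[mu]_(u in `[(t - pi)%R, (t - pi + 2 * pi)%R]) (pk ((r%:C)%C * expi t)%R u * F u)%:E =
     (per (t - pi) (fun u => pk ((r%:C)%C * expi t) u * h u))%:E)%E.
    rewrite -per_EFin //; apply: eq_integral => u; rewrite inE /= in_itv /= => /andP[u1 u2].
    rewrite /F patchE ifT // inE /= in_itv /=; apply/andP; split; lra.
  rewrite h3 in h2.
  have {}h1 : 2 * pi * lam < per (t - pi) (fun u => pk ((r%:C)%C * expi t) u * h u).
    by apply: lt_le_trans h1; rewrite ltr_pM2l // mulrA -realcM.
  have h4 : ((2 * pi * lam)%:E < 2048%:E * HL_maximal F t)%E by apply: lt_le_trans h2; rewrite lte_fin.
  rewrite /c mulrC EFinM -lte_pdivlMl ?invr_gt0 ?ltr0n // invrK.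
  exact: h4.
Qed.

(** The bound on each circle is independent of q, and the exceptional sets for radii below [q n]
    increase with n, so continuity of the measure from below preserves it. *)
Lemma weak_max g eta lam : approx g -> 0 < eta -> 0 < lam ->
  (forall q b, 0 <= q -> q < 1 -> per b (fun t => modc (g ((q%:C)%C * expi t)) ^+ 2) <= 2 * pi * eta ^+ 2) ->
  exists V, [/\ measurable V, (mu V <= (12288 * eta / lam)%:E)%E &
   forall t r, @Tset R t -> 0 <= r -> r < 1 -> lam < modc (g ((r%:C)%C * expi t)) -> V t].
Proof.
move=> Ag eta0 lam0 H.
pose q n : R := 1 - n.+2%:R^-1.
have q0 n : 0 < q n by rewrite subr_gt0 invf_lt1 // ltr1n.
have q1 n : q n < 1 by rewrite gtrBl invr_gt0.
have qm n m : (n <= m)%N -> q n <= q m.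
  by move=> nm; rewrite lerD2l lerN2 lef_pV2 ?posrE // ler_nat !ltnS.
pose A n := [set t | @Tset R t /\ exists r, [/\ 0 <= r, r < q n & lam < modc (g ((r%:C)%C * expi t))]].
(* The union runs over uncountably many radii, but its members are open, so measurability is
   kept. *)
have AE n : A n = @Tset R `&` \bigcup_(r in [set r | 0 <= r /\ r < q n]) [set t | lam < modc (g ((r%:C)%C * expi t))].
  apply/seteqP; split => t /=.
    by move=> [Tt [r [r0 r1 lt]]]; split => //; exists r.
  by move=> [Tt [r [r0 r1] lt]]; split => //; exists r.
have mA n : measurable (A n).
  rewrite AE; apply: measurableI; first exact: measurable_Tset.
  apply: open_measurable; apply: bigcup_open => r [r0 r1].
  have cr := cont_circle_mod Ag r0 (lt_trans r1 (q1 n)).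
  apply: (@open_comp _ _ (fun t => modc (g ((r%:C)%C * expi t))) [set x | lam < x]); last exact: open_gt.
  by move=> t _; exact: cr.
exists (\bigcup_n A n); split.
- by apply: bigcup_measurable => n _; exact: mA.
- have cv := @nondecreasing_cvg_mu _ _ _ mu A mA _ _.
  have {cv}cv : (mu \o A) n @[n --> \oo] --> mu (\bigcup_n A n).
    apply: cv; first by apply: bigcup_measurable => n _; exact: mA.
    move=> n m nm; apply/subsetPset => t [Tt [r [r0 r1 lt]]]; split => //; exists r; split => //.
    exact: lt_le_trans r1 (qm _ _ nm).
  have Ab n : (mu (A n) <= (12288 * eta / lam)%:E)%E.
    have [V [mV Vb HV]] := weak_max_circle Ag (ltW (q0 n)) (q1 n) eta0 lam0 (fun b => H _ b (ltW (q0 n)) (q1 n)).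
    apply: le_trans Vb; apply: le_measure; rewrite ?inE //; first exact: mA.
    move=> t [Tt [r [r0 r1 lt]]]; apply: (HV t (r / q n)) => //.
    - by rewrite divr_ge0 // ltW.
    - by rewrite ltr_pdivrMr // mul1r.
    - by rewrite [q n * _]mulrC divfK // gt_eqF.
  rewrite -(cvg_lim _ cv) //; apply: lime_le; first by apply/cvg_ex; eexists; exact: cv.
  by apply: nearW => n; exact: Ab.
- move=> t r Tt r0 r1 lt.
  have [N HN] : exists N, r < q N.
    exists (Num.truncn (1 - r)^-1); rewrite /q ltrBrDl -ltrBrDr.
    have r1' : 0 < 1 - r by rewrite subr_gt0.
    rewrite invf_plt ?posrE // (lt_le_trans (truncnS_gt _)) // ler_nat //.
  by exists N => //; split => //; exists r.
Qed.

(** This form carries the existence of the limit, whereas [radial_limit] is built on [lim], which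
    returns a default value where there is none. *)
Definition has_radial f t (l : C) := forall e, 0 < e -> exists d, [/\ 0 < d &
  forall r, 0 <= r -> 1 - d < r -> r < 1 -> modc (f ((r%:C)%C * expi t) - l) < e].

(* the Hardy space H^2 *)
Definition hardy2 f := exists (a : nat -> C) (B : R),
  (forall z, modc z < 1 -> cvgC (fun n => \sum_(k < n) a k * z ^+ k) (f z)) /\
  forall n, \sum_(k < n) modc (a k) ^+ 2 <= B.

Lemma hardy2_approx f : hardy2 f -> approx f.
Proof. by move=> [a [B [Ha _]]]; apply: analytic_approx; exists a. Qed.

Lemma ler_expr1n (x : R) n : 0 <= x -> x <= 1 -> 1 - x ^+ n <= n%:R * (1 - x).
Proof.
move=> x0 x1; elim: n => [|n IH]; first by rewrite expr0 subrr mul0r.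
have h : 0 <= x ^+ n <= 1 by rewrite exprn_ge0 //= exprn_ile1.
by rewrite exprS -natr1 mulrDl mul1r; nra.
Qed.

(** Dominated convergence for series: past an index N the squared coefficients sum to less than
    eta/2, and up to N one has 1 - s^k <= N (1 - s), small for s near 1. *)
Lemma hardy2_tail (a : nat -> C) B eta : 0 < eta -> (forall n, \sum_(k < n) modc (a k) ^+ 2 <= B) ->
  exists s0, [/\ 0 < s0, s0 < 1 & forall s, s0 <= s -> s <= 1 -> forall n,
    \sum_(k < n) modc (a k) ^+ 2 * (1 - s ^+ k) ^+ 2 <= eta].
Proof.
move=> eta0 HB.
pose u n := \sum_(k < n) modc (a k) ^+ 2.
have um n m : (n <= m)%N -> u n <= u m.
  move=> nm; rewrite /u -(subnKC nm) big_split_ord /= lerDl sumr_ge0 // => k _; exact: sqr_ge0.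
have hs : has_sup (range u) by split; [exists (u 0%N), 0%N|exists B => _ [n _ <-]; exact: HB].
have e2 : 0 < eta / 2 by rewrite divr_gt0.
have [_ [N _ <-] hN] := sup_adherent e2 hs.
have B0 : 0 <= B by have := HB 0%N; rewrite big_ord0.
pose K := 1 + N%:R * N%:R * B.
have K1 : 1 <= K by rewrite lerDl mulr_ge0 // mulr_ge0.
pose d := Num.min 2^-1 (eta / 2 / K).
have K0 : 0 < K by apply: lt_le_trans K1.
have d0 : 0 < d by rewrite lt_min invr_gt0 ltr0n /= divr_gt0.
have d2 : d <= 2^-1 by rewrite ge_min lexx.
exists (1 - d); split; [lra|lra|move=> s sd s1 n].
have s0 : 0 <= s by lra.
have sk k : 0 <= 1 - s ^+ k <= 1.
  by rewrite subr_ge0 exprn_ile1 // lerBlDr lerDl exprn_ge0.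
have sk2 k : (1 - s ^+ k) ^+ 2 <= 1 by have := sk k => /andP[? ?]; rewrite exprn_ile1.
have tb k : (k <= N)%N -> (1 - s ^+ k) ^+ 2 <= N%:R * N%:R * d.
  move=> kN; have h1 := @ler_expr1n s k s0 s1.
  have h2 : k%:R * (1 - s) <= N%:R * d.
    by apply: ler_pM; rewrite ?subr_ge0 ?ler_nat //; lra.
  have /andP[h3 _] := sk k.
  have : (1 - s ^+ k) ^+ 2 <= (N%:R * d) ^+ 2.
    by rewrite lerXn2r ?nnegrE ?mulr_ge0 ?(ltW d0) // (le_trans h1).
  move=> /le_trans; apply; rewrite exprMn expr2 ler_wpM2l ?mulr_ge0 //.
  by rewrite expr2 ler_piMr ?(ltW d0) //; lra.
have [nN|/ltnW Nn] := leqP n N; last first.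
  rewrite -(subnKC Nn) big_split_ord /= [eta]splitr; apply: lerD.
    apply: (@le_trans _ _ (\sum_(k < N) modc (a k) ^+ 2 * (N%:R * N%:R * d))).
      by apply: ler_sum => k _; rewrite ler_wpM2l ?sqr_ge0 // tb // ltnW.
    rewrite -mulr_suml; apply: (@le_trans _ _ (B * (N%:R * N%:R * d))).
      by rewrite ler_wpM2r // !mulr_ge0 // ltW.
    apply: (@le_trans _ _ (K * d)); first by rewrite mulrA ler_wpM2r ?(ltW d0) // /K [B * _]mulrC lerDr.
    by rewrite mulrC -ler_pdivlMr // ge_min lexx orbT.
  apply: (@le_trans _ _ (\sum_(k < n - N) modc (a (N + k)%N) ^+ 2)).
    by apply: ler_sum => k _; rewrite ler_piMr ?sqr_ge0.
  have : u n <= sup (range u) by apply: sup_upper_bound => //; exists n.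
  have E m : u (N + m)%N = u N + \sum_(k < m) modc (a (N + k)%N) ^+ 2 by rewrite /u big_split_ord.
  have := E (n - N)%N; rewrite subnKC // => -> h.
  by move: hN h; lra.
apply: (@le_trans _ _ (\sum_(k < N) modc (a k) ^+ 2 * (N%:R * N%:R * d))).
  have : \sum_(k < n) modc (a k) ^+ 2 * (N%:R * N%:R * d) <= \sum_(k < N) modc (a k) ^+ 2 * (N%:R * N%:R * d).
    by rewrite -!mulr_suml ler_wpM2r ?um // !mulr_ge0 // ltW.
  apply: le_trans; apply: ler_sum => k _; rewrite ler_wpM2l ?sqr_ge0 // tb //.
  by apply: leq_trans (ltnW (ltn_ord k)) nN.
rewrite -mulr_suml; apply: (@le_trans _ _ (B * (N%:R * N%:R * d))).
  by rewrite ler_wpM2r // !mulr_ge0 // ltW.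
apply: (@le_trans _ _ (K * d)); first by rewrite mulrA ler_wpM2r ?(ltW d0) // /K [B * _]mulrC lerDr.
apply: (@le_trans _ _ (eta / 2)); last lra.
by rewrite mulrC -ler_pdivlMr // ge_min lexx orbT.
Qed.

(** By Parseval the mean square is a sum of |a_k|^2 (1 - s^k)^2 q^(2k); bounding q^(2k) by 1 makes
    the estimate uniform in q. *)
Lemma hardy2_dilate f eta : hardy2 f -> 0 < eta ->
  exists s0, [/\ 0 < s0, s0 < 1 & forall s, s0 <= s -> s <= 1 -> forall q b, 0 <= q -> q < 1 ->
    per b (fun t => modc (f ((q%:C)%C * expi t) - f (((s * q)%:C)%C * expi t)) ^+ 2) <= 2 * pi * eta].
Proof.
move=> [a [B [Ha HB]]] eta0; have pp := twopi_gt0 R.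
have Af : approx f by apply: analytic_approx; exists a.
have [s0 [s00 s01 Hs]] := hardy2_tail eta0 HB.
exists s0; split => // s s0s s1 q b q0 q1.
have sq0 : 0 <= s * q by rewrite mulr_ge0 // (le_trans (ltW s00)).
have sqq : s * q <= q by rewrite ler_piMl.
have sq1 : s * q < 1 by apply: le_lt_trans q1.
pose c k := a k * ((q ^+ k)%:C)%C * ((1 - s ^+ k)%:C)%C.
pose h t := f ((q%:C)%C * expi t) - f (((s * q)%:C)%C * expi t).
have h1 : continuous (fun t => complex.Re (h t)).
  rewrite (_ : (fun _ => _) = fun t => complex.Re (f ((q%:C)%C * expi t)) - complex.Re (f (((s * q)%:C)%C * expi t))).
    by apply: contB; exact: cont_circle_Re.
  by apply/funext => t; rewrite Re_add Re_opp.
have h2 : continuous (fun t => complex.Im (h t)).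
  rewrite (_ : (fun _ => _) = fun t => complex.Im (f ((q%:C)%C * expi t)) - complex.Im (f (((s * q)%:C)%C * expi t))).
    by apply: contB; exact: cont_circle_Im.
  by apply/funext => t; rewrite Im_add Im_opp.
have h3 e : 0 < e -> exists N, forall n, (N <= n)%N -> forall t,
     modc (h t - \sum_(k < n) c k * expi (k%:R * t)) <= e.
  move=> e0; have e2 : 0 < e / 2 by rewrite divr_gt0.
  have [N HN] := psum_unif q0 q1 Ha e2; exists N => n Nn t.
  have -> : \sum_(k < n) c k * expi (k%:R * t) =
     \sum_(k < n) a k * ((q%:C)%C * expi t) ^+ k - \sum_(k < n) a k * (((s * q)%:C)%C * expi t) ^+ k.
    rewrite -sumrB; apply: eq_bigr => k _; rewrite !polarX exprMn realcM /c realcB.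
    by rewrite -[((1 : R)%:C)%C]/(1 : C); ring.
  rewrite /h; set x := f _; set y := f _; set X := \sum_(k < n) _; set Y := \sum_(k < n) _.
  have -> : x - y - (X - Y) = (x - X) - (y - Y) by ring.
  apply: le_trans (modcB _ _) _; rewrite [e]splitr.
  by apply: lerD; apply: HN => //; rewrite modc_polar.
apply/ler_addgt0Pr => e e0; have [N HN] := parseval_unif b h1 h2 h3 e0.
have := HN N (leqnn N); rewrite ler_distl => /andP[_ H]; apply: le_trans H _.
rewrite lerD2r ler_wpM2l ?(ltW pp) //; apply: le_trans (Hs s s0s s1 N).
apply: ler_sum => k _; rewrite !modcM !modc_real !exprMn !real_normK ?num_real //.
rewrite ler_wpM2r ?sqr_ge0 // -[leRHS]mulr1 ler_wpM2l ?sqr_ge0 //.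
by rewrite exprn_ile1 ?exprn_ge0 // exprn_ile1 // ltW.
Qed.

(** Cauchy's criterion along a radius; the candidate limit is an ultralimit of the bounded values at
    radii 1 - 1/(n+1), taken from an index where the oscillation is at most 1. *)
Lemma radial_cauchy f t :
  (forall m : nat, exists d, [/\ 0 < d & forall r r', 0 <= r -> 0 <= r' -> 1 - d < r -> 1 - d < r' -> r < 1 -> r' < 1 ->
      modc (f ((r%:C)%C * expi t) - f ((r'%:C)%C * expi t)) <= m.+1%:R^-1]) ->
  exists l, has_radial f t l.
Proof.
move=> H; have [U [uU fU]] := free_ultrafilter.
pose q n : R := 1 - n.+1%:R^-1.
have q0 n : 0 <= q n by rewrite subr_ge0 invf_le1 // ler1n.
have q1 n : q n < 1 by rewrite gtrBl invr_gt0.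
have qd d : 0 < d -> exists N, forall n, (N <= n)%N -> 1 - d < q n.
  move=> d0; exists (Num.truncn d^-1) => n Nn; rewrite ltrD2l ltrN2.
  by rewrite invf_plt ?posrE // (lt_le_trans (truncnS_gt _)) // ler_nat ltnS.
have [d0 [d00 Hd0]] := H 0%N; have [N0 HN0] := qd d0 d00.
have ub n : modc (f ((q (N0 + n)%N)%:C%C * expi t)) <= modc (f ((q N0)%:C%C * expi t)) + 1.
  set x := f _; set y := f _; rewrite -lerBlDl; apply: le_trans (modc_distr _ _) _.
  have := Hd0 (q (N0 + n)%N) (q N0); rewrite invr1; apply => //; apply: HN0 => //; exact: leq_addr.
have [l Hl] := bounded_ulim uU ub.
exists l => e e0; have [m Hm] : exists m : nat, m.+1%:R^-1 < e / 2.
  exists (Num.truncn (e / 2)^-1); rewrite invf_plt ?posrE ?divr_gt0 //.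
  exact: truncnS_gt.
have [d [dd Hd]] := H m; exists d; split => // r r0 rd r1.
have [N HN] := qd d dd.
have [n [Nn /= hn]] := ultra_ex uU fU N (Hl _ (divr_gt0 e0 (ltr0n R 2))).
have -> : f ((r%:C)%C * expi t) - l = (f ((r%:C)%C * expi t) - f ((q (N0 + n)%N)%:C%C * expi t))
   + (f ((q (N0 + n)%N)%:C%C * expi t) - l) by ring.
apply: le_lt_trans (modcD _ _) _; rewrite [e]splitr ltr_leD //; last exact: ltW.
apply: le_lt_trans Hm; apply: Hd => //; apply: HN.
by rewrite (leq_trans Nn) // leq_addl.
Qed.

Lemma negligible_small (N : set R) :
  (forall e, 0 < e -> exists V, [/\ measurable V, (mu V <= e%:E)%E & N `<=` V]) -> mu.-negligible N.
Proof.
move=> H.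
have /choice[V HV] : forall n : nat, exists V, [/\ measurable V, (mu V <= (n.+1%:R^-1)%:E)%E & N `<=` V].
  by move=> n; apply: H; rewrite invr_gt0.
have mV n : measurable (V n) by have [] := HV n.
exists (\bigcap_n V n); split.
- by apply: bigcap_measurable => // n _.
- apply/eqP; rewrite eq_le measure_ge0 andbT; apply/lee_addgt0Pr => e e0; rewrite add0e.
  pose n := Num.truncn e^-1; have [_ Vn _] := HV n.
  apply: (@le_trans _ _ (mu (V n))).
    by apply: le_measure; rewrite ?inE //; [exact: bigcap_measurable|exact: bigcap_inf].
  apply: le_trans Vn _; rewrite lee_fin invf_ple ?posrE //; exact: ltW (truncnS_gt _).
- by move=> t Nt n _; have [_ _] := HV n; apply.
Qed.

Lemma osc_bound (L a1 a2 c1 c2 p q S : R) : S <= p + q -> p <= a1 + a2 -> q <= c1 + c2 ->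
  a1 <= L -> a2 <= L -> c1 < L / 2 -> c2 < L / 2 -> S <= 3 * L.
Proof. lra. Qed.

(** The dilate f(s z) is continuous up to the circle and f - f(s z) is small in mean square. With
    lam a third of 1/(m+1), radial oscillation of f above 1/(m+1) forces |f - f(s z)| above lam
    somewhere on the radius, an event of measure at most e. *)
Theorem fatou_radial f : hardy2 f -> aeT (fun t => exists l, has_radial f t l).
Proof.
move=> Hf; have Af := hardy2_approx Hf; have pp := twopi_gt0 R.
pose N (m : nat) := [set t | @Tset R t /\ ~ exists d, [/\ 0 < d & forall r r', 0 <= r -> 0 <= r' -> 1 - d < r -> 1 - d < r' -> r < 1 -> r' < 1 ->
      modc (f ((r%:C)%C * expi t) - f ((r'%:C)%C * expi t)) <= m.+1%:R^-1]].
rewrite /aeT; apply: (@negligibleS _ _ _ mu (\bigcup_m N m)).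
  move=> t [Tt nl]; apply: contrapT => nN; apply: nl; apply: radial_cauchy => m.
  by apply: contrapT => H; apply: nN; exists m.
apply: negligible_bigcup => m; apply: negligible_small => e e0.
pose lam : R := (m.+1%:R^-1) / 3.
have lam0 : 0 < lam by rewrite divr_gt0 // invr_gt0.
pose eta := e * lam / 12288.
have eta0 : 0 < eta by rewrite divr_gt0 ?ltr0n // mulr_gt0.
have eta20 : 0 < eta ^+ 2 by rewrite exprn_gt0.
have [s [s0 s1 Hs]] := hardy2_dilate Hf eta20.
pose g z := f z - f ((s%:C)%C * z).
have Ag : approx g.
  rewrite (_ : g = f \+ (fun z => (-1) * f ((s%:C)%C * z))).
    by apply: approxD => //; apply: approxZ; apply: approx_dilate => //; exact: ltW.
  by apply/funext => z; rewrite /g /= mulN1r.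
have [|V [mV Vb HV]] := weak_max Ag eta0 lam0.
  move=> q b q0 q1; have := Hs s (lexx _) (ltW s1) q b q0 q1.
  by apply: le_trans; rewrite le_eqVlt; apply/orP; left; apply/eqP; apply: eq_per => t; rewrite /g mulrA -realcM.
exists V; split => //.
  by apply: le_trans Vb _; rewrite lee_fin /eta le_eqVlt; apply/orP; left; apply/eqP; field; rewrite ?gt_eqF.
move=> t [Tt nd]; apply: contrapT => nV; apply: nd.
have small r : 0 <= r -> r < 1 -> modc (f ((r%:C)%C * expi t) - f (((s * r)%:C)%C * expi t)) <= lam.
  move=> r0 r1; rewrite leNgt; apply/negP => h; apply: nV; apply: (HV t r) => //.
  by rewrite /g mulrA -realcM.
have zs : modc ((s%:C)%C * expi t : C) < 1 by rewrite modc_polar // ltW.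
have lam2 : 0 < lam / 2 by rewrite divr_gt0.
have [d [d0 Hd]] := approx_cont Af zs lam2.
have near r : 0 <= r -> 1 - d < r -> r < 1 -> modc (f (((s * r)%:C)%C * expi t) - f ((s%:C)%C * expi t)) < lam / 2.
  move=> r0 rd r1; apply: (Hd _ _).2; rewrite -mulrBl -realcB modcM modc_expi mulr1 modc_real.
  have -> : s * r - s = - (s * (1 - r)) by ring.
  rewrite normrN ger0_norm; last by rewrite mulr_ge0 ?subr_ge0 // ltW.
  apply: (@le_lt_trans _ _ (1 - r)); last by rewrite ltrBlDr -ltrBlDl.
  by rewrite ler_piMl ?subr_ge0 // ltW.
exists d; split => // r r' r0 r'0 rd r'd r1 r'1.
have h1 := small r r0 r1; have h2 := small r' r'0 r'1.
have h3 := near r r0 rd r1; have h4 := near r' r'0 r'd r'1.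
set x := f ((r%:C)%C * expi t) in h1 *; set y := f ((r'%:C)%C * expi t) in h2 *.
set x' := f (((s * r)%:C)%C * expi t) in h1 h3 *; set y' := f (((s * r')%:C)%C * expi t) in h2 h4 *.
set w := f ((s%:C)%C * expi t) in h3 h4.
have -> : x - y = (x - x') - (y - y') + ((x' - w) - (y' - w)) by ring.
have -> : m.+1%:R^-1 = 3 * lam by rewrite /lam; field.
apply: (osc_bound (modcD _ _) (modcB _ _) (modcB _ _) h1 h2 h3 h4).
Qed.

End RadialLimits.

(** * Normalized means on the circle, almost everywhere statements, Fatou and dominated
    convergence *)

Section CircleMean.
Variable R : realType.
Local Notation C := R[i].
Local Notation mu := (@lebesgue_measure R).
Local Notation Tset := (@Tset R).
Implicit Types (f g h : R -> R) (b r e t s : R).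

Definition IT h : \bar R := intT (fun t => (h t)%:E).

Lemma inv2pi_ge0 : 0 <= (2 * pi)^-1 :> R.
Proof. by rewrite invr_ge0 ltW // twopi_gt0. Qed.
Hint Resolve inv2pi_ge0 : core.

Lemma mu_Tset : mu Tset = (2 * pi)%:E.
Proof. by rewrite /Defs.Tset lebesgue_measure_itv /= lte_fin twopi_gt0 sube0. Qed.

Local Open Scope ereal_scope.

Lemma intT_ge0 (h : R -> \bar R) : (forall t, Tset t -> 0 <= h t) -> 0 <= intT h.
Proof. by move=> h0; rewrite mule_ge0 ?lee_fin // integral_ge0. Qed.

Lemma intT_ae_le (f g : R -> \bar R) :
  measurable_fun Tset f -> measurable_fun Tset g ->
  (forall t, Tset t -> 0 <= f t) -> (forall t, Tset t -> 0 <= g t) ->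
  aeT (fun t => f t <= g t) -> intT f <= intT g.
Proof.
move=> mf mg f0 g0 fg; apply: lee_wpmul2l; rewrite ?lee_fin //.
apply: ae_ge0_le_integral => //; first exact: measurable_Tset.
rewrite /almost_everywhere; move: fg; rewrite /aeT; apply: negligibleS => t /= nt.
by split; apply: contrapT => h; apply: nt => // Tt; apply: contrapT => h'.
Qed.

Lemma intT_le (f g : R -> \bar R) :
  measurable_fun Tset f -> measurable_fun Tset g ->
  (forall t, Tset t -> 0 <= f t) -> (forall t, Tset t -> f t <= g t) -> intT f <= intT g.
Proof.
move=> mf mg f0 fg; apply: lee_wpmul2l; rewrite ?lee_fin //.
by apply: ge0_le_integral => //; exact: measurable_Tset.
Qed.

Lemma intT_cst (c : R) : intT (fun=> c%:E) = c%:E.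
Proof.
rewrite /intT integral_cst; last exact: measurable_Tset.
rewrite [X in _ * (_ * X)](_ : _ = (2 * pi)%:E); last exact: mu_Tset.
by rewrite -!EFinM mulrCA mulVf ?mulr1 // gt_eqF // twopi_gt0.
Qed.

Lemma IT_le f g : measurable_fun Tset f -> measurable_fun Tset g ->
  (forall t, Tset t -> (0 <= f t)%R) -> (forall t, Tset t -> (f t <= g t)%R) -> IT f <= IT g.
Proof.
by move=> mf mg f0 fg; apply: intT_le => //; apply/measurable_EFinP.
Qed.

Lemma IT_ae_le f g : measurable_fun Tset f -> measurable_fun Tset g ->
  (forall t, Tset t -> (0 <= f t)%R) -> (forall t, Tset t -> (0 <= g t)%R) ->
  aeT (fun t => (f t <= g t)%R) -> IT f <= IT g.
Proof.
by move=> mf mg f0 g0 fg; apply: intT_ae_le => //; apply/measurable_EFinP.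
Qed.

Lemma IT_ge0 f : (forall t, Tset t -> (0 <= f t)%R) -> 0 <= IT f.
Proof. by move=> f0; apply: intT_ge0 => t Tt; rewrite lee_fin f0. Qed.

Lemma IT_cst (c : R) : IT (fun=> c) = c%:E.
Proof. exact: intT_cst. Qed.

Lemma ITD f g : measurable_fun Tset f -> measurable_fun Tset g ->
  (forall t, Tset t -> (0 <= f t)%R) -> (forall t, Tset t -> (0 <= g t)%R) ->
  IT (fun t => f t + g t)%R = IT f + IT g.
Proof.
move=> mf mg f0 g0; rewrite /IT /intT.
under eq_integral do rewrite EFinD.
rewrite ge0_integralD //.
- rewrite ge0_muleDr //; apply: integral_ge0 => t Tt; rewrite lee_fin; [exact: f0|exact: g0].
- exact: measurable_Tset.
- exact/measurable_EFinP.
- exact/measurable_EFinP.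
Qed.

Lemma ITZ (c : R) f : (0 <= c)%R -> measurable_fun Tset f ->
  (forall t, Tset t -> (0 <= f t)%R) -> IT (fun t => c * f t)%R = c%:E * IT f.
Proof.
move=> c0 mf f0; rewrite /IT /intT.
under eq_integral do rewrite EFinM.
rewrite ge0_integralZl_EFin //; first by rewrite muleCA.
- exact: measurable_Tset.
- exact/measurable_EFinP.
Qed.

Lemma IT_per h : continuous h -> IT h = ((2 * pi)^-1 * per 0 h)%:E.
Proof.
move=> ch; rewrite /IT /intT EFinM; congr (_ * _).
by rewrite -(per_EFin 0 ch) add0r.
Qed.

Lemma cont_measT h : continuous h -> measurable_fun Tset h.
Proof. by move=> ch; apply: measurable_funTS; exact: continuous_measurable_fun. Qed.

Lemma aeT_mono (P Q : R -> Prop) : (forall t, Tset t -> P t -> Q t) -> aeT P -> aeT Q.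
Proof.
by move=> PQ; apply: negligibleS => t [Tt nQ]; split => // /(PQ _ Tt).
Qed.

Lemma aeT_and (P Q : R -> Prop) : aeT P -> aeT Q -> aeT (fun t => P t /\ Q t).
Proof.
move=> aP aQ; apply: negligibleS (negligibleU aP aQ) => t [Tt nPQ].
have [p|np] := pselect (P t); last by left.
by right; split => // q; apply: nPQ.
Qed.

Lemma aeT_all (P : R -> Prop) : (forall t, Tset t -> P t) -> aeT P.
Proof.
move=> aP; rewrite /aeT (_ : [set _ | _] = set0); first exact: negligible_set0.
by apply/seteqP; split => t // [/aP].
Qed.

Lemma aeT_forall (P : nat -> R -> Prop) : (forall n, aeT (P n)) -> aeT (fun t => forall n, P n t).
Proof.
move=> aP; apply: negligibleS (negligible_bigcup aP) => t [Tt nP].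
apply: contrapT => H; apply: nP => n; apply: contrapT => h; apply: H; by exists n.
Qed.

(** Fatou's lemma packaged for uniform bounds, since nearly every modular below is obtained as a
    limit of modulars bounded by the same constant. *)
Lemma IT_fatou (u : nat -> R -> R) f (B : R) :
  (forall n, measurable_fun Tset (u n)) -> measurable_fun Tset f ->
  (forall n t, Tset t -> (0 <= u n t)%R) -> (forall t, Tset t -> (0 <= f t)%R) ->
  aeT (fun t => u n t @[n --> \oo] --> f t) ->
  (forall n, IT (u n) <= B%:E) -> IT f <= B%:E.
Proof.
move=> mu_ mf u0 f0 cvu uB.
have mT := @measurable_Tset R.
have mE n : measurable_fun Tset (fun t => (u n t)%:E) by apply/measurable_EFinP.
have u0' n t : Tset t -> 0 <= (u n t)%:E by move=> Tt; rewrite lee_fin u0.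
have ml : measurable_fun Tset (fun t => limn_einf (fun n => (u n t)%:E)).
  rewrite (_ : (fun _ => _) = fun t => - limn_esup (fun n => - (u n t)%:E)); last first.
    apply/funext => t; rewrite -limn_einfN; congr (limn_einf _).
    by apply/funext => n; rewrite /comp oppeK.
  apply: measurableT_comp => //; apply: measurable_fun_limn_esup => n.
  exact: measurableT_comp.
apply: (@le_trans _ _ (intT (fun t => limn_einf (fun n => (u n t)%:E)))).
  apply: intT_ae_le => //.
  - exact/measurable_EFinP.
  - move=> t Tt; rewrite limn_einf_lim; apply: lime_ge; first exact: is_cvg_einfs.
    by apply: nearW => n; apply: le_ereal_inf_tmp => _ [k _ <-]; exact: u0'.
  - apply: aeT_mono cvu => t Tt ct.
    have : (u n t)%:E @[n --> \oo] --> (f t)%:E by apply: cvg_EFin => //; exact: nearW.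
    by move=> /cvg_limn_einf_sup [-> _].
have := fatou mu mT mE u0'.
have uB' n : \int[mu]_(t in Tset) (u n t)%:E <= (2 * pi * B)%:E.
  have := uB n; rewrite /IT /intT lee_pdivrMl ?twopi_gt0 // -EFinM.
move=> H; rewrite /intT lee_pdivrMl ?twopi_gt0 // -EFinM.
apply: le_trans H _; rewrite limn_einf_lim; apply: lime_le; first exact: is_cvg_einfs.
apply: nearW => n; apply: le_trans (uB' n).
by apply: ereal_inf_lbound; exists n => /=.
Qed.

Lemma IT_dominated (u : nat -> R -> R) g :
  (forall n, measurable_fun Tset (u n)) -> measurable_fun Tset g ->
  (forall n t, Tset t -> (0 <= u n t)%R) -> (forall t, Tset t -> (0 <= g t)%R) ->
  aeT (fun t => u n t @[n --> \oo] --> 0%R) ->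
  (forall n, aeT (fun t => (u n t <= g t)%R)) -> IT g < +oo ->
  forall e, (0 < e)%R -> exists N, forall n, (N <= n)%N -> IT (u n) <= e%:E.
Proof.
move=> mu_ mg u0 g0 cvu ug gi e e0.
have mT := @measurable_Tset R.
have aeP (P : R -> Prop) : aeT P -> {ae mu, forall t, Tset t -> P t}.
  apply: negligibleS => t /= nt.
  by split; apply: contrapT => h; apply: nt => // Tt; apply: contrapT => h'.
have ig : mu.-integrable Tset (EFin \o g).
  apply/integrableP; split; first exact/measurable_EFinP.
  under eq_integral => t Tt do (rewrite /= ger0_norm; last by apply: g0; move: Tt; rewrite inE).
  move: gi; rewrite /IT /intT lte_pdivrMl ?twopi_gt0 // => /lt_le_trans; apply.
  exact: leey.
have := @dominated_convergence _ _ _ mu Tset mT (fun n => EFin \o u n) (cst 0) (EFin \o g).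
case.
- by move=> n; apply/measurable_EFinP; exact: mu_.
- exact: measurable_cst.
- apply: (aeP (fun t => (EFin \o u n) t @[n --> \oo] --> cst 0 t)).
  by apply: aeT_mono cvu => t Tt h; apply: cvg_EFin; [exact: nearW|exact: h].
- exact: ig.
- have := aeP _ (aeT_forall ug); apply: negligibleS => t /= nt h; apply: nt => n Tt.
  by rewrite lee_fin ger0_norm ?u0 // h.
move=> _ _; rewrite integral_cst // mul0e => cv.
have e1 : (0 < 2 * pi * e)%R by rewrite mulr_gt0 // twopi_gt0.
have : \forall n \near \oo, \int[mu]_(t in Tset) (EFin \o u n) t < (2 * pi * e)%:E.
  move/fine_cvgP : cv => [fn cv]; move/cvgrPdist_lt : cv => /(_ _ e1); move: fn; apply: filterS2 => n fn h.
  change ([sequence (\int[mu]_(x in Tset) (EFin \o u n) x)%E]_n n < (2 * pi * e)%:E).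
  rewrite -(fineK fn) lte_fin; move: h; rewrite /= sub0r normrN => h; exact: le_lt_trans (ler_norm _) h.
case=> N _ HN; exists N => n /HN /ltW h.
by rewrite /IT /intT lee_pdivrMl ?twopi_gt0 // -EFinM.
Qed.

End CircleMean.

(** * Measurability of boundary functions and the Poisson inequality on the circle *)

Section BoundaryValues.
Variable R : realType.
Local Notation C := R[i].
Local Notation mu := (@lebesgue_measure R).
Local Notation Tset := (@Tset R).
Implicit Types (f g : C -> C) (z w : C) (b r e t s : R).

Lemma has_radialE f t l : has_radial f t l -> radial_limit f t = l.
Proof.
move=> H; rewrite /radial_limit; apply: complexP => /=.
  apply: (@cvg_lim _ (@norm_hausdorff _ _)) => //; apply/cvgrPdist_lt => e e0.
  have [d [d0 Hd]] := H e e0; near=> r; rewrite distrC -Re_opp -Re_add.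
  apply: le_lt_trans (normRe_le _) _; apply: Hd; near: r.
  - by apply: nbhs_left_ge; exact: ltr01.
  - by apply: nbhs_left_gt; rewrite gtrBl.
  - exact: nbhs_left_lt.
apply: (@cvg_lim _ (@norm_hausdorff _ _)) => //; apply/cvgrPdist_lt => e e0.
have [d [d0 Hd]] := H e e0; near=> r; rewrite distrC -Im_opp -Im_add.
apply: le_lt_trans (normIm_le _) _; apply: Hd; near: r.
- by apply: nbhs_left_ge; exact: ltr01.
- by apply: nbhs_left_gt; rewrite gtrBl.
- exact: nbhs_left_lt.
Unshelve. all: by end_near. Qed.

(** A fixed sequence of radii tending to 1; the offset in the denominator makes even the first one
    positive. *)
Definition rad n : R := 1 - n.+2%:R^-1.

Lemma rad_gt0 n : 0 < rad n.
Proof. by rewrite subr_gt0 invf_lt1 // ltr1n. Qed.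
Lemma rad_ge0 n : 0 <= rad n. Proof. exact: ltW (rad_gt0 n). Qed.
Lemma rad_lt1 n : rad n < 1.
Proof. by rewrite gtrBl invr_gt0. Qed.
Lemma rad_gt d : 0 < d -> exists N, forall n, (N <= n)%N -> 1 - d < rad n.
Proof.
move=> d0; exists (Num.truncn d^-1) => n Nn; rewrite ltrD2l ltrN2.
by rewrite invf_plt ?posrE // (lt_le_trans (truncnS_gt _)) // ler_nat ltnS leqW.
Qed.

(** E is the set where Cauchy's criterion holds; its conditions are closed in t, so intersecting
    them over all pairs of radii does no harm. Off E the value of [lim] is the default [point],
    hence the whole function is a pointwise limit of measurable ones along [rad]. *)
Lemma lim_left_measurable (F : R -> R -> R) :
  (forall r, 0 <= r -> r < 1 -> continuous (F r)) ->
  measurable_fun setT (fun t => lim (F r t @[r --> at_left 1])).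
Proof.
move=> cF.
pose S m n (p : R * R) := [set t | [/\ rad n < p.1, p.1 < 1, rad n < p.2 & p.2 < 1] -> `|F p.1 t - F p.2 t| <= m.+1%:R^-1].
pose E := \bigcap_m \bigcup_n \bigcap_p S m n p.
have mE : measurable E.
  apply: bigcap_measurable => // m _; apply: bigcup_measurable => n _.
  apply: closed_measurable; apply: closed_bigI => -[r r'] _.
  have [h|h] := pselect ([/\ rad n < r, r < 1, rad n < r' & r' < 1]); last first.
    by rewrite (_ : S m n (r, r') = setT); [exact: closedT|apply/seteqP; split => // t _ /= /h].
  have [h1 h2 h3 h4] := h.
  rewrite (_ : S m n (r, r') = (fun t => `|F r t - F r' t|) @^-1` [set x | x <= m.+1%:R^-1]); last first.
    by apply/seteqP; split => t /=; [exact|move=> ? _].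
  apply: closed_comp; last exact: closed_le.
  move=> t _; apply: cont_abs; apply: contB; apply: cF => //; apply: le_trans (rad_ge0 n) _; exact: ltW.
have EP t : E t <-> cvg (F r t @[r --> at_left 1]).
  split=> [Et|/cvg_ex [l Hl] m _].
    apply/cauchy_cvgP/cauchyP => e e0.
    have [m Hm] : exists m : nat, m.+1%:R^-1 < e.
      by exists (Num.truncn e^-1); rewrite invf_plt ?posrE //; exact: truncnS_gt.
    have [n _ Hn] := Et m I.
    exists (F (rad n.+1) t).
    suff H : \forall r \near (1 : R)^'-, ball (F (rad n.+1) t) e (F r t) by exact: H.
    near=> r; rewrite /ball /=.
    apply: le_lt_trans Hm; apply: (Hn (rad n.+1, r)) => //=; split.
    + by rewrite ltrD2l ltrN2 ltf_pV2 ?posrE // ltr_nat.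
    + exact: rad_lt1.
    + by near: r; apply: nbhs_left_gt; exact: rad_lt1.
    + by near: r; exact: nbhs_left_lt.
  have e0 : 0 < m.+1%:R^-1 / 2 :> R by rewrite divr_gt0 // invr_gt0.
  move/cvgrPdist_lt : Hl => /(_ _ e0) [d /= d0 Hd].
  have [n Hn] := rad_gt d0; exists n => // -[r r'] _ [/= h1 h2 h3 h4].
  have near x : rad n < x -> x < 1 -> `|l - F x t| < m.+1%:R^-1 / 2.
    move=> x1 x2; apply: Hd => //; rewrite /ball /= ger0_norm ?subr_ge0 ?(ltW x2) //.
    rewrite ltrBlDl -ltrBlDr; exact: lt_trans (Hn n (leqnn n)) x1.
  rewrite -(subrKA l) [_^-1]splitr; apply: le_trans (ler_normD _ _) _.
  by rewrite addrC lerD ?ltW ?near // distrC near.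
have mP n : measurable_fun setT (fun t => F (rad n) t * \1_E t + (point : R) * \1_(~` E) t).
  apply: measurable_funD; apply: measurable_funM => //.
  - by apply: continuous_measurable_fun; apply: cF; [exact: rad_ge0|exact: rad_lt1].
  - apply: measurable_indic; exact: measurableC.
apply: (measurable_fun_cvg mP) => t _.
have [Et|nEt] := pselect (E t).
  rewrite /indic mem_set // memNset; last by move=> /=; exact.
  rewrite [X in X @ _](_ : _ = fun n => F (rad n) t); last first.
    by apply/funext => n; rewrite mulr1 mulr0 addr0.
  have ct := (EP t).1 Et; apply/cvgrPdist_lt => e e0.
  move/cvgrPdist_lt : (ct) => /(_ _ e0) [d /= d0 Hd].
  have [N HN] := rad_gt d0; exists N => // n /= Nn; apply: Hd; last exact: rad_lt1.
  rewrite /ball /= ger0_norm ?subr_ge0 ?(ltW (rad_lt1 n)) // ltrBlDl -ltrBlDr; exact: HN.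
rewrite dvgP; last by move=> h; apply: nEt; apply/EP.
rewrite /indic memNset // mem_set //.
rewrite [X in X @ _](_ : _ = fun n => point); first exact: cvg_cst.
by apply/funext => n; rewrite mulr1 mulr0 add0r.
Unshelve. all: by end_near. Qed.

Lemma measurable_radial_Re f : approx f -> measurable_fun setT (fun t => complex.Re (radial_limit f t)).
Proof. by move=> Af; apply: (@lim_left_measurable (fun r t => complex.Re (f ((r%:C)%C * expi t)))) => r r0 r1; exact: cont_circle_Re. Qed.

Lemma measurable_radial_Im f : approx f -> measurable_fun setT (fun t => complex.Im (radial_limit f t)).
Proof. by move=> Af; apply: (@lim_left_measurable (fun r t => complex.Im (f ((r%:C)%C * expi t)))) => r r0 r1; exact: cont_circle_Im. Qed.

Lemma measurable_modc (D : set R) (h : R -> C) : measurable_fun D (fun t => complex.Re (h t)) ->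
  measurable_fun D (fun t => complex.Im (h t)) -> measurable_fun D (fun t => modc (h t)).
Proof.
move=> m1 m2; rewrite (_ : (fun _ => _) = Num.sqrt \o (fun t => complex.Re (h t) ^+ 2 + complex.Im (h t) ^+ 2)).
  apply: measurableT_comp; first by apply: continuous_measurable_fun; exact: sqrt_continuous.
  by apply: measurable_funD; exact: measurable_funX.
by apply/funext => t; rewrite /modc /=; case: (h t).
Qed.

Lemma measurable_radial_mod f (D : set R) : approx f -> measurable_fun D (fun t => modc (radial_limit f t)).
Proof.
by move=> Af; apply: measurable_modc; apply: measurable_funTS; [exact: measurable_radial_Re|exact: measurable_radial_Im].
Qed.

Lemma measurable_radialB f g (D : set R) : approx f -> approx g ->
  measurable_fun D (fun t => modc (radial_limit f t - radial_limit g t)).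
Proof.
move=> Af Ag; apply: measurable_modc; apply: measurable_funTS.
  rewrite (_ : (fun _ => _) = fun t => complex.Re (radial_limit f t) - complex.Re (radial_limit g t)).
    by apply: measurable_funB; exact: measurable_radial_Re.
  by apply/funext => t; rewrite Re_add Re_opp.
rewrite (_ : (fun _ => _) = fun t => complex.Im (radial_limit f t) - complex.Im (radial_limit g t)).
  by apply: measurable_funB; exact: measurable_radial_Im.
by apply/funext => t; rewrite Im_add Im_opp.
Qed.

Definition has_rad f t := has_radial f t (radial_limit f t).

Lemma hardy2_radial f : hardy2 f -> aeT (has_rad f).
Proof.
move=> /fatou_radial; apply: aeT_mono => t _ [l Hl]; rewrite /has_rad.
by rewrite (has_radialE Hl).
Qed.

Lemma has_rad_cvg_mod f t : has_rad f t -> modc (f (((rad n)%:C)%C * expi t)) @[n --> \oo] --> modc (radial_limit f t).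
Proof.
move=> H; apply/cvgrPdist_lt => e e0; have [d [d0 Hd]] := H e e0.
have [N HN] := rad_gt d0; exists N => // n Nn.
rewrite distrC; apply: le_lt_trans (modc_dist _ _) _; apply: Hd; [exact: rad_ge0|exact: HN|exact: rad_lt1].
Qed.

(** Fatou applied to [hardy2_dilate] as q runs through [rad n]: there f(q e^{it}) tends to the
    boundary value and f(s q e^{it}) to f(s e^{it}). *)
Lemma hardy2_L2 f eta : hardy2 f -> 0 < eta -> exists s0, [/\ 0 < s0, s0 < 1 &
  forall s, s0 <= s -> s < 1 ->
   (IT (fun t => modc (f ((s%:C)%C * expi t) - radial_limit f t) ^+ 2)%R <= eta%:E)%E].
Proof.
move=> Hf eta0; have Af := hardy2_approx Hf; have pp := twopi_gt0 R.
have [s0 [s00 s01 Hs]] := hardy2_dilate Hf eta0.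
exists s0; split => // s s0s s1.
have s_ge0 : 0 <= s by apply: le_trans s0s; exact: ltW.
have ms (q : R) : 0 <= q -> q < 1 -> measurable_fun Tset (fun t => modc (f ((q%:C)%C * expi t) - f (((s * q)%:C)%C * expi t)) ^+ 2).
  move=> q0 q1; have sq0 : 0 <= s * q by rewrite mulr_ge0.
  have sq1 : s * q < 1 by apply: le_lt_trans q1; rewrite ler_piMl // ltW.
  apply: cont_measT; apply: (@cont_modsq R (fun t => f ((q%:C)%C * expi t) - f (((s * q)%:C)%C * expi t))).
    rewrite (_ : (fun _ => _) = fun t => complex.Re (f ((q%:C)%C * expi t)) - complex.Re (f (((s * q)%:C)%C * expi t))).
      by apply: contB; exact: cont_circle_Re.
    by apply/funext => t; rewrite Re_add Re_opp.
  rewrite (_ : (fun _ => _) = fun t => complex.Im (f ((q%:C)%C * expi t)) - complex.Im (f (((s * q)%:C)%C * expi t))).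
    by apply: contB; exact: cont_circle_Im.
  by apply/funext => t; rewrite Im_add Im_opp.
apply: (@IT_fatou R (fun n t => modc (f (((rad n)%:C)%C * expi t) - f (((s * rad n)%:C)%C * expi t)) ^+ 2)).
- by move=> n; apply: ms; [exact: rad_ge0|exact: rad_lt1].
- apply: measurable_funX; apply: measurable_modc; apply: measurable_funTS.
    rewrite (_ : (fun _ => _) = fun t => complex.Re (f ((s%:C)%C * expi t)) - complex.Re (radial_limit f t)).
      by apply: measurable_funB; [apply: continuous_measurable_fun; exact: cont_circle_Re|exact: measurable_radial_Re].
    by apply/funext => t; rewrite Re_add Re_opp.
  rewrite (_ : (fun _ => _) = fun t => complex.Im (f ((s%:C)%C * expi t)) - complex.Im (radial_limit f t)).
    by apply: measurable_funB; [apply: continuous_measurable_fun; exact: cont_circle_Im|exact: measurable_radial_Im].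
  by apply/funext => t; rewrite Im_add Im_opp.
- by move=> n t _; exact: sqr_ge0.
- by move=> t _; exact: sqr_ge0.
- apply: aeT_mono (hardy2_radial Hf) => t _ ht.
  rewrite modcBC.
  apply: (@cvg_comp _ _ _ (fun n => modc (f (((rad n)%:C)%C * expi t) - f (((s * rad n)%:C)%C * expi t))) (fun x => x ^+ 2)); last exact: exprn_continuous.
  apply/cvgrPdist_lt => e e0; have e2 : 0 < e / 2 by rewrite divr_gt0.
  have [d [d0 Hd]] := ht _ e2.
  have zs : modc ((s%:C)%C * expi t : C) < 1 by rewrite modc_polar.
  have [d' [d'0 Hd']] := approx_cont Af zs e2.
  have [N HN] := rad_gt d0; have [N' HN'] := rad_gt d'0.
  exists (maxn N N') => // n /=; rewrite geq_max => /andP[Nn N'n].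
  have h1 := Hd _ (rad_ge0 n) (HN _ Nn) (rad_lt1 n).
  have h2 : modc (f (((s * rad n)%:C)%C * expi t) - f ((s%:C)%C * expi t)) < e / 2.
    apply: (Hd' _ _).2; rewrite -mulrBl -realcB modcM modc_expi mulr1 modc_real.
    have -> : s * rad n - s = - (s * (1 - rad n)) by ring.
    have q1 := rad_lt1 n; rewrite normrN ger0_norm; last by rewrite mulr_ge0 ?subr_ge0 // ltW.
    apply: (@le_lt_trans _ _ (1 - rad n)); first by rewrite ler_piMl ?subr_ge0 // ltW.
    by rewrite ltrBlDr -ltrBlDl; exact: HN'.
  set x := radial_limit f t in h1 *; set y := f ((s%:C)%C * expi t) in h2 *.
  set x' := f (((rad n)%:C)%C * expi t) in h1 *; set y' := f (((s * rad n)%:C)%C * expi t) in h2 *.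
  rewrite distrC; apply: le_lt_trans (modc_dist _ _) _.
  have -> : x' - y' - (x - y) = (x' - x) - (y' - y) by ring.
  by apply: le_lt_trans (modcB _ _) _; rewrite [e]splitr ltrD.
- move=> n; have sq0 : 0 <= s * rad n by rewrite mulr_ge0 // rad_ge0.
  have q1 := rad_lt1 n; have q0 := rad_ge0 n.
  have sq1 : s * rad n < 1 by apply: le_lt_trans q1; rewrite ler_piMl // ltW.
  rewrite IT_per.
    by rewrite lee_fin ler_pdivrMl //; apply: Hs => //; exact: ltW.
  apply: (@cont_modsq R (fun t => f (((rad n)%:C)%C * expi t) - f (((s * rad n)%:C)%C * expi t))).
    rewrite (_ : (fun _ => _) = fun t => complex.Re (f (((rad n)%:C)%C * expi t)) - complex.Re (f (((s * rad n)%:C)%C * expi t))).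
      by apply: contB; exact: cont_circle_Re.
    by apply/funext => t; rewrite Re_add Re_opp.
  rewrite (_ : (fun _ => _) = fun t => complex.Im (f (((rad n)%:C)%C * expi t)) - complex.Im (f (((s * rad n)%:C)%C * expi t))).
    by apply: contB; exact: cont_circle_Im.
  by apply/funext => t; rewrite Im_add Im_opp.
Qed.

Lemma amgm (m eta : R) : 0 < eta -> m <= m ^+ 2 / (2 * eta) + eta / 2.
Proof.
move=> e0; have -> : m ^+ 2 / (2 * eta) + eta / 2 = m + (m - eta) ^+ 2 / (2 * eta) by field; rewrite gt_eqF.
by rewrite lerDl divr_ge0 ?sqr_ge0 // ltW // mulr_gt0.
Qed.

(** The inequality on the circle of radius s is passed to s -> 1: for fixed z the kernel is at most
    K, and [amgm] converts mean square convergence into convergence in mean. *)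
Lemma poisson_boundary f z : hardy2 f -> modc z < 1 ->
  ((modc (f z))%:E <= IT (fun t => pk z t * modc (radial_limit f t))%R)%E.
Proof.
move=> Hf z1; have Af := hardy2_approx Hf; have pp := twopi_gt0 R.
have z0 := modc_ge0 z.
pose K := 2 / (1 - modc z).
have K0 : 0 < K by rewrite divr_gt0 // subr_gt0.
have mpk : measurable_fun Tset (pk z) by apply: cont_measT; exact: pk_cont.
have mr : measurable_fun Tset (fun t => modc (radial_limit f t)) by exact: measurable_radial_mod.
have mF : measurable_fun Tset (fun t => pk z t * modc (radial_limit f t)) by exact: measurable_funM.
have F0 t : 0 <= pk z t * modc (radial_limit f t) by rewrite mulr_ge0 ?pk_ge0 ?modc_ge0.
apply/lee_addgt0Pr => e e0.
(* With mean square error eta^2 the total loss is (K / (2 eta)) eta^2 + K eta / 2 = K eta = e /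
   2. *)
pose eta := e / 2 / K.
have eta0 : 0 < eta by rewrite divr_gt0 // divr_gt0.
have [s0 [s00 s01 Hs]] := hardy2_L2 Hf (exprn_gt0 2 eta0).
have e2 : 0 < e / 2 by rewrite divr_gt0.
have [d [d0 Hd]] := approx_cont Af z1 e2.
pose s := Num.max s0 (1 - Num.min 1 d / 2).
have d'0 : 0 < Num.min 1 d by rewrite lt_min ltr01.
have d'1 : Num.min 1 d <= 1 by rewrite ge_min lexx.
have d'd : Num.min 1 d <= d by rewrite ge_min lexx orbT.
have s1 : s < 1 by rewrite gt_max s01 /=; lra.
have ss0 : s0 <= s by rewrite le_max lexx.
have sge0 : 0 <= s by apply: le_trans ss0; exact: ltW.
have sd : 1 - s < d.
  have : 1 - Num.min 1 d / 2 <= s by rewrite le_max lexx orbT.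
  lra.
have h1 : modc (f z) <= modc (f ((s%:C)%C * z)) + e / 2.
  rewrite -lerBlDl; apply: le_trans (modc_distr _ _) _; rewrite modcBC; apply: ltW.
  apply: (Hd _ _).2.
  have -> : (s%:C)%C * z - z = - (((1 - s)%:C)%C * z) by rewrite realcB; ring.
  rewrite modcN modcM modc_real ger0_norm; last by rewrite subr_ge0 ltW.
  by apply: le_lt_trans sd; rewrite ler_piMr ?subr_ge0 // ltW.
have h2 : ((modc (f ((s%:C)%C * z)))%:E <= IT (fun t => pk z t * modc (f ((s%:C)%C * expi t)))%R)%E.
  rewrite IT_per; last by apply: contM; [exact: pk_cont|exact: cont_circle_mod].
  by rewrite lee_fin ler_pdivlMl //; exact: poisson_mod.
pose G t := modc (f ((s%:C)%C * expi t) - radial_limit f t) ^+ 2.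
have mG : measurable_fun Tset G.
  apply: measurable_funX; apply: measurable_modc; apply: measurable_funTS.
    rewrite (_ : (fun _ => _) = fun t => complex.Re (f ((s%:C)%C * expi t)) - complex.Re (radial_limit f t)).
      by apply: measurable_funB; [apply: continuous_measurable_fun; exact: cont_circle_Re|exact: measurable_radial_Re].
    by apply/funext => t; rewrite Re_add Re_opp.
  rewrite (_ : (fun _ => _) = fun t => complex.Im (f ((s%:C)%C * expi t)) - complex.Im (radial_limit f t)).
    by apply: measurable_funB; [apply: continuous_measurable_fun; exact: cont_circle_Im|exact: measurable_radial_Im].
  by apply/funext => t; rewrite Im_add Im_opp.
have c0 : 0 <= K / (2 * eta) by apply: ltW; rewrite divr_gt0 // mulr_gt0.
have c1 : 0 <= K * eta / 2 by apply: ltW; rewrite divr_gt0 // mulr_gt0.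
have h3 : (IT (fun t => pk z t * modc (f ((s%:C)%C * expi t)))%R <=
   IT (fun t => pk z t * modc (radial_limit f t))%R + (e / 2)%:E)%E.
  apply: (@le_trans _ _ (IT (fun t => pk z t * modc (radial_limit f t) + (K / (2 * eta) * G t + K * eta / 2))%R)).
    apply: IT_le.
    - by apply: measurable_funM => //; apply: cont_measT; exact: cont_circle_mod.
    - apply: measurable_funD => //; apply: measurable_funD => //; exact: measurable_funM.
    - by move=> t _; rewrite mulr_ge0 ?pk_ge0 ?modc_ge0.
    - move=> t _; set x := f _; set y := radial_limit f t.
      have hx : modc x <= modc y + modc (x - y) by rewrite -lerBlDl modc_distr.
      have hp := pk_le t z1; have hp0 := pk_ge0 t z1; rewrite -/K in hp.
      have hm := modc_ge0 (x - y).
      have hG : G t = modc (x - y) ^+ 2 by [].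
      have h4 : modc (x - y) <= G t / (2 * eta) + eta / 2.
        by rewrite hG; exact: amgm.
      apply: (@le_trans _ _ (pk z t * (modc y + modc (x - y)))); first by rewrite ler_wpM2l.
      rewrite mulrDr lerD2l.
      apply: (@le_trans _ _ (K * (G t / (2 * eta) + eta / 2))); first by rewrite ler_pM.
      by rewrite [leRHS](_ : _ = K * (G t / (2 * eta) + eta / 2)) //; ring.
  rewrite ITD //; last 2 first.
  - apply: measurable_funD => //; exact: measurable_funM.
  - by move=> t _; rewrite addr_ge0 // mulr_ge0 // sqr_ge0.
  apply: leeD2l; rewrite ITD //; last 2 first.
  - exact: measurable_funM.
  - by move=> t _; rewrite mulr_ge0 // sqr_ge0.
  rewrite IT_cst ITZ //; last by move=> t _; exact: sqr_ge0.
  apply: (@le_trans _ _ ((K / (2 * eta))%:E * (eta ^+ 2)%:E + (K * eta / 2)%:E)%E).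
    by apply: leeD2r; apply: lee_wpmul2l; rewrite ?lee_fin // Hs.
  rewrite -EFinM -EFinD lee_fin le_eqVlt; apply/orP; left; apply/eqP.
  have -> : e = 2 * (eta * K) by rewrite /eta divfK ?gt_eqF //; lra.
  by field; rewrite gt_eqF.
apply: (@le_trans _ _ ((modc (f ((s%:C)%C * z)))%:E + (e / 2)%:E)%E); first by rewrite -EFinD lee_fin.
have -> : e%:E = ((e / 2)%:E + (e / 2)%:E)%E by rewrite -EFinD -splitr.
rewrite addeA; apply: leeD2r; exact: le_trans h2 h3.
Qed.

End BoundaryValues.

(** * Modulars and the Luxemburg norm *)

Section LuxemburgNorm.
Variables (R : realType) (Psi : R -> R).
Hypothesis oPsi : orlicz Psi.
Local Notation C := R[i].
Local Notation Tset := (@Tset R).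
Implicit Types (h k : R -> R) (c d t : R).

(* the modular of h / c *)
Definition om c h : \bar R := IT (fun t => Psi (`|h t| / c)).

Lemma om_meas (D : set R) h c : 0 < c -> measurable_fun D h -> measurable_fun D (fun t => Psi (`|h t| / c)).
Proof.
move=> c0 mh; rewrite (_ : (fun _ => _) = (fun x => Psi `|x|) \o (fun t => h t * c^-1)).
  apply: measurableT_comp; first by apply: continuous_measurable_fun; exact: orlicz_abs_continuous.
  by apply: measurable_funM.
by apply/funext => t /=; rewrite normrM [`|c^-1|]ger0_norm // invr_ge0 ltW.
Qed.

Lemma om_pos h c t : 0 < c -> 0 <= Psi (`|h t| / c).
Proof. by move=> c0; rewrite orlicz_ge0 // divr_ge0 // ltW. Qed.

Lemma om_ge0 h c : 0 < c -> (0 <= om c h)%E.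
Proof. by move=> c0; apply: IT_ge0 => t _; exact: om_pos. Qed.

Lemma om_le h k c : 0 < c -> measurable_fun Tset h -> measurable_fun Tset k ->
  aeT (fun t => `|h t| <= `|k t|) -> (om c h <= om c k)%E.
Proof.
move=> c0 mh mk hk; apply: IT_ae_le; try exact: om_meas; try by move=> t _; exact: om_pos.
by apply: aeT_mono hk => t _ h1; rewrite orlicz_le // ?divr_ge0 ?(ltW c0) // ler_wpM2r // invr_ge0 ltW.
Qed.

Lemma om_antimono h c d : 0 < c -> c <= d -> measurable_fun Tset h -> (om d h <= om c h)%E.
Proof.
move=> c0 cd mh; have d0 : 0 < d by apply: lt_le_trans cd.
apply: IT_le; try exact: om_meas; first by move=> t _; exact: om_pos.
by move=> t _; rewrite orlicz_le // ?divr_ge0 ?(ltW d0) // ler_wpM2l // lef_pV2.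
Qed.

Lemma lux_ge0 h : 0 <= lux Psi h.
Proof.
rewrite /lux; set A := [set c | _]; have [[a Aa]|nA] := pselect (A !=set0).
  by apply: lb_le_inf; [exists a|move=> c [/ltW]].
by rewrite (_ : A = set0) ?inf0 //; apply/seteqP; split => // c Ac; apply: nA; exists c.
Qed.

Lemma lux_le h c : 0 < c -> (om c h <= 1%:E)%E -> lux Psi h <= c.
Proof. by move=> c0 hc; apply: ge_inf => //; exists 0 => d [/ltW]. Qed.

(** The infimum of an empty set is 0 by convention, so the norm controls the modular only when some
    admissible scale is known; c0 is that witness. *)
Lemma om_lux h c c0 : measurable_fun Tset h -> 0 < c0 -> (om c0 h <= 1%:E)%E ->
  lux Psi h < c -> (om c h <= 1%:E)%E.
Proof.
move=> mh c00 hc0 lc; have hi : has_inf [set c : R | 0 < c /\ (intT (fun t => (Psi (`|h t| / c))%:E) <= 1%:E)%E].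
  by split; [exists c0|exists 0 => d [/ltW]].
have e0 : 0 < c - lux Psi h by rewrite subr_gt0.
have [d [d0 hd]] := inf_adherent e0 hi; rewrite addrC subrK => dc.
by apply: le_trans hd; apply: om_antimono => //; exact: ltW.
Qed.

(** (x + y)/(c + d) is the convex combination of x/c and y/d with weights c/(c + d) and d/(c +
    d). *)
Lemma om_tri h1 h2 h c d : 0 < c -> 0 < d -> measurable_fun Tset h1 -> measurable_fun Tset h2 ->
  measurable_fun Tset h -> aeT (fun t => `|h t| <= `|h1 t| + `|h2 t|) ->
  (om c h1 <= 1%:E)%E -> (om d h2 <= 1%:E)%E -> (om (c + d) h <= 1%:E)%E.
Proof.
move=> c0 d0 m1 m2 mh H o1 o2; have cd0 : 0 < c + d by rewrite addr_gt0.
pose l := c / (c + d).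
have l0 : 0 <= l by rewrite divr_ge0 ?ltW.
have l1 : l <= 1 by rewrite ler_pdivrMr // mul1r lerDl ltW.
have l1' : 0 <= 1 - l by rewrite subr_ge0.
apply: (@le_trans _ _ (IT (fun t => l * Psi (`|h1 t| / c) + (1 - l) * Psi (`|h2 t| / d)))).
  apply: IT_ae_le.
  - exact: om_meas.
  - by apply: measurable_funD; apply: measurable_funM => //; exact: om_meas.
  - by move=> t _; exact: om_pos.
  - by move=> t _; rewrite addr_ge0 // mulr_ge0 // om_pos.
  - apply: aeT_mono H => t _ Ht.
    have x0 : 0 <= `|h1 t| / c by rewrite divr_ge0 // ltW.
    have y0 : 0 <= `|h2 t| / d by rewrite divr_ge0 // ltW.
    have l01 : 0 <= l <= 1 by rewrite l0.
    apply: le_trans (orlicz_convex oPsi x0 y0 l01).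
    apply: (orlicz_le oPsi); first by rewrite divr_ge0 // ltW.
    have -> : l * (`|h1 t| / c) + (1 - l) * (`|h2 t| / d) = (`|h1 t| + `|h2 t|) / (c + d).
      by rewrite /l; field; rewrite ?(gt_eqF c0) ?(gt_eqF d0) ?(gt_eqF cd0).
    by rewrite ler_wpM2r // invr_ge0 ltW.
rewrite ITD.
- rewrite !ITZ //; try exact: om_meas; try by move=> t _; exact: om_pos.
  apply: (@le_trans _ _ (l%:E * 1%:E + (1 - l)%:E * 1%:E)%E).
    by apply: leeD; apply: lee_wpmul2l; rewrite ?lee_fin.
  by rewrite -!EFinM -EFinD !mulr1 addrC subrK.
- by apply: measurable_funM => //; exact: om_meas.
- by apply: measurable_funM => //; exact: om_meas.
- by move=> t _; rewrite mulr_ge0 // om_pos.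
- by move=> t _; rewrite mulr_ge0 // om_pos.
Qed.

Lemma lux_triangle h1 h2 h c d : 0 < c -> 0 < d -> measurable_fun Tset h1 -> measurable_fun Tset h2 ->
  measurable_fun Tset h -> aeT (fun t => `|h t| <= `|h1 t| + `|h2 t|) ->
  (om c h1 <= 1%:E)%E -> (om d h2 <= 1%:E)%E -> lux Psi h <= lux Psi h1 + lux Psi h2.
Proof.
move=> c0 d0 m1 m2 mh H o1 o2; apply/ler_addgt0Pr => e e0.
have e2 : 0 < e / 2 by rewrite divr_gt0.
have p1 : lux Psi h1 < lux Psi h1 + e / 2 by rewrite ltrDl.
have p2 : lux Psi h2 < lux Psi h2 + e / 2 by rewrite ltrDl.
have q1 := om_lux m1 c0 o1 p1; have q2 := om_lux m2 d0 o2 p2.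
have r1 : 0 < lux Psi h1 + e / 2 by apply: le_lt_trans p1; exact: lux_ge0.
have r2 : 0 < lux Psi h2 + e / 2 by apply: le_lt_trans p2; exact: lux_ge0.
have -> : lux Psi h1 + lux Psi h2 + e = lux Psi h1 + e / 2 + (lux Psi h2 + e / 2) by field.
by apply: lux_le; [rewrite addr_gt0|exact: (om_tri r1 r2 m1 m2 mh H q1 q2)].
Qed.

(** By convexity, enlarging the scale by the factor 1 + x divides a modular of value x by at least 1
    + x. *)
Lemma om_fin_le1 h c : 0 < c -> measurable_fun Tset h -> (om c h < +oo)%E ->
  exists d, c <= d /\ (om d h <= 1%:E)%E.
Proof.
move=> c0 mh hf; have o0 := om_ge0 h c0.
pose x := fine (om c h); have x0 : 0 <= x by exact: fine_ge0.
have ox : om c h = x%:E by rewrite /x fineK // ge0_fin_numE.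
have x1 : 0 < 1 + x by rewrite ltr_pwDl.
exists (c * (1 + x)); split; first by rewrite ler_peMr ?(ltW c0) // lerDl.
have cx0 : 0 < c * (1 + x) by rewrite mulr_gt0.
have ix : 0 <= (1 + x)^-1 by rewrite invr_ge0 ltW.
apply: (@le_trans _ _ (IT (fun t => (1 + x)^-1 * Psi (`|h t| / c)))).
  apply: IT_le.
  - exact: om_meas.
  - by apply: measurable_funM => //; exact: om_meas.
  - by move=> t _; exact: om_pos.
  - move=> t _; rewrite invfM mulrA mulrC; apply: (orlicz_scale oPsi); first by rewrite divr_ge0 // ltW.
    by rewrite ix /= invf_le1 // lerDl.
rewrite ITZ //; [|exact: om_meas|by move=> t _; exact: om_pos].
by rewrite -[IT _]/(om c h) ox -EFinM lee_fin mulrC ler_pdivrMr // mul1r lerDr.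
Qed.

End LuxemburgNorm.

(** * H^Psi inside H^2, pointwise growth, and Jensen's inequality at a point *)

Section HardyOrliczSpace.
Variables (R : realType) (Psi : R -> R).
Hypotheses (oPsi : orlicz Psi) (dPsi : Delta2 Psi).
Local Notation C := R[i].
Local Notation mu := (@lebesgue_measure R).
Local Notation Tset := (@Tset R).
Implicit Types (f g : C -> C) (z w : C) (c d M t r : R).

Local Opaque pk.

Definition hpsi f M := forall r, 0 <= r -> r < 1 ->
  (IT (fun t => Psi (modc (f ((r%:C)%C * expi t)) / M))%R <= 1%:E)%E.

Lemma hpsiP f : HPsi Psi f <-> analytic_disc f /\ exists M, 0 < M /\ hpsi f M.
Proof.
split=> -[af [M [M0 HM]]]; split => //; exists M; split => //.
  by move=> r r0 r1; apply: HM; rewrite r0.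
by move=> r /andP[r0 r1]; exact: HM.
Qed.

Lemma HPsi_approx f : HPsi Psi f -> approx f.
Proof. by move=> [/analytic_approx]. Qed.

Lemma cont_Psi (h : R -> R) c : 0 < c -> continuous h -> (forall t, 0 <= h t) ->
  continuous (fun t => Psi (h t / c)).
Proof.
move=> c0 ch h0; rewrite (_ : (fun _ => _) = fun t => Psi `|h t * c^-1|).
  apply: (@cont_comp R (fun x => Psi `|x|)); first exact: orlicz_abs_continuous.
  by apply: contM => //; exact: cont_cst.
by apply/funext => t; rewrite ger0_norm // divr_ge0 // ltW.
Qed.

(** As x^2 <= X + Psi x, Parseval bounds each finite sum of |a_k|^2 r^(2k) by B for every r < 1; the
    limit r -> 1 is made by an explicit choice of r. *)
Lemma hpsi_hardy2 f : HPsi Psi f -> hardy2 f.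
Proof.
move=> /hpsiP [[a Ha] [M [M0 HM]]]; have Af : approx f by apply: analytic_approx; exists a.
have pp := twopi_gt0 R; have [X [X0 HX]] := delta2_sqr_le oPsi dPsi.
pose B := M ^+ 2 * (X + 1); exists a, B; split => // n.
have B0 : 0 < B by rewrite mulr_gt0 ?exprn_gt0 // addr_gt0.
have bd r : 0 <= r -> r < 1 -> \sum_(k < n) modc (a k * ((r ^+ k)%:C)%C) ^+ 2 <= B.
  move=> r0 r1; pose h t := f ((r%:C)%C * expi t).
  have c1 := cont_circle_Re Af r0 r1; have c2 := cont_circle_Im Af r0 r1.
  have h3 e : 0 < e -> exists N, forall m, (N <= m)%N -> forall t,
     modc (h t - \sum_(k < m) (a k * ((r ^+ k)%:C)%C) * expi (k%:R * t)) <= e.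
    move=> e0; have [N HN] := psum_unif r0 r1 Ha e0; exists N => m Nm t.
    under eq_bigr do rewrite -mulrA -polarX.
    by apply: HN => //; rewrite modc_polar.
  have hB : per 0 (fun t => modc (h t) ^+ 2) <= 2 * pi * B.
    have cP : continuous (fun t => Psi (modc (h t) / M)).
      by apply: cont_Psi => //; [exact: cont_circle_mod|move=> t; exact: modc_ge0].
    have := HM r r0 r1; rewrite IT_per // lee_fin ler_pdivrMl // mulr1 => hP.
    apply: (@le_trans _ _ (per 0 (fun t => M ^+ 2 * (X + Psi (modc (h t) / M))))).
      apply: per_le; [exact: cont_modsq|by apply: contM; [exact: cont_cst|apply: contD => //; exact: cont_cst]|].
      move=> t; have := HX (modc (h t) / M); rewrite divr_ge0 ?modc_ge0 ?(ltW M0) // => /(_ isT).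
      by rewrite expr_div_n ler_pdivrMr ?exprn_gt0 // mulrC.
    rewrite perZ; last by apply: contD => //; exact: cont_cst.
    rewrite perD //; last exact: cont_cst.
    rewrite per_cst /B mulrCA ler_wpM2l ?sqr_ge0 //.
    by rewrite [leRHS]mulrDr mulr1 lerD2l.
  apply/ler_addgt0Pr => e e0; have [N HN] := @parseval_unif R 0 (fun k => a k * ((r ^+ k)%:C)%C) h c1 c2 h3 _ (mulr_gt0 pp e0).
  have := HN (maxn N n) (leq_maxl _ _); rewrite ler_distl => /andP[h4 h5].
  have h6 : \sum_(k < maxn N n) modc (a k * ((r ^+ k)%:C)%C) ^+ 2 <= B + e.
    rewrite -(ler_pM2l pp) [leRHS]mulrDr; move: h4; rewrite lerBlDr => h4; apply: le_trans h4 _; by rewrite lerD2r.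
  apply: le_trans h6; have := leq_maxr N n; move: (maxn N n) => m nm.
  rewrite -!(big_mkord xpredT (fun k => modc (a k * ((r ^+ k)%:C)%C) ^+ 2)) (big_cat_nat (n := n) (p := m)) //=.
  by rewrite lerDl sumr_ge0 // => k _; exact: sqr_ge0.
set A := \sum_(k < n) _; have A0 : 0 <= A by apply: sumr_ge0 => k _; exact: sqr_ge0.
rewrite leNgt; apply/negP => BA.
(* Since r^(2k) >= 1 - 2 n e for r = 1 - e, a sum A above B would lose less than A - B,
   contradicting the bound at radius r. *)
pose e := (A - B) / (2 * (A + 1) * (n%:R + 1)).
have AB : 0 < A - B by rewrite subr_gt0.
have n1 : 1 <= n%:R + 1 :> R by rewrite lerDr.
have A1 : 0 < 2 * (A + 1) by rewrite mulr_gt0 // ltr_wpDl.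
have den : 0 < 2 * (A + 1) * (n%:R + 1) by rewrite mulr_gt0 // (lt_le_trans _ n1).
have e0 : 0 < e by rewrite divr_gt0.
have ee : e * (2 * (A + 1) * (n%:R + 1)) = A - B by rewrite /e divfK // gt_eqF.
have e1 : e <= 2^-1.
  rewrite /e ler_pdivrMr //; apply: (@le_trans _ _ A); first by rewrite lerBlDr lerDl ltW.
  rewrite mulrA mulKf //; apply: (@le_trans _ _ ((A + 1) * 1)); first by rewrite mulr1 lerDl.
  by rewrite ler_wpM2l // addr_ge0.
have r0 : 0 <= 1 - e by lra.
have r1 : 1 - e < 1 by lra.
have := bd _ r0 r1; have le : (1 - 2 * (n%:R * e)) * A <= \sum_(k < n) modc (a k * (((1 - e) ^+ k)%:C)%C) ^+ 2.
  rewrite mulr_sumr; apply: ler_sum => k _; rewrite modcM modc_real exprMn mulrC ler_wpM2l ?sqr_ge0 //.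
  rewrite real_normK ?num_real // -exprM mulnC.
  have := @ler_expr1n R (1 - e) (2 * k) r0 (ltW r1).
  have : (2 * k)%:R * e <= 2 * (n%:R * e) by rewrite natrM -mulrA ler_wpM2l // ler_wpM2r ?(ltW e0) // ler_nat ltnW.
  rewrite (_ : 1 - (1 - e) = e); last by ring.
  lra.
move=> h; have {h le} h := le_trans le h.
have : 2 * (n%:R * e) * A <= e * (2 * (A + 1) * (n%:R + 1)) - e.
  have : 0 <= n%:R :> R by [].
  have : 0 <= A * e by rewrite mulr_ge0 // ltW.
  have : 0 <= n%:R * e by rewrite mulr_ge0 // ltW.
  lra.
rewrite ee; lra.
Qed.

Lemma hpsi_boundary f M : approx f -> hardy2 f -> 0 < M -> hpsi f M ->
  (om Psi M (fun t => modc (radial_limit f t)) <= 1%:E)%E.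
Proof.
move=> Af Hf M0 HM.
pose u (n : nat) t := Psi (modc (f (((rad R n)%:C)%C * expi t)) / M).
have F := @IT_fatou R u (fun t => Psi (`|modc (radial_limit f t)| / M)) 1.
rewrite /om /u in F *; apply: F.
- move=> n; apply: cont_measT; apply: cont_Psi => //; last by move=> t; exact: modc_ge0.
  by apply: cont_circle_mod => //; [exact: rad_ge0|exact: rad_lt1].
- by apply: om_meas => //; exact: measurable_radial_mod.
- by move=> n t _; rewrite orlicz_ge0 // divr_ge0 ?modc_ge0 // ltW.
- by move=> t _; exact: om_pos.
- apply: aeT_mono (hardy2_radial Hf) => t _ ht.
  have E x : 0 <= x -> Psi (x / M) = Psi `|x / M|.
    by move=> x0; rewrite ger0_norm // divr_ge0 // ltW.
  rewrite ger0_norm ?modc_ge0 // E ?modc_ge0 //.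
  rewrite (_ : (fun n => _) = (fun n => Psi `|modc (f (((rad R n)%:C)%C * expi t)) / M|)); last first.
    by apply/funext => n; rewrite E ?modc_ge0.
  apply: (@cvg_comp _ _ _ (fun n => modc (f (((rad R n)%:C)%C * expi t)) / M) (fun x => Psi `|x|)); last exact: orlicz_abs_continuous.
  by apply: cvgM; [exact: has_rad_cvg_mod|exact: cvg_cst].
- by move=> n; apply: HM; [exact: rad_ge0|exact: rad_lt1].
Qed.

Lemma HPsi_om f : HPsi Psi f -> exists M, 0 < M /\ (om Psi M (fun t => modc (radial_limit f t)) <= 1%:E)%E.
Proof.
move=> Hf; have Af := HPsi_approx Hf; have Hf2 := hpsi_hardy2 Hf.
have [_ [M [M0 HM]]] := (hpsiP f).1 Hf.
by exists M; split => //; exact: hpsi_boundary.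
Qed.

Lemma normH_le f M : HPsi Psi f -> 0 < M -> hpsi f M -> normH Psi f <= M.
Proof.
move=> Hf M0 HM; apply: lux_le => //.
by apply: hpsi_boundary => //; [exact: HPsi_approx|exact: hpsi_hardy2].
Qed.

Lemma HPsi_rad f : HPsi Psi f -> aeT (has_rad f).
Proof. by move=> /hpsi_hardy2 /hardy2_radial. Qed.

Lemma HPsi_om_lt f c : HPsi Psi f -> normH Psi f < c -> (om Psi c (fun t => modc (radial_limit f t)) <= 1%:E)%E.
Proof.
move=> Hf fc; have [M [M0 HM]] := HPsi_om Hf.
apply: (om_lux oPsi _ M0 HM) => //; apply: measurable_radial_mod; exact: HPsi_approx.
Qed.

Lemma IT_pk z : modc z < 1 -> IT (pk z) = 1%:E.
Proof.
by move=> z1; rewrite IT_per; [rewrite per_pk // mulVf // gt_eqF // twopi_gt0|exact: pk_cont].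
Qed.

(** With Psi x = 1/d, [orlicz_young] gives y <= c x + c x d Psi(y/c). The Poisson kernel has mean 1
    and is at most 2/d, so the two terms contribute c x and 2 c x, whence the factor 3. *)
Lemma hpsi_growth f c z : hardy2 f -> 0 < c -> (om Psi c (fun t => modc (radial_limit f t)) <= 1%:E)%E ->
  modc z < 1 -> modc (f z) <= 3 * c * PsiInv Psi (1 - modc z)^-1.
Proof.
move=> Hf c0 oc z1; have Af := hardy2_approx Hf.
have d0 : 0 < 1 - modc z by rewrite subr_gt0.
set d := 1 - modc z in d0 *; set x := PsiInv Psi d^-1.
have x0 : 0 < x by apply: PsiInv_gt0 => //; rewrite invr_gt0.
have Px : Psi x = d^-1 by apply: PsiInvK => //; rewrite invr_ge0 ltW.
have mr : measurable_fun Tset (fun t => modc (radial_limit f t)) by exact: measurable_radial_mod.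
have mpk : measurable_fun Tset (pk z) by apply: cont_measT; exact: pk_cont.
have mP := om_meas oPsi c0 mr.
have := poisson_boundary Hf z1.
pose K := c * x * d * (2 / d).
have h1 : (IT (fun t => (pk z t * modc (radial_limit f t))%R)%R <=
   IT (fun t => (c * x * pk z t + K * Psi (`|modc (radial_limit f t)| / c))%R)%R)%E.
  apply: IT_le.
  - exact: measurable_funM.
  - by apply: measurable_funD; apply: measurable_funM.
  - by move=> t _; rewrite mulr_ge0 ?pk_ge0 ?modc_ge0.
  - move=> t _; rewrite ger0_norm ?modc_ge0 //; set y := modc (radial_limit f t).
    have y0 : 0 <= y / c by rewrite divr_ge0 ?modc_ge0 // ltW.
    have := orlicz_young oPsi x0 y0; rewrite Px => h.
    have h2 : y <= c * x + c * x * d * Psi (y / c).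
      move: h; rewrite -(ler_pM2r (mulr_gt0 c0 d0)) mulrDl.
      have -> : y / c / d * (c * d) = y by field; rewrite !gt_eqF.
      have -> : x / d * (c * d) = c * x by field; rewrite gt_eqF.
      by rewrite (_ : x * Psi (y / c) * (c * d) = c * x * d * Psi (y / c)) //; ring.
    have p0 := pk_ge0 t z1; have pl := pk_le t z1; rewrite -/d in pl.
    apply: (@le_trans _ _ (pk z t * (c * x + c * x * d * Psi (y / c)))); first by rewrite ler_wpM2l.
    rewrite mulrDr [pk z t * (c * x)]mulrC lerD2l /K.
    rewrite (_ : pk z t * (c * x * d * Psi (y / c)) = pk z t * Psi (y / c) * (c * x * d)); last by ring.
    have cxd : 0 <= c * x * d by rewrite !mulr_ge0 // ltW.
    rewrite [leRHS](_ : _ = 2 / d * Psi (y / c) * (c * x * d)); last by ring.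
    by rewrite ler_wpM2r // ler_wpM2r // orlicz_ge0.
move=> /le_trans /(_ h1).
have K0 : 0 <= K by rewrite !mulr_ge0 ?invr_ge0 // ltW.
rewrite ITD.
- have cx0 : 0 <= c * x by rewrite mulr_ge0 // ltW.
  have o0 t : Tset t -> 0 <= Psi (`|modc (radial_limit f t)| / c) by move=> _; exact: om_pos.
  rewrite (ITZ cx0 mpk (fun t _ => pk_ge0 t z1)) (ITZ K0 mP o0).
  rewrite IT_pk // -/(om Psi c (fun t => modc (radial_limit f t))) => h.
  have : ((modc (f z))%:E <= (c * x)%:E * 1%:E + K%:E * 1%:E)%E.
    by apply: le_trans h _; apply: leeD2l; apply: lee_wpmul2l; rewrite ?lee_fin.
  rewrite -!EFinM -EFinD lee_fin !mulr1 /K.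
  have -> : c * x * d * (2 / d) = 2 * (c * x) by field; rewrite gt_eqF.
  lra.
- exact: measurable_funM.
- exact: measurable_funM.
- by move=> t _; apply: mulr_ge0; [rewrite mulr_ge0 // ltW|exact: pk_ge0].
- by move=> t _; rewrite mulr_ge0 // om_pos.
Qed.

Lemma HPsi_growth f z : HPsi Psi f -> modc z < 1 ->
  modc (f z) <= 3 * PsiInv Psi (1 - modc z)^-1 * normH Psi f.
Proof.
move=> Hf z1; set x := PsiInv Psi _.
have d0 : 0 < 1 - modc z by rewrite subr_gt0.
have x0 : 0 < x by apply: PsiInv_gt0 => //; rewrite invr_gt0.
apply/ler_addgt0Pr => e e0; pose c := normH Psi f + e / (3 * x).
have x3 : 0 < 3 * x by rewrite mulr_gt0.
have fc : normH Psi f < c by rewrite ltrDl divr_gt0.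
have c0 : 0 < c by apply: le_lt_trans fc; exact: lux_ge0.
have := hpsi_growth (hpsi_hardy2 Hf) c0 (HPsi_om_lt Hf fc) z1; rewrite -/x.
by rewrite mulrAC /c mulrDr [X in _ + X]mulrC divfK // gt_eqF.
Qed.

(** Average the supporting line of Psi at |f z| / c against the Poisson kernel, a density of mean
    1. *)
Lemma jensen_point f c z : hardy2 f -> 0 < c -> modc z < 1 ->
  ((Psi (modc (f z) / c))%:E <= IT (fun t => (pk z t * Psi (`|modc (radial_limit f t)| / c))%R)%R)%E.
Proof.
move=> Hf c0 z1; have Af := hardy2_approx Hf.
have mr : measurable_fun Tset (fun t => modc (radial_limit f t)) by exact: measurable_radial_mod.
have mpk : measurable_fun Tset (pk z) by apply: cont_measT; exact: pk_cont.
have mP := om_meas oPsi c0 mr.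
have p0 t := pk_ge0 t z1.
have r0 : (0 <= IT (fun t => (pk z t * Psi (`|modc (radial_limit f t)| / c))%R)%R)%E.
  by apply: IT_ge0 => t _; rewrite mulr_ge0 // om_pos.
set x := modc (f z) / c.
have x0 : 0 <= x by rewrite divr_ge0 ?modc_ge0 // ltW.
move: x0; rewrite le_eqVlt => /predU1P[<-|x0]; first by rewrite orlicz0.
have [s Hs] := orlicz_support oPsi x0.
(* The boundary formula bounds |f z| only from above, so it may be multiplied by the slope only if
   the slope is nonnegative. *)
have s0 : 0 <= s.
  have := Hs 0 (lexx _); rewrite orlicz0 // sub0r mulrN subr_le0 => h.
  by rewrite -(pmulr_lge0 _ x0) (le_trans _ h) // orlicz_ge0 // ltW.
have sc : 0 <= s / c by rewrite divr_ge0 // ltW.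
have Px : 0 <= Psi x by rewrite orlicz_ge0 // ltW.
have sx : 0 <= s * x by rewrite mulr_ge0 // ltW.
have h1 : (IT (fun t => (Psi x * pk z t + s / c * (pk z t * modc (radial_limit f t)))%R)%R <=
  IT (fun t => (pk z t * Psi (`|modc (radial_limit f t)| / c) + s * x * pk z t)%R)%R)%E.
  apply: IT_le.
  - by apply: measurable_funD; apply: measurable_funM => //; exact: measurable_funM.
  - by apply: measurable_funD; apply: measurable_funM => //.
  - by move=> t _; rewrite addr_ge0 // mulr_ge0 // mulr_ge0 // modc_ge0.
  - move=> t _; rewrite ger0_norm ?modc_ge0 //; set y := modc (radial_limit f t).
    have y0 : 0 <= y / c by rewrite divr_ge0 ?modc_ge0 // ltW.
    have := ler_wpM2l (p0 t) (Hs _ y0); rewrite !(mulrDr, mulrDl, mulrBr) => h.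
    have -> : s / c * (pk z t * y) = pk z t * (s * (y / c)) by ring.
    have -> : Psi x * pk z t = pk z t * Psi x by ring.
    have -> : s * x * pk z t = pk z t * (s * x) by ring.
    move: h; rewrite mulrN; lra.
rewrite ITD in h1; last 4 first.
- exact: measurable_funM.
- by apply: measurable_funM => //; exact: measurable_funM.
- by move=> t _; rewrite mulr_ge0.
- by move=> t _; apply: mulr_ge0 => //; apply: mulr_ge0 => //; exact: modc_ge0.
rewrite ITD in h1; last 4 first.
- exact: measurable_funM.
- exact: measurable_funM.
- by move=> t _; rewrite mulr_ge0 // om_pos.
- by move=> t _; rewrite mulr_ge0.
have mpr : measurable_fun Tset (fun t => pk z t * modc (radial_limit f t)) by exact: measurable_funM.
have pr0 t : Tset t -> 0 <= pk z t * modc (radial_limit f t).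
  by move=> _; apply: mulr_ge0 => //; exact: modc_ge0.
rewrite (ITZ Px mpk (fun t _ => p0 t)) (ITZ sc mpr pr0) (ITZ sx mpk (fun t _ => p0 t)) in h1.
rewrite IT_pk // in h1.
have h2 : ((s * x)%:E <= (s / c)%:E * IT (fun t => (pk z t * modc (radial_limit f t))%R)%R)%E.
  have -> : s * x = s / c * modc (f z) by rewrite /x; ring.
  by rewrite EFinM; apply: lee_wpmul2l; rewrite ?lee_fin // poisson_boundary.
rewrite -(@leeD2rE _ (s * x)%:E) //.
rewrite -[X in (_ <= _ + X)%E]mule1; apply: le_trans h1.
by rewrite mule1; apply: leeD2l.
Qed.

End HardyOrliczSpace.

(** * Jensen's inequality in the mean and the vector space structure of H^Psi *)

Section HardyOrliczSpaceTheory.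
Variables (R : realType) (Psi : R -> R).
Hypotheses (oPsi : orlicz Psi) (dPsi : Delta2 Psi).
Local Notation C := R[i].
Local Notation mu := (@lebesgue_measure R).
Local Notation Tset := (@Tset R).
Implicit Types (f g : C -> C) (z w : C) (c d M t r : R).

(** The kernel depends only on the difference of the angles; being also even, it has mean 1 in
    either variable, as the exchange of integrals in [jensen_mean] requires. *)
Lemma pk_shift r t s : pk ((r%:C)%C * expi t) s = pk ((r%:C)%C : C) (s - t).
Proof.
rewrite -[in RHS](mulr1 (r%:C)%C) -expi0 /pk !pk_polar subr0.
by rewrite !modcM !modc_expi.
Qed.

Lemma pk_even r s : pk ((r%:C)%C : C) (- s) = pk ((r%:C)%C : C) s.
Proof.
rewrite -[(r%:C)%C](mulr1 (r%:C)%C) -expi0 /pk !pk_polar !subr0; congr (_ / _ ^+ 2).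
rewrite -[RHS]modc_conj; congr modc; apply: complexP; rewrite /= ?cosN ?sinN; ring.
Qed.

Local Opaque pk.

(** [jensen_point] is integrated over the circle and Tonelli integrates the kernel out. This is how
    a bound on boundary values returns to all circles inside the disc. *)
Lemma jensen_mean f c r : hardy2 f -> 0 < c -> 0 <= r -> r < 1 ->
  (IT (fun t => Psi (modc (f ((r%:C)%C * expi t)) / c))%R <= om Psi c (fun t => modc (radial_limit f t)))%E.
Proof.
move=> Hf c0 r0 r1; have Af := hardy2_approx Hf.
have z1 t : modc ((r%:C)%C * expi t : C) < 1 by rewrite modc_polar.
have z1' : modc ((r%:C)%C : C) < 1 by rewrite modc_real ger0_norm.
pose k t := Psi (`|modc (radial_limit f t)| / c).
have mk : measurable_fun setT k by apply: om_meas => //; exact: measurable_radial_mod.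
have k0 t : 0 <= k t by exact: om_pos.
have pk0 t s : 0 <= pk ((r%:C)%C * expi t) s * k s := mulr_ge0 (pk_ge0 s (z1 t)) (k0 s).
have f0 t : 0 <= Psi (modc (f ((r%:C)%C * expi t)) / c).
  by rewrite (orlicz_ge0 oPsi) // divr_ge0 ?modc_ge0 // ltW.
(* Indicators confine the integrand to the square, so that Tonelli can be applied on the whole
   plane. *)
pose F (p : R * R) : \bar R := (\1_Tset p.1 * (pk ((r%:C)%C : C) (p.2 - p.1) * (k p.2 * \1_Tset p.2)))%:E.
have mF : measurable_fun setT F.
  apply/measurable_EFinP; apply: measurable_funM.
    by apply: measurableT_comp => //; apply: measurable_indic; exact: measurable_Tset.
  apply: measurable_funM.
    apply: (measurableT_comp (f := pk ((r%:C)%C : C))); first by apply: continuous_measurable_fun; exact: pk_cont.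
    by apply: measurable_funB; [exact: measurable_snd|exact: measurable_fst].
  apply: measurable_funM.
    by apply: (measurableT_comp mk); exact: measurable_snd.
  by apply: measurableT_comp => //; apply: measurable_indic; exact: measurable_Tset.
have ind0 (A : set R) x : 0 <= \1_A x :> R by rewrite indicE.
have F0 p : (0 <= F p)%E.
  by rewrite lee_fin; apply: mulr_ge0 => //; apply: mulr_ge0; [exact: pk_ge0|exact: mulr_ge0].
have ft := @fubini_tonelli _ _ _ _ _ mu mu F mF F0.
have i1 : 0 <= (2 * pi)^-1 :> R by exact: inv2pi_ge0.
have i0 : (0 <= ((2 * pi)^-1)%:E :> \bar R)%E by rewrite lee_fin.
have pp := twopi_gt0 R; have pn : 2 * pi != 0 :> R by rewrite gt_eqF.
have mT := @measurable_Tset R.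
have inT (g : R -> R) (t : R) : ((g t * \1_Tset t)%:E = ((fun t => (g t)%:E) \_ Tset) t)%E.
  by rewrite patchE indicE; case: ifP => _; rewrite ?mulr1 ?mulr0.
have E1 t : (\int[mu]_s F (t, s) = (2 * pi)%:E * (\1_Tset t)%:E * IT (fun s => (pk ((r%:C)%C * expi t) s * k s)%R)%R)%E.
  have EF s : F (t, s) = ((fun s => (\1_Tset t * (pk ((r%:C)%C : C) (s - t) * k s))%:E) \_ Tset) s.
    by rewrite -(inT (fun s => \1_Tset t * (pk ((r%:C)%C : C) (s - t) * k s))) /F /= !mulrA.
  under eq_integral do rewrite EF.
  rewrite -integral_mkcond; under eq_integral do rewrite EFinM -pk_shift.
  have q0 s : Tset s -> (0 <= (pk ((r%:C)%C * expi t) s * k s)%:E)%E.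
    move=> _; rewrite lee_fin; exact: pk0.
  have mq : measurable_fun Tset (fun s => (pk ((r%:C)%C * expi t) s * k s)%:E).
    apply/measurable_EFinP; apply: measurable_funM; last exact: measurable_funTS.
    by apply: cont_measT; exact: pk_cont.
  rewrite (ge0_integralZl_EFin mu mT q0 mq (ind0 _ _)).
  rewrite /IT /intT muleA; congr (_ * _)%E.
  by rewrite -!EFinM mulrAC (mulfV pn) mul1r.
have E2 s : (\int[mu]_t F (t, s) = (2 * pi)%:E * (k s * \1_Tset s)%:E)%E.
  have EF t : F (t, s) = ((fun t => (pk ((r%:C)%C : C) (s - t) * (k s * \1_Tset s))%:E) \_ Tset) t.
    by rewrite -(inT (fun t => pk ((r%:C)%C : C) (s - t) * (k s * \1_Tset s))) /F /= mulrC.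
  under eq_integral do rewrite EF.
  rewrite -integral_mkcond; under eq_integral do rewrite mulrC EFinM -opprB pk_even.
  have q0 t : Tset t -> (0 <= (pk ((r%:C)%C : C) (t - s))%:E)%E by move=> _; rewrite lee_fin; exact: pk_ge0.
  have mq : measurable_fun Tset (fun t => (pk ((r%:C)%C : C) (t - s))%:E).
    apply/measurable_EFinP; apply: cont_measT.
    apply: (@cont_comp R (pk ((r%:C)%C : C)) (fun t => t - s)); first exact: pk_cont.
    by apply: contB; [exact: cont_id|exact: cont_cst].
  rewrite (ge0_integralZl_EFin mu mT q0 mq (mulr_ge0 (k0 s) (ind0 _ _))).
  rewrite muleC; congr (_ * _)%E.
  transitivity (\int[mu]_(t in Tset) (pk ((r%:C)%C * expi s) t)%:E)%E.
    by apply: eq_integral => t _; rewrite pk_shift.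
  rewrite TsetE per_EFin; last exact: pk_cont.
  by rewrite per_pk.
have mFF : measurable_fun setT (fun t => (\int[mu]_s F (t, s))%E).
  exact: (@measurable_fun_fubini_tonelli_F _ _ _ _ _ mu F mF F0).
have E3 t : Tset t -> IT (fun s => (pk ((r%:C)%C * expi t) s * k s)%R)%R = (((2 * pi)^-1)%:E * \int[mu]_s F (t, s))%E.
  move=> Tt; rewrite E1 indicE (mem_set Tt) mule1 muleA -EFinM (mulVf pn) mul1e; exact: erefl.
have mFFT : measurable_fun Tset (fun t => (\int[mu]_s F (t, s))%E) by exact: measurable_funTS.
have F1 t : (0 <= \int[mu]_s F (t, s))%E by apply: integral_ge0 => s _; exact: F0.
have L : (IT (fun t => Psi (modc (f ((r%:C)%C * expi t)) / c))%R <=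
   intT (fun t => IT (fun s => (pk ((r%:C)%C * expi t) s * k s)%R)%R))%E.
  apply: intT_le.
  - apply/measurable_EFinP; apply: cont_measT.
    by apply: cont_Psi; [exact: oPsi|exact: c0|exact: cont_circle_mod|move=> t; exact: modc_ge0].
  - apply: (@eq_measurable_fun _ _ _ _ Tset (fun t => ((2 * pi)^-1)%:E * \int[mu]_s F (t, s))%E).
      by move=> t; rewrite inE => Tt; rewrite E3.
    by apply: measurable_funTS; exact: measurable_funeM.
  - move=> t _; rewrite lee_fin; exact: f0.
  - by move=> t _; exact: jensen_point.
apply: le_trans L _.
have EFk s : (k s * \1_Tset s)%:E = ((fun s => (k s)%:E) \_ Tset) s by exact: inT.
have mk' : measurable_fun setT ((fun s => (k s)%:E) \_ Tset).
  by apply/(measurable_restrictT _ mT); apply/measurable_EFinP; exact: measurable_funTS.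
have k0' s : setT s -> (0 <= ((fun s => (k s)%:E) \_ Tset) s)%E.
  by move=> _; rewrite -EFk lee_fin; apply: mulr_ge0.
have TT : (\int[mu]_(t in Tset) \int[mu]_s F (t, s) = \int[mu]_t \int[mu]_s F (t, s))%E.
  rewrite integral_mkcond; apply: eq_integral => t _; rewrite patchE; case: ifP => [_|nT]; first exact: erefl.
  rewrite E1 indicE nT mule0 mul0e; exact: erefl.
rewrite /intT; under eq_integral => t do [move=> /set_mem Tt; rewrite (E3 _ Tt)].
rewrite (ge0_integralZl_EFin mu mT (fun t _ => F1 t) mFFT i1) TT ft.
under eq_integral do rewrite E2 EFk.
rewrite (ge0_integralZl_EFin mu measurableT k0' mk' (ltW pp)) -integral_mkcond.
rewrite [X in (_ * X)%E]muleA -EFinM (mulVf pn) mul1e.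
exact: lexx.
Qed.

Lemma bounded_HPsi f B : approx f -> (forall z, modc z < 1 -> modc (f z) <= B) -> HPsi Psi f.
Proof.
move=> Af HB; apply/hpsiP; split; first exact: approx_analytic.
have B0 : 0 <= B by apply: le_trans (modc_ge0 _) (HB 0 _); rewrite modc0.
pose x := PsiInv Psi 1; have x0 : 0 < x by exact: PsiInv_gt0.
exists ((B + 1) / x); have M0 : 0 < (B + 1) / x by rewrite divr_gt0 // ltr_wpDl.
split => // r r0 r1; rewrite -(IT_cst (1 : R)); apply: IT_le.
- apply: cont_measT; apply: cont_Psi => //; first exact: cont_circle_mod.
  by move=> t; exact: modc_ge0.
- exact: measurable_cst.
- by move=> t _; rewrite orlicz_ge0 // divr_ge0 ?modc_ge0 // ltW.
- move=> t _; apply: (@le_trans _ _ (Psi x)); last by rewrite (PsiInvK oPsi) // ler01.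
  apply: (orlicz_le oPsi); first by rewrite divr_ge0 ?modc_ge0 // ltW.
  rewrite ler_pdivrMr // [x * _]mulrC divfK ?gt_eqF //.
  by apply: le_trans (HB _ _) _; [rewrite modc_polar|rewrite lerDl].
Qed.

Lemma HPsiD f g : HPsi Psi f -> HPsi Psi g -> HPsi Psi (f \+ g).
Proof.
move=> Hf Hg; have Af := HPsi_approx Hf; have Ag := HPsi_approx Hg.
have [_ [M [M0 HM]]] := (hpsiP Psi f).1 Hf; have [_ [N [N0 HN]]] := (hpsiP Psi g).1 Hg.
apply/hpsiP; split; first by apply: approx_analytic; exact: approxD.
exists (M + N); split; first by rewrite addr_gt0.
move=> r r0 r1.
have mm h : approx h -> measurable_fun Tset (fun t => modc (h ((r%:C)%C * expi t))).
  by move=> Ah; apply: cont_measT; exact: cont_circle_mod.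
have E h M' : IT (fun t => Psi (modc (h ((r%:C)%C * expi t)) / M'))%R = om Psi M' (fun t => modc (h ((r%:C)%C * expi t))).
  by rewrite /om; congr IT; apply/funext => t; rewrite ger0_norm // modc_ge0.
rewrite E; apply: (om_tri oPsi M0 N0 (mm _ Af) (mm _ Ag)).
- by apply: mm; exact: approxD.
- by apply: aeT_all => t _; rewrite !ger0_norm ?modc_ge0 //; exact: modcD.
- by rewrite -E; exact: HM.
- by rewrite -E; exact: HN.
Qed.

Lemma HPsiZ (a : C) f : HPsi Psi f -> HPsi Psi (fun z => a * f z).
Proof.
move=> Hf; have Af := HPsi_approx Hf; have [_ [M [M0 HM]]] := (hpsiP Psi f).1 Hf.
apply/hpsiP; split; first by apply: approx_analytic; exact: approxZ.
have a1 : 0 < 1 + modc a by rewrite ltr_wpDr // modc_ge0.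
exists ((1 + modc a) * M); split; first by rewrite mulr_gt0.
move=> r r0 r1; apply: le_trans (HM r r0 r1); apply: IT_le.
- apply: cont_measT; apply: cont_Psi; [exact: oPsi|by rewrite mulr_gt0|exact: (cont_circle_mod (approxZ a Af) r0 r1)|].
  by move=> t; exact: modc_ge0.
- apply: cont_measT; apply: cont_Psi => //; first exact: cont_circle_mod.
  by move=> t; exact: modc_ge0.
- by move=> t _; rewrite (orlicz_ge0 oPsi) // divr_ge0 ?modc_ge0 // mulr_ge0 // ltW.
- move=> t _; apply: (orlicz_le oPsi); first by rewrite divr_ge0 ?modc_ge0 // mulr_ge0 // ltW.
  rewrite modcM invfM mulrACA ler_piMl ?divr_ge0 ?modc_ge0 ?(ltW M0) //.
  by rewrite ler_pdivrMr // mul1r lerDr.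
Qed.

Lemma HPsiB f g : HPsi Psi f -> HPsi Psi g -> HPsi Psi (fun z => f z - g z).
Proof.
move=> Hf Hg; rewrite (_ : (fun _ => _) = f \+ (fun z => (-1) * g z)).
  by apply: HPsiD => //; exact: HPsiZ.
by apply/funext => z /=; rewrite mulN1r.
Qed.

Lemma has_radialD f g t a b : has_radial f t a -> has_radial g t b -> has_radial (fun z => f z + g z) t (a + b).
Proof.
move=> H1 H2 e e0; have e2 : 0 < e / 2 by rewrite divr_gt0.
have [d1 [d10 Hd1]] := H1 _ e2; have [d2 [d20 Hd2]] := H2 _ e2.
exists (Num.min d1 d2); split; first by rewrite lt_min d10.
move=> r r0 rd r1; rewrite opprD addrACA; apply: le_lt_trans (modcD _ _) _.
rewrite [e]splitr ltrD //; [apply: Hd1 => //|apply: Hd2 => //]; apply: le_lt_trans rd;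
  by rewrite lerD2l lerN2 ge_min lexx ?orbT.
Qed.

Lemma has_radialZ f t (c a : C) : has_radial f t a -> has_radial (fun z => c * f z) t (c * a).
Proof.
move=> H e e0; have c1 : 0 < 1 + modc c by rewrite ltr_wpDr // modc_ge0.
have [d [d0 Hd]] := H _ (divr_gt0 e0 c1); exists d; split => // r r0 rd r1.
rewrite -mulrBr modcM; have := Hd r r0 rd r1; rewrite ltr_pdivlMr // mulrC.
by apply: le_lt_trans; rewrite ler_wpM2r ?modc_ge0 // lerDr.
Qed.

Lemma has_radialB f g t a b : has_radial f t a -> has_radial g t b -> has_radial (fun z => f z - g z) t (a - b).
Proof.
move=> H1 H2; have := has_radialD H1 (has_radialZ (-1) H2).
by rewrite mulN1r; rewrite (_ : (fun z => f z + -1 * g z) = (fun z => f z - g z)) //; apply/funext => z; rewrite mulN1r.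
Qed.

(** One side takes the boundary value of the difference, the other the difference of boundary
    values; they agree wherever both radial limits exist. *)
Lemma distH_normH f g : HPsi Psi f -> HPsi Psi g -> normH Psi (fun z => f z - g z) = distH Psi f g.
Proof.
move=> Hf Hg; rewrite /normH /distH /lux; congr inf; apply/seteqP.
have Af := HPsi_approx Hf; have Ag := HPsi_approx Hg.
have ae : aeT (fun t => radial_limit (fun z => f z - g z) t = radial_limit f t - radial_limit g t).
  apply: aeT_mono (aeT_and (HPsi_rad oPsi dPsi Hf) (HPsi_rad oPsi dPsi Hg)) => t _ [h1 h2].
  by apply: has_radialE; exact: has_radialB.
have m1 : measurable_fun Tset (fun t => modc (radial_limit (fun z => f z - g z) t)).
  by apply: measurable_radial_mod; apply: HPsi_approx; exact: HPsiB.
have m2 : measurable_fun Tset (fun t => modc (radial_limit f t - radial_limit g t)) by exact: measurable_radialB.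
have E c : 0 < c -> om Psi c (fun t => modc (radial_limit (fun z => f z - g z) t)) = om Psi c (fun t => modc (radial_limit f t - radial_limit g t)).
  move=> c0; apply/eqP; rewrite eq_le; apply/andP; split; apply: om_le => //; apply: aeT_mono ae => t _ ->; exact: lexx.
by split => c /= [c0 hc]; split => //; have := E c c0; rewrite /om /IT => Ec; [rewrite -Ec|rewrite Ec].
Qed.

End HardyOrliczSpaceTheory.

(** * The test functions [u_ar] and their square roots [kern] *)

Section TestFunctions.
Variables (R : realType).
Local Notation C := R[i].
Implicit Types (f g : C -> C) (a z w q : C) (r s t e : R).

Definition kern a r z : C := ((1 - r)%:C)%C / (1 - (a^*)%C * ((r%:C)%C) * z).

Lemma u_arE a r z : u_ar a r z = kern a r z ^+ 2. Proof. by []. Qed.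

Lemma modc_arz a r z : modc a = 1 -> 0 <= r -> modc z <= 1 -> modc ((a^*)%C * ((r%:C)%C) * z) <= r.
Proof.
move=> a1 r0 z1; rewrite !modcM modc_conj a1 mul1r modc_real ger0_norm //.
by rewrite -[leRHS]mulr1 ler_wpM2l.
Qed.

Lemma modc1B_ge q r : modc q <= r -> 1 - r <= modc (1 - q).
Proof.
move=> qr; apply: le_trans (modc_distr 1 q); rewrite modc1 lerD2l lerN2 //.
Qed.

Lemma kern_den_ge a r z : modc a = 1 -> 0 <= r -> modc z <= 1 ->
  1 - r <= modc (1 - (a^*)%C * ((r%:C)%C) * z).
Proof. by move=> a1 r0 z1; apply: modc1B_ge; exact: modc_arz. Qed.

Lemma kern_le1 a r z : modc a = 1 -> 0 <= r -> r < 1 -> modc z <= 1 -> modc (kern a r z) <= 1.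
Proof.
move=> a1 r0 r1 z1; have h := kern_den_ge a1 r0 z1; have d0 : 0 < 1 - r by rewrite subr_gt0.
rewrite /kern modcM modcV modc_real ger0_norm ?(ltW d0) //.
by rewrite ler_pdivrMr ?mul1r // (lt_le_trans d0).
Qed.

Lemma modc_u_ar a r z : modc (u_ar a r z) = modc (kern a r z) ^+ 2.
Proof. by rewrite u_arE modcX. Qed.

Lemma u_ar_le1 a r z : modc a = 1 -> 0 <= r -> r < 1 -> modc z <= 1 -> modc (u_ar a r z) <= 1.
Proof. by move=> a1 r0 r1 z1; rewrite modc_u_ar expr_le1 ?modc_ge0 // kern_le1. Qed.

(** With w = conj(a) r z, the left side is (1 - r)^2 / |1 - w|^2 and the right side (1 - r) Re(1 -
    w) / |1 - w|^2, where Re(1 - w) >= 1 - r. Sums of kernels with nonnegative coefficients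
    therefore dominate each test function involved. *)
Lemma u_ar_le_Re_kern a r z : modc a = 1 -> 0 <= r -> r < 1 -> modc z <= 1 ->
  modc (u_ar a r z) <= complex.Re (kern a r z).
Proof.
move=> a1 r0 r1 z1; have h := kern_den_ge a1 r0 z1; have d0 : 0 < 1 - r by rewrite subr_gt0.
rewrite modc_u_ar /kern modcM modcV modc_real ger0_norm ?(ltW d0) // Re_div Re_real_mul expr_div_n.
have D0 : 0 < modc (1 - (a^*)%C * (r%:C)%C * z) by apply: lt_le_trans h.
rewrite ler_wpM2r ?invr_ge0 ?sqr_ge0 // expr2 ler_wpM2l ?(ltW d0) //.
have -> w : complex.Re (w^*)%C = complex.Re w by case: w.
rewrite Re_add Re_opp /= lerD2l lerN2.
by apply: le_trans (Re_le_modc _) _; exact: modc_arz.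
Qed.

Lemma kern_approx a r : modc a = 1 -> 0 <= r -> r < 1 -> approx (kern a r).
Proof.
move=> a1 r0 r1; have d0 : 0 < 1 - r by rewrite subr_gt0.
apply: analytic_approx; exists (fun k => ((1 - r)%:C)%C * ((a^*)%C * (r%:C)%C) ^+ k) => z z1.
apply/cvgCP => e e0; have [N HN] := expr_small 1 r0 r1 e0; exists N => n Nn.
set q := (a^*)%C * (r%:C)%C; have qr : modc (q * z) <= r by apply: modc_arz => //; exact: ltW.
have D := modc1B_ge qr; have D0 : 0 < modc (1 - q * z) by apply: lt_le_trans D.
have Dn : 1 - q * z != 0 by rewrite -modc_eq0 gt_eqF.
have -> : \sum_(k < n) ((1 - r)%:C)%C * q ^+ k * z ^+ k = ((1 - r)%:C)%C * ((1 - (q * z) ^+ n) / (1 - q * z)).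
  have -> : (1 - (q * z) ^+ n) / (1 - q * z) = \sum_(k < n) (q * z) ^+ k.
    have := subrX1 (q * z) n => h; apply: (canLR (mulfK Dn)).
    by rewrite -[LHS]opprB h -[1 - q * z]opprB mulrN mulrC.
  by rewrite mulr_sumr; apply: eq_bigr => k _; rewrite -mulrA -exprMn.
rewrite /kern -/q -mulrBr mulrBl mul1r addrAC subrr add0r mulrN modcN !modcM modcV modc_real ger0_norm ?(ltW d0) //.
apply: le_lt_trans HN; rewrite mul1r.
set D1 := modc (1 - q * z) in D D0 *; set Q := modc _.
rewrite ?mulrA [(1 - r) * Q]mulrC -mulrA; apply: (@le_trans _ _ (Q * 1)).
  by apply: ler_wpM2l; [exact: modc_ge0|rewrite ler_pdivrMr // mul1r].
rewrite mulr1 /Q modcX; apply: (@le_trans _ _ (r ^+ n)); first by rewrite lerXn2r ?nnegrE ?modc_ge0.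
by apply: ler_wiXn2l => //; exact: ltW.
Qed.

Lemma approxM f g : approx f -> approx g -> approx (fun z => f z * g z).
Proof.
move=> Af Ag r r0 r1 e e0.
have [p1 Hp1] := Af r r0 r1 1 ltr01; have [B [B0 HB]] := poly_bounded p1.
have fB z : modc z <= r -> modc (f z) <= B + 1.
  move=> zr; rewrite -[f z](subrK p1.[z]); apply: le_trans (modcD _ _) _.
  by rewrite addrC lerD ?Hp1 ?HB // (le_trans zr) // ltW.
have B1 : 0 < B + 1 by rewrite ltr_wpDl.
have e1 : 0 < e / 2 / (B + 1) by rewrite !divr_gt0.
have [q Hq] := Ag r r0 r1 _ e1; have [B' [B'0 HB']] := poly_bounded q.
have B'1 : 0 < B' + 1 by rewrite ltr_wpDl.
have e2 : 0 < e / 2 / (B' + 1) by rewrite !divr_gt0.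
have [p Hp] := Af r r0 r1 _ e2; exists (p * q) => z zr; rewrite hornerM.
have -> : f z * g z - p.[z] * q.[z] = f z * (g z - q.[z]) + q.[z] * (f z - p.[z]) by ring.
apply: le_trans (modcD _ _) _; rewrite [e]splitr !modcM; apply: lerD.
  apply: (@le_trans _ _ ((B + 1) * (e / 2 / (B + 1)))); last by rewrite mulrC divfK // gt_eqF.
  by apply: ler_pM; rewrite ?modc_ge0 ?fB ?Hq.
apply: (@le_trans _ _ ((B' + 1) * (e / 2 / (B' + 1)))); last by rewrite mulrC divfK // gt_eqF.
apply: ler_pM; rewrite ?modc_ge0 ?Hp //; apply: (@le_trans _ _ B'); last by rewrite lerDl.
by apply: HB'; apply: le_trans zr (ltW r1).
Qed.

Lemma u_ar_approx a r : modc a = 1 -> 0 <= r -> r < 1 -> approx (u_ar a r).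
Proof.
move=> a1 r0 r1; have A := kern_approx a1 r0 r1; have := approxM A A.
by congr approx; apply/funext => z; rewrite u_arE expr2.
Qed.

Lemma kern_lipschitz a r z w : modc a = 1 -> 0 <= r -> r < 1 -> modc z <= 1 -> modc w <= 1 ->
  modc (kern a r z - kern a r w) <= modc (z - w) / (1 - r).
Proof.
move=> a1 r0 r1 z1 w1; have d0 : 0 < 1 - r by rewrite subr_gt0.
have hz := kern_den_ge a1 r0 z1; have hw := kern_den_ge a1 r0 w1.
set Z := 1 - (a^*)%C * (r%:C)%C * z in hz; set W := 1 - (a^*)%C * (r%:C)%C * w in hw.
have Z0 : 0 < modc Z by apply: lt_le_trans hz.
have W0 : 0 < modc W by apply: lt_le_trans hw.
have Zn : Z != 0 by rewrite -modc_eq0 gt_eqF.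
have Wn : W != 0 by rewrite -modc_eq0 gt_eqF.
have -> : kern a r z - kern a r w = ((1 - r)%:C)%C / Z * (((a^*)%C * (r%:C)%C * (z - w)) / W).
  rewrite /kern -/Z -/W; have -> : (a^*)%C * (r%:C)%C * (z - w) = W - Z by rewrite /W /Z; ring.
  by field; rewrite Zn Wn.
rewrite modcM -[leRHS]mul1r; apply: ler_pM; rewrite ?modc_ge0 //.
  by rewrite modcM modcV modc_real ger0_norm ?(ltW d0) // ler_pdivrMr // mul1r.
rewrite modcM modcV; apply: ler_pM; rewrite ?modc_ge0 ?invr_ge0 ?modc_ge0 //; last by rewrite lef_pV2.
rewrite modcM -[leRHS]mul1r ler_wpM2r ?modc_ge0 //.
have := modc_arz a1 r0 (_ : modc (1 : C) <= 1); rewrite modc1 mulr1 => /(_ (lexx _)) h.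
exact: le_trans h (ltW r1).
Qed.

Lemma u_ar_lipschitz a r z w : modc a = 1 -> 0 <= r -> r < 1 -> modc z <= 1 -> modc w <= 1 ->
  modc (u_ar a r z - u_ar a r w) <= 2 / (1 - r) * modc (z - w).
Proof.
move=> a1 r0 r1 z1 w1; rewrite !u_arE subr_sqr modcM mulrAC -mulrA mulrC.
apply: ler_pM; rewrite ?modc_ge0 //; last exact: kern_lipschitz.
by apply: le_trans (modcD _ _) _; rewrite (_ : 2 = 1 + 1 :> R) // lerD // kern_le1.
Qed.

(** Covers points with |l| = 1, out of reach of [has_radial_comp]; the test functions qualify
    because they are Lipschitz on the closed disc. *)
Lemma has_radial_lipschitz f phi t l L : 0 <= L ->
  (forall z w, modc z <= 1 -> modc w <= 1 -> modc (f z - f w) <= L * modc (z - w)) ->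
  (forall z, modc z < 1 -> modc (phi z) < 1) -> modc l <= 1 ->
  has_radial phi t l -> has_radial (f \o phi) t (f l).
Proof.
move=> L0 HL H1 l1 H e e0; have L1 : 0 < L + 1 by rewrite ltr_wpDl.
have [d [d0 Hd]] := H _ (divr_gt0 e0 L1); exists d; split => // r r0 rd r1 /=.
apply: le_lt_trans (HL _ _ _ l1) _; first by rewrite ltW // H1 // modc_polar.
have := Hd r r0 rd r1; rewrite ltr_pdivlMr // mulrC; apply: le_lt_trans.
by rewrite ler_wpM2r ?modc_ge0 // lerDl.
Qed.

Lemma has_radial_comp f phi t l : approx f -> modc l < 1 ->
  has_radial phi t l -> has_radial (f \o phi) t (f l).
Proof.
move=> Af l1 H e e0; have [d1 [d10 Hd1]] := approx_cont Af l1 e0.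
have [d [d0 Hd]] := H _ d10; exists d; split => // r r0 rd r1 /=.
by have [] := Hd1 _ (Hd r r0 rd r1).
Qed.

Lemma has_radial_le1 phi t l : (forall z, modc z < 1 -> modc (phi z) < 1) ->
  has_radial phi t l -> modc l <= 1.
Proof.
move=> H1 H; apply/ler_addgt0Pr => e e0; have [d [d0 Hd]] := H e e0.
pose d' := Num.min d 1; have d'0 : 0 < d' by rewrite lt_min d0 ltr01.
have d'1 : d' <= 1 by rewrite ge_min lexx orbT.
have d'd : d' <= d by rewrite ge_min lexx.
pose r := 1 - d' / 2; have r0 : 0 <= r by rewrite /r; lra.
have r1 : r < 1 by rewrite /r; lra.
have rd : 1 - d < r by rewrite /r; lra.
have h := Hd r r0 rd r1; have h2 : modc (phi ((r%:C)%C * expi t)) < 1 by apply: H1; rewrite modc_polar.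
have := modc_distr l (phi ((r%:C)%C * expi t)); rewrite modcBC; lra.
Qed.

(** On the circle of radius s, |kern|^2 is (1 - r)^2 / (1 - (r s)^2) times the Poisson kernel of r s
    a, and the latter has mean 1. *)
Lemma kern_mean a r s : modc a = 1 -> 0 <= r -> r < 1 -> 0 <= s -> s < 1 ->
  (IT (fun t => modc (kern a r ((s%:C)%C * expi t)) ^+ 2)%R <= (1 - r)%:E)%E.
Proof.
move=> a1 r0 r1 s0 s1; have d0 : 0 < 1 - r by rewrite subr_gt0.
pose z : C := ((r * s)%:C)%C * a; have rs0 : 0 <= r * s by rewrite mulr_ge0.
have zr : modc z = r * s by rewrite /z modcM modc_real a1 mulr1 ger0_norm.
have rsr : r * s <= r by rewrite ler_piMr // ltW.
have rs1 : r * s < 1 by apply: le_lt_trans r1.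
have z1 : modc z < 1 by rewrite zr.
have q0 : 0 < 1 - (r * s) ^+ 2 by rewrite subr_gt0 exprn_ilt1.
have K0 : 0 <= (1 - r) ^+ 2 / (1 - (r * s) ^+ 2) by rewrite divr_ge0 ?sqr_ge0 // ltW.
have -> : (fun t => modc (kern a r ((s%:C)%C * expi t)) ^+ 2) =
          (fun t => (1 - r) ^+ 2 / (1 - (r * s) ^+ 2) * pk z t).
  apply/funext => t; rewrite /pk zr /kern modcM modcV modc_real ger0_norm ?(ltW d0) //.
  have -> : (z^*)%C * expi t = (a^*)%C * (r%:C)%C * ((s%:C)%C * expi t).
    rewrite /z realcM; apply: complexP; rewrite !(Re_mul, Im_mul) /=; case: a {a1 z zr z1} => x y /=; ring.
  rewrite expr_div_n; set D := modc _ ^+ 2.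
  by rewrite mulrA divfK // gt_eqF.
rewrite (ITZ K0 (cont_measT (pk_cont z1)) (fun t _ => pk_ge0 t z1)) IT_pk // mule1 lee_fin.
rewrite ler_pdivrMr // expr2 ler_wpM2l ?(ltW d0) // lerD2l lerN2.
by apply: (@le_trans _ _ (r * s)) => //; rewrite expr2 ler_piMr // ltW.
Qed.

End TestFunctions.

(** * The scale Psi^{-1}(1/l) and normalized test functions *)

Section InverseOrliczScale.
Variables (R : realType) (Psi : R -> R).
Hypotheses (oPsi : orlicz Psi) (dPsi : Delta2 Psi).
Local Notation C := R[i].
Local Notation Tset := (@Tset R).
Implicit Types (f g : C -> C) (a z w q : C) (r s t e l : R).

(* |f(z)| <= 3 xl (1 - |z|) on the unit ball, and xl (1 - r) u_{a,r} lies in that ball *)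
Definition xl l := PsiInv Psi l^-1.

Lemma xl_gt0 l : 0 < l -> 0 < xl l.
Proof. by move=> l0; apply: PsiInv_gt0 => //; rewrite invr_gt0. Qed.

Lemma xlK l : 0 < l -> Psi (xl l) = l^-1.
Proof. by move=> l0; apply: PsiInvK => //; rewrite invr_ge0 ltW. Qed.

Lemma xl_le l m : 0 < l -> l <= m -> xl m <= xl l.
Proof.
move=> l0 lm; have m0 : 0 < m by apply: lt_le_trans lm.
by apply: PsiInv_le; rewrite ?invr_ge0 ?(ltW m0) // lef_pV2.
Qed.

Lemma xl_large M : exists d, 0 < d /\ forall l, 0 < l -> l < d -> M <= xl l.
Proof.
pose m := Num.max M 1; have m0 : 0 < m by rewrite lt_max ltr01 orbT.
have P0 := orlicz_gt0 oPsi m0; exists (Psi m)^-1; split; first by rewrite invr_gt0.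
move=> l l0 lm; apply: (@le_trans _ _ m); first by rewrite le_max lexx.
by apply: le_PsiInv => //; [exact: ltW|rewrite -[Psi m]invrK lef_pV2 ?posrE ?invr_gt0 // ltW].
Qed.

(** From Psi(x) >= x^3 and Psi(xl l) = 1/l one gets l (xl l)^3 <= 1, and xl l tends to infinity. *)
Lemma xl_sqr_small e : 0 < e -> exists d, 0 < d /\ forall l, 0 < l -> l < d -> xl l ^+ 2 * l <= e.
Proof.
move=> e0; have [X [X0 HX]] := delta2_growth oPsi dPsi.
have [d [d0 Hd]] := xl_large (Num.max X e^-1); exists d; split => // l l0 ld.
have := Hd l l0 ld; rewrite ge_max => /andP[h1 h2]; have x0 := xl_gt0 l0.
have := HX _ h1; rewrite xlK // => h3.
rewrite -(ler_pM2l x0); apply: (@le_trans _ _ 1).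
  by rewrite mulrA -exprS -(ler_pM2r (_ : 0 < l^-1)) ?invr_gt0 // mulfK ?gt_eqF // mul1r.
by rewrite -(ler_pM2r (_ : 0 < e^-1)) ?invr_gt0 // mulfK ?gt_eqF // mul1r.
Qed.

(** K is the constant of Delta^2: Psi(xl l / K)^2 <= Psi(xl l) = 1/l, so the square of the quantity
    is at most l (xl l)^2. *)
Lemma xl_scaled_small : exists K, 1 <= K /\ forall e, 0 < e -> exists d, 0 < d /\
  forall l, 0 < l -> l < d -> l * xl l * Psi (xl l / K) <= e.
Proof.
have [K [K1 [x0 HK]]] := dPsi; have K0 : 0 < K by rewrite (lt_trans ltr01).
exists K; split; first exact: ltW.
move=> e e0; have [d1 [d10 H1]] := xl_large (K * x0).
have e20 : 0 < e ^+ 2 by rewrite exprn_gt0.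
have [d2 [d20 H2]] := xl_sqr_small e20.
exists (Num.min d1 d2); split; first by rewrite lt_min d10.
move=> l l0; rewrite lt_min => /andP[l1 l2]; have xp := xl_gt0 l0.
have P0 : 0 <= Psi (xl l / K) by rewrite orlicz_ge0 // divr_ge0 ?(ltW xp) ?(ltW K0).
have h := HK (xl l / K); rewrite ler_pdivlMr // mulrC H1 // in h.
have E : K * (xl l / K) = xl l by rewrite mulrC divfK // gt_eqF.
have {h} := h isT; rewrite E xlK // => h.
have q0 : 0 <= l * xl l * Psi (xl l / K) by rewrite mulr_ge0 // mulr_ge0 // ltW.
rewrite -(@ler_pXn2r _ 2) ?nnegrE ?(ltW e0) //; apply: le_trans (H2 l l0 l2).
rewrite exprMn exprMn; apply: (@le_trans _ _ (l ^+ 2 * xl l ^+ 2 * l^-1)).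
  by rewrite ler_wpM2l // mulr_ge0 // sqr_ge0.
by rewrite [l ^+ 2 * _]mulrC -mulrA expr2 mulfK // gt_eqF.
Qed.

(** As |u| <= 1, convexity gives Psi(x |u|) <= |u| Psi(x) = |kern|^2 / (1 - r), and [kern_mean]
    makes the mean at most 1. *)
Lemma hpsi_u_ar a r : modc a = 1 -> 0 <= r -> r < 1 ->
  hpsi Psi (fun z => ((xl (1 - r))%:C)%C * u_ar a r z) 1.
Proof.
move=> a1 r0 r1 s s0 s1; have d0 : 0 < 1 - r by rewrite subr_gt0.
have x0 := xl_gt0 d0; have Ak := kern_approx a1 r0 r1.
have P0 : 0 <= Psi (xl (1 - r)) by rewrite orlicz_ge0 // ltW.
have z1 t : modc ((s%:C)%C * expi t : C) <= 1 by rewrite modc_polar // ltW.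
have mk : measurable_fun Tset (fun t => modc (kern a r ((s%:C)%C * expi t)) ^+ 2).
  apply: cont_measT; apply: cont_modsq; [exact: cont_circle_Re|exact: cont_circle_Im].
apply: (@le_trans _ _ (IT (fun t => Psi (xl (1 - r)) * modc (kern a r ((s%:C)%C * expi t)) ^+ 2)%R)).
  apply: IT_le.
  - apply: cont_measT; apply: cont_Psi => //; last by move=> t; exact: modc_ge0.
    exact: (cont_circle_mod (approxZ _ (u_ar_approx a1 r0 r1)) s0 s1).
  - by apply: measurable_funM.
  - by move=> t _; rewrite orlicz_ge0 // divr_ge0 // modc_ge0.
  - move=> t _; rewrite divr1 modcM modc_real (ger0_norm (ltW x0)) modc_u_ar mulrC [leRHS]mulrC.
    apply: orlicz_scale => //; first exact: ltW.
    by rewrite sqr_ge0 expr_le1 ?modc_ge0 ?kern_le1.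
rewrite (ITZ P0 mk (fun t _ => sqr_ge0 _)).
apply: (@le_trans _ _ ((Psi (xl (1 - r)))%:E * (1 - r)%:E)%E).
  by apply: lee_wpmul2l; [rewrite lee_fin|exact: kern_mean].
by rewrite -EFinM lee_fin xlK // mulVf // gt_eqF.
Qed.

Lemma u_ar_ballH a r : modc a = 1 -> 0 <= r -> r < 1 ->
  ballH Psi (fun z => ((xl (1 - r))%:C)%C * u_ar a r z).
Proof.
move=> a1 r0 r1; have H := hpsi_u_ar a1 r0 r1.
have HP : HPsi Psi (fun z => ((xl (1 - r))%:C)%C * u_ar a r z).
  apply/hpsiP; split; last by exists 1.
  by apply: approx_analytic; apply: approxZ; exact: u_ar_approx.
by split => //; exact: normH_le.
Qed.

End InverseOrliczScale.

(** * Boundary values of the symbol and of compositions with it *)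

Section SelfMap.
Variables (R : realType) (Psi : R -> R) (phi : R[i] -> R[i]).
Hypotheses (oPsi : orlicz Psi) (dPsi : Delta2 Psi) (sphi : self_map_disc phi).
Local Notation C := R[i].
Local Notation Tset := (@Tset R).
Local Notation ph t := (radial_limit phi t).
Implicit Types (f g : C -> C) (a z w q : C) (r s t e l : R).

Lemma self_map_approx : approx phi.
Proof. by case: sphi => /analytic_approx. Qed.

Lemma self_map_lt1 z : modc z < 1 -> modc (phi z) < 1.
Proof. by case: sphi => _; apply. Qed.

Lemma self_map_rad : aeT (has_rad phi).
Proof.
apply: (HPsi_rad oPsi dPsi); apply: (@bounded_HPsi _ _ oPsi phi 1 self_map_approx) => z z1.
by rewrite ltW // self_map_lt1.
Qed.

Lemma self_map_rad_le1 t : has_rad phi t -> modc (ph t) <= 1.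
Proof. by apply: has_radial_le1; exact: self_map_lt1. Qed.

Lemma measurable_ph D : measurable_fun D (fun t => modc (ph t)).
Proof. by apply: measurable_radial_mod; exact: self_map_approx. Qed.

Lemma comp_approx f : approx f -> approx (f \o phi).
Proof. by move=> Af; apply: approx_comp => //; [exact: self_map_approx|exact: self_map_lt1]. Qed.

Lemma comp_bounded_HPsi f B : approx f -> (forall z, modc z < 1 -> modc (f z) <= B) -> HPsi Psi (f \o phi).
Proof.
move=> Af HB; apply: (@bounded_HPsi _ _ oPsi _ B); first exact: comp_approx.
by move=> z z1; apply: HB; exact: self_map_lt1.
Qed.

Lemma comp_rad f t : approx f -> has_rad phi t -> modc (ph t) < 1 -> radial_limit (f \o phi) t = f (ph t).
Proof. by move=> Af h1 h2; apply: has_radialE; exact: has_radial_comp. Qed.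

Lemma comp_u_ar_has_radial a r t : modc a = 1 -> 0 <= r -> r < 1 -> has_rad phi t ->
  has_radial (Cphi phi (u_ar a r)) t (u_ar a r (ph t)).
Proof.
move=> a1 r0 r1 h; apply: (@has_radial_lipschitz _ _ _ _ _ (2 / (1 - r))) => //.
- by rewrite divr_ge0 // subr_ge0 ltW.
- by move=> z w z1 w1; exact: u_ar_lipschitz.
- exact: self_map_lt1.
- exact: self_map_rad_le1.
Qed.

Lemma comp_u_ar_rad a r t : modc a = 1 -> 0 <= r -> r < 1 -> has_rad phi t ->
  radial_limit (Cphi phi (u_ar a r)) t = u_ar a r (ph t).
Proof. by move=> a1 r0 r1 h; apply: has_radialE; exact: comp_u_ar_has_radial. Qed.

Lemma comp_u_arZ_rad (c : C) a r t : modc a = 1 -> 0 <= r -> r < 1 -> has_rad phi t ->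
  radial_limit (Cphi phi (fun z => c * u_ar a r z)) t = c * u_ar a r (ph t).
Proof.
move=> a1 r0 r1 h; apply: has_radialE.
exact: (@has_radialZ _ (Cphi phi (u_ar a r)) _ _ _ (comp_u_ar_has_radial a1 r0 r1 h)).
Qed.

Lemma comp_u_ar_HPsi a r : modc a = 1 -> 0 <= r -> r < 1 -> HPsi Psi (Cphi phi (u_ar a r)).
Proof.
move=> a1 r0 r1; apply: (@comp_bounded_HPsi _ 1); first exact: u_ar_approx.
by move=> z z1; rewrite u_ar_le1 // ltW.
Qed.

End SelfMap.

(** * Markov's inequality and null sets on the circle *)

Section CircleMeasure.
Variable R : realType.
Local Notation C := R[i].
Local Notation mu := (@lebesgue_measure R).
Local Notation Tset := (@Tset R).
Implicit Types (A : set R) (f : R -> R) (s t c : R).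

Lemma mT_IT A : measurable A -> mT A = IT (fun t => \1_A t).
Proof.
by move=> mA; rewrite /mT /IT /intT integral_indic //; exact: measurable_Tset.
Qed.

Lemma markovT A f c : measurable A -> measurable_fun Tset f -> 0 <= c ->
  (forall t, Tset t -> 0 <= f t) -> aeT (fun t => A t -> c <= f t) -> (c%:E * mT A <= IT f)%E.
Proof.
move=> mA mf c0 f0 H; have ind0 t : 0 <= \1_A t :> R by rewrite indicE.
have mI : measurable_fun Tset (\1_A : R -> R) by apply: measurable_funTS; exact: measurable_indic.
rewrite mT_IT // -(ITZ c0 mI (fun t _ => ind0 t)); apply: IT_ae_le => //.
- exact: measurable_funM.
- by move=> t _; exact: mulr_ge0.
- apply: aeT_mono H => t Tt h; rewrite indicE; case: (boolP (t \in A)) => [/set_mem At|_].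
    by rewrite mulr1 h.
  by rewrite mulr0 f0.
Qed.

Lemma aeT_mT_small (P : R -> Prop) : measurable [set t | ~ P t] ->
  (forall e, 0 < e -> (mT [set t | ~ P t] <= e%:E)%E) -> aeT P.
Proof.
move=> mP H; rewrite /aeT; have -> : [set t | Tset t /\ ~ P t] = [set t | ~ P t] `&` Tset.
  by apply/seteqP; split => t [].
have mA : measurable ([set t | ~ P t] `&` Tset) by apply: measurableI => //; exact: measurable_Tset.
apply/negligibleP => //; apply/eqP; rewrite eq_le measure_ge0 andbT.
apply/lee_addgt0Pr => e e0; rewrite add0e.
have pp := twopi_gt0 R; have := H _ (divr_gt0 e0 pp); rewrite /mT => h.
rewrite -(@lee_pmul2l _ ((2 * pi)^-1)%:E) ?lte_fin ?invr_gt0 // ?fin_numE //.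
by apply: le_trans h _; rewrite -EFinM lee_fin mulrC.
Qed.

Lemma mean_value_1 (f df : R -> R) s t : (forall x : R, is_derive x 1 f (df x)) -> (forall x, `|df x| <= 1) ->
  `|f t - f s| <= `|t - s|.
Proof.
move=> fd f1; wlog st : s t / s <= t.
  by move=> W; have [/W//|/ltW/W] := leP s t; rewrite distrC [leRHS]distrC.
have cf : {within `[s, t], continuous f}.
  by apply: derivable_within_continuous => x _; apply: ex_derive.
have [x _ ->] := MVT_segment st (fun x _ => fd x) cf.
by rewrite normrM ler_piMl.
Qed.

Lemma expi_lipschitz s t : modc (expi s - expi t : C) <= 2 * `|s - t|.
Proof.
apply: le_trans (modc_le_ReIm _) _; rewrite Re_add Re_opp Im_add Im_opp /= mulr_natl mulr2n; apply: lerD.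
  apply: (@mean_value_1 cos (fun x => - sin x)); last by move=> x; rewrite normrN; exact: sin_max.
apply: (@mean_value_1 sin cos); last by move=> x; exact: cos_max.
Qed.

End CircleMeasure.

(** * Assertions 4 to 6, and 4 implies 5 *)

Section LevelSets.
Variables (R : realType) (Psi : R -> R) (phi : R[i] -> R[i]).
Hypotheses (oPsi : orlicz Psi) (dPsi : Delta2 Psi) (sphi : self_map_disc phi).
Local Notation C := R[i].
Local Notation Tset := (@Tset R).
Local Notation ph t := (radial_limit phi t).
Local Notation xP := (xl Psi).
Implicit Types (f g : C -> C) (a z w q : C) (r s t e l c : R).

(* junk value where |phi*| >= 1, a null set under each of the assertions below *)
Definition bdist t := xP (1 - modc (ph t)).

Definition cond4 := MPsiE Psi (fun t => if modc (ph t) < 1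
                 then (PsiInv Psi ((1 - modc (ph t))^-1))%:E else +oo%E).
(** Assertion 4 with the value +oo traded for an explicit null set, so that all later integrands are
    real. *)
Definition cond4_ae := aeT (fun t => modc (ph t) < 1) /\ forall c, 0 < c -> (om Psi c bdist < +oo)%E.
Definition cond5 := forall A : R, 0 < A -> exists K : R, exists delta : R, 0 < delta /\
              forall l : R, 0 < l < delta ->
                (mT [set t | (1 - modc (radial_limit phi t) < l)%R] <= (K / chi Psi A l^-1)%:E)%E.
Definition cond6 := forall eps : R, 0 < eps -> exists delta : R, 0 < delta < 1 /\
              forall r : R, delta <= r < 1 -> forall s : R,
                normH Psi (Cphi phi (u_ar (expi s) r)) <= eps / PsiInv Psi ((1 - r)^-1).

(** For y < 0 the supremum is over the empty set and equals 0 by convention. [PsiInv] is thereby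
    monotone on the whole line, hence measurable. *)
Lemma PsiInv_le0 y : y <= 0 -> PsiInv Psi y = 0.
Proof.
rewrite le_eqVlt => /predU1P[->|y0]; first by apply: PsiInvE; rewrite ?orlicz0.
rewrite /PsiInv (_ : [set _ | _] = set0) ?sup0 //; apply/seteqP; split => // u /= [u0 h].
by have := orlicz_ge0 oPsi u0; rewrite leNgt (le_lt_trans h).
Qed.

Lemma measurable_PsiInv : measurable_fun setT (PsiInv Psi).
Proof.
apply: nondecreasing_measurable => // x y xy.
have [x0|x0] := leP 0 x; first exact: PsiInv_le.
rewrite (PsiInv_le0 (ltW x0)); have [y0|y0] := leP 0 y; first exact: PsiInv_ge0.
by rewrite (PsiInv_le0 (ltW y0)).
Qed.

Lemma measurable_1ph : measurable_fun setT (fun t => 1 - modc (ph t)).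
Proof. by apply: measurable_funB => //; exact: (measurable_ph sphi). Qed.

Lemma measurable_bdist : measurable_fun setT bdist.
Proof.
pose w t := 1 - modc (ph t).
(* The inverse of w is expressed by measurable functions where w > 0; where w <= 0, both sides are 0
   by [PsiInv_le0]. *)
rewrite (_ : bdist = PsiInv Psi \o (fun t => if 0 < w t then expR (- ln (w t)) else 0)).
  apply: (measurableT_comp measurable_PsiInv); apply: measurable_fun_ifT => //.
    by apply: measurable_fun_ltr => //; exact: measurable_1ph.
  apply: measurableT_comp => //; apply: measurableT_comp => //.
  by apply: measurableT_comp => //; exact: measurable_1ph.
apply/funext => t /=; rewrite /bdist /xl -/(w t); case: ifPn => w0.
  by rewrite expRN lnK.
by rewrite PsiInv_le0 ?invr_le0 ?leNgt // PsiInv_le0.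
Qed.

Lemma bdist_ge0 t : modc (ph t) < 1 -> 0 <= bdist t.
Proof. by move=> h; rewrite ltW // xl_gt0 // subr_gt0. Qed.

Lemma measurable_level l : measurable [set t | 1 - modc (ph t) < l].
Proof.
rewrite (_ : [set _ | _] = (fun t => 1 - modc (ph t)) @^-1` `]-oo, l[%classic).
  by rewrite -[X in measurable X]setTI; apply: measurable_1ph => //; exact: measurable_itv.
by apply/seteqP; split => t /=; rewrite in_itv.
Qed.

Lemma measurable_ge1 : measurable [set t | ~ modc (ph t) < 1].
Proof.
rewrite (_ : [set _ | _] = ~` [set t | 0 < 1 - modc (ph t)]).
  apply: measurableC; rewrite (_ : [set _ | _] = (fun t => 1 - modc (ph t)) @^-1` `]0, +oo[%classic).
    by rewrite -[X in measurable X]setTI; apply: measurable_1ph => //; exact: measurable_itv.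
  by apply/seteqP; split => t /=; rewrite in_itv /= andbT.
by apply/seteqP; split => t /=; rewrite subr_gt0.
Qed.

Lemma cond4P : cond4 <-> cond4_ae.
Proof.
pose g t : \bar R := if modc (ph t) < 1 then (PsiInv Psi ((1 - modc (ph t))^-1))%:E else +oo%E.
have mlt : measurable_fun setT (fun t => modc (ph t) < 1).
  by apply: measurable_fun_ltr => //; exact: (measurable_ph sphi).
have mg : measurable_fun setT g.
  apply: measurable_fun_ifT => //; apply/measurable_EFinP; exact: measurable_bdist.
have gE c t : PsiE Psi (g t) c = if modc (ph t) < 1 then (Psi (`|bdist t| / c))%:E else +oo%E.
  by rewrite /g; case: ifP.
have mE c : 0 < c -> measurable_fun setT (fun t => PsiE Psi (g t) c).
  move=> c0; rewrite (_ : (fun _ => _) = fun t => if modc (ph t) < 1 then (Psi (`|bdist t| / c))%:E else +oo%E).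
    apply: measurable_fun_ifT => //; apply/measurable_EFinP; apply: (om_meas oPsi c0); exact: measurable_bdist.
  by apply/funext => t; rewrite gE.
have E0 c t : 0 < c -> (0 <= PsiE Psi (g t) c)%E.
  by move=> c0; rewrite gE; case: ifP => // _; rewrite lee_fin; exact: om_pos.
have mb c : 0 < c -> measurable_fun Tset (fun t => (Psi (`|bdist t| / c))%:E).
  by move=> c0; apply/measurable_EFinP; apply: (om_meas oPsi c0); apply: measurable_funTS; exact: measurable_bdist.
split=> [[_ H]|[ae H]].
  split; last first.
    move=> c c0; apply: le_lt_trans (H c c0); apply: intT_le.
    - exact: mb.
    - by apply: measurable_funTS; exact: mE.
    - by move=> t _; rewrite lee_fin; exact: om_pos.
    - by move=> t _; rewrite -/(g t) gE; case: ifP => // _; exact: leey.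
  have If := H 1 ltr01; have I0 : (0 <= intT (fun t => PsiE Psi (g t) 1))%E by apply: intT_ge0 => t _; exact: E0.
  pose K := fine (intT (fun t => PsiE Psi (g t) 1)).
  have KE : intT (fun t => PsiE Psi (g t) 1) = K%:E by rewrite /K fineK // ge0_fin_numE.
  have K0 : 0 <= K by exact: fine_ge0.
  apply: aeT_mT_small; first exact: measurable_ge1.
  (* On A the integrand is +oo, so Markov's inequality holds there with any weight; this weight
     makes the measure at most e. *)
  set A := [set t | _]; move=> e e0; pose n := (K + 1) / e.
  have K1 : 0 < K + 1 by rewrite ltr_wpDl.
  have n0 : 0 < n by rewrite divr_gt0.
  have ind0 t : 0 <= \1_A t :> R by rewrite indicE.
  have mI : measurable_fun Tset (\1_A : R -> R) by apply: measurable_funTS; apply: measurable_indic; exact: measurable_ge1.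
  have h : (n%:E * mT A <= K%:E)%E.
    rewrite mT_IT; last exact: measurable_ge1.
    rewrite -(ITZ (ltW n0) mI (fun t _ => ind0 t)) -KE; apply: intT_le.
    - by apply/measurable_EFinP; exact: measurable_funM.
    - by apply: measurable_funTS; exact: mE.
    - by move=> t _; rewrite lee_fin mulr_ge0 // ltW.
    - move=> t _; rewrite gE indicE; case: (boolP (t \in A)) => [/set_mem /= /negP /negbTE ->|nA].
        exact: leey.
      by rewrite mulr0; rewrite -gE; exact: E0.
  rewrite -(@lee_pmul2l _ n%:E) ?lte_fin //; apply: le_trans h _.
  by rewrite -EFinM lee_fin /n divfK ?gt_eqF // lerDl.
split; first by apply: measurable_funTS.
move=> c c0; apply: le_lt_trans (H c c0); apply: intT_ae_le.
- by apply: measurable_funTS; exact: mE.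
- exact: mb.
- by move=> t _; exact: E0.
- by move=> t _; rewrite lee_fin; exact: om_pos.
- by apply: aeT_mono ae => t _ h; rewrite -/(g t) gE h.
Qed.

(** Markov's inequality at scale 1/A: on the level set [bdist] is at least Psi^{-1}(1/l), so the
    integrand is at least chi_A(1/l). The constant K is the modular itself. *)
Lemma cond4_cond5 : cond4_ae -> cond5.
Proof.
move=> [ae H] A A0; have iA : 0 < A^-1 by rewrite invr_gt0.
have o0 := om_ge0 oPsi bdist iA; have of0 := H _ iA.
pose K := fine (om Psi A^-1 bdist).
have KE : om Psi A^-1 bdist = K%:E by rewrite /K fineK // ge0_fin_numE.
exists K, 1; split => // l /andP[l0 _]; rewrite /chi -/(xP l).
have P0 : 0 < Psi (A * xP l) by apply: orlicz_gt0 => //; rewrite mulr_gt0 // xl_gt0.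
have := @markovT R _ (fun t => Psi (`|bdist t| / A^-1)) (Psi (A * xP l)) (measurable_level l).
rewrite -[IT _]/(om Psi A^-1 bdist) KE => h.
rewrite -(@lee_pmul2l _ (Psi (A * xP l))%:E) ?lte_fin // -EFinM [X in (_ <= X%:E)%E]mulrC divfK ?gt_eqF //; apply: h.
- by apply: (om_meas oPsi iA); apply: measurable_funTS; exact: measurable_bdist.
- exact: ltW.
- by move=> t _; exact: om_pos.
- apply: aeT_mono ae => t _ t1 /= tl; apply: orlicz_le => //; first by rewrite mulr_ge0 // ltW // xl_gt0.
  rewrite invrK mulrC ler_wpM2r ?(ltW A0) // ger0_norm ?bdist_ge0 //.
  by apply: xl_le => //; [rewrite subr_gt0|exact: ltW].
Qed.

(** For A = 1 the function chi_A is the identity, so the level sets have measure O(l), and each of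
    them contains the exceptional set. *)
Lemma cond5_ae : cond5 -> aeT (fun t => modc (ph t) < 1).
Proof.
move=> /(_ 1 ltr01) [K [d [d0 H]]]; apply: aeT_mT_small; first exact: measurable_ge1.
move=> e e0; have K1 : 0 < `|K| + 1 by rewrite ltr_wpDl.
pose l := Num.min (d / 2) (e / (`|K| + 1)).
have l0 : 0 < l by rewrite lt_min !divr_gt0.
have ld : l < d by rewrite gt_min ltr_pdivrMr // ltr_pMr // ltr1n.
have := H l; rewrite l0 ld => /(_ isT); rewrite /chi mul1r PsiInvK ?invr_ge0 ?(ltW l0) // invrK => h.
apply: (@le_trans _ _ (mT [set t | 1 - modc (ph t) < l])).
  have sub : [set t | ~ modc (ph t) < 1] `<=` [set t | 1 - modc (ph t) < l].
    by move=> t /= /negP; rewrite -leNgt => h1; apply: le_lt_trans l0; rewrite subr_le0.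
  apply: lee_wpmul2l; first by rewrite lee_fin; exact: inv2pi_ge0.
  apply: le_measure; rewrite ?inE; last exact: setSI.
    by apply: measurableI; [exact: measurable_ge1|exact: measurable_Tset].
  by apply: measurableI; [exact: measurable_level|exact: measurable_Tset].
apply: le_trans h _; rewrite lee_fin; apply: (@le_trans _ _ ((`|K| + 1) * l)).
  by rewrite ler_wpM2r ?(ltW l0) // (le_trans (ler_norm _)) // lerDl.
by rewrite -ler_pdivlMl // mulrC ge_min lexx orbT.
Qed.

End LevelSets.

(** * Summation over dyadic level sets: 5 implies 4 *)

Section LevelSetSums.
Variables (R : realType) (Psi : R -> R) (phi : R[i] -> R[i]).
Hypotheses (oPsi : orlicz Psi) (dPsi : Delta2 Psi) (sphi : self_map_disc phi).
Local Notation C := R[i].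
Local Notation Tset := (@Tset R).
Local Notation ph t := (radial_limit phi t).
Local Notation xP := (xl Psi).
Implicit Types (f g : C -> C) (a z w q : C) (r s t e l c : R).

Lemma IT_sum_le (F : nat -> R -> R) (b : nat -> R) N :
  (forall k, measurable_fun Tset (F k)) -> (forall k t, 0 <= F k t) ->
  (forall k, (IT (F k) <= (b k)%:E)%E) ->
  (IT (fun t => \sum_(k < N) F k t)%R <= (\sum_(k < N) b k)%:E)%E.
Proof.
move=> mF F0 Fb; elim: N => [|N IH].
  rewrite big_ord0 (_ : (fun _ => _) = fun=> 0); first by rewrite IT_cst.
  by apply/funext => t; rewrite big_ord0.
rewrite (_ : (fun _ => _) = fun t => \sum_(k < N) F k t + F N t); last first.
  by apply/funext => t; rewrite big_ord_recr.
rewrite ITD //; last by move=> t _; exact: sumr_ge0.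
  by rewrite big_ord_recr /= EFinD; apply: leeD.
by apply: measurable_sum.
Qed.

(** Capping f by the partial sums gives functions that are eventually equal to f at almost every
    point, so Fatou handles the countable sum. *)
Lemma level_sum_bound (f : R -> R) c0 b0 (F : nat -> R -> R) (b : nat -> R) B :
  measurable_fun Tset f -> (forall t, 0 <= f t) -> 0 <= c0 ->
  (forall k, measurable_fun Tset (F k)) -> (forall k t, 0 <= F k t) ->
  (forall k, (IT (F k) <= (b k)%:E)%E) -> (forall N, \sum_(k < N) b k <= B) -> c0 + B <= b0 ->
  aeT (fun t => exists N, f t <= c0 + \sum_(k < N) F k t) -> (IT f <= b0%:E)%E.
Proof.
move=> mf f0 c00 mF F0 Fb HB Hb H.
have mS N : measurable_fun Tset (fun t => \sum_(k < N) F k t) by apply: measurable_sum.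
have S0 N t : 0 <= \sum_(k < N) F k t by exact: sumr_ge0.
pose u N t := Num.min (f t) (c0 + \sum_(k < N) F k t).
have mono N M t : (N <= M)%N -> \sum_(k < N) F k t <= \sum_(k < M) F k t.
  move=> NM; rewrite -!(big_mkord xpredT (fun k => F k t)) (big_cat_nat (n := N) (p := M)) //=.
  by rewrite lerDl sumr_ge0.
apply: (@IT_fatou R u f b0) => //.
- move=> N; apply: measurable_minr => //; exact: measurable_funD.
- by move=> N t _; rewrite le_min f0 addr_ge0.
- apply: aeT_mono H => t _ [N HN]; apply: cvg_near_cst; exists N => //= M NM.
  by rewrite /u min_l // (le_trans HN) // lerD2l mono.
- move=> N; apply: (@le_trans _ _ (IT (fun t => c0 + \sum_(k < N) F k t)%R)).
    apply: IT_le; [by apply: measurable_minr => //; exact: measurable_funD|exact: measurable_funD| |].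
      by move=> t _; rewrite le_min f0 addr_ge0.
    by move=> t _; rewrite ge_min lexx orbT.
  rewrite ITD // IT_cst; apply: (@le_trans _ _ (c0%:E + (\sum_(k < N) b k)%:E)%E).
    by apply: leeD => //; exact: IT_sum_le.
  by rewrite -EFinD lee_fin (le_trans _ Hb) // lerD2l.
Qed.

Lemma half_lt1 : 2^-1 < 1 :> R. Proof. by rewrite invf_lt1 // ltr1n. Qed.
Lemma half_ge0 : 0 <= 2^-1 :> R. Proof. by rewrite invr_ge0. Qed.

Lemma exp2_large (x : R) : exists n, x < 2 ^+ n.
Proof.
have [n hn] := @expr_small R 2^-1 x 1 half_ge0 half_lt1 ltr01; exists n.
by move: hn; rewrite exprVn ltr_pdivrMr ?exprn_gt0 // mul1r.
Qed.

(** Where p k <= [bdist] < 2 p k the integrand is at most Psi(q k), q k = 2 p k / c. Assertion 5 at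
    A = 4 alpha / c together with Delta^2 bounds the measure of this shell by |K| / Psi(q k)^2,
    leaving |K| / Psi(q k), which decays at least like 2^-k. *)
Lemma cond5_cond4 : cond5 Psi phi -> cond4_ae Psi phi.
Proof.
move=> H5; have ae := cond5_ae oPsi sphi H5; split => // c c0.
have [alpha [a1 [x0 Ha]]] := dPsi; have a0 : 0 < alpha by rewrite (lt_trans ltr01).
have A0 : 0 < 4 * alpha / c by rewrite divr_gt0 // mulr_gt0.
have [K [d [d0 HK]]] := H5 _ A0.
have [X1 [X10 HX1]] := orlicz_superlinear oPsi 1.
have [d' [d'0 Hd']] := xl_large oPsi 1.
(* the dyadic levels start where the growth conditions are in force *)
pose big := Num.max (Num.max (c * x0) (c * X1)) (Num.max 1 (Num.max X1 (4 / d))).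
have [k0 Hk0] := exp2_large big.
pose p k := 2 ^+ (k + k0) : R.
have pb k : big <= p k.
  by apply: le_trans (ltW Hk0) _; rewrite /p exprD ler_peMl ?exprn_ge0 // exprn_ege1 // ler1n.
have h1 k : c * x0 <= p k by apply: le_trans (pb k); rewrite !le_max lexx.
have h2 k : c * X1 <= p k by apply: le_trans (pb k); rewrite !le_max lexx !orbT.
have h3 k : 1 <= p k by apply: le_trans (pb k); rewrite !le_max lexx !orbT.
have h4 k : X1 <= p k by apply: le_trans (pb k); rewrite !le_max lexx !orbT.
have h5 k : 4 / d <= p k by apply: le_trans (pb k); rewrite !le_max lexx !orbT.
have p0 k : 0 < p k by apply: lt_le_trans (h3 k).
have Pp k : p k <= Psi (p k) by have := HX1 _ (h4 k); rewrite mul1r.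
pose q k := 2 * p k / c.
have q0 k : 0 < q k by rewrite divr_gt0 // mulr_gt0.
have pq k : p k / c <= q k by rewrite /q -mulrA ler_peMl ?ler1n // divr_ge0 // ltW.
have Pq0 k : 0 < Psi (q k) by exact: orlicz_gt0.
have Pq k : p k / c <= Psi (q k).
  apply: le_trans (pq k) _; have := HX1 (q k); rewrite mul1r; apply.
  by apply: le_trans (pq k); rewrite ler_pdivlMr // mulrC.
(* On the shell only the weak inequality with 1 / Psi(p k) is known; the factor 2 makes it strict.
   Its cost, a halved argument by convexity, is included in the 4 of A = 4 alpha / c. *)
pose E k := [set t | 1 - modc (ph t) < 2 / Psi (p k)].
have mE k : measurable (E k) by exact: measurable_level.
have Eb k : (mT (E k) <= (`|K| / Psi (q k) ^+ 2)%:E)%E.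
  have l0 : 0 < 2 / Psi (p k) by rewrite divr_gt0 // orlicz_gt0.
  have ld : 2 / Psi (p k) < d.
    have P1 : 0 < Psi (p k) by exact: orlicz_gt0.
    rewrite ltr_pdivrMr //; have : 4 / d <= Psi (p k) by apply: le_trans (h5 k) (Pp k).
    rewrite ler_pdivrMr // mulrC; lra.
  have := HK (2 / Psi (p k)); rewrite l0 ld => /(_ isT) h; apply: le_trans h _; rewrite lee_fin.
  have x1 : p k / 2 <= xP (2 / Psi (p k)).
    apply: le_PsiInv => //; first by rewrite divr_ge0 // ltW.
    rewrite invf_div mulrC [leRHS]mulrC; apply: orlicz_scale => //; first exact: ltW.
    by rewrite invr_ge0 ler0n invf_le1 // ler1n.
  have x2 : alpha * q k <= 4 * alpha / c * xP (2 / Psi (p k)).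
    rewrite (_ : alpha * q k = 4 * alpha / c * (p k / 2)); last by rewrite /q; field; rewrite gt_eqF.
    by rewrite ler_wpM2l // ltW.
  have x3 : Psi (q k) ^+ 2 <= chi Psi (4 * alpha / c) (2 / Psi (p k))^-1.
    apply: (@le_trans _ _ (Psi (alpha * q k))).
      apply: Ha; apply: le_trans (pq k); by rewrite ler_pdivlMr // mulrC.
    by apply: orlicz_le => //; rewrite mulr_ge0 // ltW.
  have P2 : 0 < Psi (q k) ^+ 2 by rewrite exprn_gt0.
  have P3 := lt_le_trans P2 x3.
  apply: (@le_trans _ _ (`|K| / chi Psi (4 * alpha / c) (2 / Psi (p k))^-1)).
    by rewrite ler_wpM2r ?ler_norm // invr_ge0 ltW.
  by rewrite ler_wpM2l // lef_pV2.
have mb : measurable_fun Tset (fun t => Psi (`|bdist Psi phi t| / c)).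
  by apply: (om_meas oPsi c0); apply: measurable_funTS; exact: measurable_bdist.
have ind0 (A : set R) t : 0 <= \1_A t :> R by rewrite indicE.
have mI k : measurable_fun Tset (\1_(E k) : R -> R) by apply: measurable_funTS; exact: measurable_indic.
have e2 k : 2^-1 ^+ k = (2 ^+ k)^-1 :> R by rewrite exprVn.
suff : (IT (fun t => Psi (`|bdist Psi phi t| / c)) <= (Psi (p 0%N / c) + `|K| * c * 2)%:E)%E.
  by move=> h; apply: le_lt_trans h _; exact: ltry.
apply: (@level_sum_bound _ (Psi (p 0%N / c)) _ (fun k t => Psi (q k) * \1_(E k) t)
  (fun k => `|K| * c * (2^-1 ^+ k)) (`|K| * c * 2)) => //.
- by move=> t; exact: om_pos.
- by rewrite orlicz_ge0 // divr_ge0 // ltW.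
- by move=> k; exact: measurable_funM.
- by move=> k t; rewrite mulr_ge0 // ltW.
- move=> k; rewrite (ITZ (ltW (Pq0 k)) (mI k) (fun t _ => ind0 _ t)) -mT_IT //.
  apply: (@le_trans _ _ ((Psi (q k))%:E * (`|K| / Psi (q k) ^+ 2)%:E)%E).
    by apply: lee_wpmul2l; rewrite ?lee_fin ?(ltW (Pq0 k)).
  rewrite -EFinM lee_fin.
  have -> : Psi (q k) * (`|K| / Psi (q k) ^+ 2) = `|K| / Psi (q k) by field; rewrite gt_eqF.
  rewrite -mulrA ler_wpM2l // e2; apply: (@le_trans _ _ (p k / c)^-1).
    by rewrite lef_pV2 // ?posrE ?Pq0 // (divr_gt0 (p0 k) c0).
  rewrite invf_div ler_wpM2l ?(ltW c0) // lef_pV2 ?posrE ?exprn_gt0 // /p exprD ler_peMr ?exprn_ge0 //.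
  by rewrite exprn_ege1 // ler1n.
- move=> N; rewrite -mulr_sumr ler_wpM2l // ?mulr_ge0 // ?(ltW c0) //.
  have := geom_sum_le N half_ge0 half_lt1.
  by move=> h; apply: le_trans h _; rewrite (_ : (1 - 2^-1)^-1 = 2 :> R) //; field.
apply: aeT_mono ae => t _ t1; have y0 := bdist_ge0 oPsi t1.
set y := bdist Psi phi t in y0 *; rewrite ger0_norm //.
have [yp|yp] := leP y (p 0%N).
  by exists 0%N; rewrite big_ord0 addr0; apply: orlicz_le => //; [rewrite divr_ge0 // ltW|rewrite ler_wpM2r // invr_ge0 ltW].
have [n yn] : exists n, y < p n.
  have [n hn] := exp2_large y; exists n; apply: lt_le_trans hn _.
  by rewrite /p exprD ler_peMr ?exprn_ge0 // exprn_ege1 // ler1n.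
have [k [yk1 yk2]] : exists k, p k <= y /\ y < p k.+1.
  elim: n yn => [|n IH] yn; first by have := lt_trans yp yn; rewrite ltxx.
  by have [|/IH//] := leP (p n) y; exists n.
have Et : E k t.
  rewrite /E /=; have w0 : 0 < 1 - modc (ph t) by rewrite subr_gt0.
  have := orlicz_le oPsi (ltW (p0 k)) yk1; rewrite /y /bdist xlK // => h.
  have P1 : 0 < Psi (p k) by exact: orlicz_gt0.
  rewrite ltr_pdivlMr //; apply: (@le_lt_trans _ _ 1); last by rewrite ltr1n.
  by rewrite -(ler_pM2l w0) divff ?gt_eqF // in h; rewrite mulrC mulrC.
exists k.+1; apply: (@le_trans _ _ (Psi (q k) * \1_(E k) t)).
  rewrite indicE mem_set // mulr1; apply: orlicz_le => //; first by rewrite divr_ge0 // ltW.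
  rewrite /q ler_wpM2r ?invr_ge0 ?(ltW c0) //; move: yk2; rewrite /p addSn exprS => h; exact: ltW.
rewrite big_ord_recr /= addrA lerDr; apply: addr_ge0.
  by rewrite (orlicz_ge0 oPsi) // divr_ge0 // ltW.
by apply: sumr_ge0 => i _; rewrite mulr_ge0 // ltW.
Qed.

End LevelSetSums.

(** * Covering the boundary by Carleson windows: 6 implies 5 *)

Section CarlesonWindows.
Variables (R : realType) (Psi : R -> R) (phi : R[i] -> R[i]).
Hypotheses (oPsi : orlicz Psi) (dPsi : Delta2 Psi) (sphi : self_map_disc phi).
Local Notation C := R[i].
Local Notation Tset := (@Tset R).
Local Notation ph t := (radial_limit phi t).
Local Notation xP := (xl Psi).
Implicit Types (f g : C -> C) (a z w q : C) (r s t e l c : R).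

(** The denominator is at most 2 l for the angle plus 1 - (1 - l) r <= 2 l for the radius, so |kern|
    >= 1/4. *)
Lemma u_ar_window l s t r : 0 < l -> l < 1 -> 1 - l < r -> r <= 1 -> `|s - t| <= l ->
  1 / 16 <= modc (u_ar (expi s) (1 - l) ((r%:C)%C * expi t) : C).
Proof.
move=> l0 l1 r1 r2 st; rewrite modc_u_ar /kern modcM modcV modc_real opprB addrCA subrr addr0 gtr0_norm //.
set D := modc _; have r0 : 0 <= r by lra.
have D4 : D <= 4 * l.
  have -> : D = modc (expi s - ((1 - l)%:C)%C * ((r%:C)%C * expi t)).
    have -> : expi s - ((1 - l)%:C)%C * ((r%:C)%C * expi t) =
       expi s * (1 - ((expi s)^*)%C * ((1 - l)%:C)%C * ((r%:C)%C * expi t)).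
      by rewrite mulrBr mulr1 !mulrA expi_conj -expiD subrr expi0 mul1r.
    by rewrite modcM modc_expi mul1r.
  have -> : expi s - ((1 - l)%:C)%C * ((r%:C)%C * expi t) =
     (expi s - expi t) + ((1 - (1 - l) * r)%:C)%C * expi t :> C.
    have -> : ((1 - (1 - l) * r)%:C)%C = 1 - ((1 - l)%:C)%C * (r%:C)%C :> C.
      by rewrite [LHS]realcB [X in _ - X]realcM.
    by ring.
  apply: le_trans (modcD _ _) _; have := expi_lipschitz s t.
  have h : 0 <= 1 - (1 - l) * r by nra.
  by rewrite modc_polar //; nra.
have D0 : 0 < D.
  apply: (@lt_le_trans _ _ (1 - (1 - l))); first by rewrite opprB addrCA subrr addr0.
  by apply: kern_den_ge; rewrite ?modc_expi ?modc_polar ?subr_ge0 ?(ltW l1).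
have h : 1 / 4 <= l / D by rewrite ler_pdivlMr //; lra.
by apply: (@le_trans _ _ ((1 / 4) ^+ 2)); [lra|rewrite lerXn2r ?nnegrE // ?divr_ge0 // ltW].
Qed.

Lemma cond6_cond5 : cond6 Psi phi -> cond5 Psi phi.
Proof.
move=> H6 A A0; have [alpha [a1 [x0 Ha]]] := dPsi; have a0 : 0 < alpha by rewrite (lt_trans ltr01).
pose A' := Num.max A 1; have A'1 : 1 <= A' by rewrite le_max lexx orbT.
have AA' : A <= A' by rewrite le_max lexx.
have A'0 : 0 < A' by apply: lt_le_trans A'1.
(* At the scale 2 eps / xl used below, the value 1/16 on a window becomes exactly alpha A' xl, the
   argument Delta^2 calls for. *)
pose eps := (32 * alpha * A')^-1.
have e0 : 0 < eps by rewrite invr_gt0 !mulr_gt0.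
have [d1 [/andP[d10 d11] H1]] := H6 _ e0; have [d2 [d20 H2]] := xl_large oPsi x0.
pose d := Num.min (1 - d1) (Num.min d2 1).
(* At most 2 pi / l + 1 windows are used, and l times this number is at most 2 pi + 1 <= 9, as pi <
   4. *)
exists 9, d; split; first by rewrite !lt_min subr_gt0 d11 d20 ltr01.
move=> l /andP[l0]; rewrite !lt_min => /and3P[l1 l2 l3].
pose r := 1 - l; have r0 : 0 <= r by rewrite /r; lra.
have r1 : r < 1 by rewrite /r; lra.
have rl : 1 - r = l by rewrite /r; ring.
have x0l := xl_gt0 oPsi l0.
have ex0 : 0 < 2 * eps / xP l by rewrite divr_gt0 // mulr_gt0.
pose n := (Num.trunc (2 * pi / l)).+1.
have pp := twopi_gt0 R; have pl0 : 0 <= 2 * pi / l by rewrite divr_ge0 // ltW.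
have [n1 n2] : 2 * pi / l < n%:R /\ (n%:R : R) <= 2 * pi / l + 1.
  by have /andP[h1 h2] := trunc_itv pl0; split => //; rewrite /n -addn1 natrD lerD2r.
pose h j t := Psi (`|modc (radial_limit (Cphi phi (u_ar (expi (j%:R * l)) r)) t)| / (2 * eps / xP l)).
have HP j : HPsi Psi (Cphi phi (u_ar (expi (j%:R * l)) r)).
  exact: (comp_u_ar_HPsi oPsi sphi (modc_expi _) r0 r1).
have hI (j : nat) : (IT (h j) <= 1%:E)%E.
  apply: (HPsi_om_lt oPsi dPsi (HP j)).
  have := H1 r; have -> : d1 <= r < 1 by rewrite r1 andbT /r; lra.
  move=> /(_ isT (j%:R * l)); rewrite rl -/(xP l) => hj; apply: le_lt_trans hj _.
  by rewrite ltr_pM2r ?invr_gt0 // ltr_pMl // ltr1n.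
have mh j : measurable_fun Tset (h j).
  by apply: (om_meas oPsi ex0); apply: measurable_radial_mod; exact: HPsi_approx (HP j).
have h0 j t : 0 <= h j t by exact: om_pos.
have hS := @IT_sum_le R h (fun=> 1) n mh h0 hI.
have P0 : 0 < Psi (alpha * (A' * xP l)) by apply: orlicz_gt0 => //; rewrite !mulr_gt0.
have mS : measurable_fun Tset (fun t => \sum_(k < n) h k t) by apply: measurable_sum.
have S0 t : 0 <= \sum_(k < n) h k t by exact: sumr_ge0.
have key : ((Psi (alpha * (A' * xP l)))%:E * mT [set t | (1 - modc (ph t) < l)%R] <= n%:R%:E)%E.
  apply: (@le_trans _ _ (IT (fun t => \sum_(k < n) h k t)%R)); last first.
    by apply: le_trans hS _; rewrite sumr_const card_ord.
  apply: markovT => //; [exact: measurable_level|exact: ltW|].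
  apply: aeT_mono (self_map_rad oPsi dPsi sphi) => t _ ht wt.
  have {}wt : 1 - modc (ph t) < l := wt.
  have p1 := self_map_rad_le1 sphi ht.
  have [th [th0 th1 E]] := polar_ex (ph t).
  have tl0 : 0 <= th / l by rewrite divr_ge0 // ltW.
  have /andP[j1 j2] := trunc_itv tl0; set j := Num.trunc (th / l) in j1 j2.
  have jn : (j < n)%N.
    rewrite -(ltr_nat R); apply: le_lt_trans j1 _; apply: lt_trans n1.
    by rewrite ltr_pM2r ?invr_gt0.
  rewrite (bigD1 (Ordinal jn)) //=; apply: (@le_trans _ _ (h j t)); last by rewrite lerDl sumr_ge0.
  rewrite /h ger0_norm ?modc_ge0 //.
  have -> : radial_limit (Cphi phi (u_ar (expi (j%:R * l)) r)) t = u_ar (expi (j%:R * l)) r (ph t).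
    exact: (comp_u_ar_rad sphi (modc_expi _) r0 r1 ht).
  apply: orlicz_le => //; first by rewrite !mulr_ge0 // ltW.
  have W : 1 / 16 <= modc (u_ar (expi (j%:R * l)) r (ph t)).
    rewrite E; apply: u_ar_window => //; first lra.
    rewrite ler_distl.
    move: j1 j2; rewrite ler_pdivlMr // ltr_pdivrMr // -natr1 mulrDl mul1r => j1 j2.
    by apply/andP; split; lra.
  rewrite ler_pdivlMr //; apply: le_trans W.
  by rewrite /eps le_eqVlt; apply/orP; left; apply/eqP; field; rewrite !gt_eqF.
have x1 : x0 <= A' * xP l by apply: le_trans (H2 l l0 l2) _; rewrite ler_peMl // ltW.
have P1 : 0 < Psi (A * xP l) by apply: orlicz_gt0 => //; rewrite mulr_gt0.
(* Since A' >= 1 and A' >= A, both 1/l = Psi(xl) and Psi(A xl) are at most Psi(A' xl), and Delta^2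
   absorbs the square. *)
have PA : l^-1 * Psi (A * xP l) <= Psi (alpha * (A' * xP l)).
  apply: le_trans (Ha _ x1); rewrite expr2 -(xlK oPsi l0); apply: ler_pM.
  - by rewrite orlicz_ge0 // ltW.
  - exact: ltW.
  - by apply: orlicz_le => //; [exact: ltW|rewrite ler_peMl // ltW].
  - by apply: orlicz_le => //; [rewrite mulr_ge0 // ltW|rewrite ler_wpM2r // ltW].
have n8 : n%:R * l <= 9 :> R.
  have p4 := pihalf_lt2 R; move: n2; rewrite -(ler_pM2r l0) mulrDl divfK ?gt_eqF // mul1r; lra.
rewrite /chi -/(xP l) -(@lee_pmul2l _ (Psi (alpha * (A' * xP l)))%:E) ?lte_fin //.
apply: le_trans key _; rewrite -EFinM lee_fin [leRHS]mulrA ler_pdivlMr //.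
apply: (@le_trans _ _ (l^-1 * Psi (A * xP l) * 9)); last by rewrite ler_pM2r.
rewrite mulrAC ler_wpM2r ?(ltW P1) //.
by rewrite -ler_pdivrMl ?invr_gt0 // invrK mulrC.
Qed.

End CarlesonWindows.

(** * Montel's theorem for functions bounded on smaller discs *)

Section Montel.
Variable R : realType.
Local Notation C := R[i].
Implicit Types (f g : C -> C) (z w : C) (r s e : R).

Lemma subsequence_choice (P : nat -> nat -> Prop) : (forall m N, exists n, (N <= n)%N /\ P m n) ->
  exists sg : nat -> nat, (forall k, (sg k < sg k.+1)%N) /\ forall k, P k (sg k).
Proof.
move=> H; pose g m N := xget 0%N [set n | (N <= n)%N /\ P m n].
have Hg m N : (N <= g m N)%N /\ P m (g m N).
  by have [n Hn] := H m N; have := xgetPex 0%N (ex_intro [set n | (N <= n)%N /\ P m n] n Hn).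
pose sg := fix sg k := if k is k'.+1 then g k (sg k').+1 else g 0%N 0%N.
by exists sg; split => [k|[|k]] /=; [have [] := Hg k.+1 (sg k).+1|have [] := Hg 0%N 0%N|have [] := Hg k.+1 (sg k).+1].
Qed.

Lemma subseq_ge (sg : nat -> nat) : (forall k, (sg k < sg k.+1)%N) -> forall k, (k <= sg k)%N.
Proof. by move=> H; elim=> // k IH; exact: leq_ltn_trans IH (H k). Qed.

Lemma filter_forall_lt (U : set_system nat) (A : nat -> set nat) m : Filter U -> (forall k, U (A k)) ->
  U [set n | forall k, (k < m)%N -> A k n].
Proof.
move=> fU HA; elim: m => [|m IH]; first by apply: filterS filterT.
apply: filterS (filterI IH (HA m)) => n [h1 h2] k; rewrite ltnS leq_eqVlt => /predU1P[->//|]; exact: h1.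
Qed.

Lemma horner_tail (p : {poly C}) r B N z : 0 < r -> 0 <= B -> (forall k, modc p`_k * r ^+ k <= B) -> modc z < r ->
  modc (p.[z] - \sum_(k < N) p`_k * z ^+ k) <= B * (modc z / r) ^+ N / (1 - modc z / r).
Proof.
move=> r0 B0 Hp zr; rewrite (@horner_coef_wide _ (N + size p)) ?leq_addl //.
exact: psum_cauchy.
Qed.

Lemma tail_small B q e : 0 <= B -> 0 <= q -> q < 1 -> 0 < e ->
  exists N, forall n, (N <= n)%N -> B * q ^+ n / (1 - q) < e :> R.
Proof.
move=> B0 q0 q1 e0; have d0 : 0 < 1 - q by rewrite subr_gt0.
have [N HN] := expr_small B q0 q1 (mulr_gt0 e0 d0); exists N => n Nn.
rewrite ltr_pdivrMr //; apply: le_lt_trans HN; rewrite ler_wpM2l //.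
by apply: ler_wiXn2l => //; exact: ltW.
Qed.

Lemma sum_const_le e N : 0 <= e -> \sum_(k < N) (e / N.+1%:R) <= e.
Proof.
move=> e0; rewrite sumr_const card_ord -[X in X <= _]mulr_natr -mulrA ler_piMr // mulrC.
by rewrite ler_pdivrMr // mul1r ler_nat.
Qed.

(** F n is replaced by a polynomial within 1/(n+1) of it on radius [rad n]. The ultralimits of the
    coefficients determine f, and Cauchy's estimate makes the tails uniform in n, so convergence of
    coefficients implies pointwise convergence. *)
Lemma montel (F : nat -> C -> C) (B : R -> R) : (forall n, approx (F n)) ->
  (forall n r z, modc z <= r -> r < 1 -> modc (F n z) <= B r) ->
  exists sg : nat -> nat, (forall k, (sg k < sg k.+1)%N) /\
  exists f, approx f /\ forall z, modc z < 1 ->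
    forall e, 0 < e -> exists N, forall k, (N <= k)%N -> modc (F (sg k) z - f z) < e.
Proof.
move=> AF HB; have [U [uU freeU]] := free_ultrafilter.
have FU : Filter U by exact: ultra_proper.
have half0 : 0 < 2^-1 :> R by rewrite invr_gt0.
have half1 : 2^-1 < 1 :> R by rewrite invf_lt1 // ltr1n.
have B0 r : 0 <= r -> r < 1 -> 0 <= B r.
  by move=> r0 r1; apply: le_trans (modc_ge0 (F 0%N 0)) (HB _ _ _ _ r1); rewrite modc0.
pose en n : R := n.+1%:R^-1; have en0 n : 0 < en n by rewrite invr_gt0.
have en1 n : en n <= 1 by rewrite invf_le1 // ler1n.
have ens e : 0 < e -> exists N, forall n, (N <= n)%N -> en n < e.
  move=> e0; have [N HN] := @rad_gt R _ e0; exists N.+1 => -[//|n]; rewrite ltnS => /HN.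
  by rewrite /rad ltrD2l ltrN2.
have /choice [p Hp] : forall n, exists p : {poly C}, forall z, modc z <= rad R n -> modc (F n z - p.[z]) <= en n.
  by move=> n; apply: AF => //; [exact: rad_gt0|exact: rad_lt1].
have pB n r z : 0 <= r -> r < 1 -> r <= rad R n -> modc z <= r -> modc (p n).[z] <= B r + 1.
  move=> r0 r1 rn zr; rewrite -[(p n).[z]](subrK (F n z)) addrC; apply: le_trans (modcD _ _) _.
  by apply: lerD; [exact: HB|rewrite modcBC (le_trans (Hp n z _)) // (le_trans zr)].
have cB n r k : 0 <= r -> r < 1 -> r <= rad R n -> modc (p n)`_k * r ^+ k <= B r + 1.
  by move=> r0 r1 rn; apply: cauchy_poly => // z zr; exact: pB.
have radh n : 2^-1 <= rad R n.
  rewrite /rad; have : n.+2%:R^-1 <= 2^-1 :> R by rewrite lef_pV2 ?posrE ?ler_nat.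
  by move: (n.+2%:R^-1) => x; lra.
have /choice [a Ha] : forall k, exists l, forall e, 0 < e -> U [set n | modc ((p n)`_k - l) < e].
  move=> k; apply: (@bounded_ulim _ _ uU (fun n => (p n)`_k) ((B 2^-1 + 1) * 2 ^+ k)) => n.
  have := cB n 2^-1 k (ltW half0) half1 (radh n).
  by rewrite exprVn ler_pdivrMr ?exprn_gt0.
have /choice [f Hf] : forall z, exists l, modc z < 1 -> forall e, 0 < e -> U [set n | modc (F n z - l) < e].
  move=> z; have [z1|z1] := ltP (modc z) 1; last by exists 0.
  by have [l Hl] := @bounded_ulim _ _ uU (fun n => F n z) (B (modc z)) (fun n => HB n _ _ (lexx _) z1); exists l.
(* Here f is a pointwise ultralimit and [a] collects ultralimits of coefficients; this estimate
   identifies f with the power series of [a]. *)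
have tail r z N : 0 < r -> r < 1 -> modc z < r ->
  modc (f z - \sum_(k < N) a k * z ^+ k) <= (B r + 1) * (modc z / r) ^+ N / (1 - modc z / r).
  move=> r0 r1 zr; have z1 : modc z < 1 by exact: lt_trans r1.
  set T := _ / _; apply/ler_addgt0Pr => e e0; have e4 : 0 < e / 4 by rewrite divr_gt0.
  have [N1 HN1] := ens _ e4; have d0 : 0 < 1 - r by rewrite subr_gt0.
  have [N2 HN2] := @rad_gt R _ d0.
  have eN : 0 < e / 4 / N.+1%:R by rewrite !divr_gt0.
  have [n [nN [h1 h2]]] := ultra_ex uU freeU (maxn N1 N2)
     (filterI (Hf z z1 _ e4) (filter_forall_lt N FU (fun k => Ha k _ eN))).
  move: nN; rewrite geq_max => /andP[n1 n2].
  have rn : r <= rad R n by have := HN2 n n2; lra.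
  have h3 : modc (F n z - (p n).[z]) < e / 4.
    by apply: le_lt_trans (HN1 n n1); apply: Hp; exact: le_trans (ltW zr) rn.
  have B1 : 0 <= B r + 1 by rewrite addr_ge0 // B0 // ltW.
  have h4 := @horner_tail (p n) r (B r + 1) N z r0 B1 (fun k => cB n r k (ltW r0) r1 rn) zr.
  have h5 : modc (\sum_(k < N) (p n)`_k * z ^+ k - \sum_(k < N) a k * z ^+ k) <= e / 4.
    rewrite -sumrB; apply: le_trans (modc_sum _ _ _) _.
    apply: (@le_trans _ _ (\sum_(k < N) (e / 4 / N.+1%:R))).
      apply: ler_sum => k _; rewrite -mulrBl modcM -[leRHS]mulr1; apply: ler_pM; rewrite ?modc_ge0 //.
        by apply: ltW; exact: h2.
      by rewrite modcX exprn_ile1 ?modc_ge0 // ltW.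
    by apply: sum_const_le; exact: ltW.
  have -> : f z - \sum_(k < N) a k * z ^+ k = (f z - F n z) + (F n z - (p n).[z]) +
     ((p n).[z] - \sum_(k < N) (p n)`_k * z ^+ k) +
     (\sum_(k < N) (p n)`_k * z ^+ k - \sum_(k < N) a k * z ^+ k) by ring.
  do 3 (apply: le_trans (modcD _ _) _; rewrite -?lerBrDr).
  move: h1 => /=; rewrite modcBC; rewrite -/T in h4; lra.
have Af : approx f.
  apply: analytic_approx; exists a => z z1; apply/cvgCP => e e0.
  pose r := (modc z + 1) / 2; have z0 := modc_ge0 z.
  have r0 : 0 < r by rewrite /r; lra.
  have r1 : r < 1 by rewrite /r; lra.
  have zr : modc z < r by rewrite /r; lra.
  have q1 : modc z / r < 1 by rewrite ltr_pdivrMr // mul1r.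
  have q0 : 0 <= modc z / r by rewrite divr_ge0 // ltW.
  have B1 : 0 <= B r + 1 by rewrite addr_ge0 // B0 // ltW.
  have [N HN] := tail_small B1 q0 q1 e0; exists N => n Nn.
  by rewrite modcBC; apply: le_lt_trans (HN n Nn); exact: tail.
(* At stage m only the first m coefficients are constrained, a finite intersection of members of U,
   so a genuine subsequence can be chosen. *)
have [sg [sg1 sg2]] := @subsequence_choice (fun m n => forall k, (k < m)%N -> modc ((p n)`_k - a k) < en m)
  (fun m N => ultra_ex uU freeU N (filter_forall_lt m FU (fun k => Ha k _ (en0 m)))).
exists sg; split => //; exists f; split => // z z1 e e0.
pose r := (modc z + 1) / 2; have z0 := modc_ge0 z.
have r0 : 0 < r by rewrite /r; lra.
have r1 : r < 1 by rewrite /r; lra.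
have zr : modc z < r by rewrite /r; lra.
have q1 : modc z / r < 1 by rewrite ltr_pdivrMr // mul1r.
have q0 : 0 <= modc z / r by rewrite divr_ge0 // ltW.
have B1 : 0 <= B r + 1 by rewrite addr_ge0 // B0 // ltW.
have e4 : 0 < e / 4 by rewrite divr_gt0.
have [N HN] := tail_small B1 q0 q1 e4.
have [N1 HN1] := ens _ e4; have d0 : 0 < 1 - r by rewrite subr_gt0.
have [N2 HN2] := @rad_gt R _ d0.
have eN : 0 < e / 4 / N.+1%:R by rewrite !divr_gt0.
have [N3 HN3] := ens _ eN.
exists (maxn N (maxn N1 (maxn N2 N3))) => k; rewrite !geq_max => /and4P[k0 k1 k2 k3].
have ks := subseq_ge sg1 k; set n := sg k in ks *.
have rn : r <= rad R n by have := HN2 n (leq_trans k2 ks); lra.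
have h3 : modc (F n z - (p n).[z]) < e / 4.
  by apply: le_lt_trans (HN1 n (leq_trans k1 ks)); apply: Hp; exact: le_trans (ltW zr) rn.
have h4 := @horner_tail (p n) r (B r + 1) N z r0 B1 (fun k => cB n r k (ltW r0) r1 rn) zr.
have h5 : modc (\sum_(k < N) (p n)`_k * z ^+ k - \sum_(k < N) a k * z ^+ k) <= e / 4.
  rewrite -sumrB; apply: le_trans (modc_sum _ _ _) _.
  apply: (@le_trans _ _ (\sum_(k < N) (e / 4 / N.+1%:R))).
    apply: ler_sum => j _; rewrite -mulrBl modcM -[leRHS]mulr1; apply: ler_pM; rewrite ?modc_ge0 //.
      apply: ltW; apply: lt_trans (HN3 k k3); apply: sg2; exact: leq_trans (ltn_ord j) k0.
    by rewrite modcX exprn_ile1 ?modc_ge0 // ltW.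
  by apply: sum_const_le; exact: ltW.
have -> : F n z - f z = (F n z - (p n).[z]) +
   ((p n).[z] - \sum_(k < N) (p n)`_k * z ^+ k) +
   (\sum_(k < N) (p n)`_k * z ^+ k - \sum_(k < N) a k * z ^+ k) + (\sum_(k < N) a k * z ^+ k - f z) by ring.
do 3 (apply: le_lt_trans (modcD _ _) _; rewrite -?ltrBrDr).
have := tail r z N r0 r1 zr; have := HN N (leqnn N); rewrite [modc (_ - f z)]modcBC; lra.
Qed.

End Montel.

(** * From assertion 4 to order boundedness and norm compactness *)

Section Compactness.
Variables (R : realType) (Psi : R -> R) (phi : R[i] -> R[i]).
Hypotheses (oPsi : orlicz Psi) (dPsi : Delta2 Psi) (sphi : self_map_disc phi).
Local Notation C := R[i].
Local Notation Tset := (@Tset R).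
Local Notation ph t := (radial_limit phi t).
Local Notation xP := (xl Psi).
Local Notation Cp := (Cphi phi).
Implicit Types (f g : C -> C) (a z w q : C) (r s t e l c K : R).

Definition growth K f := forall z, modc z < 1 -> modc (f z) <= K * xP (1 - modc z).

Lemma ballH_growth f : ballH Psi f -> growth 3 f.
Proof.
move=> [Hf n1] z z1; apply: le_trans (HPsi_growth oPsi dPsi Hf z1) _.
by rewrite ler_piMr // mulr_ge0 // PsiInv_ge0 // invr_ge0 subr_ge0 ltW.
Qed.

Lemma growth_le K f r z : 0 <= K -> growth K f -> modc z <= r -> r < 1 -> modc (f z) <= K * xP (1 - r).
Proof.
move=> K0 H zr r1; apply: le_trans (H z (le_lt_trans zr r1)) _; rewrite ler_wpM2l //.
by apply: xl_le => //; rewrite ?subr_gt0 // lerD2l lerN2.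
Qed.

Lemma comp_ae f : approx f -> aeT (fun t => modc (ph t) < 1) ->
  aeT (fun t => modc (ph t) < 1 /\ radial_limit (Cp f) t = f (ph t)).
Proof.
move=> Af ae; apply: aeT_mono (aeT_and ae (self_map_rad oPsi dPsi sphi)) => t _ [h1 h2].
by split => //; exact: comp_rad.
Qed.

Lemma order_bounded_of_cond4 : cond4_ae Psi phi -> order_bounded_M Psi Cp.
Proof.
move=> [ae H]; have mb : measurable_fun Tset (fun t => `|bdist Psi phi t|).
  by apply: measurableT_comp => //; apply: measurable_funTS; exact: measurable_bdist.
exists (fun t => 3 * `|bdist Psi phi t|); split; first by move=> t; rewrite mulr_ge0.
split.
  split; first exact: measurable_funM.
  move=> c c0; have c3 : 0 < c / 3 by rewrite divr_gt0.
  suff -> : intT (fun t => (Psi (`|3 * `|bdist Psi phi t| | / c))%:E) = om Psi (c / 3) (bdist Psi phi) by exact: H.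
  rewrite /om /IT; congr intT; apply/funext => t; congr (Psi _)%:E.
  by rewrite normrM normr_id ger0_norm //; field; rewrite gt_eqF.
move=> f bf; have Af := HPsi_approx bf.1.
apply: aeT_mono (comp_ae Af ae) => t _ [h1 ->].
by apply: le_trans (ballH_growth bf h1) _; rewrite ler_wpM2l // -/(bdist Psi phi t) ler_norm.
Qed.

(* Jensen applied to the dilates of f, which are bounded, followed by Fatou. *)
Lemma comp_growth_HPsi K f : cond4_ae Psi phi -> approx f -> 0 < K -> growth K f -> HPsi Psi (Cp f).
Proof.
move=> [ae H] Af K0 gf; have k1 : 0 < K^-1 by rewrite invr_gt0.
have mb : measurable_fun Tset (bdist Psi phi) by apply: measurable_funTS; exact: measurable_bdist.
have [d [d1 od]] := om_fin_le1 oPsi k1 mb (H _ k1).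
have d0 : 0 < d by exact: lt_le_trans d1.
have [d2 [d21 od2]] := om_fin_le1 oPsi ltr01 mb (H _ ltr01).
have d20 : 0 < d2 by exact: lt_le_trans d21.
pose c := K * d2; have c0 : 0 < c by rewrite mulr_gt0.
have Afp := comp_approx sphi Af.
apply/hpsiP; split; first exact: approx_analytic.
exists c; split => // r r0 r1.
have zr t : modc ((r%:C)%C * expi t : C) < 1 by rewrite modc_polar.
have pz t : modc (phi ((r%:C)%C * expi t)) < 1 by exact: self_map_lt1.
pose fn n z := f (((rad R n)%:C)%C * z).
have Afn n : approx (fn n) by apply: approx_dilate => //; [exact: rad_ge0|exact: rad_lt1].
have rad0 n := rad_ge0 R n; have rad1 n := rad_lt1 R n; have radp n := rad_gt0 R n.
have modr n z : modc (((rad R n)%:C)%C * z) = rad R n * modc z by rewrite modcM modc_real ger0_norm.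
have fnB n z : modc z < 1 -> modc (fn n z) <= K * xP (1 - rad R n).
  by move=> z1; apply: (growth_le (ltW K0) gf _ (rad1 n)); rewrite modr ler_piMr ?rad0 ?(ltW z1) //.
apply: (@IT_fatou R (fun n t => Psi (modc (fn n (phi ((r%:C)%C * expi t))) / c)) _ 1).
- move=> n; apply: cont_measT; apply: cont_Psi => //; last by move=> t; exact: modc_ge0.
  exact: (cont_circle_mod (comp_approx sphi (Afn n)) r0 r1).
- apply: cont_measT; apply: cont_Psi => //; last by move=> t; exact: modc_ge0.
  exact: (cont_circle_mod Afp r0 r1).
- by move=> n t _; rewrite (orlicz_ge0 oPsi) // divr_ge0 ?modc_ge0 // ltW.
- by move=> t _; rewrite (orlicz_ge0 oPsi) // divr_ge0 ?modc_ge0 // ltW.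
- apply: aeT_all => t _; pose w := phi ((r%:C)%C * expi t).
  have E (x : R) : 0 <= x -> Psi (x / c) = Psi `|x / c|.
    by move=> x0; rewrite ger0_norm // divr_ge0 // ltW.
  rewrite -/w (_ : (fun n => _) = (fun n => Psi `|modc (fn n w) / c|)); last first.
    by apply/funext => n; rewrite E ?modc_ge0.
  rewrite /Cphi /= -/w E ?modc_ge0 //.
  apply: (@cvg_comp _ _ _ (fun n => modc (fn n w) / c) (fun x => Psi `|x|)); last exact: orlicz_abs_continuous.
  apply: cvgM; last exact: cvg_cst.
  apply/cvgrPdist_lt => e e0; have [d3 [d30 Hd3]] := approx_cont Af (pz t) e0.
  have [N HN] := @rad_gt R _ d30; exists N => //= n Nn; rewrite distrC.
  apply: le_lt_trans (modc_dist _ _) _.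
  apply: (proj2 (Hd3 _ _)); rewrite -/w.
  have -> : ((rad R n)%:C)%C * w - w = - (((1 - rad R n)%:C)%C * w) by rewrite (realcB 1 (rad R n)) mulrBl mul1r opprB.
  rewrite modcN modcM modc_real ger0_norm ?subr_ge0 ?(ltW (rad1 n)) //.
  apply: (@le_lt_trans _ _ (1 - rad R n)); last by have := HN n Nn; lra.
  by rewrite ler_piMr ?subr_ge0 ?(ltW (rad1 n)) // ltW // pz.
move=> n; have Hn := comp_bounded_HPsi oPsi sphi (Afn n) (fnB n).
apply: le_trans (jensen_mean oPsi (hpsi_hardy2 oPsi dPsi Hn) c0 r0 r1) _.
apply: le_trans od2; apply: (@le_trans _ _ (om Psi c (fun t => K * bdist Psi phi t))).
  apply: om_le => //.
  - by apply: measurable_radial_mod; exact: comp_approx.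
  - exact: measurable_funM.
  - apply: aeT_mono (comp_ae (Afn n) ae) => t _ [h1 ->].
    have b0 := bdist_ge0 oPsi h1; rewrite ger0_norm ?modc_ge0 // ger0_norm ?mulr_ge0 ?(ltW K0) //.
    have m1 : modc (((rad R n)%:C)%C * ph t) <= modc (ph t) by rewrite modr ler_piMl ?modc_ge0 // ltW.
    exact: (growth_le (ltW K0) gf m1 h1).
have -> : om Psi c (fun t => K * bdist Psi phi t) = om Psi d2 (bdist Psi phi); last exact: lexx.
rewrite /om; congr IT; apply/funext => t; congr (Psi _).
by rewrite normrM ger0_norm ?(ltW K0) // /c; field; rewrite !gt_eqF.
Qed.

(** Dominated convergence of the modulars at scale e, the majorant being 2 K times [bdist]. It is
    integrable at this scale for every e because [bdist] has finite modular at all scales. *)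
Lemma comp_cvg K (F : nat -> C -> C) f : cond4_ae Psi phi -> 0 < K -> (forall n, approx (F n)) -> approx f ->
  (forall n, growth K (F n)) -> growth K f ->
  (forall z, modc z < 1 -> forall e, 0 < e -> exists N, forall k, (N <= k)%N -> modc (F k z - f z) < e) ->
  forall e, 0 < e -> exists N, forall k, (N <= k)%N -> distH Psi (Cp (F k)) (Cp f) <= e.
Proof.
move=> [ae H] K0 AF Af gF gf HF e e0.
have mb : measurable_fun Tset (bdist Psi phi) by apply: measurable_funTS; exact: measurable_bdist.
pose u n t := modc (radial_limit (Cp (F n)) t - radial_limit (Cp f) t).
have mu n : measurable_fun Tset (u n) by apply: measurable_radialB; exact: comp_approx.
have e1 : 0 < e / (2 * K) by rewrite divr_gt0 // mulr_gt0.
have aF : aeT (fun t => forall n, radial_limit (Cp (F n)) t = F n (ph t)).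
  by apply: aeT_forall => n; apply: aeT_mono (comp_ae (AF n) ae) => t _ [].
have [| |N HN] := @IT_dominated R (fun n t => Psi (`|u n t| / e)) (fun t => Psi (`|bdist Psi phi t| / (e / (2 * K))))
  (fun n => om_meas oPsi e0 (mu n)) (om_meas oPsi e1 mb) (fun n t _ => om_pos oPsi (u n) t e0)
  (fun t _ => om_pos oPsi (bdist Psi phi) t e1) _ _ (H _ e1) 1 ltr01.
- apply: aeT_mono (aeT_and aF (comp_ae Af ae)) => t _ [h1 [h2 h3]].
  have -> : 0 = Psi (`|0 / e|) by rewrite mul0r normr0 orlicz0.
  rewrite (_ : (fun n => _) = (fun n => Psi `|u n t / e|)); last first.
    by apply/funext => n; rewrite normrM [`|e^-1|]ger0_norm // invr_ge0 ltW.
  apply: (@cvg_comp _ _ _ (fun n => u n t / e) (fun x => Psi `|x|)); last exact: orlicz_abs_continuous.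
  apply: cvgM; last exact: cvg_cst.
  apply/cvgrPdist_lt => d d0; have [N HN] := HF _ h2 _ d0; exists N => //= n Nn.
  by rewrite sub0r normrN ger0_norm ?modc_ge0 // /u h1 h3; exact: HN.
- move=> n; apply: aeT_mono (aeT_and aF (comp_ae Af ae)) => t _ [h1 [h2 h3]].
  apply: orlicz_le => //; first by rewrite divr_ge0 // ltW.
  have b0 := bdist_ge0 oPsi h2; rewrite /u h1 h3 ger0_norm ?modc_ge0 // ger0_norm //.
  have -> : bdist Psi phi t / (e / (2 * K)) = 2 * K * bdist Psi phi t / e by field; rewrite !gt_eqF.
  rewrite ler_wpM2r ?invr_ge0 ?(ltW e0) //; apply: le_trans (modcB _ _) _.
  have := gF n _ h2; have := gf _ h2; rewrite -/(bdist Psi phi t); lra.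
exists N => k Nk; apply: lux_le => //; exact: HN.
Qed.

(** A norm at most 1 gives the modular inequality at every scale c > 1. Each of these passes to the
    limit by Fatou, so the norm of f is at most every c > 1. *)
Lemma ballH_lim (F : nat -> C -> C) f : (forall n, ballH Psi (F n)) -> approx f ->
  (forall z, modc z < 1 -> forall e, 0 < e -> exists N, forall k, (N <= k)%N -> modc (F k z - f z) < e) ->
  ballH Psi f.
Proof.
move=> BF Af HF.
have Hc c : 1 < c -> hpsi Psi f c.
  move=> c1 r r0 r1; have c0 : 0 < c by apply: lt_trans c1.
  have zr t : modc ((r%:C)%C * expi t : C) < 1 by rewrite modc_polar.
  apply: (@IT_fatou R (fun n t => Psi (modc (F n ((r%:C)%C * expi t)) / c)) _ 1).
  - move=> n; apply: cont_measT; apply: cont_Psi => //; last by move=> t; exact: modc_ge0.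
    by apply: cont_circle_mod => //; exact: HPsi_approx (BF n).1.
  - apply: cont_measT; apply: cont_Psi => //; last by move=> t; exact: modc_ge0.
    exact: cont_circle_mod.
  - by move=> n t _; rewrite (orlicz_ge0 oPsi) // divr_ge0 ?modc_ge0 // ltW.
  - by move=> t _; rewrite (orlicz_ge0 oPsi) // divr_ge0 ?modc_ge0 // ltW.
  - apply: aeT_all => t _; set w := _ * expi t.
    have E (x : R) : 0 <= x -> Psi (x / c) = Psi `|x / c|.
      by move=> x0; rewrite ger0_norm // divr_ge0 // ltW.
    rewrite (_ : (fun n => _) = (fun n => Psi `|modc (F n w) / c|)); last first.
      by apply/funext => n; rewrite E ?modc_ge0.
    rewrite E ?modc_ge0 //.
    apply: (@cvg_comp _ _ _ (fun n => modc (F n w) / c) (fun x => Psi `|x|)); last exact: orlicz_abs_continuous.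
    apply: cvgM; last exact: cvg_cst.
    apply/cvgrPdist_lt => e e0; have [N HN] := HF w (zr t) e e0; exists N => //= n Nn; rewrite distrC.
    by apply: le_lt_trans (modc_dist _ _) _; exact: HN.
  - move=> n; apply: le_trans (jensen_mean oPsi (hpsi_hardy2 oPsi dPsi (BF n).1) c0 r0 r1) _.
    by apply: (HPsi_om_lt oPsi dPsi (BF n).1); apply: le_lt_trans (BF n).2 c1.
have Hf : HPsi Psi f.
  apply/hpsiP; split; first exact: approx_analytic.
  by exists 2; split => //; apply: Hc; rewrite ltr1n.
split => //; apply/ler_addgt0Pr => e e0; apply: (normH_le oPsi dPsi Hf); first by rewrite addr_gt0.
by apply: Hc; rewrite ltrDl.
Qed.

Lemma image_ball_compact (F : nat -> C -> C) : cond4_ae Psi phi -> (forall n, ballH Psi (F n)) ->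
  exists sg : nat -> nat, (forall k, (sg k < sg k.+1)%N) /\ exists f, [/\ ballH Psi f, HPsi Psi (Cp f),
   (forall z, modc z < 1 -> forall e, 0 < e -> exists N, forall k, (N <= k)%N -> modc (F (sg k) z - f z) < e) &
   forall e, 0 < e -> exists N, forall k, (N <= k)%N -> distH Psi (Cp (F (sg k))) (Cp f) <= e].
Proof.
move=> H4 BF; have AF n := HPsi_approx (BF n).1; have GF n := ballH_growth (BF n).
have [sg [sg1 [f [Af Hf]]]] := @montel R F (fun r => 3 * xP (1 - r)) AF
   (fun n _ _ hz hr => growth_le (ler0n R 3) (GF n) hz hr).
exists sg; split => //; exists f.
have Bf : ballH Psi f := @ballH_lim (fun k => F (sg k)) f (fun n => BF (sg n)) Af Hf.
have Gf := ballH_growth Bf; split; [exact: Bf|exact: (comp_growth_HPsi H4 Af (ltr0Sn R 2) Gf)|exact: Hf|].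
exact: (@comp_cvg 3 (fun k => F (sg k)) f H4 (ltr0Sn R 2) (fun n => AF (sg n)) Af (fun n => GF (sg n)) Gf Hf).
Qed.

Lemma compact_of_cond4 : cond4_ae Psi phi -> compact_op Psi Cp.
Proof.
move=> H4 F BF; have [sg [sg1 [f [Bf Hf _ Hd]]]] := image_ball_compact H4 BF.
exists sg; split => //; exists (Cp f); split => //.
apply/cvgrPdist_le => e e0; have [N HN] := Hd e e0; exists N => //= n Nn.
by rewrite sub0r normrN ger0_norm ?lux_ge0 //; exact: HN.
Qed.

End Compactness.

(** * Norm and weak topologies of H^Psi *)

Section WeakTopology.
Variables (R : realType) (Psi : R -> R).
Hypotheses (oPsi : orlicz Psi) (dPsi : Delta2 Psi).
Local Notation C := R[i].
Local Notation Tset := (@Tset R).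
Implicit Types (f g h : C -> C) (z w : C) (e : R).

Lemma normH_triangle f g : HPsi Psi f -> HPsi Psi g -> normH Psi (f \+ g) <= normH Psi f + normH Psi g.
Proof.
move=> Hf Hg; have [c [c0 oc]] := HPsi_om oPsi dPsi Hf; have [d [d0 od]] := HPsi_om oPsi dPsi Hg.
have mm h : HPsi Psi h -> measurable_fun Tset (fun t => modc (radial_limit h t)).
  by move=> Hh; apply: measurable_radial_mod; exact: HPsi_approx Hh.
apply: (lux_triangle oPsi c0 d0 (mm _ Hf) (mm _ Hg) (mm _ (HPsiD oPsi Hf Hg)) _ oc od).
apply: aeT_mono (aeT_and (HPsi_rad oPsi dPsi Hf) (HPsi_rad oPsi dPsi Hg)) => t _ [h1 h2].
rewrite (has_radialE (has_radialD h1 h2)) !ger0_norm ?modc_ge0 //; exact: modcD.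
Qed.

Lemma distH_triangle f g h : HPsi Psi f -> HPsi Psi g -> HPsi Psi h ->
  distH Psi f g <= distH Psi f h + distH Psi h g.
Proof.
move=> Hf Hg Hh; rewrite -!(distH_normH oPsi dPsi) //.
rewrite (_ : (fun z => f z - g z) = (fun z => f z - h z) \+ (fun z => h z - g z)).
  exact: normH_triangle (HPsiB oPsi Hf Hh) (HPsiB oPsi Hh Hg).
by apply/funext => z /=; rewrite addrA subrK.
Qed.

Lemma distHC f g : distH Psi f g = distH Psi g f.
Proof. by rewrite /distH; congr lux; apply/funext => t; rewrite modcBC. Qed.

Lemma distH_ge0 f g : 0 <= distH Psi f g.
Proof. exact: lux_ge0. Qed.

(** Elements of H^Psi are encoded as functions on the whole plane with arbitrary values outside the
    disc; this and the next facts make those values invisible to the norm, to functionals and to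
    weakly open sets. *)
Lemma distH_disc_eq f g : HPsi Psi f -> HPsi Psi g -> (forall z, modc z < 1 -> f z = g z) -> distH Psi f g = 0.
Proof.
move=> Hf Hg E; apply/eqP; rewrite eq_le distH_ge0 andbT; apply/ler_addgt0Pr => e e0; rewrite add0r.
rewrite -(distH_normH oPsi dPsi Hf Hg); apply: (normH_le oPsi dPsi (HPsiB oPsi Hf Hg) e0) => r r0 r1.
rewrite (_ : (fun _ => _) = fun=> 0); first by rewrite IT_cst lee_fin.
by apply/funext => t; rewrite E ?modc_polar // subrr modc0 mul0r orlicz0.
Qed.

Lemma HPsi_disc_eq f g : HPsi Psi f -> (forall z, modc z < 1 -> f z = g z) -> HPsi Psi g.
Proof.
move=> Hf E; have [[a Ha] [M [M0 HM]]] := (hpsiP Psi f).1 Hf; apply/hpsiP; split.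
  by exists a => z z1; rewrite -E //; exact: Ha.
exists M; split => // r r0 r1; have := HM r r0 r1; congr (IT _ <= _)%E.
by apply/funext => t; rewrite E ?modc_polar.
Qed.

Lemma functional_lipschitz (L : (C -> C) -> C) : bdd_functional Psi L ->
  exists K, 0 <= K /\ forall f g, HPsi Psi f -> HPsi Psi g -> modc (L f - L g) <= K * distH Psi f g.
Proof.
move=> [LD LZ [K HK]]; exists `|K|; split => // f g Hf Hg.
have -> : L f - L g = L (fun z => f z - g z).
  rewrite (_ : (fun z => f z - g z) = f \+ (fun z => -1 * g z)).
    by rewrite LD // ?LZ // ?mulN1r //; exact: HPsiZ.
  by apply/funext => z /=; rewrite mulN1r.
have Hfg := HPsiB oPsi Hf Hg; apply: le_trans (HK _ Hfg) _; rewrite (distH_normH oPsi dPsi) //.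
by rewrite ler_wpM2r ?distH_ge0 // ler_norm.
Qed.

Lemma functional_disc_eq (L : (C -> C) -> C) f g : bdd_functional Psi L -> HPsi Psi f -> HPsi Psi g ->
  (forall z, modc z < 1 -> f z = g z) -> L f = L g.
Proof.
move=> /functional_lipschitz [K [K0 HK]] Hf Hg E; have := HK f g Hf Hg.
rewrite (distH_disc_eq Hf Hg E) mulr0 => h; apply/eqP; rewrite -subr_eq0 -modc_eq0.
by rewrite eq_le h modc_ge0.
Qed.

Lemma evaluation_bdd z : modc z < 1 -> bdd_functional Psi (fun f => f z).
Proof.
by move=> z1; split => //; exists (3 * PsiInv Psi (1 - modc z)^-1) => f Hf; exact: HPsi_growth.
Qed.

(** A basic weak neighbourhood involves finitely many Lipschitz functionals; dividing e by 1 plus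
    the sum of their constants gives a norm ball inside it. *)
Lemma weak_open_ball (O : set (C -> C)) s : weak_open Psi O -> O s ->
  exists rho, 0 < rho /\ forall g, HPsi Psi g -> distH Psi g s < rho -> O g.
Proof.
move=> [OH HO] Os; have Hs := OH _ Os; have [n [Ls [e [HL e0 HOs]]]] := HO s Os.
have /choice [K HK] : forall i, exists K, 0 <= K /\ forall f g, HPsi Psi f -> HPsi Psi g ->
    modc (Ls i f - Ls i g) <= K * distH Psi f g by move=> i; exact: functional_lipschitz.
have S0 : 0 <= \sum_i K i by apply: sumr_ge0 => i _; case: (HK i).
have S1 : 0 < 1 + \sum_i K i by rewrite ltr_pwDl.
exists (e / (1 + \sum_i K i)); split; first by rewrite divr_gt0.
move=> g Hg; rewrite ltr_pdivlMr // => h; apply: HOs => // i.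
have [Ki0 Hi] := HK i; apply: le_lt_trans (Hi _ _ Hg Hs) _; apply: le_lt_trans h.
rewrite mulrC ler_wpM2l ?distH_ge0 // (bigD1 i) //= addrCA lerDl addr_ge0 //.
by apply: sumr_ge0 => j _; case: (HK j).
Qed.

Lemma weak_open_disc_eq (O : set (C -> C)) f g : weak_open Psi O -> HPsi Psi g ->
  (forall z, modc z < 1 -> f z = g z) -> O f -> O g.
Proof.
move=> WO Hg E Of; have [rho [rho0 H]] := weak_open_ball WO Of; apply: H => //.
by rewrite distHC distH_disc_eq //; case: WO => H _; exact: H.
Qed.

End WeakTopology.

(** * Weak compactness of the image of the ball under assertion 4 *)

Section WeakCompactness.
Variables (R : realType) (Psi : R -> R) (phi : R[i] -> R[i]).
Hypotheses (oPsi : orlicz Psi) (dPsi : Delta2 Psi) (sphi : self_map_disc phi).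
Local Notation C := R[i].
Local Notation Cp := (Cphi phi).
Implicit Types (f g h : C -> C) (z w : C) (e : R).

(** An enumeration of a countable dense subset of the disc; codes that decode to nothing, or to a
    point outside the disc, are sent to 0. *)
Definition rat_point (n : nat) : C :=
  if unpickle n is Some q then
    let z := Complex (ratr (q : rat * rat).1) (ratr q.2) in if modc z < 1 then z else 0
  else 0.

Lemma rat_point_lt1 n : modc (rat_point n) < 1.
Proof.
rewrite /rat_point; case: (unpickle n) => [q|]; last by rewrite modc0.
by case: ifP => //; rewrite modc0.
Qed.

Lemma rat_point_dense z e : modc z < 1 -> 0 < e -> exists n, modc (rat_point n - z) < e.
Proof.
move=> z1 e0; pose d := Num.min (e / 2) ((1 - modc z) / 2).
have d0 : 0 < d by rewrite lt_min !divr_gt0 // subr_gt0.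
have [p hp] := @rat_in_itvoo R (complex.Re z - d) (complex.Re z + d) (ltac:(lra)).
have [q hq] := @rat_in_itvoo R (complex.Im z - d) (complex.Im z + d) (ltac:(lra)).
pose w : C := Complex (ratr p) (ratr q).
have wz : modc (w - z) < 2 * d.
  apply: le_lt_trans (modc_le_ReIm _) _; rewrite mulr_natl mulr2n Re_add Im_add Re_opp Im_opp /=.
  by move: hp hq; rewrite !in_itv /= => hp hq; apply: ltrD; rewrite ltr_distl.
have w1 : modc w < 1.
  have := modc_distr w z; have : d <= (1 - modc z) / 2 by rewrite ge_min lexx orbT.
  lra.
exists (pickle (p, q)); rewrite /rat_point pickleK /= w1; apply: lt_le_trans wz _.
have : d <= e / 2 by rewrite ge_min lexx.
lra.
Qed.

(** Testing against the first n evaluations at rational points gives a sequence in the image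
    converging to g at every such point. Norm compactness supplies a limit in the image, and
    continuity extends the equality to the disc. *)
Lemma image_ball_weak_closure g : cond4_ae Psi phi -> weak_closure Psi (Cp @` ballH Psi) g ->
  exists f, [/\ ballH Psi f, HPsi Psi (Cp f) & forall z, modc z < 1 -> Cp f z = g z].
Proof.
move=> H4 [Hg Hc].
have /choice [F HF] : forall n : nat, exists f, ballH Psi f /\ forall i, (i < n)%N ->
    modc (f (phi (rat_point i)) - g (rat_point i)) < n.+1%:R^-1.
  move=> n; have n0 : 0 < n.+1%:R^-1 :> R by rewrite invr_gt0.
  have [_ [[f Bf <-] Hf]] := Hc n (fun (i : 'I_n) f => f (rat_point i)) _
    (fun i => evaluation_bdd oPsi dPsi (rat_point_lt1 i)) n0.
  by exists f; split => // i lin; exact: (Hf (Ordinal lin)).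
have [sg [sg1 [f [Bf Hf Hp _]]]] := image_ball_compact oPsi dPsi sphi H4 (fun n => (HF n).1).
exists f; split => // z z1.
have E i : Cp f (rat_point i) = g (rat_point i).
  apply: modc_le_eps => e e0; have e2 : 0 < e / 2 by rewrite divr_gt0.
  have p1 := self_map_lt1 sphi (rat_point_lt1 i).
  have [N HN] := Hp _ p1 _ e2; have [N1 HN1] := @rad_gt R _ e2.
  pose k := maxn N (maxn N1.+1 i.+1); have ks := subseq_ge sg1 k.
  have k1 : (N <= k)%N by rewrite leq_maxl.
  have k2 : (N1.+1 <= sg k)%N by apply: leq_trans ks; rewrite !leq_max leqnn orbT.
  have k3 : (i < sg k)%N by apply: leq_trans ks; rewrite !leq_max leqnn !orbT.
  have h1 := HN k k1; have h2 := (HF (sg k)).2 i k3.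
  have h3 : (sg k).+1%:R^-1 < e / 2.
    move: k2 {h2 k3 ks h1}; case: (sg k) => // m; rewrite ltnS => /HN1.
    by rewrite /rad ltrD2l ltrN2.
  have -> : Cp f (rat_point i) - g (rat_point i) =
     - (F (sg k) (phi (rat_point i)) - f (phi (rat_point i))) + (F (sg k) (phi (rat_point i)) - g (rat_point i)).
    by rewrite /Cphi /=; ring.
  by apply: le_trans (modcD _ _) _; rewrite modcN [e]splitr; apply: lerD; apply: ltW => //; exact: lt_trans h2 h3.
apply: modc_le_eps => e e0; have e2 : 0 < e / 2 by rewrite divr_gt0.
have [d1 [d10 H1]] := approx_cont (HPsi_approx Hf) z1 e2.
have [d2 [d20 H2]] := approx_cont (HPsi_approx Hg) z1 e2.
have d0 : 0 < Num.min d1 d2 by rewrite lt_min d10.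
have [n] := rat_point_dense z1 d0; rewrite lt_min => /andP[h1 h2].
have [_ a1] := H1 _ h1; have [_ a2] := H2 _ h2.
have -> : Cp f z - g z = - (Cp f (rat_point n) - Cp f z) + (g (rat_point n) - g z) by rewrite E; ring.
by apply: le_trans (modcD _ _) _; rewrite modcN [e]splitr; apply: lerD; exact: ltW.
Qed.

Lemma weakly_compact_of_cond4 : cond4_ae Psi phi -> weakly_compact_op Psi Cp.
Proof.
move=> H4 I O WO cov; apply: contrapT => nofin.
have HC f : ballH Psi f -> HPsi Psi (Cp f).
  move=> Bf; apply: (comp_growth_HPsi oPsi dPsi sphi H4 (HPsi_approx Bf.1) (ltr0Sn R 2)).
  exact: ballH_growth.
have subK f : ballH Psi f -> weak_closure Psi (Cp @` ballH Psi) (Cp f).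
  move=> Bf; split; first exact: HC.
  move=> n Ls e _ e0; exists (Cp f); split; first by exists f.
  by move=> i; rewrite subrr modc0.
(* a Lebesgue number of the cover *)
have [eta [eta0 Heta]] : exists eta, 0 < eta /\ forall f, ballH Psi f -> exists i, forall f', ballH Psi f' ->
    distH Psi (Cp f') (Cp f) < eta -> O i (Cp f').
  apply: contrapT => no.
  have /choice [F HF] : forall n : nat, exists f, ballH Psi f /\ forall i, exists f', [/\ ballH Psi f',
      distH Psi (Cp f') (Cp f) < n.+1%:R^-1 & ~ O i (Cp f')].
    move=> n; apply: contrapT => no2; apply: no; exists n.+1%:R^-1; split; first by rewrite invr_gt0.
    move=> f Bf; apply: contrapT => no3; apply: no2; exists f; split => // i.
    apply: contrapT => no4; apply: no3; exists i => f' Bf' hd; apply: contrapT => no5.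
    by apply: no4; exists f'.
  have [sg [sg1 [f [Bf Hf _ Hd]]]] := image_ball_compact oPsi dPsi sphi H4 (fun n => (HF n).1).
  have [i Oi] := cov _ (subK f Bf).
  have [rho [rho0 Hrho]] := weak_open_ball oPsi dPsi (WO i) Oi.
  have r2 : 0 < rho / 2 by rewrite divr_gt0.
  have [N HN] := Hd _ r2; have [N1 HN1] := @rad_gt R _ r2.
  pose k := maxn N N1.+1; have ks := subseq_ge sg1 k.
  have k1 : (N <= k)%N by rewrite leq_maxl.
  have k2 : (N1.+1 <= sg k)%N by apply: leq_trans ks; rewrite leq_maxr.
  have h3 : (sg k).+1%:R^-1 < rho / 2.
    move: k2 {ks}; case: (sg k) => // m; rewrite ltnS => /HN1.
    by rewrite /rad ltrD2l ltrN2.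
  have [f' [Bf' d' nO]] := (HF (sg k)).2 i; apply: nO; apply: Hrho; first exact: HC.
  apply: le_lt_trans (distH_triangle oPsi dPsi (HC _ Bf') Hf (HC _ (HF (sg k)).1)) _.
  by rewrite [rho]splitr; apply: ltr_leD; [exact: lt_trans d' h3|exact: HN].
(* Outside the ball a default index is needed; one exists because the image of 0 is covered. *)
have /choice [ix Hix] : forall f, exists i, ballH Psi f -> forall f', ballH Psi f' ->
    distH Psi (Cp f') (Cp f) < eta -> O i (Cp f').
  move=> f; have [Bf|nB] := pselect (ballH Psi f); first by have [i Hi] := Heta f Bf; exists i.
  have [i0 _] : exists i, O i (Cp (fun=> 0)).
    apply: cov; apply: subK; have HP0 : HPsi Psi (fun=> 0 : C).
      apply: (@bounded_HPsi _ _ oPsi _ 0); last by move=> z _; rewrite modc0.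
      by move=> r r0 r1 e e0; exists 0 => z _; rewrite horner0 subrr modc0 ltW.
    split => //; apply: (normH_le oPsi dPsi HP0 ltr01) => r r0 r1.
    by rewrite modc0 mul0r orlicz0 // IT_cst lee_fin.
  exists i0 => Bf; case: (nB Bf).
(* A point of the closure missed by finitely many chosen sets is replaced by an image agreeing with
   it on the disc. Iterating produces images at mutual distance at least eta, which cannot have a
   convergent subsequence. *)
have /choice [G HG] : forall l : seq (C -> C), exists f, ballH Psi f /\
    forall j, (j < size l)%N -> ~ O (ix (nth (fun=> 0) l j)) (Cp f).
  move=> l; apply: contrapT => no; apply: nofin.
  exists (size l), (fun j => ix (nth (fun=> 0) l j)) => g Kg; apply: contrapT => ng; apply: no.
  have [f [Bf Hf E]] := image_ball_weak_closure H4 Kg; exists f; split => // j jl Oj.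
  apply: ng; exists (Ordinal jl); exact: (weak_open_disc_eq oPsi dPsi (WO _) Kg.1 E).
pose l := fix l n := if n is m.+1 then rcons (l m) (G (l m)) else [::].
have szl n : size (l n) = n by elim: n => //= n IH; rewrite size_rcons IH.
have nthl n j : (j < n)%N -> nth (fun=> 0) (l n) j = G (l j).
  elim: n => // n IH; rewrite ltnS leq_eqVlt => /predU1P[->|jn] /=; rewrite nth_rcons szl.
    by rewrite ltnn eqxx.
  by rewrite jn IH.
have sep m n : (m < n)%N -> eta <= distH Psi (Cp (G (l n))) (Cp (G (l m))).
  move=> mn; rewrite leNgt; apply/negP => h.
  apply: ((HG (l n)).2 m); first by rewrite szl.
  by rewrite nthl //; apply: Hix => //; exact: (HG _).1.
have [sg [sg1 [f [Bf Hf _ Hd]]]] := image_ball_compact oPsi dPsi sphi H4 (fun n => (HG (l n)).1).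
have e4 : 0 < eta / 4 by rewrite divr_gt0.
have [N HN] := Hd _ e4.
have T := distH_triangle oPsi dPsi (HC _ (HG (l (sg N.+1))).1) (HC _ (HG (l (sg N))).1) Hf.
rewrite [distH _ (Cp f) _]distHC in T.
have := le_trans (sep _ _ (sg1 N)) (le_trans T (lerD (HN N.+1 (leqnSn N)) (HN N (leqnn N)))).
by move=> {sep T HN Hd Heta Hix}; lra.
Qed.

End WeakCompactness.

(** * From compactness or a common majorant to assertion 6 *)

Section TestFunctionConditions.
Variables (R : realType) (Psi : R -> R) (phi : R[i] -> R[i]).
Hypotheses (oPsi : orlicz Psi) (dPsi : Delta2 Psi) (sphi : self_map_disc phi).
Local Notation C := R[i].
Local Notation Tset := (@Tset R).
Local Notation ph t := (radial_limit phi t).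
Local Notation xP := (xl Psi).
Local Notation Cp := (Cphi phi).
Implicit Types (f g : C -> C) (a z w q : C) (r s t e l c : R).

Definition tf s l : C -> C := fun z => ((xP l)%:C)%C * u_ar (expi s) (1 - l) z.

(* the common consequence of order boundedness and of weak compactness *)
Definition majorized_subseq := forall s l : nat -> R,
  (forall n, 0 < l n) -> (forall n, l n <= 1) -> (forall e, 0 < e -> exists N, forall n, (N <= n)%N -> l n < e) ->
  exists sg : nat -> nat, (forall k, (sg k < sg k.+1)%N) /\ exists G : R -> R,
    [/\ MPsi Psi G, forall t, 0 <= G t &
        forall k, aeT (fun t => modc (radial_limit (Cp (tf (s (sg k)) (l (sg k)))) t) <= G t)].

Lemma tf_ballH s l : 0 < l -> l <= 1 -> ballH Psi (tf s l).
Proof.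
move=> l0 l1; have := @u_ar_ballH _ _ oPsi dPsi (expi s) (1 - l) (modc_expi s).
rewrite /tf (_ : 1 - (1 - l) = l); last by ring.
by apply; rewrite ?subr_ge0 // gtrBl.
Qed.

Lemma tf_rad s l t : 0 < l -> l <= 1 -> has_rad phi t ->
  modc (radial_limit (Cp (tf s l)) t) = xP l * modc (u_ar (expi s) (1 - l) (ph t)).
Proof.
move=> l0 l1 ht; rewrite (comp_u_arZ_rad sphi _ (modc_expi s) _ _ ht) ?subr_ge0 ?gtrBl //.
by rewrite modcM modc_real ger0_norm // ltW // xl_gt0.
Qed.

Lemma order_bounded_majorized : order_bounded_M Psi Cp -> majorized_subseq.
Proof.
move=> [G [G0 [MG HG]]] s l l0 l1 _; exists id; split => //; exists G; split => // k.
by apply: HG; exact: tf_ballH.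
Qed.

Lemma tf_HPsi s l : 0 < l -> l <= 1 -> HPsi Psi (Cp (tf s l)).
Proof.
move=> l0 l1; apply: (@comp_bounded_HPsi _ _ _ oPsi sphi (tf s l) (xP l)).
  exact: (HPsi_approx (tf_ballH s l0 l1).1).
move=> z z1; have x0 := xl_gt0 oPsi l0.
rewrite modcM modc_real ger0_norm ?(ltW x0) // ler_piMr ?(ltW x0) //.
by apply: u_ar_le1; rewrite ?modc_expi ?subr_ge0 ?gtrBl // ltW.
Qed.

Lemma normH_u_le s l e : 0 < l -> l <= 1 -> 0 < e ->
  (om Psi e (fun t => modc (radial_limit (Cp (tf s l)) t)) <= 1%:E)%E ->
  normH Psi (Cp (u_ar (expi s) (1 - l))) <= e / xP l.
Proof.
move=> l0 l1 e0 h; have x0 := xl_gt0 oPsi l0; apply: lux_le; first by rewrite divr_gt0.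
have d0 : 0 <= 1 - l by rewrite subr_ge0.
have d1 : 1 - l < 1 by rewrite gtrBl.
have ex0 : 0 < e / xP l by rewrite divr_gt0.
have Hu := comp_u_ar_HPsi oPsi sphi (modc_expi s) d0 d1.
have m1 : measurable_fun Tset (fun t => modc (radial_limit (Cp (u_ar (expi s) (1 - l))) t)).
  by apply: measurable_radial_mod; exact: HPsi_approx Hu.
have m2 : measurable_fun Tset (fun t => modc (radial_limit (Cp (tf s l)) t)).
  by apply: measurable_radial_mod; exact: HPsi_approx (tf_HPsi s l0 l1).
apply: le_trans h; apply: IT_ae_le; try exact: om_meas; try by move=> t _; exact: om_pos.
apply: aeT_mono (self_map_rad oPsi dPsi sphi) => t _ ht.
rewrite tf_rad // (comp_u_ar_rad sphi (modc_expi s) d0 d1 ht) ger0_norm ?modc_ge0 //.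
rewrite ger0_norm ?mulr_ge0 ?modc_ge0 ?(ltW x0) //.
by rewrite invf_div mulrA [modc _ * _]mulrC; exact: lexx.
Qed.

Lemma not_cond6 : ~ cond6 Psi phi -> exists e (s l : nat -> R), [/\ 0 < e, forall n, 0 < l n,
  forall n, l n <= n.+2%:R^-1 & forall n, e / xP (l n) < normH Psi (Cp (u_ar (expi (s n)) (1 - l n)))].
Proof.
move=> n6; apply: contrapT => H; apply: n6 => e e0; apply: contrapT => H'; apply: H; exists e.
have /choice [p Hp] : forall n : nat, exists p : R * R, [/\ 0 < p.2, p.2 <= n.+2%:R^-1 &
     e / xP p.2 < normH Psi (Cp (u_ar (expi p.1) (1 - p.2)))].
  move=> n; apply: contrapT => H2; apply: H'; exists (rad R n).
  rewrite rad_gt0 rad_lt1; split => // r /andP[r0 r1] s; rewrite leNgt; apply/negP => h.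
  apply: H2; exists (s, 1 - r) => /=; split; first by rewrite subr_gt0.
    by move: r0; rewrite /rad lerBlDr addrC -lerBlDr.
  by rewrite (_ : 1 - (1 - r) = r); last ring.
exists (fun n => (p n).1), (fun n => (p n).2); split => // n; by case: (Hp n).
Qed.

Lemma inv_small (l : nat -> R) : (forall n, l n <= n.+2%:R^-1) ->
  (forall n, l n <= 1) /\ (forall e, 0 < e -> exists N, forall n, (N <= n)%N -> l n < e).
Proof.
move=> H; split=> [n|e e0].
  by apply: le_trans (H n) _; rewrite invf_le1 // ler1n.
have [N HN] := @rad_gt R _ e0; exists N => n /HN; rewrite /rad ltrD2l ltrN2.
exact: le_lt_trans (H n).
Qed.

Lemma xl_l_small e : 0 < e -> exists d, 0 < d /\ forall l, 0 < l -> l < d -> xP l * l <= e.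
Proof.
move=> e0; have [d1 [d10 H1]] := xl_sqr_small oPsi dPsi e0; have [d2 [d20 H2]] := xl_large oPsi 1.
exists (Num.min d1 d2); rewrite lt_min d10 d20; split => // l l0; rewrite lt_min => /andP[h1 h2].
apply: le_trans (H1 l l0 h1); rewrite ler_wpM2r ?(ltW l0) // expr2 ler_peMl ?H2 // ltW // xl_gt0 //.
Qed.

(** Where the denominator stays at least m, the test function is O(l Psi^{-1}(1/l)), which tends to
    0 by [xl_l_small]. *)
Lemma tf_away_le s l w m : 0 < l -> l <= 1 -> 0 < m ->
  m <= modc (1 - ((expi s)^*)%C * ((1 - l)%:C)%C * w) ->
  xP l * modc (u_ar (expi s) (1 - l) w) <= xP l * l / m ^+ 2.
Proof.
move=> l0 l1 m0 hm; have x0 := xl_gt0 oPsi l0; rewrite -mulrA ler_wpM2l ?(ltW x0) //.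
rewrite modc_u_ar /kern modcM modcV modc_real opprB addrCA subrr addr0 gtr0_norm //.
set D := modc _ in hm *; have D0 : 0 < D by exact: lt_le_trans hm.
rewrite expr_div_n; apply: (@le_trans _ _ (l / D ^+ 2)).
  by rewrite ler_wpM2r ?invr_ge0 ?sqr_ge0 // expr2 ler_piMl // ltW.
by rewrite ler_wpM2l ?(ltW l0) // lef_pV2 ?posrE ?exprn_gt0 // lerXn2r ?nnegrE // ltW.
Qed.

Lemma compact_cond6 : compact_op Psi Cp -> cond6 Psi phi.
Proof.
move=> H2; apply: contrapT => /not_cond6 [e [s [l [e0 l0 lb Hn]]]]; have [l1 ls] := inv_small lb.
have [sg [sg1 [g [Hg Hd]]]] := H2 (fun n => tf (s n) (l n)) (fun n => tf_ballH (s n) (l0 n) (l1 n)).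
have HT n : HPsi Psi (Cp (tf (s n) (l n))) by exact: tf_HPsi.
have dsm d : 0 < d -> exists N, forall k, (N <= k)%N -> distH Psi (Cp (tf (s (sg k)) (l (sg k)))) g < d.
  move=> d0; move/cvgrPdist_lt: Hd => /(_ d d0) [N _ HN]; exists N => k Nk.
  by have := HN k Nk; rewrite sub0r normrN ger0_norm ?distH_ge0.
(* Norm convergence implies pointwise convergence by the growth estimate, and the test functions
   tend to 0 at the point phi z of the open disc. *)
have g0 z : modc z < 1 -> g z = 0.
  move=> z1; apply: modc_le_eps => d d0; have d2 : 0 < d / 2 by rewrite divr_gt0.
  have p1 := self_map_lt1 sphi z1; set w := phi z in p1.
  pose K := 3 * PsiInv Psi (1 - modc z)^-1.
  have K0 : 0 < K + 1.
    by rewrite ltr_wpDl // mulr_ge0 // PsiInv_ge0 // invr_ge0 subr_ge0 ltW.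
  have [N1 HN1] := dsm _ (divr_gt0 d2 K0).
  have m0 : 0 < 1 - modc w by rewrite subr_gt0.
  have m2 : 0 < (1 - modc w) ^+ 2 by rewrite exprn_gt0.
  have [d' [d'0 Hd']] := xl_l_small (mulr_gt0 d2 m2).
  have [N2 HN2] := ls _ d'0; pose k := maxn N1 N2; have ks := subseq_ge sg1 k.
  have k2 : (N2 <= sg k)%N by apply: leq_trans ks; rewrite leq_maxr.
  have h1 : modc (Cp (tf (s (sg k)) (l (sg k))) z - g z) <= d / 2.
    have := HPsi_growth oPsi dPsi (HPsiB oPsi (HT (sg k)) Hg) z1.
    rewrite -/K (distH_normH oPsi dPsi (HT _) Hg) => h; apply: le_trans h _.
    have hN := HN1 k (leq_maxl _ _); apply: (@le_trans _ _ ((K + 1) * (d / 2 / (K + 1)))).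
      apply: ler_pM; rewrite ?distH_ge0 ?(ltW hN) ?lerDl //.
      by rewrite mulr_ge0 // PsiInv_ge0 // invr_ge0 subr_ge0 ltW.
    by rewrite mulrC divfK // gt_eqF.
  have h2 : modc (Cp (tf (s (sg k)) (l (sg k))) z) <= d / 2.
    rewrite /Cphi /= -/w /tf modcM modc_real ger0_norm ?(ltW (xl_gt0 oPsi (l0 _))) //.
    have hm : 1 - modc w <= modc (1 - ((expi (s (sg k)))^*)%C * ((1 - l (sg k))%:C)%C * w).
      apply: modc1B_ge; rewrite !modcM modc_conj modc_expi mul1r modc_real ger0_norm ?subr_ge0 ?l1 //.
      by rewrite ler_piMl ?modc_ge0 // gerBl ltW.
    apply: le_trans (tf_away_le (l0 _) (l1 _) m0 hm) _.
    by rewrite ler_pdivrMr //; apply: Hd' => //; exact: HN2.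
  rewrite subr0 [d]splitr.
  have -> : g z = - (Cp (tf (s (sg k)) (l (sg k))) z - g z) + Cp (tf (s (sg k)) (l (sg k))) z by ring.
  by apply: le_trans (modcD _ _) _; rewrite modcN; exact: lerD.
(* The distance to g is computed from boundary values, so it reduces to the norm of the composed
   test functions themselves. *)
have rg t : radial_limit g t = 0.
  apply: has_radialE => d d0; exists 1; split => // r r0 _ r1.
  by rewrite g0 ?modc_polar // subrr modc0.
have [N HN] := dsm _ e0; have := HN N (leqnn N); have := Hn (sg N).
set sN := s (sg N); set lN := l (sg N) => hn hd.
have E : distH Psi (Cp (tf sN lN)) g = normH Psi (Cp (tf sN lN)).
  by rewrite /distH /normH; congr lux; apply/funext => t; rewrite rg subr0.
rewrite E in hd; have := HPsi_om_lt oPsi dPsi (HT (sg N)) hd.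
by move=> /(normH_u_le (l0 _) (l1 _) e0); rewrite leNgt hn.
Qed.

Lemma majorized_cond6 : majorized_subseq -> cond6 Psi phi.
Proof.
move=> HD; apply: contrapT => /not_cond6 [e [s [l [e0 l0 lb Hn]]]]; have [l1 ls] := inv_small lb.
have [U [uU freeU]] := @free_ultrafilter.
(* The centres vary with n; along a subsequence they approach a, the only boundary value at which
   the test functions need not tend to 0. *)
have [a Ha] := @bounded_ulim _ _ uU (fun n => expi (s n) : C) 1 (fun n => eq_ind_r (fun x => x <= 1) (lexx 1) (modc_expi (s n))).
have a1 : modc a = 1.
  apply/eqP; rewrite -subr_eq0 -normr_eq0 eq_le normr_ge0 andbT; apply/ler_addgt0Pr => d d0; rewrite add0r.
  have [n [_ hn]] := ultra_ex uU freeU 0%N (Ha d d0).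
  by rewrite -(modc_expi (s n)); apply: le_trans (modc_dist _ _) _; rewrite modcBC ltW.
have [th [_ _]] := polar_ex a; rewrite a1 mul1r => E.
have in0 m : 0 < m.+1%:R^-1 :> R by rewrite invr_gt0.
have [sg1 [sg11 sg12]] := @subsequence_choice (fun m n => modc (expi (s n) - a) < m.+1%:R^-1)
  (fun m N => ultra_ex uU freeU N (Ha _ (in0 m))).
have inf_s (sg : nat -> nat) : (forall k, (sg k < sg k.+1)%N) ->
    forall d, 0 < d -> exists N, forall n, (N <= n)%N -> l (sg n) < d.
  move=> Hs d d0; have [N HN] := ls d d0; exists N => n Nn; apply: HN.
  exact: leq_trans Nn (subseq_ge Hs n).
(* the level set {phi* = a} is null: there the test functions centred at a blow up *)
have na : aeT (fun t => ph t <> a).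
  have [sg' [sg'1 [G' [_ _ HG']]]] := HD (fun=> th) l l0 l1 ls.
  apply: aeT_mono (aeT_and (self_map_rad oPsi dPsi sphi) (aeT_forall HG')) => t _ [ht hG] pa.
  have [d [d0 Hd]] := xl_large oPsi (G' t + 1); have [N HN] := inf_s _ sg'1 _ d0.
  have := hG N; rewrite tf_rad // pa E.
  have -> : u_ar (expi th) (1 - l (sg' N)) (expi th) = 1 :> C.
    rewrite u_arE /kern mulrAC expi_conj -expiD addNr expi0 mul1r.
    have E1 : 1 - (1 - l (sg' N))%:C%C = (l (sg' N))%:C%C :> C.
      by rewrite (realcB 1 (l (sg' N))) opprB addrCA subrr addr0.
    rewrite E1 (_ : 1 - (1 - l (sg' N)) = l (sg' N)); last by ring.
    by rewrite divff ?expr1n // -modc_eq0 modc_real normr_eq0 gt_eqF.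
  have := Hd _ (l0 _) (HN N (leqnn N)); rewrite modc1 mulr1; lra.
have [sg2 [sg21 [G [[mG MG] G0 HG]]]] := HD (s \o sg1) (l \o sg1) (fun n => l0 _) (fun n => l1 _) (inf_s _ sg11).
pose sg k := sg1 (sg2 k).
have hg k : HPsi Psi (Cp (tf (s (sg k)) (l (sg k)))) by exact: tf_HPsi.
pose u k t := modc (radial_limit (Cp (tf (s (sg k)) (l (sg k)))) t).
have mu k : measurable_fun Tset (u k) by apply: measurable_radial_mod; exact: HPsi_approx (hg k).
have [| |N HN] := @IT_dominated R (fun n t => Psi (`|u n t| / e)) (fun t => Psi (`|G t| / e))
  (fun n => om_meas oPsi e0 (mu n)) (om_meas oPsi e0 mG) (fun n t _ => om_pos oPsi (u n) t e0)
  (fun t _ => om_pos oPsi G t e0) _ _ (MG _ e0) 1 ltr01.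
- apply: aeT_mono (aeT_and (self_map_rad oPsi dPsi sphi) na) => t _ [ht nt].
  have -> : 0 = Psi (`|0 / e|) by rewrite mul0r normr0 orlicz0.
  rewrite (_ : (fun n => _) = (fun n => Psi `|u n t / e|)); last first.
    by apply/funext => n; rewrite normrM [`|e^-1|]ger0_norm // invr_ge0 ltW.
  apply: (@cvg_comp _ _ _ (fun n => u n t / e) (fun x => Psi `|x|)); last exact: orlicz_abs_continuous.
  apply: cvgM; last exact: cvg_cst.
  pose m := modc (a - ph t); have m0 : 0 < m.
    by rewrite lt_def modc_ge0 andbT modc_eq0 subr_eq0; apply/eqP => h; apply: nt.
  have m2 : 0 < m / 2 by rewrite divr_gt0.
  have m4 : 0 < m / 4 by rewrite divr_gt0.
  apply/cvgrPdist_le => d d0.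
  have [d' [d'0 Hd']] := xl_l_small (mulr_gt0 d0 (exprn_gt0 2 m2)).
  have [N1 HN1] := inf_s _ sg11 _ m4; have [N2 HN2] := inf_s _ sg11 _ d'0.
  have [N3 HN3] := @rad_gt R _ m4.
  exists (maxn N1 (maxn N2 N3.+1)) => // k; rewrite /= !geq_max => /and3P[k1 k2 k3].
  have ks := subseq_ge sg21 k.
  rewrite sub0r normrN ger0_norm ?modc_ge0 // /u tf_rad //.
  have p1 := self_map_rad_le1 sphi ht.
  (* From the distance m between a and the boundary value, at most m/4 is lost by moving the centre
     and at most m/4 by the factor 1 - l. *)
  have hm : m / 2 <= modc (1 - ((expi (s (sg k)))^*)%C * ((1 - l (sg k))%:C)%C * ph t).
    have -> : modc (1 - ((expi (s (sg k)))^*)%C * ((1 - l (sg k))%:C)%C * ph t) =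
        modc (expi (s (sg k)) - ((1 - l (sg k))%:C)%C * ph t).
      rewrite -[LHS]mul1r -{1}(modc_expi (s (sg k))) -modcM mulrBr mulr1 !mulrA expi_conj -expiD subrr expi0.
      by rewrite mul1r.
    have e1 : modc (expi (s (sg k)) - a) < m / 4.
      apply: lt_trans (sg12 (sg2 k)) _; move: (leq_trans k3 ks); case: (sg2 k) => // j; rewrite ltnS => /HN3.
      by rewrite /rad ltrD2l ltrN2.
    have e2 : modc ((l (sg k))%:C%C * ph t) <= m / 4.
      rewrite modcM modc_real ger0_norm ?(ltW (l0 _)) //; apply: (@le_trans _ _ (l (sg k))).
        by rewrite ler_piMr // ltW.
      by apply: ltW; apply: HN1; exact: leq_trans k1 ks.
    have -> : expi (s (sg k)) - ((1 - l (sg k))%:C)%C * ph t =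
      (a - ph t) - (- (expi (s (sg k)) - a) - (l (sg k))%:C%C * ph t).
      by rewrite (realcB 1 (l (sg k))) mulrBl mul1r; ring.
    have h1 := modc_distr (a - ph t) (- (expi (s (sg k)) - a) - (l (sg k))%:C%C * ph t).
    have h2 := modcB (- (expi (s (sg k)) - a)) ((l (sg k))%:C%C * ph t).
    rewrite modcN in h2; rewrite -/m in h1; apply: le_trans h1.
    move: e1 e2 h2; move: (modc (_ - a)) (modc (_ * ph t)) (modc (_ - _ * ph t)) => x y v; lra.
  apply: le_trans (tf_away_le (l0 _) (l1 _) m2 hm) _.
  rewrite ler_pdivrMr ?exprn_gt0 //; apply: Hd' => //; apply: HN2; exact: leq_trans k2 ks.
- move=> n; apply: aeT_mono (HG n) => t _ h; apply: orlicz_le => //; first by rewrite divr_ge0 // ltW.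
  by rewrite ler_wpM2r ?invr_ge0 ?(ltW e0) // ger0_norm ?modc_ge0 // ger0_norm ?G0.
have := HN N (leqnn N) => h; have := normH_u_le (l0 (sg N)) (l1 (sg N)) e0 h.
by rewrite leNgt Hn.
Qed.

End TestFunctionConditions.

(** * Sparse sums of kernels dominating a subsequence of test functions *)

Section LacunarySums.
Variables (R : realType) (Psi : R -> R).
Hypotheses (oPsi : orlicz Psi) (dPsi : Delta2 Psi).
Local Notation C := R[i].
Local Notation Tset := (@Tset R).
Local Notation xP := (xl Psi).
Implicit Types (f g : C -> C) (z w : C) (r e c : R) (s l v x y : nat -> R).

(** The requirement on the j-th index may involve the sum of w over the indices already chosen, so
    the recursion carries that sum as its second component. *)
Lemma subsequence_choice_sum (P : nat -> R -> nat -> Prop) (w : nat -> R) :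
  (forall j X N, exists n, (N <= n)%N /\ P j X n) ->
  exists sg : nat -> nat, (forall k, (sg k < sg k.+1)%N) /\ forall j, P j (\sum_(i < j) w (sg i)) (sg j).
Proof.
move=> H; pose g j X N := xget 0%N [set n | (N <= n)%N /\ P j X n].
have Hg j X N : (N <= g j X N)%N /\ P j X (g j X N).
  by have [n Hn] := H j X N; have := xgetPex 0%N (ex_intro [set n | (N <= n)%N /\ P j X n] n Hn).
pose st := fix st j : nat * R := if j is j'.+1 then
   (g j ((st j').2 + w (st j').1) (st j').1.+1, (st j').2 + w (st j').1) else (g 0%N 0 0%N, 0).
have st2 j : (st j).2 = \sum_(i < j) w (st i).1.
  by elim: j => [|j IH] /=; [rewrite big_ord0|rewrite big_ord_recr /= -IH].
exists (fun j => (st j).1); split=> [k|j]; first by have [] := Hg k.+1 ((st k).2 + w (st k).1) (st k).1.+1.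
rewrite -st2; case: j => [|j]; first by have [] := Hg 0%N 0 0%N.
by have [] := Hg j.+1 ((st j).2 + w (st j).1) (st j).1.+1.
Qed.

Lemma geom_half_le N : \sum_(k < N) 2^-1 ^+ k <= 2 :> R.
Proof.
have := geom_sum_le N (half_ge0 R) (half_lt1 R); rewrite (_ : (1 - 2^-1)^-1 = 2 :> R) //; by field.
Qed.

(* n is the last index at which y n exceeds 2^-n: the later terms form a geometric tail,
   and the earlier ones are bounded by x *)
Lemma last_large_term x y N : (forall n, 0 <= y n) -> (forall n, y n <= x n) ->
  \sum_(k < N) y k <= \sum_(k < N) 2^-1 ^+ k \/ exists n, [/\ (n < N)%N, 2^-1 ^+ n < y n &
    \sum_(k < N) y k <= \sum_(k < N) 2^-1 ^+ k + \sum_(k < n) x k + y n].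
Proof.
move=> y0 yx; elim: N => [|N IH]; first by left; rewrite !big_ord0.
have p0 : 0 <= 2^-1 ^+ N :> R by rewrite exprn_ge0 // half_ge0.
have [h|h] := leP (y N) (2^-1 ^+ N); last first.
  right; exists N; split => //; rewrite big_ord_recr /= lerD2r.
  apply: (@le_trans _ _ (\sum_(k < N) x k)); first exact: ler_sum.
  by rewrite lerDr sumr_ge0 // => k _; rewrite exprn_ge0 // half_ge0.
rewrite !big_ord_recr /=; case: IH => [IH|[n [nN yn IH]]]; first by left; exact: lerD.
by right; exists n; split => //; [exact: ltnW|lra].
Qed.

(** With n the last large index, the sum is at most 2 + X + x_n v_n, and [orlicz_add3] separates the
    three pieces. Inserting powers of 2^n x_n v_n >= 1 turns the last two into multiples of v_n^2;
    for kernels this square has mean at most l. *)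
Lemma lacunary_orlicz K x v N : 1 <= K -> Psi (2 / K) <= 2^-1 ->
  (forall n, 0 <= x n) -> (forall n, 0 <= v n) -> (forall n, v n <= 1) ->
  Psi ((\sum_(k < N) x k * v k) / (3 * K)) <= 2^-1 + \sum_(k < N)
    (4 ^+ k * x k ^+ 2 * Psi (\sum_(i < k) x i) + 2 ^+ k * x k * Psi (x k / K)) * v k ^+ 2.
Proof.
move=> K1 PK x0 v0 v1; have K0 : 0 < K by exact: lt_le_trans K1.
have K3 : 0 < 3 * K by rewrite mulr_gt0.
have y0 n : 0 <= x n * v n by rewrite mulr_ge0.
have yx n : x n * v n <= x n by rewrite ler_piMr.
have X0 n : 0 <= \sum_(i < n) x i by exact: sumr_ge0.
pose T k := (4 ^+ k * x k ^+ 2 * Psi (\sum_(i < k) x i) + 2 ^+ k * x k * Psi (x k / K)) * v k ^+ 2.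
have PX k : 0 <= Psi (\sum_(i < k) x i) by exact: orlicz_ge0.
have Px k : 0 <= Psi (x k / K) by rewrite (orlicz_ge0 oPsi) // divr_ge0 // ltW.
have T0 k : 0 <= T k.
  by rewrite mulr_ge0 ?sqr_ge0 // addr_ge0 // mulr_ge0 // mulr_ge0 ?sqr_ge0 // exprn_ge0.
have S0 : 0 <= \sum_(k < N) T k by exact: sumr_ge0.
have A0 : 0 <= \sum_(k < N) x k * v k by exact: sumr_ge0.
have twoK : 0 <= 2 / K by rewrite divr_ge0 // ltW.
have [h|[n [nN yn h]]] := last_large_term N y0 yx.
  have h2 := le_trans h (geom_half_le N).
  apply: (@le_trans _ _ (Psi (2 / K))); last by apply: le_trans PK _; rewrite lerDl.
  apply: (orlicz_le oPsi); first by rewrite divr_ge0 // ltW.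
  apply: (@le_trans _ _ (2 / (3 * K))); first by rewrite ler_wpM2r // invr_ge0 ltW.
  by rewrite ler_wpM2l // lef_pV2 // ler_peMl ?(ltW K0) // ler1n.
have h2 : \sum_(k < N) x k * v k <= 2 + \sum_(i < n) x i + x n * v n.
  by apply: le_trans h _; rewrite -[leLHS]addrA -[leRHS]addrA lerD2r; exact: geom_half_le.
set X := \sum_(i < n) x i in h2.
have XK : 0 <= X / K by rewrite divr_ge0 ?X0 // ltW.
have yK : 0 <= x n * v n / K by rewrite divr_ge0 // ltW.
apply: (@le_trans _ _ (Psi (2 / K) + Psi (X / K) + Psi (x n * v n / K))).
  apply: le_trans (orlicz_add3 oPsi twoK XK yK); apply: (orlicz_le oPsi); first by rewrite divr_ge0 // ltW.
  rewrite -!mulrDl -mulrA -invfM [K * 3]mulrC.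
  by rewrite ler_wpM2r // invr_ge0 ltW.
rewrite -addrA; apply: lerD => //; apply: (@le_trans _ _ (T n)); last first.
  by rewrite (bigD1 (Ordinal nN)) //= lerDl; apply: sumr_ge0 => i _; exact: (T0 i).
have q1 : 1 <= 2 ^+ n * (x n * v n).
  by rewrite -ler_pdivrMl ?exprn_gt0 // mulr1 -exprVn ltW.
have q2 : 1 <= 4 ^+ n * (x n * v n) ^+ 2.
  have -> : 4 ^+ n * (x n * v n) ^+ 2 = (2 ^+ n * (x n * v n)) ^+ 2.
    have -> : 4 = 2 ^+ 2 :> R by ring.
    by rewrite [RHS]exprMn exprAC.
  exact: exprn_ege1.
rewrite /T mulrDl; apply: lerD.
  apply: (@le_trans _ _ (Psi X)).
    by apply: (orlicz_le oPsi) => //; rewrite ler_pdivrMr // ler_peMr // X0.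
  have -> : 4 ^+ n * x n ^+ 2 * Psi X * v n ^+ 2 = 4 ^+ n * (x n * v n) ^+ 2 * Psi X by ring.
  by rewrite ler_peMl // PX.
apply: (@le_trans _ _ (v n * Psi (x n / K))).
  have -> : x n * v n / K = v n * (x n / K) by ring.
  by apply: (orlicz_scale oPsi); rewrite ?v0 ?v1 // divr_ge0 // ltW.
have -> : 2 ^+ n * x n * Psi (x n / K) * v n ^+ 2 = 2 ^+ n * (x n * v n) * (v n * Psi (x n / K)) by ring.
by rewrite ler_peMl // mulr_ge0.
Qed.

(** Enlarging K preserves the smallness of [xl_scaled_small], and K > 2 Psi(2) gives the bound on
    Psi(2/K) by convexity. *)
Lemma small_scale : exists K, [/\ 1 <= K, Psi (2 / K) <= 2^-1 & forall e, 0 < e -> exists d, 0 < d /\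
  forall l : R, 0 < l -> l < d -> l * xP l * Psi (xP l / K) <= e].
Proof.
have [K1 [K11 H]] := xl_scaled_small oPsi dPsi.
have P2 : 0 <= Psi 2 by exact: orlicz_ge0.
pose K := Num.max K1 (2 * Psi 2 + 1).
have KK1 : K1 <= K by rewrite le_max lexx.
have K1' : 1 <= K by exact: le_trans K11 KK1.
have K0 : 0 < K by exact: lt_le_trans K1'.
exists K; split => // [|e e0].
  have -> : 2 / K = K^-1 * 2 by rewrite mulrC.
  apply: le_trans (orlicz_scale oPsi (ler0n R 2) _) _; first by rewrite invr_ge0 (ltW K0) invf_le1.
  rewrite mulrC ler_pdivrMr // ler_pdivlMl //.
  have : 2 * Psi 2 + 1 <= K by rewrite le_max lexx orbT.
  lra.
have [d [d0 Hd]] := H e e0; exists d; split => // l l0 ld; apply: le_trans (Hd l l0 ld).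
have x0 := ltW (xl_gt0 oPsi l0).
rewrite ler_wpM2l // ?mulr_ge0 // ?(ltW l0) //; apply: (orlicz_le oPsi); first by rewrite divr_ge0 // ltW.
by rewrite ler_wpM2l // lef_pV2 ?posrE // (lt_le_trans _ K11).
Qed.

(* S is a sparse sum of the functions xl . kern: since |u_ar| <= Re kern, its real part dominates
   each of the chosen test functions. *)
Lemma lacunary_majorant s l : (forall n, 0 < l n) -> (forall n, l n <= 1) ->
  (forall e, 0 < e -> exists N, forall n, (N <= n)%N -> l n < e) ->
  exists sg : nat -> nat, (forall k, (sg k < sg k.+1)%N) /\ exists S M, [/\ approx S, 0 < M, hpsi Psi S M &
    forall k z, modc z < 1 -> modc (tf Psi (s (sg k)) (l (sg k)) z) <= modc (S z)].
Proof.
move=> l0 l1 ls; have [K [K1 PK HK]] := small_scale; have K0 : 0 < K by exact: lt_le_trans K1.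
(* The first half makes the series converge uniformly on smaller discs. The second makes the j-th
   term of [lacunary_orlicz] have mean at most 2^-j / 4; these add up to at most 1/2, and with the
   leading 1/2 the modular is at most 1. *)
pose P j X n := xP (l n) * l n <= 2^-1 ^+ j /\
  l n * (4 ^+ j * xP (l n) ^+ 2 * Psi X + 2 ^+ j * xP (l n) * Psi (xP (l n) / K)) <= 2^-1 ^+ j / 4.
have xp n : 0 < xP (l n) by exact: xl_gt0.
have ex j X N : exists n, (N <= n)%N /\ P j X n.
  have p0 : 0 < 2^-1 ^+ j :> R by rewrite exprn_gt0 // invr_gt0.
  have q0 : 0 < 4 ^+ j * (`|Psi X| + 1) by rewrite mulr_gt0 ?exprn_gt0 // ltr_wpDl.
  have t0 : 0 < 2 ^+ j :> R by rewrite exprn_gt0.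
  have p8 : 0 < 2^-1 ^+ j / 8 :> R by rewrite divr_gt0.
  have [d1 [d10 H1]] := xl_sqr_small oPsi dPsi (divr_gt0 p8 q0).
  have [d2 [d20 H2]] := HK _ (divr_gt0 p8 t0).
  have [d3 [d30 H3]] := xl_l_small oPsi dPsi p0.
  have d0 : 0 < Num.min d1 (Num.min d2 d3) by rewrite !lt_min d10 d20.
  have [N1 HN1] := ls _ d0; exists (maxn N N1); split; first exact: leq_maxl.
  have := HN1 _ (leq_maxr N N1); move: (maxn N N1) => n; rewrite !lt_min => /and3P[h1 h2 h3].
  split; first exact: H3.
  rewrite mulrDr (_ : 2^-1 ^+ j / 4 = 2^-1 ^+ j / 8 + 2^-1 ^+ j / 8 :> R); last by field.
  apply: lerD.
    have := H1 _ (l0 n) h1; rewrite ler_pdivlMr // => h; apply: le_trans h.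
    have -> : l n * (4 ^+ j * xP (l n) ^+ 2 * Psi X) = xP (l n) ^+ 2 * l n * (4 ^+ j * Psi X) by ring.
    apply: ler_wpM2l; first by rewrite mulr_ge0 ?sqr_ge0 // ltW.
    apply: ler_wpM2l; first exact: exprn_ge0.
    by apply: le_trans (ler_norm _) _; rewrite lerDl.
  have := H2 _ (l0 n) h2; rewrite ler_pdivlMr // => h; apply: le_trans h.
  by rewrite le_eqVlt; apply/orP; left; apply/eqP; ring.
have [sg [sg1 HP]] := subsequence_choice_sum (fun n => xP (l n)) ex.
exists sg; split => //; pose x k := xP (l (sg k)); pose L k := l (sg k).
have x0 k : 0 < x k by exact: xp.
pose V k z := kern (expi (s (sg k)) : C) (1 - L k) z.
have r0 k : 0 <= 1 - L k by rewrite subr_ge0; exact: l1.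
have r1 k : 1 - L k < 1 by rewrite gtrBl; exact: l0.
have AV k : approx (V k) by apply: kern_approx => //; exact: modc_expi.
have V1 k z : modc z <= 1 -> modc (V k z) <= 1 by move=> z1; apply: kern_le1 => //; exact: modc_expi.
have ReV k z : modc z <= 1 -> modc (u_ar (expi (s (sg k))) (1 - L k) z) <= complex.Re (V k z).
  by move=> z1; apply: u_ar_le_Re_kern => //; exact: modc_expi.
have Vd k z r : modc z <= r -> r < 1 -> x k * modc (V k z) <= 2^-1 ^+ k / (1 - r).
  move=> zr r1'; have d0 : 0 < 1 - r by rewrite subr_gt0.
  have D : 1 - r <= modc (1 - ((expi (s (sg k)))^*)%C * ((1 - L k)%:C)%C * z).
    apply: modc1B_ge; rewrite !modcM modc_conj modc_expi mul1r modc_real ger0_norm //.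
    by apply: le_trans zr; rewrite ler_piMl ?modc_ge0 // ltW.
  have D0 := lt_le_trans d0 D.
  rewrite /V /kern modcM modcV modc_real (_ : 1 - (1 - L k) = L k); last by ring.
  rewrite gtr0_norm ?l0 // mulrA; apply: ler_pM; rewrite ?mulr_ge0 ?invr_ge0 ?modc_ge0 ?(ltW (x0 _)) ?(ltW (l0 _)) //.
    by have [] := HP k.
  by rewrite lef_pV2.
pose S_ N z := \sum_(k < N) ((x k)%:C)%C * V k z.
have AS N : approx (S_ N).
  elim: N => [|N IH].
    by move=> r _ _ e e0; exists 0 => z _; rewrite /S_ big_ord0 horner0 subrr modc0 ltW.
  have := approxD IH (approxZ ((x N)%:C)%C (AV N)); congr approx.
  by apply/funext => z; rewrite /S_ big_ord_recr.
have SC N M z r : modc z <= r -> r < 1 -> modc (S_ (N + M)%N z - S_ N z) <= 2 * 2^-1 ^+ N / (1 - r).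
  move=> zr r1'; have d0 : 0 < 1 - r by rewrite subr_gt0.
  rewrite /S_ big_split_ord /= addrAC subrr add0r; apply: le_trans (modc_sum _ _ _) _.
  apply: (@le_trans _ _ (\sum_(k < M) 2^-1 ^+ N / (1 - r) * 2^-1 ^+ k)).
    apply: ler_sum => k _; rewrite modcM modc_real gtr0_norm //; apply: le_trans (Vd _ _ _ zr r1') _.
    by rewrite exprD mulrAC.
  rewrite -mulr_sumr (_ : 2 * 2^-1 ^+ N / (1 - r) = 2^-1 ^+ N / (1 - r) * 2); last by ring.
  apply: ler_wpM2l; last exact: geom_half_le.
  by rewrite divr_ge0 ?exprn_ge0 ?half_ge0 // ltW.
have S_0 z : S_ 0%N z = 0 by rewrite /S_ big_ord0.
have [U [uU freeU]] := @free_ultrafilter; have FU : Filter U by exact: ultra_proper.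
have /choice [S HS] : forall z, exists q : C, modc z < 1 -> forall e, 0 < e -> U [set n | modc (S_ n z - q) < e].
  move=> z; have [z1|z1] := ltP (modc z) 1; last by exists 0.
  have SB n : modc (S_ n z) <= 2 * 2^-1 ^+ 0 / (1 - modc z).
    by have := SC 0%N n z _ (lexx _) z1; rewrite S_0 subr0.
  by have [q Hq] := bounded_ulim uU SB; exists q.
have tail N z r : modc z <= r -> r < 1 -> modc (S z - S_ N z) <= 2 * 2^-1 ^+ N / (1 - r).
  move=> zr r1'; apply/ler_addgt0Pr => e e0.
  have [n [Nn hn]] := ultra_ex uU freeU N (HS z (le_lt_trans zr r1') e e0).
  have := SC N (n - N)%N z r zr r1'; rewrite subnKC // => h.
  have -> : S z - S_ N z = (S_ n z - S_ N z) - (S_ n z - S z) by ring.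
  by apply: le_trans (modcB _ _) _; apply: lerD => //; exact: ltW.
have tsm r e : r < 1 -> 0 < e -> exists N, forall n, (N <= n)%N -> 2 * 2^-1 ^+ n / (1 - r) < e.
  move=> r1' e0; have d0 : 0 < 1 - r by rewrite subr_gt0.
  have [N HN] := expr_small 2 (half_ge0 R) (half_lt1 R) (mulr_gt0 e0 d0); exists N => n Nn.
  rewrite ltr_pdivrMr //; apply: le_lt_trans HN; rewrite ler_wpM2l //.
  exact: (ler_wiXn2l (half_ge0 R) (ltW (half_lt1 R)) Nn).
have ASS : approx S.
  apply: (@approx_lim _ S_ S) => // r _ r1' e e0; have [N HN] := tsm r e r1' e0; exists N => z zr.
  by apply: le_trans (tail N z r zr r1') _; exact: ltW (HN N (leqnn N)).
have M0 : 0 < 3 * K by rewrite mulr_gt0.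
exists S, (3 * K); split => //.
- move=> r r0' r1'; have zr t : modc ((r%:C)%C * expi t : C) < 1 by rewrite modc_polar.
  have zr' t : modc ((r%:C)%C * expi t : C) <= 1 by exact: ltW.
  apply: (@IT_fatou R (fun n t => Psi (modc (S_ n ((r%:C)%C * expi t)) / (3 * K))) _ 1).
  + move=> n; apply: cont_measT; apply: cont_Psi => //; last by move=> t; exact: modc_ge0.
    exact: cont_circle_mod.
  + apply: cont_measT; apply: cont_Psi => //; last by move=> t; exact: modc_ge0.
    exact: cont_circle_mod.
  + by move=> n t _; rewrite (orlicz_ge0 oPsi) // divr_ge0 ?modc_ge0 // ltW.
  + by move=> t _; rewrite (orlicz_ge0 oPsi) // divr_ge0 ?modc_ge0 // ltW.
  + apply: aeT_all => t _; have := zr t; set w := _ * expi t => w1.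
    have E (y : R) : 0 <= y -> Psi (y / (3 * K)) = Psi `|y / (3 * K)|.
      by move=> y0; rewrite ger0_norm // divr_ge0 // ltW.
    rewrite (_ : (fun n => _) = (fun n => Psi `|modc (S_ n w) / (3 * K)|)); last first.
      by apply/funext => n; rewrite E ?modc_ge0.
    rewrite E ?modc_ge0 //.
    apply: (@cvg_comp _ _ _ (fun n => modc (S_ n w) / (3 * K)) (fun q : R => Psi `|q|)); last exact: orlicz_abs_continuous.
    apply: cvgM; last exact: cvg_cst.
    apply/cvgrPdist_lt => e e0; have [N HN] := tsm _ _ w1 e0; exists N => //= n Nn.
    apply: le_lt_trans (modc_dist _ _) _; exact: le_lt_trans (tail n w _ (lexx _) w1) (HN n Nn).
  + move=> N; pose c k := 4 ^+ k * x k ^+ 2 * Psi (\sum_(i < k) x i) + 2 ^+ k * x k * Psi (x k / K).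
    have c0 k : 0 <= c k.
      by rewrite addr_ge0 // mulr_ge0 ?mulr_ge0 ?exprn_ge0 ?(ltW (x0 _)) //;
        rewrite (orlicz_ge0 oPsi) // ?divr_ge0 ?(ltW (x0 _)) ?(ltW K0) //; apply: sumr_ge0 => i _; exact: ltW.
    pose F k t := c k * modc (V k ((r%:C)%C * expi t)) ^+ 2.
    have mV k : measurable_fun Tset (fun t => modc (V k ((r%:C)%C * expi t)) ^+ 2).
      by apply: cont_measT; apply: cont_modsq; [exact: cont_circle_Re|exact: cont_circle_Im].
    have mF k : measurable_fun Tset (F k) by apply: measurable_funM => //; exact: measurable_cst.
    have F0 k t : 0 <= F k t by rewrite mulr_ge0 ?sqr_ge0.
    have FI k : (IT (F k) <= (2^-1 ^+ k / 4)%:E)%E.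
      rewrite (ITZ (c0 k) (mV k) (fun t _ => sqr_ge0 _)).
      apply: (@le_trans _ _ ((c k)%:E * (L k)%:E)%E).
        apply: lee_wpmul2l; first by rewrite lee_fin.
        have := kern_mean (modc_expi (s (sg k))) (r0 k) (r1 k) r0' r1'.
        by rewrite (_ : 1 - (1 - L k) = L k) //; ring.
      by rewrite -EFinM lee_fin mulrC; have [] := HP k.
    apply: (@le_trans _ _ (IT (fun t => 2^-1 + \sum_(k < N) F k t)%R)).
      apply: IT_le.
      * apply: cont_measT; apply: cont_Psi => //; last by move=> t; exact: modc_ge0.
        exact: cont_circle_mod.
      * by apply: measurable_funD => //; exact: measurable_sum.
      * by move=> t _; rewrite (orlicz_ge0 oPsi) // divr_ge0 ?modc_ge0 // ltW.
      * move=> t _; apply: le_trans (lacunary_orlicz N K1 PK (fun n => ltW (x0 n)) (fun n => modc_ge0 (V n _)) (fun n => V1 n _ (zr' t))).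
        apply: (orlicz_le oPsi); first by rewrite divr_ge0 ?modc_ge0 // ltW.
        rewrite ler_wpM2r ?invr_ge0 ?(ltW M0) //; apply: le_trans (modc_sum _ _ _) _.
        by apply: ler_sum => k _; rewrite modcM modc_real gtr0_norm.
    rewrite ITD //; last first.
    - by move=> t _; exact: sumr_ge0.
    - exact: measurable_sum.
    rewrite IT_cst; apply: (@le_trans _ _ ((2^-1)%:E + (\sum_(k < N) 2^-1 ^+ k / 4)%:E)%E).
      by apply: leeD => //; exact: (IT_sum_le N mF F0 FI).
    rewrite -EFinD lee_fin -mulr_suml; have := geom_half_le N; lra.
- move=> k z z1; have z1' := ltW z1.
  rewrite /tf modcM modc_real gtr0_norm ?xl_gt0 // -/(x k).
  apply: (@le_trans _ _ (complex.Re (S z))); last exact: Re_le_modc.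
  apply/ler_addgt0Pr => e e0; have [N HN] := tsm _ _ z1 e0.
  pose n := maxn N k.+1; have kn : (k < n)%N by rewrite leq_maxr.
  have h : complex.Re (S_ n z) <= complex.Re (S z) + e.
    rewrite -lerBlDl -Re_opp -Re_add; apply: le_trans (Re_le_modc _) _; rewrite modcBC.
    by apply: le_trans (tail n z _ (lexx _) z1) _; apply: ltW; apply: HN; rewrite leq_maxl.
  apply: le_trans h; rewrite /S_ Re_sum (bigD1 (Ordinal kn)) //= Re_real_mul.
  apply: (@le_trans _ _ (x k * complex.Re (V k z))); first by rewrite ler_wpM2l ?(ltW (x0 k)) // ReV.
  (* The remaining terms of the partial sum have nonnegative real part, so they can only help. *)
  rewrite lerDl; apply: sumr_ge0 => i _; rewrite Re_real_mul mulr_ge0 ?(ltW (x0 _)) //.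
  by apply: le_trans (ReV _ _ z1'); exact: modc_ge0.
Qed.

End LacunarySums.

(** * Means of signed integrable functions on the circle *)

Section CircleIntegral.
Variable R : realType.
Local Notation C := R[i].
Local Notation mu := (@lebesgue_measure R).
Local Notation Tset := (@Tset R).
Implicit Types (h k : R -> R) (c t : R).

Definition intg h := measurable_fun Tset h /\ (IT (fun t => `|h t|%R) < +oo)%E.

(** The real-valued counterpart of [IT], needed because the functionals below integrate signed
    functions. *)
Definition mean h : R := (2 * pi)^-1 * \int[mu]_(t in Tset) h t.

Lemma intg_integrable h : intg h -> mu.-integrable Tset (EFin \o h).
Proof.
move=> [mh fh]; apply/integrableP; split; first exact/measurable_EFinP.
move: fh; rewrite /IT /intT => fh; under eq_integral do rewrite /=.
rewrite ltey; apply/negP => /eqP E; move: fh; rewrite [X in (_ * X)%E]E.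
by rewrite mulry gtr0_sg ?mul1e ?ltxx // invr_gt0 twopi_gt0.
Qed.

Lemma intg_abs_le h k : measurable_fun Tset h -> measurable_fun Tset k ->
  (forall t, Tset t -> `|h t| <= k t) -> (IT k < +oo)%E -> intg h.
Proof.
move=> mh mk hk fk; split => //; apply: le_lt_trans fk; apply: IT_le => //.
exact: measurableT_comp.
Qed.

Lemma intg_abs h : intg h -> intg (fun t => `|h t|).
Proof.
move=> [mh fh]; apply: (@intg_abs_le _ (fun t => `|h t|)) => //; try exact: measurableT_comp.
by move=> t _; rewrite normr_id.
Qed.

Lemma intgD h k : intg h -> intg k -> intg (fun t => h t + k t).
Proof.
move=> [mh fh] [mk fk]; apply: (@intg_abs_le _ (fun t => `|h t| + `|k t|)).
- exact: measurable_funD.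
- by apply: measurable_funD; exact: measurableT_comp.
- by move=> t _; exact: ler_normD.
- by rewrite ITD //; try exact: measurableT_comp; rewrite lte_add_pinfty.
Qed.

Lemma intgM h k c : intg h -> measurable_fun Tset k -> (forall t, `|k t| <= c) -> intg (fun t => h t * k t).
Proof.
move=> [mh fh] mk kc; have c0 : 0 <= c by apply: le_trans (kc 0).
apply: (@intg_abs_le _ (fun t => c * `|h t|)).
- exact: measurable_funM.
- by apply: measurable_funM => //; exact: measurableT_comp.
- by move=> t _; rewrite normrM mulrC ler_wpM2r.
- rewrite ITZ //; last exact: measurableT_comp.
  by rewrite lte_mul_pinfty ?lee_fin.
Qed.

Lemma intgZ h c : intg h -> intg (fun t => c * h t).
Proof.
move=> ih; have := @intgM h (fun=> c) `|c| ih (measurable_cst _) (fun=> lexx _).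
by congr intg; apply/funext => t; rewrite mulrC.
Qed.

Lemma meanD h k : intg h -> intg k -> mean (fun t => h t + k t) = mean h + mean k.
Proof.
by move=> ih ik; rewrite /mean RintegralD ?mulrDr //; try exact: intg_integrable; exact: measurable_Tset.
Qed.

Lemma meanZ h c : intg h -> mean (fun t => c * h t) = c * mean h.
Proof.
move=> ih; rewrite /mean RintegralZl; [|exact: measurable_Tset|exact: intg_integrable].
exact: mulrCA.
Qed.

Lemma mean_le h k : intg h -> intg k -> (forall t, Tset t -> h t <= k t) -> mean h <= mean k.
Proof.
move=> ih ik hk; rewrite /mean ler_wpM2l ?inv2pi_ge0 //.
by apply: le_Rintegral => //; try exact: intg_integrable; exact: measurable_Tset.
Qed.

Lemma mean_abs h : intg h -> `|mean h| <= mean (fun t => `|h t|).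
Proof.
move=> ih; rewrite /mean normrM ger0_norm ?inv2pi_ge0 // ler_wpM2l ?inv2pi_ge0 //.
by apply: le_normr_Rintegral; [exact: measurable_Tset|exact: intg_integrable].
Qed.

Lemma mean_IT h : intg h -> (forall t, 0 <= h t) -> (mean h)%:E = IT h.
Proof.
move=> ih h0; rewrite /mean /IT /intT EFinM /Rintegral fineK //.
by apply: integrable_fin_num; [exact: measurable_Tset|exact: intg_integrable].
Qed.

Lemma mean_ae_eq h k : intg h -> intg k -> aeT (fun t => h t = k t) -> mean h = mean k.
Proof.
move=> ih ik E; have inb := intgZ (-1) ik; have ib := intgD ih inb.
have : `|mean (fun t => h t + -1 * k t)| <= 0.
  apply: le_trans (mean_abs ib) _; rewrite -lee_fin (mean_IT (intg_abs ib)) //.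
  rewrite -(IT_cst 0); apply: IT_ae_le => //; first exact: (intg_abs ib).1.
  by apply: aeT_mono E => t _ ->; rewrite mulN1r subrr normr0.
rewrite normr_le0 meanD // meanZ // mulN1r subr_eq0 => /eqP; exact.
Qed.

Lemma mean_pair_bound (h1 h2 a b k m : R -> R) c : intg h1 -> intg h2 -> measurable_fun Tset a -> measurable_fun Tset b ->
  measurable_fun Tset k -> intg m ->
  (forall t, `|a t| <= k t) -> (forall t, `|b t| <= k t) -> (forall t, k t <= c) ->
  (forall t, `|h1 t| <= m t) -> (forall t, `|h2 t| <= m t) ->
  `|mean (fun t => h1 t * a t + h2 t * b t)| <= 2 * mean (fun t => m t * k t).
Proof.
move=> i1 i2 ma mb mk im ak bk kc h1m h2m.
have k0 t : 0 <= k t by apply: le_trans (ak t).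
have m0 t : 0 <= m t by apply: le_trans (h1m t).
have ia : intg (fun t => h1 t * a t) by apply: (intgM i1 ma) => t; exact: le_trans (ak t) (kc t).
have ib : intg (fun t => h2 t * b t) by apply: (intgM i2 mb) => t; exact: le_trans (bk t) (kc t).
have ik : intg (fun t => m t * k t) by apply: (intgM im mk (c := c)) => t; rewrite ger0_norm.
have iab := intgD ia ib.
apply: le_trans (mean_abs iab) _; rewrite -meanZ //; apply: mean_le; [exact: intg_abs|exact: intgZ|].
move=> t _; apply: le_trans (ler_normD _ _) _; rewrite mulr_natl mulr2n !normrM.
by apply: lerD; apply: ler_pM.
Qed.

End CircleIntegral.

(** * Pairings of boundary functions with bounded densities *)

Section OrliczFunctionals.
Variables (R : realType) (Psi : R -> R).
Hypotheses (oPsi : orlicz Psi) (dPsi : Delta2 Psi).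
Local Notation C := R[i].
Local Notation Tset := (@Tset R).
Implicit Types (f g h : C -> C) (c t e : R) (gam : R -> R).

(** Superlinearity gives y <= X + Psi(y), applied to y = |h| / M. *)
Lemma HPsi_mod_intg h : HPsi Psi h -> intg (fun t => modc (radial_limit h t)).
Proof.
move=> Hh; have [M [M0 HM]] := HPsi_om oPsi dPsi Hh; have [X [X0 HX]] := orlicz_superlinear oPsi 1.
have mh : measurable_fun Tset (fun t => modc (radial_limit h t)).
  by apply: measurable_radial_mod; exact: HPsi_approx Hh.
have mP := om_meas oPsi M0 mh.
have P0 t : 0 <= Psi (`|modc (radial_limit h t)| / M) by exact: om_pos.
have MX0 : 0 <= M * X by rewrite mulr_ge0 // ltW.
apply: (@intg_abs_le _ _ (fun t => M * X + M * Psi (`|modc (radial_limit h t)| / M))) => //.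
- by apply: measurable_funD => //; exact: measurable_funM.
- move=> t _; rewrite -mulrDr -ler_pdivrMl // mulrC; set y := _ / M.
  have [yX|Xy] := leP X y; first by have := HX y yX; rewrite mul1r => h1; apply: le_trans h1 _; rewrite lerDr ltW.
  by apply: le_trans (ltW Xy) _; rewrite lerDl; exact: P0.
- rewrite ITD //; last by move=> t _; rewrite mulr_ge0 // ltW.
    rewrite IT_cst ITZ ?(ltW M0) //; apply: (@le_lt_trans _ _ ((M * X)%:E + M%:E * 1%:E)%E).
      by apply: leeD => //; apply: lee_wpmul2l; rewrite ?lee_fin ?(ltW M0).
    by rewrite -EFinM -EFinD ltry.
  exact: measurable_funM.
Qed.

Lemma HPsi_Re_intg h : HPsi Psi h -> intg (fun t => complex.Re (radial_limit h t)).
Proof.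
move=> Hh; have [m1 f1] := HPsi_mod_intg Hh.
have f1' : (IT (fun t => modc (radial_limit h t)) < +oo)%E.
  by move: f1; congr (IT _ < _)%E; apply/funext => t; rewrite ger0_norm ?modc_ge0.
apply: (intg_abs_le _ m1 _ f1').
  by apply: measurable_funTS; apply: measurable_radial_Re; exact: HPsi_approx Hh.
by move=> t _; exact: normRe_le.
Qed.

Lemma HPsi_Im_intg h : HPsi Psi h -> intg (fun t => complex.Im (radial_limit h t)).
Proof.
move=> Hh; have [m1 f1] := HPsi_mod_intg Hh.
have f1' : (IT (fun t => modc (radial_limit h t)) < +oo)%E.
  by move: f1; congr (IT _ < _)%E; apply/funext => t; rewrite ger0_norm ?modc_ge0.
apply: (intg_abs_le _ m1 _ f1').
  by apply: measurable_funTS; apply: measurable_radial_Im; exact: HPsi_approx Hh.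
by move=> t _; exact: normIm_le.
Qed.

(* h |-> mean of (h* . conj (a + i b)) *)
Definition pairing (a b : R -> R) h : C :=
  Complex (mean (fun t => complex.Re (radial_limit h t) * a t + complex.Im (radial_limit h t) * b t))
          (mean (fun t => complex.Im (radial_limit h t) * a t + complex.Re (radial_limit h t) * - b t)).

Lemma Re_pairing a b h : complex.Re (pairing a b h) =
  mean (fun t => complex.Re (radial_limit h t) * a t + complex.Im (radial_limit h t) * b t).
Proof. by []. Qed.

Lemma Im_pairing a b h : complex.Im (pairing a b h) =
  mean (fun t => complex.Im (radial_limit h t) * a t + complex.Re (radial_limit h t) * - b t).
Proof. by []. Qed.

Section Pairing.
Variables (a b k : R -> R) (B : R).
Hypotheses (ma : measurable_fun Tset a) (mb : measurable_fun Tset b) (mk : measurable_fun Tset k).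
Hypotheses (ak : forall t, `|a t| <= k t) (bk : forall t, `|b t| <= k t) (kB : forall t, k t <= B).

Let aB t : `|a t| <= B := le_trans (ak t) (kB t).
Let bB t : `|b t| <= B := le_trans (bk t) (kB t).
Let nbB t : `|- b t| <= B. Proof. by rewrite normrN. Qed.
Let mnb : measurable_fun Tset (fun t => - b t). Proof. exact: measurableT_comp. Qed.

Let pairing_intg h : HPsi Psi h ->
  [/\ intg (fun t => complex.Re (radial_limit h t) * a t), intg (fun t => complex.Im (radial_limit h t) * b t),
      intg (fun t => complex.Im (radial_limit h t) * a t) & intg (fun t => complex.Re (radial_limit h t) * - b t)].
Proof.
move=> Hh; split.
- exact: intgM (HPsi_Re_intg Hh) ma aB.
- exact: intgM (HPsi_Im_intg Hh) mb bB.
- exact: intgM (HPsi_Im_intg Hh) ma aB.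
- exact: intgM (HPsi_Re_intg Hh) mnb nbB.
Qed.

Lemma pairingD f g : HPsi Psi f -> HPsi Psi g -> pairing a b (f \+ g) = pairing a b f + pairing a b g.
Proof.
move=> Hf Hg; have [f1 f2 f3 f4] := pairing_intg Hf; have [g1 g2 g3 g4] := pairing_intg Hg.
have [s1 s2 s3 s4] := pairing_intg (HPsiD oPsi Hf Hg).
have E : aeT (fun t => radial_limit (f \+ g) t = radial_limit f t + radial_limit g t).
  apply: aeT_mono (aeT_and (HPsi_rad oPsi dPsi Hf) (HPsi_rad oPsi dPsi Hg)) => t _ [h1 h2].
  exact: has_radialE (has_radialD h1 h2).
apply: complexP; [rewrite Re_add !Re_pairing|rewrite Im_add !Im_pairing].
  rewrite -(meanD (intgD f1 f2) (intgD g1 g2)); apply: mean_ae_eq; [exact: intgD|by apply: intgD; exact: intgD|].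
  by apply: aeT_mono E => t _ ->; rewrite Re_add Im_add; ring.
rewrite -(meanD (intgD f3 f4) (intgD g3 g4)); apply: mean_ae_eq; [exact: intgD|by apply: intgD; exact: intgD|].
by apply: aeT_mono E => t _ ->; rewrite Re_add Im_add; ring.
Qed.

Lemma pairingZ (c : C) f : HPsi Psi f -> pairing a b (fun z => c * f z) = c * pairing a b f.
Proof.
move=> Hf; have [f1 f2 f3 f4] := pairing_intg Hf.
have [s1 s2 s3 s4] := pairing_intg (HPsiZ oPsi c Hf).
have E : aeT (fun t => radial_limit (fun z => c * f z) t = c * radial_limit f t).
  apply: aeT_mono (HPsi_rad oPsi dPsi Hf) => t _ h1.
  exact: has_radialE (has_radialZ c h1).
pose p := complex.Re c; pose q := complex.Im c.
apply: complexP; [rewrite Re_mul !Re_pairing !Im_pairing -/p -/q|rewrite Im_mul !Re_pairing !Im_pairing -/p -/q].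
  rewrite -mulNr -(meanZ p (intgD f1 f2)) -(meanZ (- q) (intgD f3 f4)) -meanD; try (apply: intgZ; exact: intgD).
  apply: mean_ae_eq; [exact: intgD|by apply: intgD; apply: intgZ; exact: intgD|].
  by apply: aeT_mono E => t _ ->; rewrite Re_mul Im_mul -/p -/q; ring.
rewrite -(meanZ q (intgD f1 f2)) -(meanZ p (intgD f3 f4)) -meanD; try (apply: intgZ; exact: intgD).
apply: mean_ae_eq; [exact: intgD|by apply: intgD; apply: intgZ; exact: intgD|].
by apply: aeT_mono E => t _ ->; rewrite Re_mul Im_mul -/p -/q; ring.
Qed.

Lemma pairing_bound f : HPsi Psi f ->
  modc (pairing a b f) <= 4 * mean (fun t => modc (radial_limit f t) * k t).
Proof.
move=> Hf; have h1 := @mean_pair_bound R _ _ a b k _ B (HPsi_Re_intg Hf) (HPsi_Im_intg Hf) ma mb mk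
  (HPsi_mod_intg Hf) ak bk kB (fun t => normRe_le _) (fun t => normIm_le _).
have nbk t : `|- b t| <= k t by rewrite normrN.
have h2 := @mean_pair_bound R _ _ a (fun t => - b t) k _ B (HPsi_Im_intg Hf) (HPsi_Re_intg Hf) ma mnb mk
  (HPsi_mod_intg Hf) ak nbk kB (fun t => normIm_le _) (fun t => normRe_le _).
apply: le_trans (modc_le_ReIm _) _; rewrite Re_pairing Im_pairing.
apply: le_trans (lerD h1 h2) _; rewrite -mulrDl (_ : 2 + 2 = 4 :> R); last by ring.
exact: lexx.
Qed.

End Pairing.

End OrliczFunctionals.

(** * A bounded functional that detects boundary functions outside M^Psi *)

Section SingularFunctional.
Variables (R : realType) (Psi : R -> R).
Hypotheses (oPsi : orlicz Psi) (dPsi : Delta2 Psi).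
Local Notation C := R[i].
Local Notation Tset := (@Tset R).
Implicit Types (f g h : C -> C) (c t e : R).

(** The upper cut makes the densities bounded; the lower one keeps gamma away from 0 and drives it
    to infinity with n. *)
Definition shell (gam : R -> R) (n m : nat) : set R := [set t | n.+1%:R < gam t <= m%:R].

Lemma measurable_shell gam n m : measurable_fun setT gam -> measurable (shell gam n m).
Proof.
move=> mg; rewrite (_ : shell gam n m = gam @^-1` `]n.+1%:R, m%:R]%classic).
  by rewrite -[X in measurable X]setTI; apply: mg => //; exact: measurable_itv.
by apply/seteqP; split => t /=; rewrite in_itv.
Qed.

(** If every upper cut left a mass below 1, Fatou would bound the full modular by Psi(n+1) + 1. *)
Lemma shell_large (gam : R -> R) n : measurable_fun setT gam -> (forall t, 0 <= gam t) ->
  ~ (IT (fun t => Psi (gam t)) < +oo)%E ->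
  exists m, (1%:E <= IT (fun t => \1_(shell gam n m) t * Psi (gam t))%R)%E.
Proof.
move=> mg g0 Hinf; apply: contrapT => no; apply: Hinf.
have mP : measurable_fun Tset (fun t => Psi (gam t)).
  have := om_meas oPsi ltr01 (measurable_funTS (D := Tset) mg); congr measurable_fun.
  by apply/funext => t; rewrite divr1 ger0_norm.
have P0 t : 0 <= Psi (gam t) by exact: orlicz_ge0.
have Pn : 0 <= Psi n.+1%:R by exact: orlicz_ge0.
have ind0 (A : set R) t : 0 <= \1_A t :> R by rewrite indicE.
have mI m : measurable_fun Tset (\1_(shell gam n m) : R -> R).
  by apply: measurable_funTS; apply: measurable_indic; exact: measurable_shell.
pose u m t := Num.min (Psi (gam t)) (Psi n.+1%:R + \1_(shell gam n m) t * Psi (gam t)).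
have mu m : measurable_fun Tset (u m).
  by apply: measurable_minr => //; apply: measurable_funD => //; exact: measurable_funM.
have u0 m t : 0 <= u m t by rewrite le_min P0 addr_ge0 // mulr_ge0.
apply: (@le_lt_trans _ _ (Psi n.+1%:R + 1)%:E); last exact: ltry.
apply: (@IT_fatou R u) => //.
- apply: aeT_all => t _; apply: cvg_near_cst.
  have g1 : 0 <= gam t by exact: g0.
  exists (Num.trunc (gam t)).+1 => // m /= hm; rewrite /u min_l //.
  have [gn|gn] := leP (gam t) n.+1%:R.
    by apply: (@le_trans _ _ (Psi n.+1%:R)); [exact: orlicz_le|rewrite lerDl mulr_ge0].
  rewrite indicE mem_set ?mul1r ?lerDr // /shell /= gn /=.
  have /andP[_ h2] := trunc_itv g1; apply: le_trans (ltW h2) _; by rewrite ler_nat.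
- move=> m; apply: (@le_trans _ _ (IT (fun t => Psi n.+1%:R + \1_(shell gam n m) t * Psi (gam t))%R)).
    apply: IT_le => //; first by apply: measurable_funD => //; exact: measurable_funM.
    by move=> t _; rewrite /u ge_min lexx orbT.
  rewrite ITD //; last 2 first.
  - exact: measurable_funM.
  - by move=> t _; exact: mulr_ge0.
  rewrite IT_cst EFinD; apply: leeD => //.
  by rewrite leNgt; apply/negP => h; apply: no; exists m; exact: ltW.
Qed.

(** The uniform bound gives every f an ultralimit; uniqueness of ultralimits makes the value picked
    by [xget] linear and equal to the ordinary limit when there is one. *)
Lemma ultralimit_functional (L_ : nat -> (C -> C) -> C) (K : R) :
  (forall n f g, HPsi Psi f -> HPsi Psi g -> L_ n (f \+ g) = L_ n f + L_ n g) ->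
  (forall n (c : C) f, HPsi Psi f -> L_ n (fun z => c * f z) = c * L_ n f) ->
  (forall n f, HPsi Psi f -> modc (L_ n f) <= K * normH Psi f) ->
  exists L, bdd_functional Psi L /\ forall f q, HPsi Psi f ->
    (forall e, 0 < e -> exists N, forall n, (N <= n)%N -> modc (L_ n f - q) < e) -> L f = q.
Proof.
move=> LD LZ LB; have [U [uU freeU]] := @free_ultrafilter; have FU : Filter U by exact: ultra_proper.
pose is_lim f q := forall e, 0 < e -> U [set n | modc (L_ n f - q) < e].
have uniq_lim f q q' : is_lim f q -> is_lim f q' -> q = q'.
  move=> h1 h2; apply: modc_le_eps => e e0; have e2 : 0 < e / 2 by rewrite divr_gt0.
  have [n [_ [a b]]] := ultra_ex uU freeU 0%N (filterI (h1 _ e2) (h2 _ e2)).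
  have -> : q - q' = - (L_ n f - q) + (L_ n f - q') by ring.
  apply: le_trans (modcD _ _) _; rewrite modcN [e]splitr; apply: lerD; exact: ltW.
pose L f := xget 0 [set q | is_lim f q].
have HL f : HPsi Psi f -> is_lim f (L f).
  move=> Hf; have [q Hq] := bounded_ulim uU (fun n => LB n f Hf).
  exact: (xgetPex 0 (ex_intro [set q | is_lim f q] q Hq)).
exists L; split; last first.
  move=> f q Hf Hq; apply: (uniq_lim f); first exact: HL.
  move=> e e0; have [N HN] := Hq e e0; apply: freeU; exists N => // n Nn; exact: HN.
split.
- move=> f g Hf Hg; apply: (uniq_lim (f \+ g)); first by apply: HL; exact: HPsiD.
  move=> e e0; have e2 : 0 < e / 2 by rewrite divr_gt0.
  apply: filterS (filterI (HL f Hf _ e2) (HL g Hg _ e2)) => n /= [h1 h2].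
  rewrite LD // opprD addrACA; apply: le_lt_trans (modcD _ _) _.
  by rewrite [e]splitr; exact: ltrD.
- move=> c f Hf; apply: (uniq_lim (fun z => c * f z)); first by apply: HL; exact: HPsiZ.
  move=> e e0; have c1 : 0 < 1 + modc c by rewrite ltr_pwDl // modc_ge0.
  apply: filterS (HL f Hf _ (divr_gt0 e0 c1)) => n /=; rewrite LZ // -mulrBr modcM ltr_pdivlMr // mulrC.
  by apply: le_lt_trans; rewrite ler_wpM2r ?modc_ge0 // lerDr.
- exists K => f Hf; apply/ler_addgt0Pr => e e0.
  have [n [_ hn]] := ultra_ex uU freeU 0%N (HL f Hf _ e0).
  have := modc_distr (L f) (L_ n f); rewrite modcBC => h.
  have := LB n f Hf; move: hn h => /=; move: (modc (L f)) (modc (L_ n f)) (modc (_ - _)) => x y w; lra.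
Qed.

Lemma measurable_inv_ge0 (f : R -> R) : measurable_fun setT f -> (forall t, 0 <= f t) ->
  measurable_fun setT (fun t => (f t)^-1).
Proof.
move=> mf f0; rewrite (_ : (fun _ => _) = fun t => if 0 < f t then expR (- ln (f t)) else 0).
  apply: measurable_fun_ifT => //; first exact: measurable_fun_ltr.
  by apply: measurableT_comp => //; apply: measurableT_comp => //; exact: measurableT_comp.
apply/funext => t; case: ifPn => ft; first by rewrite expRN lnK.
by rewrite (_ : f t = 0) ?invr0 //; apply/eqP; rewrite eq_le f0 leNgt ft.
Qed.

Lemma has_radial_dom f g t (p q : C) M : 0 <= M -> (forall z, modc z < 1 -> modc (f z) <= M * modc (g z)) ->
  has_radial f t p -> has_radial g t q -> modc p <= M * modc q.
Proof.
move=> M0 fg Hf Hg; apply/ler_addgt0Pr => e e0; have e2 : 0 < e / 2 by rewrite divr_gt0.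
have M1 : 0 < M + 1 by rewrite ltr_wpDl.
have [d1 [d10 H1]] := Hf _ e2; have [d2 [d20 H2]] := Hg _ (divr_gt0 e2 M1).
have d0 : 0 < Num.min d1 d2 by rewrite lt_min d10.
have [n Hn] := @rad_gt R _ d0; have := Hn n (leqnn n); set r := rad R n => hr.
have r0 : 0 <= r by exact: rad_ge0.
have r1 : r < 1 by exact: rad_lt1.
have h1 : 1 - d1 < r by apply: le_lt_trans hr; rewrite lerD2l lerN2 ge_min lexx.
have h2 : 1 - d2 < r by apply: le_lt_trans hr; rewrite lerD2l lerN2 ge_min lexx orbT.
have k1 := H1 r r0 h1 r1; have k2 := H2 r r0 h2 r1.
have z1 : modc ((r%:C)%C * expi t : C) < 1 by rewrite modc_polar.
have := fg _ z1; move: k1 k2; set u := f _; set v := g _ => k1 k2 uv.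
have h3 := modc_distr p u; have h4 := modc_distr v q; rewrite modcBC in h3.
have h5 : M * modc v <= M * modc q + e / 2.
  apply: (@le_trans _ _ (M * (modc q + e / 2 / (M + 1)))).
    by rewrite ler_wpM2l //; move: k2 h4; move: (modc (v - q)) (modc v) (modc q) => x y w; lra.
  rewrite mulrDr lerD2l mulrA ler_pdivrMr // mulrC ler_wpM2l ?(ltW e2) // lerDl //.
move: k1 h3 uv h5; move: (modc (u - p)) (modc u) (modc p) (M * modc v) (M * modc q) => x1 x2 x3 x4 x5; lra.
Qed.

Lemma mean_ae_le (h k : R -> R) : intg h -> intg k -> (forall t, 0 <= h t) -> (forall t, 0 <= k t) ->
  aeT (fun t => h t <= k t) -> mean h <= mean k.
Proof.
move=> ih ik h0 k0 hk; rewrite -lee_fin !mean_IT //.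
by apply: IT_ae_le => //; [exact: ih.1|exact: ik.1].
Qed.

(* If the boundary function of g is not in M^Psi, pairing with its sign times Psi(gamma)/gamma,
   gamma its modulus over c, normalized on the shells n < gamma <= m, and passing to an ultralimit
   gives a functional that kills the bounded functions but not g. *)
Lemma singular_functional g c : HPsi Psi g -> 0 < c ->
  ~ (om Psi c (fun t => modc (radial_limit g t)) < +oo)%E ->
  exists L, [/\ bdd_functional Psi L, L g = (c%:C)%C &
    forall f B, approx f -> (forall z, modc z < 1 -> modc (f z) <= B) -> L f = 0].
Proof.
move=> Hg c0 Hinf; pose G t := modc (radial_limit g t); pose gam t := G t / c.
have G0 t : 0 <= G t by exact: modc_ge0.
have gam0 t : 0 <= gam t by rewrite divr_ge0 // ltW.
have mG : measurable_fun setT G by apply: measurable_radial_mod; exact: HPsi_approx Hg.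
have mgam : measurable_fun setT gam by apply: measurable_funM => //; exact: measurable_cst.
have omE : om Psi c (fun t => modc (radial_limit g t)) = IT (fun t => Psi (gam t)).
  by rewrite /om; congr IT; apply/funext => t; rewrite ger0_norm ?modc_ge0.
rewrite omE in Hinf.
have /choice [m Hm] := fun n => shell_large n mgam gam0 Hinf.
pose E n := shell gam n (m n).
have mE n : measurable (E n) by exact: measurable_shell.
have ind0 (A : set R) t : 0 <= \1_A t :> R by rewrite indicE.
pose W n t := \1_(E n) t * Psi (gam t).
have P0 t : 0 <= Psi (gam t) by exact: orlicz_ge0.
have W0 n t : 0 <= W n t by exact: mulr_ge0.
have mP : measurable_fun setT (fun t => Psi (gam t)).
  have := om_meas oPsi ltr01 mgam; congr measurable_fun.
  by apply/funext => t; rewrite divr1 ger0_norm.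
have mW n : measurable_fun Tset (W n).
  by apply: measurable_funTS; apply: measurable_funM => //; exact: measurable_indic.
have Wm n t : W n t <= Psi (m n)%:R.
  rewrite /W indicE; case: (boolP (t \in E n)) => [/set_mem /= /andP[_ h]|_].
    by rewrite mul1r; exact: orlicz_le.
  by rewrite mul0r orlicz_ge0.
have fW n : (IT (W n) < +oo)%E.
  apply: (@le_lt_trans _ _ (Psi (m n)%:R)%:E); last exact: ltry.
  by rewrite -IT_cst; apply: IT_le.
have iW n : intg (W n).
  by apply: (@intg_abs_le _ _ (W n)) => // t _; rewrite ger0_norm.
pose I n := mean (W n).
have IE n : (I n)%:E = IT (W n) by rewrite /I mean_IT.
have I1 n : 1 <= I n by rewrite -lee_fin IE; exact: Hm.
have I0 n : 0 < I n by exact: lt_le_trans (I1 n).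
(* Weight for the density: |g| = c gamma on the boundary, so |g| k = c W / I has mean c. *)
pose k n t := W n t / (gam t * I n).
have gamE n t : E n t -> n.+1%:R < gam t by move=> /= /andP[].
have kE n t : ~ E n t -> k n t = 0.
  by move=> nE; rewrite /k /W indicE memNset // !mul0r.
have k0 n t : 0 <= k n t by rewrite divr_ge0 // mulr_ge0 // ltW.
have IW n t : 0 <= W n t / I n by rewrite divr_ge0 // ltW.
(* On the shell gamma > n + 1, so k has mean at most 1/(n+1): bounded functions are killed in the
   limit. *)
have kW n t : k n t <= W n t / I n / n.+1%:R.
  have [Et|/kE ->] := pselect (E n t); last by rewrite divr_ge0.
  have g1 := gamE _ _ Et; have g2 : 0 < gam t by exact: lt_trans g1.
  rewrite /k invfM [(gam t)^-1 * _]mulrC mulrA; apply: ler_wpM2l => //.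
  by rewrite lef_pV2 ?posrE //; exact: ltW.
have kB n t : k n t <= Psi (m n)%:R.
  apply: le_trans (kW n t) _; rewrite ler_pdivrMr // ler_pdivrMr //; apply: le_trans (Wm n t) _.
  have Pm : 0 <= Psi (m n)%:R by exact: orlicz_ge0.
  by rewrite -mulrA ler_peMr // mulr_ege1 // ler1n.
have mk n : measurable_fun Tset (k n).
  apply: measurable_funM => //; apply: measurable_funTS; apply: measurable_inv_ge0.
    by apply: measurable_funM => //; exact: measurable_cst.
  by move=> t; rewrite mulr_ge0 // ltW.
have mGi : measurable_fun setT (fun t => (G t)^-1) by exact: measurable_inv_ge0.
pose a n t := k n t * (complex.Re (radial_limit g t) / G t).
pose b n t := k n t * (complex.Im (radial_limit g t) / G t).
have ma n : measurable_fun Tset (a n).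
  apply: measurable_funM => //; apply: measurable_funTS; apply: measurable_funM => //.
  by apply: measurable_radial_Re; exact: HPsi_approx Hg.
have mb n : measurable_fun Tset (b n).
  apply: measurable_funM => //; apply: measurable_funTS; apply: measurable_funM => //.
  by apply: measurable_radial_Im; exact: HPsi_approx Hg.
have ratio (x y : R) : 0 <= y -> `|x| <= y -> `|x / y| <= 1.
  rewrite le_eqVlt => /predU1P[<-|y0] xy; first by rewrite invr0 mulr0 normr0.
  by rewrite normrM normfV (gtr0_norm y0) ler_pdivrMr // mul1r.
have ak n t : `|a n t| <= k n t.
  by rewrite normrM ger0_norm // ler_piMr //; apply: ratio => //; exact: normRe_le.
have bk n t : `|b n t| <= k n t.
  by rewrite normrM ger0_norm // ler_piMr //; apply: ratio => //; exact: normIm_le.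
have iWI n : intg (fun t => W n t / I n).
  by have := intgZ (I n)^-1 (iW n); congr intg; apply/funext => t; rewrite mulrC.
have mWI n : mean (fun t => W n t / I n) = 1.
  have <- : mean (fun t => (I n)^-1 * W n t) = mean (fun t => W n t / I n).
    by congr mean; apply/funext => t; rewrite mulrC.
  by rewrite meanZ // -/(I n) mulVf // gt_eqF.
have ifk f n : HPsi Psi f -> intg (fun t => modc (radial_limit f t) * k n t).
  move=> Hf; apply: (intgM (HPsi_mod_intg oPsi dPsi Hf) (mk n) (c := Psi (m n)%:R)) => t.
  by rewrite ger0_norm.
have fk0 f n t : 0 <= modc (radial_limit f t) * k n t by rewrite mulr_ge0 ?modc_ge0.
(* With y = |f| / d, [orlicz_young] gives y k <= W / I + Psi(y) because I >= 1. Both terms have mean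
   at most 1, and [pairing_bound] contributes the factor 4. *)
have pb f n : HPsi Psi f -> modc (pairing (a n) (b n) f) <= 8 * normH Psi f.
  move=> Hf; apply: le_trans (pairing_bound oPsi dPsi (ma n) (mb n) (mk n) (ak n) (bk n) (kB n) Hf) _.
  rewrite (_ : 8 * normH Psi f = 4 * (2 * normH Psi f)); last by ring.
  rewrite ler_wpM2l //; apply/ler_addgt0Pr => e e0; have e2 : 0 < e / 2 by rewrite divr_gt0.
  pose d := normH Psi f + e / 2; have fd : normH Psi f < d by rewrite ltrDl.
  have d0 : 0 < d by apply: le_lt_trans fd; exact: lux_ge0.
  have od := HPsi_om_lt oPsi dPsi Hf fd.
  have mf : measurable_fun Tset (fun t => modc (radial_limit f t)).
    by apply: measurable_radial_mod; exact: HPsi_approx Hf.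
  have mPf := om_meas oPsi d0 mf.
  have P0f t : 0 <= Psi (`|modc (radial_limit f t)| / d) by exact: om_pos.
  rewrite -lee_fin mean_IT //; last exact: ifk.
  apply: (@le_trans _ _ (IT (fun t => d * (W n t / I n) + d * Psi (`|modc (radial_limit f t)| / d))%R)).
    apply: IT_le => //.
    - exact: (ifk f n Hf).1.
    - by apply: measurable_funD; apply: measurable_funM => //; exact: (iWI n).1.
    - move=> t _; rewrite -mulrDr; set y := `|_| / d.
      have -> : modc (radial_limit f t) = d * y by rewrite /y ger0_norm ?modc_ge0 // mulrC divfK // gt_eqF.
      have y0 : 0 <= y by rewrite divr_ge0 // ltW.
      rewrite -mulrA ler_wpM2l ?(ltW d0) //.
      have [Et|nE] := pselect (E n t); last by rewrite kE // mulr0 addr_ge0 // orlicz_ge0.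
      have g1 := gamE _ _ Et; have g2 : 0 < gam t by exact: lt_trans g1.
      have WE : W n t = Psi (gam t) by rewrite /W indicE mem_set // mul1r.
      rewrite /k WE mulrA (ler_pdivrMr _ _ (mulr_gt0 g2 (I0 n))).
      apply: le_trans (orlicz_young oPsi g2 y0) _.
      have -> : (Psi (gam t) / I n + Psi y) * (gam t * I n) = gam t * Psi (gam t) + gam t * Psi y * I n.
        have aux (A B' g' i : R) : i != 0 -> (A / i + B') * (g' * i) = g' * A + g' * B' * i by move=> i0; field.
        by apply: aux; rewrite gt_eqF.
      by rewrite lerD2l ler_peMr // mulr_ge0 ?(ltW g2) // orlicz_ge0.
  rewrite ITD.
  - rewrite ITZ ?(ltW d0) // ?ITZ ?(ltW d0) //; last exact: (iWI n).1.
    rewrite -(mean_IT (iWI n)) // mWI.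
    apply: (@le_trans _ _ (d%:E * 1%:E + d%:E * 1%:E)%E).
      by apply: leeD => //; apply: lee_wpmul2l; rewrite ?lee_fin ?(ltW d0).
    by rewrite -!EFinM -EFinD lee_fin /d; lra.
  - by apply: measurable_funM => //; exact: (iWI n).1.
  - exact: measurable_funM.
  - by move=> t _; rewrite mulr_ge0 // ltW.
  - by move=> t _; rewrite mulr_ge0 // ltW.
have pg n : pairing (a n) (b n) g = (c%:C)%C.
  apply: complexP; [rewrite Re_pairing|rewrite Im_pairing].
    transitivity (mean (fun t => c * (W n t / I n))); last by rewrite (meanZ c (iWI n)) mWI mulr1.
    congr mean; apply/funext => t.
    have [Et|nE] := pselect (E n t); last first.
      by rewrite /a /b kE // !(mul0r, mulr0) addr0 /W indicE memNset // !mul0r mulr0.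
    have g1 := gamE _ _ Et; have g2 : 0 < gam t by exact: lt_trans g1.
    have Gg : G t = c * gam t by rewrite /gam mulrC divfK // gt_eqF.
    have G1 : 0 < G t by rewrite Gg mulr_gt0.
    have -> : complex.Re (radial_limit g t) * a n t + complex.Im (radial_limit g t) * b n t = k n t * (modc (radial_limit g t) ^+ 2 / G t).
      by rewrite modc_sqr /a /b; ring.
    rewrite -/(G t) expr2 mulfK ?gt_eqF // Gg /k.
    have aux (A c' g' i : R) : i != 0 -> g' != 0 -> A / (g' * i) * (c' * g') = c' * (A / i).
      by move=> i0 g0; field; rewrite i0 g0.
    by apply: aux; rewrite gt_eqF.
  rewrite (_ : (fun _ => _) = fun=> 0); last by apply/funext => t; rewrite /a /b; ring.
  by rewrite /mean Rintegral_cst ?mul0r ?mulr0 //; exact: measurable_Tset.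
have [L [bL HL]] := @ultralimit_functional (fun n => pairing (a n) (b n)) 8
  (fun n => pairingD oPsi dPsi (ma n) (mb n) (ak n) (bk n) (kB n))
  (fun n => pairingZ oPsi dPsi (ma n) (mb n) (ak n) (bk n) (kB n)) (fun n f => pb f n).
exists L; split => //.
  by apply: HL => // e e0; exists 0%N => n _; rewrite pg subrr modc0.
move=> f B Af HB; have Hf := bounded_HPsi oPsi Af HB; apply: HL => // e e0.
have B0 : 0 <= B by apply: le_trans (modc_ge0 _) (HB 0 _); rewrite modc0.
have fB : aeT (fun t => modc (radial_limit f t) <= B).
  apply: aeT_mono (HPsi_rad oPsi dPsi Hf) => t _ ht.
  have h1 : has_radial (fun=> 1 : C) t 1.
    by move=> d d0; exists 1; split => // r _ _ _; rewrite subrr modc0.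
  have := @has_radial_dom f (fun=> 1) t _ _ B B0 _ ht h1; rewrite modc1 mulr1; apply.
  exact: HB.
have B4 : 0 < 4 * B + 1 by rewrite ltr_wpDl // mulr_ge0.
have [N HN] := @rad_gt R _ (divr_gt0 e0 B4); exists N.+1 => -[//|n]; rewrite ltnS => /HN.
rewrite /rad ltrD2l ltrN2 => hn; rewrite subr0.
apply: le_lt_trans (pairing_bound oPsi dPsi (ma _) (mb _) (mk _) (ak _) (bk _) (kB _) Hf) _.
have iB : intg (fun t => B / n.+2%:R * (W n.+1 t / I n.+1)) by exact: intgZ.
have h : mean (fun t => modc (radial_limit f t) * k n.+1 t) <= B / n.+2%:R.
  apply: (@le_trans _ _ (mean (fun t => B / n.+2%:R * (W n.+1 t / I n.+1)))); last first.
    by rewrite (meanZ _ (iWI n.+1)) mWI mulr1.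
  apply: mean_ae_le => //.
  - exact: ifk.
  - by move=> t; rewrite mulr_ge0 // divr_ge0.
  - apply: aeT_mono fB => t _ ft.
    apply: (@le_trans _ _ (B * (W n.+1 t / I n.+1 / n.+2%:R))); last by rewrite mulrCA -mulrA mulrC -mulrA mulrC !mulrA.
    by apply: ler_pM; rewrite ?modc_ge0.
apply: (@le_lt_trans _ _ ((4 * B + 1) * n.+2%:R^-1)); last by rewrite mulrC -ltr_pdivlMr.
apply: (@le_trans _ _ (4 * (B / n.+2%:R))); first by rewrite ler_wpM2l.
by rewrite mulrA ler_wpM2r // ?invr_ge0 // lerDl.
Qed.

End SingularFunctional.

(** * Weak compactness yields a majorant in M^Psi *)

Section WeakCompactConsequences.
Variables (R : realType) (Psi : R -> R) (phi : R[i] -> R[i]).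
Hypotheses (oPsi : orlicz Psi) (dPsi : Delta2 Psi) (sphi : self_map_disc phi).
Local Notation C := R[i].
Local Notation Tset := (@Tset R).
Local Notation ph t := (radial_limit phi t).
Local Notation Cp := (Cphi phi).
Implicit Types (f g h : C -> C) (z w : C) (r t e c : R).

(** Otherwise the weakly open sets O N, of functions with a neighbourhood avoiding [gs m] for all m
    >= N, cover K. With N the largest index of a finite subcover, [gs N] lies in a member that
    excludes it. *)
Lemma weak_compact_cluster (K : set (C -> C)) (gs : nat -> C -> C) : weak_compact Psi K ->
  (forall m, K (gs m)) -> (forall g, K g -> HPsi Psi g) ->
  exists g, K g /\ forall n (Ls : 'I_n -> (C -> C) -> C) e, (forall i, bdd_functional Psi (Ls i)) -> 0 < e ->
    forall N, exists m, (N <= m)%N /\ forall i, modc (Ls i (gs m) - Ls i g) < e.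
Proof.
move=> cK Kgs KH; apply: contrapT => no.
pose O (N : nat) : set (C -> C) := [set h | HPsi Psi h /\ exists n (Ls : 'I_n -> (C -> C) -> C) e,
  [/\ forall i, bdd_functional Psi (Ls i), 0 < e &
      forall m, (N <= m)%N -> ~ (forall i, modc (Ls i (gs m) - Ls i h) < e)]].
have WO N : weak_open Psi (O N).
  split; first by move=> h [].
  move=> h [Hh [n [Ls [e [HL e0 Hm]]]]]; have e2 : 0 < e / 2 by rewrite divr_gt0.
  exists n, Ls, (e / 2); split => // h' Hh' near; split => //; exists n, Ls, (e / 2); split => // m Nm H.
  apply: (Hm m Nm) => i; have -> : Ls i (gs m) - Ls i h = (Ls i (gs m) - Ls i h') + (Ls i h' - Ls i h) by ring.
  by apply: le_lt_trans (modcD _ _) _; rewrite [e]splitr; apply: ltrD; [exact: H|exact: near].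
have cov g : K g -> exists N, O N g.
  move=> Kg; apply: contrapT => nO; apply: no; exists g; split => // n Ls e HL e0 N.
  apply: contrapT => nm; apply: nO; exists N; split; first exact: KH.
  exists n, Ls, e; split => // m Nm H; apply: nm; by exists m.
have [n [J HJ]] := cK nat O WO cov.
pose N := (\max_(j < n) J j)%N; have [j [_ [k [Ls [e [_ e0 Hm]]]]]] := HJ _ (Kgs N).
apply: (Hm N); first exact: (leq_bigmax j).
by move=> i; rewrite subrr modc0.
Qed.

Lemma approx_bounded f r : approx f -> 0 < r -> r < 1 -> exists B, forall z, modc z <= r -> modc (f z) <= B.
Proof.
move=> Af r0 r1; have [p Hp] := Af r r0 r1 1 ltr01; have [B [_ HB]] := poly_bounded p.
exists (1 + B) => z zr; rewrite -[f z](subrK p.[z]); apply: le_trans (modcD _ _) _.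
by apply: lerD; [exact: Hp|apply: HB; exact: le_trans zr (ltW r1)].
Qed.

Lemma weakly_compact_MPsi f : weakly_compact_op Psi Cp -> approx f -> hpsi Psi f 1 ->
  HPsi Psi (Cp f) /\ forall c, 0 < c -> (om Psi c (fun t => modc (radial_limit (Cp f) t)) < +oo)%E.
Proof.
move=> H3 Af Hf; pose fm m z := f (((rad R m)%:C)%C * z).
have rad0 m := rad_ge0 R m; have radp m := rad_gt0 R m; have rad1 m := rad_lt1 R m.
have Afm m : approx (fm m) by exact: approx_dilate.
have modr m z : modc (((rad R m)%:C)%C * z) = rad R m * modc z by rewrite modcM modc_real ger0_norm.
have fB m : exists B, forall z, modc z < 1 -> modc (fm m z) <= B.
  have [B HB] := approx_bounded Af (radp m) (rad1 m); exists B => z z1; apply: HB.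
  by rewrite modr ler_piMr // ltW.
have Bm m : ballH Psi (fm m).
  have hm : hpsi Psi (fm m) 1.
    move=> r r0 r1; have m0 : 0 <= rad R m * r by rewrite mulr_ge0.
    have m1 : rad R m * r < 1 by apply: le_lt_trans (rad1 m); rewrite ler_piMr // ltW.
    have := Hf _ m0 m1; congr (IT _ <= _)%E; apply/funext => t.
    by rewrite /fm mulrA -realcM.
  have HP : HPsi Psi (fm m).
    by apply/hpsiP; split; [exact: approx_analytic|exists 1].
  by split => //; exact: normH_le.
have Hgm m : HPsi Psi (Cp (fm m)).
  by have [B HB] := fB m; exact: (comp_bounded_HPsi oPsi sphi (Afm m) HB).
have Kgm m : weak_closure Psi (Cp @` ballH Psi) (Cp (fm m)).
  split => // n Ls e _ e0; exists (Cp (fm m)); split; first by exists (fm m).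
  by move=> i; rewrite subrr modc0.
have [g [[Hg _] cl]] := weak_compact_cluster H3 Kgm (fun g => @proj1 _ _).
(* Evaluations are weakly continuous and the dilates converge pointwise, so the cluster point can
   only be f o phi on the disc. *)
have E z : modc z < 1 -> g z = Cp f z.
  move=> z1; apply: modc_le_eps => e e0; have e2 : 0 < e / 2 by rewrite divr_gt0.
  have p1 := self_map_lt1 sphi z1; have [d [d0 Hd]] := approx_cont Af p1 e2.
  have [N HN] := @rad_gt R _ d0.
  have [m [Nm hm]] := cl 1%N (fun=> fun f => f z) _ (fun=> evaluation_bdd oPsi dPsi z1) e2 N.
  have := hm ord0; rewrite /Cphi /= => h1.
  have h2 : modc (fm m (phi z) - f (phi z)) < e / 2.
    apply: (proj2 (Hd _ _)).
    have -> : ((rad R m)%:C)%C * phi z - phi z = - (((1 - rad R m)%:C)%C * phi z).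
      by rewrite (realcB 1 (rad R m)) mulrBl mul1r opprB.
    rewrite modcN modcM modc_real ger0_norm ?subr_ge0 ?(ltW (rad1 m)) //.
    apply: (@le_lt_trans _ _ (1 - rad R m)); last by rewrite ltrBlDr -ltrBlDl; exact: HN.
    by rewrite ler_piMr ?subr_ge0 ?(ltW (rad1 m)) // ltW.
  have -> : g z - f (phi z) = - (fm m (phi z) - g z) + (fm m (phi z) - f (phi z)) by ring.
  by apply: le_trans (modcD _ _) _; rewrite modcN [e]splitr; apply: lerD; exact: ltW.
have HCf := HPsi_disc_eq Hg E; split => // c c0; apply: contrapT => ninf.
have [L [bL Lc L0]] := singular_functional oPsi dPsi HCf c0 ninf.
have [m [_ hm]] := cl 1%N (fun=> L) _ (fun=> bL) c0 0%N.
(* L vanishes on the bounded images of the dilates, so closeness within c to the value c reads c <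
   c. *)
have := hm ord0; rewrite (functional_disc_eq oPsi dPsi bL Hg HCf E) Lc.
have [B HB] := fB m; rewrite (L0 (Cp (fm m)) B) ?sub0r ?modcN ?modc_real ?gtr0_norm ?ltxx //.
  exact: comp_approx.
by move=> z z1; apply: HB; exact: self_map_lt1.
Qed.

Lemma weakly_compact_majorized : weakly_compact_op Psi Cp -> majorized_subseq Psi phi.
Proof.
move=> H3 s l l0 l1 ls.
have [sg [sg1 [S [M [AS M0 HS dom]]]]] := lacunary_majorant oPsi dPsi s l0 l1 ls.
exists sg; split => //; pose f z := ((M^-1)%:C)%C * S z.
have Mn : M != 0 by rewrite gt_eqF.
have Sf z : modc (S z) = M * modc (f z).
  by rewrite /f modcM modc_real gtr0_norm ?invr_gt0 // mulrA mulfV // mul1r.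
have Af : approx f by exact: approxZ.
have Hf : hpsi Psi f 1.
  move=> r r0 r1; have := HS r r0 r1; congr (IT _ <= _)%E; apply/funext => t.
  by rewrite divr1 /f modcM modc_real gtr0_norm ?invr_gt0 // mulrC.
have [HC fin] := weakly_compact_MPsi H3 Af Hf.
have mC : measurable_fun Tset (fun t => modc (radial_limit (Cp f) t)).
  by apply: measurable_radial_mod; exact: comp_approx.
exists (fun t => M * modc (radial_limit (Cp f) t)); split.
- split; first exact: measurable_funM.
  move=> c c0; have cM : 0 < c / M by rewrite divr_gt0.
  suff -> : intT (fun t => (Psi (`|M * modc (radial_limit (Cp f) t)| / c))%:E) =
     om Psi (c / M) (fun t => modc (radial_limit (Cp f) t)) by exact: fin.
  rewrite /om /IT; congr intT; apply/funext => t; congr (Psi _)%:E.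
  by rewrite normrM (gtr0_norm M0) invf_div mulrA [M * _]mulrC.
- by move=> t; rewrite mulr_ge0 ?modc_ge0 // ltW.
move=> k; have HT := tf_HPsi oPsi dPsi sphi (s (sg k)) (l0 (sg k)) (l1 (sg k)).
apply: aeT_mono (aeT_and (HPsi_rad oPsi dPsi HT) (HPsi_rad oPsi dPsi HC)) => t _ [h1 h2].
apply: (has_radial_dom (ltW M0) _ h1 h2) => z z1; rewrite -Sf; apply: dom.
exact: self_map_lt1.
Qed.

End WeakCompactConsequences.

(** * The equivalence of the six assertions *)

Theorem mainTheorem1 (R : realType) (Psi : R -> R) (phi : R[i] -> R[i]) :
  orlicz Psi -> Delta2 Psi -> self_map_disc phi ->
  let C1 := order_bounded_M Psi (Cphi phi) in
  let C2 := compact_op Psi (Cphi phi) in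
  let C3 := weakly_compact_op Psi (Cphi phi) in
  let C4 := MPsiE Psi (fun t => if modc (radial_limit phi t) < 1
                 then (PsiInv Psi ((1 - modc (radial_limit phi t))^-1))%:E
                 else +oo%E) in
  let C5 := forall A : R, 0 < A -> exists K : R, exists delta : R, 0 < delta /\
              forall l : R, 0 < l < delta ->
                (mT [set t | (1 - modc (radial_limit phi t) < l)%R]
                   <= (K / chi Psi A l^-1)%:E)%E in
  let C6 := forall eps : R, 0 < eps -> exists delta : R, 0 < delta < 1 /\
              forall r : R, delta <= r < 1 -> forall s : R,
                normH Psi (Cphi phi (u_ar (expi s) r))
                  <= eps / PsiInv Psi ((1 - r)^-1) in
  [/\ C1 <-> C2, C2 <-> C3, C3 <-> C4, C4 <-> C5 & C5 <-> C6].
Proof.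
move=> oPsi dPsi sphi C1 C2 C3 C4 C5 C6.
have h41 := order_bounded_of_cond4 oPsi dPsi sphi.
have h42 := compact_of_cond4 oPsi dPsi sphi.
have h43 := weakly_compact_of_cond4 oPsi dPsi sphi.
have h45 : cond4_ae Psi phi -> C5 := cond4_cond5 oPsi sphi.
have h54 : C5 -> cond4_ae Psi phi := cond5_cond4 oPsi dPsi sphi.
have h4 : C4 <-> cond4_ae Psi phi := cond4P oPsi sphi.
have h65 : C6 -> C5 := cond6_cond5 oPsi dPsi sphi.
have hM6 : majorized_subseq Psi phi -> C6 := majorized_cond6 oPsi dPsi sphi.
have h26 : C2 -> C6 := compact_cond6 oPsi dPsi sphi.
have h16 : C1 -> C6 := fun h => hM6 (order_bounded_majorized oPsi dPsi h).
have h36 : C3 -> C6 := fun h => hM6 (weakly_compact_majorized oPsi dPsi sphi h).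
(* Assertion 4 in its a.e. form is the hub: it yields 1, 2, 3 and 5, and assertion 6 returns to it
   through 5. *)
have h64 : C6 -> cond4_ae Psi phi := fun h => h54 (h65 h).
split; split => [h|h].
- exact: h42 (h64 (h16 h)).
- exact: h41 (h64 (h26 h)).
- exact: h43 (h64 (h26 h)).
- exact: h42 (h64 (h36 h)).
- exact: h4.2 (h64 (h36 h)).
- exact: h43 (h4.1 h).
- exact: h45 (h4.1 h).
- exact: h4.2 (h54 h).
- exact: h16 (h41 (h54 h)).
- exact: h65 h.
Qed.
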